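(* Let $H_B=-\frac{d^2}{dx^2}+ix^3$ on $L^2(\mathbb R)$ be the imaginary cubic oscillator. Then: (1) For every $\delta>0$ and $R>0$ there exists an $\varepsilon>0$ such that $$\sigma_\varepsilon(H_B)\subset\{z\in\mathbb C:\operatorname{Re}z\ge R\}\cup\bigcup_{\lambda\in\sigma(H_B)}\{z\in\mathbb C:|z-\lambda|<\delta\}.$$ (2) There exists a constant $C>0$ such that for every $\delta>0$ there is an $\varepsilon\in(0,1)$ such that $$\sigma_\varepsilon(H_B)\subset\left\{z\in\mathbb C:\operatorname{Re}z\ge C\left(\log\tfrac1\varepsilon\right)^{6/5}\right\}\cup\bigcup_{\lambda\in\sigma(H_B)}\{z\in\mathbb C:|z-\lambda|<\delta\}.$$ In particular, apart from the discs around the eigenvalues, this $\varepsilon$-pseudospectrum is contained in the half plane $\{\operatorname{Re}z\ge C(\log\frac1\varepsilon)^{6/5}\}$.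
   Context: $H_B$ is the closure in $L^2(\mathbb R)=L^2(\mathbb R,\mathbb C)$ of $-\frac{d^2}{dx^2}+ix^3$ on $C_0^\infty(\mathbb R)$; its domain is $H^2(\mathbb R)\cap\{\psi\in L^2(\mathbb R):x^3\psi\in L^2(\mathbb R)\}$. It is known that $H_B$ is m-accretive with compact resolvent, and that its spectrum is real and positive. For a closed operator $A$ and $\varepsilon>0$, the $\varepsilon$-pseudospectrum is $\sigma_\varepsilon(A):=\sigma(A)\cup\{z\in\rho(A):\|(z-A)^{-1}\|>1/\varepsilon\}$. *)

(* Defs.v *)
From HB Require Import structures.
From mathcomp Require Import all_boot all_order all_algebra.
From mathcomp Require Import complex.
From mathcomp Require Import all_classical all_reals all_analysis.
From mathcomp Require Import measurable_realfun.

Set Implicit Arguments.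
Unset Strict Implicit.
Unset Printing Implicit Defensive.

Import Order.TTheory GRing.Theory Num.Theory.
Import numFieldNormedType.Exports.
Import Normc.

Local Open Scope classical_set_scope.
Local Open Scope ring_scope.
Local Open Scope complex_scope.
Local Open Scope quotient_scope.

Section complex_L2.
Context d (T : measurableType d) (R : realType).
Variable mu : {measure set T -> \bar R}.
Implicit Types f g : T -> R[i].

(* A complex function is measurable when its real and imaginary parts are;
   the library puts no sigma-algebra on R[i]. *)
Definition cmeasurable f :=
  measurable_fun setT (@complex.Re R \o f) /\
  measurable_fun setT (@complex.Im R \o f).

Definition cL2norm f : \bar R := 'N[mu]_2%:E[EFin \o (@normc R \o f)].

Definition cL2 : {pred (T -> R[i])} :=
  mem [set f | cmeasurable f /\ (cL2norm f < +oo)%E].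

Lemma normc_ge0 (x : R[i]) : 0 <= normc x.
Proof. by case: x => a b /=; rewrite sqrtr_ge0. Qed.

Lemma measurable_normc f : cmeasurable f -> measurable_fun setT (@normc R \o f).
Proof.
move=> [mr mi].
have -> : @normc R \o f = Num.sqrt \o
    (fun x => complex.Re (f x) ^+ 2 + complex.Im (f x) ^+ 2).
  by apply/funext => x /=; case: (f x).
apply: measurableT_comp.
  exact: continuous_measurable_fun (@sqrt_continuous R).
by apply: measurable_funD; apply: measurable_funX.
Qed.

Lemma cmeasurableD f g : cmeasurable f -> cmeasurable g -> cmeasurable (f + g).
Proof.
move=> [fr fi] [gr gi]; split.
  have -> : @complex.Re R \o (f + g) = (@complex.Re R \o f) \+ (@complex.Re R \o g).
    by apply/funext => x /=; rewrite fctE; case: (f x) (g x) => [? ?] [? ?].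
  exact: measurable_funD.
have -> : @complex.Im R \o (f + g) = (@complex.Im R \o f) \+ (@complex.Im R \o g).
  by apply/funext => x /=; rewrite fctE; case: (f x) (g x) => [? ?] [? ?].
exact: measurable_funD.
Qed.

Lemma cmeasurableZ (c : R[i]) f : cmeasurable f -> cmeasurable (c *: f).
Proof.
move=> [fr fi]; split.
  have -> : @complex.Re R \o (c *: f) =
     (fun x => complex.Re c * (@complex.Re R \o f) x
             - complex.Im c * (@complex.Im R \o f) x).
    by apply/funext => x /=; rewrite fctE; case: (f x) c => [? ?] [? ?].
  by apply: measurable_funB; apply: measurable_funM.
have -> : @complex.Im R \o (c *: f) =
   (fun x => complex.Re c * (@complex.Im R \o f) x
           + complex.Im c * (@complex.Re R \o f) x).
  by apply/funext => x /=; rewrite fctE; case: (f x) c => [? ?] [? ?].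
by apply: measurable_funD; apply: measurable_funM.
Qed.

Lemma cL2normD f g : cmeasurable f -> cmeasurable g ->
  (cL2norm (f + g)%R <= cL2norm f + cL2norm g)%E.
Proof.
move=> mf mg; have nf := measurable_normc mf; have ng := measurable_normc mg.
have nfg := measurable_normc (cmeasurableD mf mg).
apply: le_trans (@minkowski_EFin _ _ _ mu _ _ 2 nf ng _); last by rewrite ler1n.
rewrite /cL2norm unlock gt0_ler_poweR ?invr_ge0//.
- by rewrite in_itv/= leey andbT integral_ge0// => x _; exact: poweR_ge0.
- by rewrite in_itv/= leey andbT integral_ge0// => x _; exact: poweR_ge0.
apply: ge0_le_integral => //=.
- apply/measurable_EFinP.
  apply: (@measurableT_comp _ _ _ _ _ _ (fun x : R => x `^ 2)) => //.
  exact: measurableT_comp.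
- apply/measurable_EFinP.
  apply: (@measurableT_comp _ _ _ _ _ _ (fun x : R => x `^ 2)) => //.
  by apply: measurableT_comp => //; exact: measurable_funD.
- move=> x _; rewrite lee_fin ge0_ler_powR// ?nnegrE//.
  rewrite !ger0_norm ?addr_ge0 ?normc_ge0//.
  exact: le_normcD.
Qed.

Lemma cL2normZ (c : R[i]) f : cmeasurable f ->
  cL2norm (c *: f) = ((normc c)%:E * cL2norm f)%E.
Proof.
move=> mf; have nf := measurable_normc mf.
rewrite /cL2norm unlock.
under eq_integral => x _.
  rewrite /= fctE normcM normrM powRM// EFinM.
  over.
rewrite ge0_integralZl//=.
- rewrite poweRM ?integral_ge0//.
  rewrite poweR_EFin -powRrM mulfV// powRr1// ger0_norm//; exact: normc_ge0.
- apply/measurable_EFinP.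
  apply: (@measurableT_comp _ _ _ _ _ _ (fun x : R => x `^ 2)) => //.
  exact: measurableT_comp.
Qed.

Lemma cL2_submod_closed : submod_closed cL2.
Proof.
have H0 : cmeasurable 0.
  split; rewrite (_ : _ \o _ = cst 0)//.
split.
  apply/mem_set; split => //.
  have := cL2normZ 0 H0; rewrite scale0r => ->.
  by rewrite normc0 mul0e.
move=> c f g /set_mem[mf nf] /set_mem[mg ng]; apply/mem_set.
have mcf := cmeasurableZ c mf.
split; first exact: cmeasurableD.
apply: le_lt_trans (cL2normD mcf mg) _.
rewrite lte_add_pinfty// cL2normZ// lte_mul_pinfty ?lee_fin ?normc_ge0//.
Qed.

HB.instance Definition _ := GRing.isSubmodClosed.Build R[i] _ cL2 cL2_submod_closed.

Record cL2fun := CL2fun { cL2fun_val :> T -> R[i] ; _ : cL2fun_val \in cL2 }.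

HB.instance Definition _ := [isSub for cL2fun_val].
HB.instance Definition _ := [Choice of cL2fun by <:].
HB.instance Definition _ := [SubChoice_isSubLmodule of cL2fun by <:].

Definition ae0 : {pred cL2fun} := mem [set f : cL2fun | {ae mu, forall x, f x = 0}].

Lemma ae0_zmod_closed : zmod_closed ae0.
Proof.
split.
  by apply/mem_set; apply: nearW.
move=> f g /set_mem f0 /set_mem g0; apply/mem_set => /=.
apply: filterS2 f0 g0 => x fx gx.
by rewrite -[LHS]/(f x - g x) fx gx subrr.
Qed.

HB.instance Definition _ := GRing.isZmodClosed.Build _ ae0 ae0_zmod_closed.

(* L^2(T, mu; C): classes of square-integrable functions modulo a.e. equality. *)
Definition L2C := {ideal_quot ae0}.
HB.instance Definition _ := Choice.on L2C.
HB.instance Definition _ := GRing.Zmodule.on L2C.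
HB.instance Definition _ := EqQuotient.on L2C.
HB.instance Definition _ := ZmodQuotient.on L2C.

Definition cL2fun_of (u : L2C) : cL2fun := repr u.
Coercion cL2fun_of : L2C >-> cL2fun.

Definition L2C_scale (c : R[i]) (u : L2C) : L2C := \pi_L2C (c *: repr u).

Lemma eqL2P (f g : cL2fun) :
  reflect {ae mu, forall x, f x = g x} (\pi_L2C f == \pi_L2C g).
Proof.
rewrite eqmodE; apply: (iffP idP).
  move=> /set_mem; apply: filterS => x /eqP.
  by rewrite -[X in X == _]/(f x - g x) subr_eq0 => /eqP.
move=> fg; apply/mem_set; apply: filterS fg => x fg.
by rewrite -[LHS]/(f x - g x) fg subrr.
Qed.

Lemma reprL2 (f : cL2fun) : {ae mu, forall x, (\pi_L2C f : L2C) x = f x}.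
Proof. by apply/eqL2P; rewrite reprK. Qed.

Lemma L2C_scaleE c (f : cL2fun) : L2C_scale c (\pi_L2C f) = \pi_L2C (c *: f).
Proof.
apply/eqP/eqL2P; apply: filterS (reprL2 f) => x fx.
by rewrite -[LHS]/(c * (\pi_L2C f : L2C) x) -[RHS]/(c * f x) fx.
Qed.

Lemma L2C_addE (f g : cL2fun) : \pi_L2C f + \pi_L2C g = \pi_L2C (f + g) :> L2C.
Proof. by rewrite raddfD. Qed.

Fact L2C_scaleA a b u : L2C_scale a (L2C_scale b u) = L2C_scale (a * b) u.
Proof. by rewrite -[u]reprK !(L2C_scaleE _ (repr u)) L2C_scaleE scalerA. Qed.

Fact L2C_scale1 : left_id 1 L2C_scale.
Proof. by move=> u; rewrite -[u]reprK L2C_scaleE scale1r. Qed.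

Fact L2C_scaleDr : right_distributive L2C_scale +%R.
Proof.
move=> a u v; rewrite -[u]reprK -[v]reprK.
by rewrite L2C_addE !L2C_scaleE L2C_addE scalerDr.
Qed.

Fact L2C_scaleDl u : {morph L2C_scale^~ u : a b / a + b}.
Proof. by move=> a b; rewrite -[u]reprK !L2C_scaleE L2C_addE scalerDl. Qed.

HB.instance Definition _ := GRing.Zmodule_isLmodule.Build R[i] L2C
  L2C_scaleA L2C_scale1 L2C_scaleDr L2C_scaleDl.

Lemma cL2norm_ge0 f : (0 <= cL2norm f)%E.
Proof. exact: Lnorm_ge0. Qed.

Lemma cL2fun_meas (f : cL2fun) : cmeasurable f.
Proof. by case: f => f /= /set_mem[]. Qed.

Lemma cL2fun_fin_num (f : cL2fun) : cL2norm f \is a fin_num.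
Proof. by case: f => f /= /set_mem[_]; rewrite ge0_fin_numE ?cL2norm_ge0. Qed.

Lemma eq_ae_cL2norm (f g : cL2fun) :
  {ae mu, forall x, f x = g x} -> cL2norm f = cL2norm g.
Proof.
move=> fg; rewrite /cL2norm unlock; congr poweR.
apply: ae_eq_integral => //.
- apply: (measurableT_comp (measurable_poweR _)) => //.
  apply: measurableT_comp => //.
  exact/measurable_EFinP/measurable_normc/cL2fun_meas.
- apply: (measurableT_comp (measurable_poweR _)) => //.
  apply: measurableT_comp => //.
  exact/measurable_EFinP/measurable_normc/cL2fun_meas.
- by apply: filterS fg => x /= ->.
Qed.

(* In a normedModType over R[i] the norm is valued in R[i]. *)
Definition L2C_norm (u : L2C) : R[i] := (fine (cL2norm u))%:C.

Lemma L2C_normE (f : cL2fun) : L2C_norm (\pi_L2C f) = (fine (cL2norm f))%:C.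
Proof. by rewrite /L2C_norm (eq_ae_cL2norm (reprL2 f)). Qed.

Fact L2C_normD u v : L2C_norm (u + v) <= L2C_norm u + L2C_norm v.
Proof.
rewrite -[u]reprK -[v]reprK L2C_addE !L2C_normE -rmorphD/= lecR.
rewrite -fineD ?cL2fun_fin_num// fine_le ?fin_numD ?cL2fun_fin_num//.
  exact: (cL2fun_fin_num (repr u + repr v)).
exact: (cL2normD (cL2fun_meas (repr u)) (cL2fun_meas (repr v))).
Qed.

Fact L2C_normZ (c : R[i]) u : L2C_norm (c *: u) = `|c| * L2C_norm u.
Proof.
rewrite -[u]reprK -[c *: _]/(L2C_scale _ _) L2C_scaleE !L2C_normE.
rewrite -[`|c|]/((normc c)%:C) -rmorphM/=; congr (_%:C).
rewrite (cL2normZ _ (cL2fun_meas _)) fineM ?cL2fun_fin_num//.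
Qed.

Fact L2C_norm_eq0 u : L2C_norm u = 0 -> u = 0.
Proof.
rewrite -[u]reprK L2C_normE => -[/eqP].
rewrite -eqe fineK ?cL2fun_fin_num// => /eqP /Lnorm_eq0_eq0.
have /measurable_EFinP m := measurable_normc (cL2fun_meas (repr u)).
have p2 : (0 < 2%:E :> \bar R)%E by rewrite lte_fin.
move=> /(_ m p2) u0; rewrite -[RHS](raddf0 \pi_L2C); apply/eqP/eqL2P.
by apply: filterS u0 => x /(_ I) [] /eq0_normc ->.
Qed.

HB.instance Definition _ := Lmodule_isNormed.Build R[i] L2C
  L2C_normD L2C_normZ L2C_norm_eq0.

End complex_L2.

(* An unbounded operator A is given by its graph: A (u, v) means that u is in
   the domain of A and v = A u. *)
Section spectrum.
Context (R : realType) (V : normedModType R[i]).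
Implicit Types (A : set (V * V)) (z : R[i]) (T : {linear V -> V}).

Definition op_norm T : R :=
  sup [set complex.Re `|T f| | f in [set f : V | `|f| <= 1]].

(* T is the everywhere defined bounded inverse of z - A: its graph is the
   transpose of {(u, z u - A u)}, and A u = z u - f amounts to (z - A) u = f. *)
Definition is_resolvent A z T :=
  continuous T /\ forall u f, A (u, z *: u - f) <-> u = T f.

Definition resolvent_set A := [set z | exists T, is_resolvent A z T].

Definition spectrum A := ~` resolvent_set A.

Definition pseudospectrum A (e : R) :=
  spectrum A `|` [set z | exists2 T, is_resolvent A z T & 1 / e < op_norm T].

End spectrum.

Section cubic_oscillator.
Variable R : realType.

Local Notation L2R := (L2C (@lebesgue_measure R)).

Definition test_function (u : R -> R) :=
  (forall n x, derivable (derive1n n u) x 1) /\ compact (closure [set x | u x != 0]).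

Definition ctest_function (phi : R -> R[i]) :=
  test_function (@complex.Re R \o phi) /\ test_function (@complex.Im R \o phi).

(* R[i] is not a normed module over R in the library, so phi'' is taken on the
   real and imaginary parts. *)
Definition cubic_oscillator_expr (phi : R -> R[i]) (x : R) : R[i] :=
  - (derive1n 2 (@complex.Re R \o phi) x +i* derive1n 2 (@complex.Im R \o phi) x)
  + 'i%C * (x ^+ 3)%:C * phi x.

Definition cubic_oscillator_test : set (L2R * L2R) :=
  [set uv : L2R * L2R | exists2 phi, ctest_function phi &
     {ae lebesgue_measure, forall x, uv.1 x = phi x} /\
     {ae lebesgue_measure, forall x, uv.2 x = cubic_oscillator_expr phi x}].

(* The closed operator: its graph is the closure in L^2 x L^2 of the graph on
   test functions. *)
Definition cubic_oscillator : set (L2R * L2R) := closure cubic_oscillator_test.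

End cubic_oscillator.

Arguments cubic_oscillator_test : clear implicits.
Arguments cubic_oscillator : clear implicits.

(* Main.v *)
Require Import Defs.
From HB Require Import structures.
From mathcomp Require Import all_boot all_order all_algebra.
From mathcomp Require Import complex.
From mathcomp Require Import all_classical all_reals all_analysis.
From mathcomp Require Import measurable_realfun ring lra.

Set Implicit Arguments.
Unset Strict Implicit.
Unset Printing Implicit Defensive.

Import Order.TTheory GRing.Theory Num.Theory.
Import numFieldNormedType.Exports.
Import Normc.

Local Open Scope classical_set_scope.
Local Open Scope ring_scope.
Local Open Scope complex_scope.

(* The solution of [psi'' = (i x^3 - z) psi] decaying at +oo is a rotation of the
   subdominant solution of [y'' = (x^3 - E) y], whose value and derivative at 0 are
   entire functions [Dd E] and [Nd E] of size at most exp (K rho^5) for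
   |E| <= kp rho^6; the mirror image of that solution decays at -oo. Their
   Wronskian is, up to the factor [Dd (- z)], the difference [Psi z] of the values
   of [Dd], multiplied by unit constants, at the two points of arguments
   arg z + pi / 5 and arg z - pi / 5. In the upper half plane |Dd E| strictly
   increases with arg E, at a rate that is bounded below quantitatively; hence
   |Psi z| >= exp (- K rho^5) for |z| <= kp rho^6, unless z is within
   exp (- rho^5) of a real zero of [Psi], and real zeros are eigenvalues. Variation
   of constants turns this into ||(H - z)^-1|| <= exp (K rho^5) for
   1 <= Re z <= rho^6, where rho^6 is the power 6/5 of rho^5. For large |Im z| the
   Wronskian is bounded below by comparing both solutions on a line in the
   lower half plane; the half plane Re z <= -1 is dealt with by accretivity,
   and what remains at bounded Re z by compactness. *)

(** The exponent 6/5 comes from one scale [rho]: for |z| of order rho^6 the term i x^3 balances z at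
    |x| of order rho^2, where solutions change at rate rho^3, hence by a factor exp (O(rho^5)).
    Sizes alone cannot bound a Wronskian below, since it is a difference of two terms that may be
    exponentially large; this is why the argument rests on a monotonicity. The subdominant solution
    is never built at infinity: it is replaced by exact solutions with WKB data at a finite point,
    for which derivatives in E and Wronskian identities are exact, and only their data at 0 are
    passed to the limit. Integrals are mostly held as increments of primitives, so that estimates
    reduce to monotonicity of functions of one real variable. No resolvent is constructed: off the
    spectrum it exists by definition, and a priori bounds on test functions pass to the closure.
    What must be proved about the spectrum is that it contains the real zeros of [Psi]; this follows
    by exhibiting a function outside the range. *)

Notation Re := complex.Re.
Notation Im := complex.Im.

Notation cj := conjc.

(** * Complex numbers, their exponential and the unit circle *)

Section complex_numbers.
Variable R : realType.
Implicit Types (z w : R[i]) (x y a b : R).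

Lemma ReD z w : Re (z + w) = Re z + Re w. Proof. by case: z w => [? ?] []. Qed.
Lemma ImD z w : Im (z + w) = Im z + Im w. Proof. by case: z w => [? ?] []. Qed.
Lemma ReN z : Re (- z) = - Re z. Proof. by case: z. Qed.
Lemma ImN z : Im (- z) = - Im z. Proof. by case: z. Qed.
Lemma ReB z w : Re (z - w) = Re z - Re w. Proof. by rewrite ReD ReN. Qed.
Lemma ImB z w : Im (z - w) = Im z - Im w. Proof. by rewrite ImD ImN. Qed.
Lemma ReM z w : Re (z * w) = Re z * Re w - Im z * Im w.
Proof. by case: z w => [? ?] []. Qed.
Lemma ImM z w : Im (z * w) = Re z * Im w + Im z * Re w.
Proof. by case: z w => [? ?] []. Qed.
Lemma ReJ z : Re (cj z) = Re z. Proof. by case: z. Qed.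
Lemma ImJ z : Im (cj z) = - Im z. Proof. by case: z. Qed.
Lemma ReC x : Re x%:C = x. Proof. by []. Qed.
Lemma ImC x : Im (x%:C : R[i]) = 0. Proof. by []. Qed.
Lemma Rei : Re ('i%C : R[i]) = 0. Proof. by []. Qed.
Lemma Imi : Im ('i%C : R[i]) = 1. Proof. by []. Qed.
Lemma Re0 : Re (0 : R[i]) = 0. Proof. by []. Qed.
Lemma Im0 : Im (0 : R[i]) = 0. Proof. by []. Qed.
Lemma Re1 : Re (1 : R[i]) = 1. Proof. by []. Qed.
Lemma Im1 : Im (1 : R[i]) = 0. Proof. by []. Qed.
Lemma Ren n : Re (n%:R : R[i]) = n%:R.
Proof. by rewrite -(rmorph_nat (real_complex R)). Qed.
Lemma Imn n : Im (n%:R : R[i]) = 0.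
Proof. by rewrite -(rmorph_nat (real_complex R)). Qed.

Definition ReImE := (Rei, Imi, ReD, ImD, ReN, ImN, ReM, ImM, ReJ, ImJ, ReC, ImC,
  Re0, Im0, Re1, Im1, Ren, Imn).

Lemma eqC z w : Re z = Re w -> Im z = Im w -> z = w.
Proof. by case: z w => [? ?] [? ?] /= -> ->. Qed.

Lemma complexRI z : z = (Re z)%:C + 'i%C * (Im z)%:C.
Proof. by apply: eqC; rewrite !ReImE; ring. Qed.

Lemma cCD x y : (x + y)%:C = x%:C + y%:C :> R[i]. Proof. exact: rmorphD. Qed.
Lemma cCM x y : (x * y)%:C = x%:C * y%:C :> R[i]. Proof. exact: rmorphM. Qed.
Lemma cCN x : (- x)%:C = - x%:C :> R[i]. Proof. exact: rmorphN. Qed.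
Lemma cCV x : (x^-1)%:C = x%:C^-1 :> R[i]. Proof. exact: fmorphV. Qed.
Lemma cCX x n : (x ^+ n)%:C = x%:C ^+ n :> R[i]. Proof. exact: rmorphXn. Qed.
Lemma cC0 : 0%:C = 0 :> R[i]. Proof. by []. Qed.
Lemma cC1 : 1%:C = 1 :> R[i]. Proof. by []. Qed.
Lemma cCn n : (n%:R)%:C = n%:R :> R[i]. Proof. exact: rmorph_nat. Qed.
Lemma cC_eq0 x : (x%:C == 0 :> R[i]) = (x == 0).
Proof. by rewrite eq_complex /= eqxx andbT. Qed.

(** Squared moduli stay polynomial in the real coordinates, so they are differentiable everywhere
    and identities between them are left to [ring]. *)
Definition sqn z : R := Re z ^+ 2 + Im z ^+ 2.
Definition dotc z w : R := Re z * Re w + Im z * Im w.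

Lemma sqn_ge0 z : 0 <= sqn z. Proof. by rewrite addr_ge0 // sqr_ge0. Qed.
Lemma normc_sqr z : normc z ^+ 2 = sqn z.
Proof. by case: z => a b; rewrite /= sqr_sqrtr // addr_ge0 // sqr_ge0. Qed.
Lemma ler_normc z w : (normc z <= normc w) = (sqn z <= sqn w).
Proof. by rewrite -!normc_sqr ler_pXn2r // nnegrE normc_ge0. Qed.
Lemma sqnM z w : sqn (z * w) = sqn z * sqn w.
Proof. by rewrite -!normc_sqr normcM exprMn. Qed.
Lemma sqnJ z : sqn (cj z) = sqn z. Proof. by rewrite /sqn ReJ ImJ sqrrN. Qed.
Lemma sqnN z : sqn (- z) = sqn z. Proof. by rewrite /sqn !ReImE !sqrrN. Qed.
Lemma sqnC x : sqn x%:C = x ^+ 2. Proof. by rewrite /sqn !ReImE; lra. Qed.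
Lemma sqn0 : sqn 0 = 0. Proof. by rewrite /sqn !ReImE; lra. Qed.
Lemma sqn_eq0 z : sqn z = 0 -> z = 0.
Proof. by rewrite -normc_sqr => /eqP; rewrite expf_eq0 /= => /eqP /eq0_normc. Qed.
Lemma sqn_gt0 z : z != 0 -> 0 < sqn z.
Proof. by move=> z0; rewrite lt0r sqn_ge0 andbT; apply: contraNneq z0 => /sqn_eq0 ->. Qed.
Lemma normc_gt0 z : (0 < normc z) = (z != 0).
Proof.
rewrite lt0r normc_ge0 andbT; congr negb; apply/eqP/eqP => [/eq0_normc//|->].
exact: normc0.
Qed.
Lemma normcJ' z : normc (cj z) = normc z.
Proof. by apply/eqP; rewrite -(eqrXn2 (n := 2)) ?normc_ge0 // !normc_sqr sqnJ. Qed.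
Lemma normcR x : normc x%:C = `|x| :> R.
Proof. by rewrite /= expr0n addr0 sqrtr_sqr. Qed.
Lemma normcX z n : normc (z ^+ n) = normc z ^+ n.
Proof. by elim: n => [|n ih]; rewrite ?expr0 ?normc1 // !exprS normcM ih. Qed.
Lemma normcB z w : normc (z - w) <= normc z + normc w.
Proof. by apply: le_trans (le_normcD _ _) _; rewrite normcN. Qed.
Lemma normc_distl z w : normc z - normc w <= normc (z + w).
Proof. by rewrite lerBlDr; have := normcB (z + w) w; rewrite addrK. Qed.
Lemma normcBC z w : normc (z - w) = normc (w - z).
Proof. by rewrite -normcN opprB. Qed.
Lemma normc_i : normc ('i%C : R[i]) = 1.
Proof. by rewrite /= expr0n add0r expr1n sqrtr1. Qed.
Lemma normc_nat n : normc (n%:R : R[i]) = n%:R.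
Proof. by rewrite -(rmorph_nat (real_complex R)) normcR ger0_norm ?ler0n. Qed.

Lemma Re_normc z : `|Re z| <= normc z.
Proof. by rewrite -normcR ler_normc sqnC /sqn lerDl sqr_ge0. Qed.
Lemma Im_normc z : `|Im z| <= normc z.
Proof. by rewrite -normcR ler_normc sqnC /sqn lerDr sqr_ge0. Qed.
Lemma Re_le z : Re z <= normc z. Proof. exact: le_trans (ler_norm _) (Re_normc z). Qed.
Lemma Im_le z : Im z <= normc z. Proof. exact: le_trans (ler_norm _) (Im_normc z). Qed.
Lemma normc_ReIm z : normc z <= `|Re z| + `|Im z|.
Proof.
rewrite {1}(complexRI z); apply: le_trans (le_normcD _ _) _.
by rewrite normcM normc_i mul1r !normcR.
Qed.

Lemma dotcE z w : dotc z w = Re (z * (cj w)).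
Proof. by rewrite /dotc !ReImE; lra. Qed.
Lemma dotcC z w : dotc z w = dotc w z.
Proof. by rewrite /dotc; lra. Qed.
Lemma dotc_le z w : dotc z w <= normc z * normc w.
Proof. by rewrite dotcE (le_trans (Re_le _)) // normcM normcJ'. Qed.
Lemma dotc_norm z w : `|dotc z w| <= normc z * normc w.
Proof. by rewrite dotcE (le_trans (Re_normc _)) // normcM normcJ'. Qed.
Lemma sqnD_le z w : sqn (z + w) <= 2 * (sqn z + sqn w).
Proof.
rewrite /sqn !ReImE.
have := sqr_ge0 (Re z - Re w); have := sqr_ge0 (Im z - Im w); nra.
Qed.

Lemma cjM z w : cj (z * w) = cj z * cj w. Proof. exact: rmorphM. Qed.
Lemma cjD z w : cj (z + w) = cj z + cj w. Proof. exact: rmorphD. Qed.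
Lemma cjB z w : cj (z - w) = cj z - cj w. Proof. exact: rmorphB. Qed.
Lemma cjN z : cj (- z) = - cj z. Proof. exact: rmorphN. Qed.
Lemma cjV z : cj (z^-1) = (cj z)^-1. Proof. exact: conjc_inv. Qed.
Lemma cjX z n : cj (z ^+ n) = cj z ^+ n. Proof. exact: rmorphXn. Qed.
Lemma cjn n : cj (n%:R : R[i]) = n%:R. Proof. exact: conjc_nat. Qed.
Lemma cjC x : cj (x%:C : R[i]) = x%:C. Proof. exact: conjc_real. Qed.
Lemma cj0 : cj (0 : R[i]) = 0. Proof. exact: conjc0. Qed.
Lemma cj1 : cj (1 : R[i]) = 1. Proof. exact: conjc1. Qed.
Lemma cjK z : cj (cj z) = z. Proof. exact: conjcK. Qed.
Lemma cji : cj ('i%C : R[i]) = - 'i%C. Proof. by apply: eqC; rewrite !ReImE; ring. Qed.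
Definition cjE := (cjM, cjD, cjB, cjN, cjV, cjX, cjn, cjC, cji, cj0, cj1, cjK).

(* Locked, lest unification unfolds it to a product. *)
Fact cexp_key : unit. Proof. exact: tt. Qed.
Definition cexp : R[i] -> R[i] := locked_with cexp_key
  (fun z => (expR (Re z))%:C * (cos (Im z) +i* sin (Im z))).

Lemma Re_cexp z : Re (cexp z) = expR (Re z) * cos (Im z).
Proof. by rewrite /cexp unlock !ReImE /=; ring. Qed.
Lemma Im_cexp z : Im (cexp z) = expR (Re z) * sin (Im z).
Proof. by rewrite /cexp unlock !ReImE /=; ring. Qed.
Lemma cexpD z w : cexp (z + w) = cexp z * cexp w.
Proof.
by apply: eqC; rewrite !(ReImE, Re_cexp, Im_cexp) expRD ?cosD ?sinD; ring.
Qed.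
Lemma cexp0 : cexp 0 = 1.
Proof. by apply: eqC; rewrite ?Re_cexp ?Im_cexp !ReImE expR0 ?cos0 ?sin0; lra. Qed.
Lemma sqn_cexp z : sqn (cexp z) = expR (2 * Re z).
Proof.
rewrite /sqn Re_cexp Im_cexp !exprMn -mulrDr cos2Dsin2 mulr1.
by rewrite expRM_natl.
Qed.
Lemma normc_cexp z : normc (cexp z) = expR (Re z).
Proof.
apply/eqP; rewrite -(eqrXn2 (n := 2)) ?normc_ge0 ?expR_ge0 // normc_sqr sqn_cexp.
by rewrite expRM_natl.
Qed.
Lemma cexp_neq0 z : cexp z != 0.
Proof. by rewrite -normc_gt0 normc_cexp expR_gt0. Qed.
Lemma cexpN z : cexp (- z) = (cexp z)^-1.
Proof.
by apply: (mulfI (cexp_neq0 z)); rewrite -cexpD subrr cexp0 mulfV ?cexp_neq0.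
Qed.
Lemma cexpMn z n : cexp (n%:R * z) = cexp z ^+ n.
Proof.
elim: n => [|n ih]; first by rewrite mul0r cexp0 expr0.
by rewrite exprS -ih -cexpD -natr1; congr cexp; ring.
Qed.
Lemma cexpJ z : (cj (cexp z)) = cexp (cj z).
Proof.
by apply: eqC; rewrite !(ReImE, Re_cexp, Im_cexp) ?cosN ?sinN ?mulrN.
Qed.
Lemma cexpR x : cexp x%:C = (expR x)%:C.
Proof. by apply: eqC; rewrite ?Re_cexp ?Im_cexp !ReImE ?cos0 ?sin0; lra. Qed.

Definition cis a : R[i] := cexp ('i%C * a%:C).

Lemma cisE a : cis a = cos a +i* sin a.
Proof.
by apply: eqC; rewrite /cis ?Re_cexp ?Im_cexp !ReImE /= mul0r !mul1r ?(mul0r,subrr,addr0,add0r,oppr0) expR0 ?mul1r.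
Qed.
Lemma Re_cis a : Re (cis a) = cos a. Proof. by rewrite cisE. Qed.
Lemma Im_cis a : Im (cis a) = sin a. Proof. by rewrite cisE. Qed.
Lemma cisD a b : cis (a + b) = cis a * cis b.
Proof. by rewrite /cis -cexpD; congr cexp; rewrite cCD; ring. Qed.
Lemma cis0 : cis 0 = 1. Proof. by rewrite /cis mulr0 cexp0. Qed.
Lemma cisN a : cis (- a) = (cj (cis a)).
Proof. by apply: eqC; rewrite !(ReImE, Re_cis, Im_cis) ?cosN ?sinN. Qed.
Lemma cisV a : cis (- a) = (cis a)^-1.
Proof. by rewrite /cis -cexpN; congr cexp; rewrite cCN; ring. Qed.
Lemma normc_cis a : normc (cis a) = 1.
Proof. by rewrite /cis normc_cexp !ReImE mul0r !mul1r subr0 expR0. Qed.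
Lemma sqn_cis a : sqn (cis a) = 1.
Proof. by rewrite -normc_sqr normc_cis expr1n. Qed.
Lemma cis_neq0 a : cis a != 0. Proof. exact: cexp_neq0. Qed.
Lemma cisMn a n : cis (n%:R * a) = cis a ^+ n.
Proof. by rewrite /cis -cexpMn; congr cexp; rewrite cCM cCn; ring. Qed.
Lemma cis_pihalf : cis (pi / 2) = 'i%C.
Proof. by rewrite cisE cos_pihalf sin_pihalf. Qed.
Lemma cis_pi : cis pi = -1.
Proof. by rewrite cisE cospi sinpi; apply: eqC; rewrite !ReImE /= ?oppr0. Qed.
Lemma polar_cexp (s t : R) : cexp (s%:C + 'i%C * t%:C) = (expR s)%:C * cis t.
Proof. by rewrite cexpD cexpR. Qed.

End complex_numbers.
Arguments cis {R}.
Arguments cexp {R}.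
#[global] Arguments complex.Re : simpl never.
#[global] Arguments complex.Im : simpl never.
#[global] Arguments normc : simpl never.
#[global] Arguments conjc : simpl never.

(** * Calculus of complex-valued functions of a real variable *)

Section calculus.
Variable R : realType.
Implicit Types (f g : R -> R) (u v : R -> R[i]) (x a b : R).

Definition rder f x (d : R) := is_derive x (1 : R) f d.
Definition cder u x (d : R[i]) :=
  rder (fun t => Re (u t)) x (Re d) /\ rder (fun t => Im (u t)) x (Im d).

Lemma rder_eq f x d d' : rder f x d -> d = d' -> rder f x d'.
Proof. by move=> ? <-. Qed.
Lemma rder_ext f g x d : (forall t, f t = g t) -> rder f x d -> rder g x d.
Proof. by move=> /funext ->. Qed.
Lemma rder_uniq f x d d' : rder f x d -> rder f x d' -> d = d'.
Proof. by move=> [_ <-] [_ <-]. Qed.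
Lemma rder_cst (c : R) x : rder (fun=> c) x 0.
Proof. exact: is_derive_cst. Qed.
Lemma rder_id x : rder (fun t => t) x 1.
Proof. exact: is_derive_id. Qed.
Lemma rderD f g x d e : rder f x d -> rder g x e -> rder (fun t => f t + g t) x (d + e).
Proof. exact: is_deriveD. Qed.
Lemma rderN f x d : rder f x d -> rder (fun t => - f t) x (- d).
Proof. exact: is_deriveN. Qed.
Lemma rder_opp x : rder -%R x (-1).
Proof. exact: rderN (rder_id x). Qed.
Lemma rderM f g x d e : rder f x d -> rder g x e ->
  rder (fun t => f t * g t) x (d * g x + f x * e).
Proof.
move=> df dg; apply: rder_eq (is_deriveM df dg) _.
by rewrite /GRing.scale /= addrC [g x * d]mulrC.
Qed.
Lemma rderX f n x d : rder f x d ->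
  rder (fun t => f t ^+ n) x (n%:R * f x ^+ n.-1 * d).
Proof.
move=> df; have -> : (fun t => f t ^+ n) = f ^+ n.
  by apply/funext => t; elim: n => [|n ih]; rewrite ?expr0 // !exprS ih.
exact: is_deriveX.
Qed.
Lemma rder_comp f g x d e : rder g x e -> rder f (g x) d ->
  rder (fun t => f (g t)) x (d * e).
Proof. by move=> dg df; exact: is_derive1_comp. Qed.
Lemma rderV f x d : f x != 0 -> rder f x d ->
  rder (fun t => (f t)^-1) x (- d / f x ^+ 2).
Proof.
move=> f0 df; apply: rder_eq (is_deriveV f0 df) _.
by rewrite /GRing.scale /= !mulNr mulrC.
Qed.
Lemma rder_expR f x d : rder f x d -> rder (fun t => expR (f t)) x (expR (f x) * d).
Proof. by move=> df; apply: rder_comp df _; exact: is_derive_expR. Qed.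
Lemma rder_exp x : rder expR x (expR x).
Proof. exact: is_derive_expR. Qed.
Lemma rder_cos f x d : rder f x d -> rder (fun t => cos (f t)) x (- sin (f x) * d).
Proof. by move=> df; apply: rder_comp df _; exact: is_derive_cos. Qed.
Lemma rder_sin f x d : rder f x d -> rder (fun t => sin (f t)) x (cos (f x) * d).
Proof. by move=> df; apply: rder_comp df _; exact: is_derive_sin. Qed.
Lemma rder_cont f x d : rder f x d -> {for x, continuous f}.
Proof. by move=> [df _]; apply: differentiable_continuous; apply/derivable1_diffP. Qed.

Lemma cder_eq u x d d' : cder u x d -> d = d' -> cder u x d'.
Proof. by move=> ? <-. Qed.
Lemma cder_ext u v x d : (forall t, u t = v t) -> cder u x d -> cder v x d.
Proof. by move=> /funext ->. Qed.
Lemma cder_cst (c : R[i]) x : cder (fun=> c) x 0.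
Proof. by split; exact: rder_cst. Qed.
Lemma cderD u v x d e : cder u x d -> cder v x e -> cder (fun t => u t + v t) x (d + e).
Proof.
move=> [ur ui] [vr vi]; split; rewrite ?ReD ?ImD.
  by apply: (rder_ext _ (rderD ur vr)) => t; rewrite ReD.
by apply: (rder_ext _ (rderD ui vi)) => t; rewrite ImD.
Qed.
Lemma cderN u x d : cder u x d -> cder (fun t => - u t) x (- d).
Proof.
move=> [ur ui]; split; rewrite ?ReN ?ImN.
  by apply: (rder_ext _ (rderN ur)) => t; rewrite ReN.
by apply: (rder_ext _ (rderN ui)) => t; rewrite ImN.
Qed.
Lemma cderM u v x d e : cder u x d -> cder v x e ->
  cder (fun t => u t * v t) x (d * v x + u x * e).
Proof.
move=> [ur ui] [vr vi]; split.
  have H := rderD (rderM ur vr) (rderN (rderM ui vi)).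
  apply: (rder_ext _ (rder_eq H _)) => [t|]; first by rewrite ReM.
  by rewrite !ReImE; ring.
have H := rderD (rderM ur vi) (rderM ui vr).
apply: (rder_ext _ (rder_eq H _)) => [t|]; first by rewrite ImM.
by rewrite !ReImE; ring.
Qed.
Lemma cderJ u x d : cder u x d -> cder (fun t => (cj (u t))) x (cj d).
Proof.
move=> [ur ui]; split.
  by apply: (rder_ext _ (rder_eq ur _)) => [t|]; rewrite ReJ.
by apply: (rder_ext _ (rder_eq (rderN ui) _)) => [t|]; rewrite ImJ.
Qed.
Lemma cderC f x d : rder f x d -> cder (fun t => (f t)%:C) x d%:C.
Proof. by move=> df; split => //=; exact: rder_cst. Qed.
Lemma cder_realc x : cder (real_complex R) x 1.
Proof. exact: cderC (rder_id x). Qed.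
Lemma cderX u n x d : cder u x d ->
  cder (fun t => u t ^+ n) x (n%:R * u x ^+ n.-1 * d).
Proof.
move=> du; elim: n => [|n ih].
  apply: (@cder_ext (fun=> 1)) => [t|]; first by rewrite expr0.
  by rewrite !mul0r; exact: cder_cst.
apply: (@cder_ext (fun t => u t * u t ^+ n)) => [t|]; first by rewrite exprS.
apply: cder_eq (cderM du ih) _ => /=.
case: n {ih} => [|n]; first by rewrite !expr0; ring.
by rewrite -natr1 /= exprS; ring.
Qed.
Lemma cder_cexp u x d : cder u x d -> cder (fun t => cexp (u t)) x (cexp (u x) * d).
Proof.
move=> [ur ui]; split.
  apply: (@rder_ext (fun t => expR (Re (u t)) * cos (Im (u t)))) => [t|].
    by rewrite Re_cexp.
  apply: rder_eq (rderM (rder_expR ur) (rder_cos ui)) _.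
  by rewrite ReM Re_cexp Im_cexp; ring.
apply: (@rder_ext (fun t => expR (Re (u t)) * sin (Im (u t)))) => [t|].
  by rewrite Im_cexp.
apply: rder_eq (rderM (rder_expR ur) (rder_sin ui)) _.
by rewrite ImM Re_cexp Im_cexp; ring.
Qed.
Lemma cder_cis f x d : rder f x d -> cder (fun t => cis (f t)) x ('i%C * d%:C * cis (f x)).
Proof.
move=> df; rewrite /cis.
apply: cder_eq (cder_cexp (cderM (cder_cst 'i%C x) (cderC df))) _.
by rewrite mul0r add0r mulrC.
Qed.
Lemma cder_comp u g x d e : rder g x e -> cder u (g x) d ->
  cder (fun t => u (g t)) x (e%:C * d).
Proof.
move=> dg [ur ui]; split.
  apply: rder_eq (rder_comp dg ur) _.
  by rewrite !ReImE; ring.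
apply: rder_eq (rder_comp dg ui) _.
by rewrite !ReImE; ring.
Qed.

Lemma rder_Re u x d : cder u x d -> rder (fun t => Re (u t)) x (Re d).
Proof. by case. Qed.
Lemma rder_Im u x d : cder u x d -> rder (fun t => Im (u t)) x (Im d).
Proof. by case. Qed.
Lemma rder_dotc u v x d e : cder u x d -> cder v x e ->
  rder (fun t => dotc (u t) (v t)) x (dotc d (v x) + dotc (u x) e).
Proof.
move=> [ur ui] [vr vi].
apply: rder_eq (rderD (rderM ur vr) (rderM ui vi)) _.
by rewrite /dotc; ring.
Qed.
Lemma rder_sqn u x d : cder u x d -> rder (fun t => sqn (u t)) x (2 * dotc (u x) d).
Proof.
move=> du; apply: rder_eq (rder_dotc du du) _.
by rewrite (dotcC d); ring.
Qed.

Lemma nondecr f (f' : R -> R) a b : a <= b ->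
  (forall x, a <= x <= b -> rder f x (f' x)) ->
  (forall x, a <= x <= b -> 0 <= f' x) -> f a <= f b.
Proof.
move=> ab df f'0.
have cf : {within `[a, b], continuous f}.
  apply: continuous_in_subspaceT => x; rewrite inE /= in_itv /= => xab.
  exact: rder_cont (df _ xab).
have [x xab|c cab E] := @MVT_segment _ f f' a b ab _ cf.
  by apply: df; move: xab; rewrite in_itv /= => /andP[/ltW -> /ltW ->].
rewrite -subr_ge0 E mulr_ge0 ?subr_ge0 // f'0 //.
Qed.

Lemma nondecr_le f g (f' g' : R -> R) a b : a <= b ->
  (forall x, a <= x <= b -> rder f x (f' x)) ->
  (forall x, a <= x <= b -> rder g x (g' x)) ->
  (forall x, a <= x <= b -> f' x <= g' x) -> f b - f a <= g b - g a.
Proof.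
move=> ab df dg fg; suff : g a + - f a <= g b + - f b by lra.
apply: (@nondecr (fun t => g t + - f t) (fun t => g' t + - f' t)) => // x xab.
  by apply: rderD (dg _ xab) (rderN (df _ xab)).
by rewrite subr_ge0 fg.
Qed.

(** The increment [w] is projected on itself: the real function [dotc w (u t)] increases by |w|^2,
    and its derivative is at most |w| times that of [g]. *)
Lemma normc_incr_le u g (u' : R -> R[i]) (g' : R -> R) a b : a <= b ->
  (forall x, a <= x <= b -> cder u x (u' x)) ->
  (forall x, a <= x <= b -> rder g x (g' x)) ->
  (forall x, a <= x <= b -> normc (u' x) <= g' x) -> normc (u b - u a) <= g b - g a.
Proof.
move=> ab du dg ug; set w := u b - u a.
have gg : 0 <= g b - g a.
  rewrite subr_ge0; apply: (nondecr ab dg) => x xab.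
  by apply: le_trans (ug _ xab); exact: normc_ge0.
have : dotc w (u b) - dotc w (u a) <= normc w * (g b - g a).
  rewrite mulrBr; apply: (@nondecr_le (fun t => dotc w (u t)) (fun t => normc w * g t)
    (fun t => dotc w (u' t)) (fun t => normc w * g' t)) => // x xab.
  - apply: rder_eq (rder_dotc (cder_cst w x) (du _ xab)) _.
    by rewrite /dotc !ReImE; ring.
  - by apply: rder_eq (rderM (rder_cst (normc w) x) (dg _ xab)) _; ring.
  - apply: le_trans (dotc_le _ _) _.
    by apply: ler_wpM2l; [exact: normc_ge0|exact: ug].
have -> : dotc w (u b) - dotc w (u a) = normc w ^+ 2.
  by rewrite normc_sqr /dotc /sqn /w !ReImE; ring.
have := normc_ge0 w; rewrite le_eqVlt => /orP[/eqP <-//|w0].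
by rewrite expr2 ler_pM2l.
Qed.

Lemma cder0_cst u a b : a <= b -> (forall x, a <= x <= b -> cder u x 0) -> u b = u a.
Proof.
move=> ab du; apply/eqP; rewrite -subr_eq0; apply/eqP/eq0_normc/eqP.
rewrite eq_le normc_ge0 andbT.
rewrite -(subrr (0 : R)); apply: (@normc_incr_le u (fun=> 0) (fun=> 0) (fun=> 0)) => // x _.
  exact: rder_cst.
by rewrite normc0.
Qed.

Lemma gronwall (m k m' k' : R -> R) a b : a <= b ->
  (forall x, a <= x <= b -> rder m x (m' x)) ->
  (forall x, a <= x <= b -> rder k x (k' x)) ->
  (forall x, a <= x <= b -> m' x <= k' x * m x) ->
  m b <= m a * expR (k b - k a).
Proof.
move=> ab dm dk mk.
have H : m b * expR (- k b) <= m a * expR (- k a).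
  rewrite -subr_le0 -(subrr (0 : R)).
  apply: (@nondecr_le (fun t => m t * expR (- k t)) (fun=> 0)
   (fun t => m' t * expR (- k t) + m t * (expR (- k t) * - k' t)) (fun=> 0)) => // x xab.
  - apply: rderM; first exact: dm.
    by apply: rder_expR; apply: rderN; exact: dk.
  - exact: rder_cst.
  - rewrite [m x * _]mulrCA [m' x * _]mulrC -mulrDr pmulr_rle0 ?expR_gt0 //.
    by rewrite mulrN subr_le0 mulrC mk.
rewrite -(ler_pM2r (expR_gt0 (- k b))) -mulrA -expRD.
by have -> : k b - k a - k b = - k a by ring.
Qed.

Lemma gronwall_back (m k m' k' : R -> R) a b : a <= b ->
  (forall x, a <= x <= b -> rder m x (m' x)) ->
  (forall x, a <= x <= b -> rder k x (k' x)) ->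
  (forall x, a <= x <= b -> - (k' x * m x) <= m' x) ->
  m a <= m b * expR (k b - k a).
Proof.
move=> ab dm dk mk.
have H : m a * expR (k a) <= m b * expR (k b).
  apply: (@nondecr (fun t => m t * expR (k t))
    (fun t => m' t * expR (k t) + m t * (expR (k t) * k' t))) => // x xab.
    apply: rderM; first exact: dm.
    by apply: rder_expR; exact: dk.
  rewrite [m x * _]mulrCA [m' x * _]mulrC -mulrDr pmulr_rge0 ?expR_gt0 //.
  by have := mk _ xab; lra.
rewrite -(ler_pM2r (expR_gt0 (k a))) -mulrA -expRD.
by have -> : k b - k a + k a = k b by ring.
Qed.

End calculus.

Ltac der1 := match goal with
 | |- rder (fun _ => ?c) _ _ => apply: rder_cst
 | |- rder (fun x => x) _ _ => apply: rder_id
 | |- rder (-%R)%R _ _ => apply: rder_opp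
 | |- rder expR _ _ => apply: rder_exp
 | |- rder (fun x => (@?f x + @?g x)%R) _ _ => apply: rderD
 | |- rder (fun x => (- @?f x)%R) _ _ => apply: rderN
 | |- rder (fun x => (@?f x * @?g x)%R) _ _ => apply: rderM
 | |- rder (fun x => (@?f x ^+ ?n)%R) _ _ => apply: rderX
 | |- rder (fun x => expR (@?f x)) _ _ => apply: rder_expR
 | |- rder (fun x => cos (@?f x)) _ _ => apply: rder_cos
 | |- rder (fun x => sin (@?f x)) _ _ => apply: rder_sin
 | |- rder (fun x => sqn (@?f x)) _ _ => apply: rder_sqn
 | |- rder (fun x => dotc (@?f x) (@?g x)) _ _ => apply: rder_dotc
 | |- rder (fun x => complex.Re (@?f x)) _ _ => apply: rder_Re
 | |- rder (fun x => complex.Im (@?f x)) _ _ => apply: rder_Im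
 | |- cder (fun _ => ?c) _ _ => apply: cder_cst
 | |- cder (fun x => (@?f x + @?g x)%R) _ _ => apply: cderD
 | |- cder (fun x => (- @?f x)%R) _ _ => apply: cderN
 | |- cder (fun x => (@?f x * @?g x)%R) _ _ => apply: cderM
 | |- cder (fun x => (@?f x ^+ ?n)%R) _ _ => apply: cderX
 | |- cder (fun x => cj (@?f x)) _ _ => apply: cderJ
 | |- cder (fun x => (@?f x)%:C) _ _ => apply: cderC
 | |- cder (real_complex _) _ _ => apply: cder_realc
 | |- cder (fun x => cexp (@?f x)) _ _ => apply: cder_cexp
 | |- cder (fun x => cis (@?f x)) _ _ => apply: cder_cis
 end.
Ltac der := repeat (first [eassumption | der1]).

(** * Entire functions *)

Section entire_functions.
Variable R : realType.
Implicit Types (x z h : R[i]) (a : nat -> R[i]).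

(** The difference quotients of [f] at [t] are dominated by those of [q], both functions vanishing
    there. *)
Lemma rder_squeeze (f q : R -> R) (t : R) : f t = 0 -> q t = 0 ->
  (\forall s \near t, `|f s| <= q s) -> rder q t 0 -> rder f t 0.
Proof.
move=> ft qt fq [dq q0].
have cq : (fun h : R => h^-1 *: ((q \o shift t) (h *: (1 : R)) - q t)) @ 0^' --> (0 : R).
  by rewrite -[X in _ --> X]q0; exact: dq.
have cf : (fun h : R => h^-1 *: ((f \o shift t) (h *: (1 : R)) - f t)) @ 0^' --> (0 : R).
  apply/cvgr0Pnorm_le => e e0.
  have /cvgr0Pnorm_le/(_ e e0) Hq := cq.
  have fq' : \forall h \near 0^', `|f (h *: (1 : R) + t)| <= q (h *: (1 : R) + t).
    have : (fun h : R => h *: (1 : R) + t) @ 0^' --> t.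
      rewrite -[X in _ --> X]add0r; apply: cvgD; last exact: cvg_cst.
      rewrite -[X in _ --> X](scale0r (1 : R)).
      by apply: cvgZr_tmp; exact: cvg_within.
    by move/(_ _ fq).
  near=> h.
  have A : `|h^-1 *: ((q \o shift t) (h *: (1 : R)) - q t)| <= e by near: h.
  have B : `|f (h *: (1 : R) + t)| <= q (h *: (1 : R) + t) by near: h.
  apply: le_trans A; rewrite /= ft qt !subr0 !normrZ.
  apply: ler_wpM2l => //; apply: le_trans (ler_norm _); exact: B.
split; first by apply/cvg_ex; exists 0; exact: cf.
by apply: cvg_lim cf.
Unshelve. all: by end_near.
Qed.

(** A quadratic remainder, uniform on discs, in place of complex differentiability: it passes from
    partial sums to the sum of a power series without an interchange of limits. *)
Definition holo (f f' : R[i] -> R[i]) := forall r : R, exists M : R, forall x h,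
  normc x <= r -> normc (x + h) <= r ->
  normc (f (x + h) - f x - h * f' x) <= M * normc h ^+ 2.

(** The remainder of the expansion at [g t] is dominated by a multiple of [sqn (g s - g t)], whose
    derivative at [t] is 0. *)
Lemma cder_holo f f' (g : R -> R[i]) t d : holo f f' -> cder g t d ->
  cder (fun s => f (g s)) t (f' (g t) * d).
Proof.
move=> hf dg; have [M HM] := hf (normc (g t) + 1).
pose q s := `|M| * sqn (g s - g t).
have dq : rder q t 0.
  apply: rder_eq; first by rewrite /q; der.
  by rewrite /= /dotc !ReImE; ring.
have near1 : \forall s \near t, normc (f (g s) - f (g t) - (g s - g t) * f' (g t)) <= q s.
  have cs : {for t, continuous (fun s => sqn (g s - g t))}.
    by apply: rder_cont (_ : rder _ t (2 * dotc (g t - g t) (d + - 0))); der.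
  have : \forall s \near t, sqn (g s - g t) < 1.
    by apply: (cvgr_lt _ cs); rewrite subrr sqn0.
  apply: filterS => s s1.
  have n1 : normc (g s - g t) <= 1.
    by rewrite -(@ler_pXn2r _ 2) ?nnegrE ?normc_ge0 // normc_sqr expr1n ltW.
  have E : g t + (g s - g t) = g s by ring.
  have := HM (g t) (g s - g t); rewrite E => H.
  apply: le_trans (H _ _) _; first by rewrite lerDl.
    have := le_normcD (g t) (g s - g t); rewrite E => H1.
    by apply: le_trans H1 _; rewrite lerD2l.
  rewrite /q -normc_sqr; apply: ler_wpM2r; [exact: sqr_ge0|exact: ler_norm].
have q0 : q t = 0 by rewrite /q subrr sqn0 mulr0.
pose rm s := f (g s) - f (g t) - (g s - g t) * f' (g t).
have rm0 : rm t = 0 by rewrite /rm !subrr mul0r subrr.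
have drm : cder rm t 0.
  split; apply: (rder_squeeze _ q0 _ dq); rewrite ?rm0 //.
    by apply: filterS near1 => s; apply: le_trans; exact: Re_normc.
  by apply: filterS near1 => s; apply: le_trans; exact: Im_normc.
apply: (@cder_ext _ (fun s => rm s + f (g t) + (g s - g t) * f' (g t))) => [s|].
  by rewrite /rm; ring.
apply: cder_eq; first by der.
by rewrite /=; ring.
Qed.

Lemma sup_squeeze (T : Type) (lo hi : T -> R) (t0 : T) :
  (forall m n, lo m <= hi n) -> exists l, forall m, lo m <= l <= hi m.
Proof.
move=> H; exists (sup (range lo)) => m; apply/andP; split.
  apply: ub_le_sup; last by exists m.
  by exists (hi t0) => _ [n _ <-].
apply: ge_sup; first by exists (lo t0); exists t0.
by move=> _ [n _ <-].
Qed.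

(** Completeness with a rate, over any totally ordered index set, so that it serves sequences as
    well as functions of a real variable. *)
Lemma rlim_exists d (T : orderType d) (u e : T -> R) (t0 : T) :
  (forall m n, (t0 <= m)%O -> (m <= n)%O -> `|u n - u m| <= e m) ->
  exists l, forall m, (t0 <= m)%O -> `|l - u m| <= e m.
Proof.
move=> H.
have e0 m : (t0 <= m)%O -> 0 <= e m.
  by move=> tm; apply: le_trans (H m m tm (Order.POrderTheory.lexx m)).
pose T' := {t : T | (t0 <= t)%O}.
have [|l Hl] := @sup_squeeze T' (fun t => u (sval t) - e (sval t))
   (fun t => u (sval t) + e (sval t)) (exist _ t0 (Order.POrderTheory.lexx t0)).
  move=> [m tm] [n tn] /=; case: (Order.TotalTheory.leP m n) => mn.
    by have := H m n tm mn; have := e0 n tn; rewrite ler_norml => ? /andP[]; lra.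
  have := H n m tn (Order.POrderTheory.ltW mn); have := e0 m tm.
  by rewrite ler_norml => ? /andP[]; lra.
exists l => m tm; have := Hl (exist _ m tm) => /= /andP[? ?].
by rewrite ler_norml; apply/andP; split; lra.
Qed.

Lemma clim_exists d (T : orderType d) (u : T -> R[i]) (e : T -> R) (t0 : T) :
  (forall m n, (t0 <= m)%O -> (m <= n)%O -> normc (u n - u m) <= e m) ->
  exists l, forall m, (t0 <= m)%O -> normc (l - u m) <= 2 * e m.
Proof.
move=> H.
have [|lr Hr] := @rlim_exists _ T (fun t => Re (u t)) e t0.
  by move=> m n tm mn; rewrite -ReB; apply: le_trans (Re_normc _) (H _ _ tm mn).
have [|li Hi] := @rlim_exists _ T (fun t => Im (u t)) e t0.
  by move=> m n tm mn; rewrite -ImB; apply: le_trans (Im_normc _) (H _ _ tm mn).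
exists (lr +i* li) => m tm; apply: le_trans (normc_ReIm _) _.
by rewrite ReB ImB /=; have := Hr m tm; have := Hi m tm; lra.
Qed.

Definition ccvg (u : nat -> R[i]) (l : R[i]) :=
  forall e : R, 0 < e -> exists N, forall n, (N <= n)%N -> normc (u n - l) <= e.

Lemma ccvg_uniq u l l' : ccvg u l -> ccvg u l' -> l = l'.
Proof.
move=> ul ul'; apply/eqP; rewrite -subr_eq0; apply/eqP/eq0_normc/eqP.
rewrite eq_le normc_ge0 andbT; apply/ler_addgt0Pl => e e0; rewrite addr0.
have [N HN] := ul _ (divr_gt0 e0 (ltr0Sn R 1)); have [N' HN'] := ul' _ (divr_gt0 e0 (ltr0Sn R 1)).
have := HN (maxn N N') (leq_maxl _ _); have := HN' (maxn N N') (leq_maxr _ _).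
set v := u _ => A B.
have -> : l - l' = (v - l') - (v - l) by ring.
by apply: le_trans (normcB _ _) _; lra.
Qed.

Lemma ccvg_le (u : nat -> R[i]) l (c : R) N : ccvg u l ->
  (forall n, (N <= n)%N -> normc (u n) <= c) -> normc l <= c.
Proof.
move=> ul H; apply/ler_addgt0Pl => e e0; have [N' HN'] := ul _ e0.
have A := HN' _ (leq_maxl N' N); have B := H _ (leq_maxr N' N).
set v := u _ in A B; have -> : l = v - (v - l) by ring.
by apply: le_trans (normcB _ _) _; lra.
Qed.

Lemma ccvgD u v l m : ccvg u l -> ccvg v m -> ccvg (fun n => u n + v n) (l + m).
Proof.
move=> ul vm e e0; have [N HN] := ul _ (divr_gt0 e0 (ltr0Sn R 1)).
have [N' HN'] := vm _ (divr_gt0 e0 (ltr0Sn R 1)).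
exists (maxn N N') => n; rewrite geq_max => /andP[/HN A /HN' B].
have -> : u n + v n - (l + m) = (u n - l) + (v n - m) by ring.
by apply: le_trans (le_normcD _ _) _; lra.
Qed.

Lemma ccvgZ u l c : ccvg u l -> ccvg (fun n => c * u n) (c * l).
Proof.
move=> ul e e0; have c0 : 0 < normc c + 1 by have := normc_ge0 c; lra.
have [N HN] := ul _ (divr_gt0 e0 c0); exists N => n /HN H.
rewrite -mulrBr normcM; apply: le_trans (_ : (normc c + 1) * normc (u n - l) <= _).
  by apply: ler_wpM2r; [exact: normc_ge0|lra].
by rewrite mulrC -ler_pdivlMr.
Qed.

Lemma ccvgN u l : ccvg u l -> ccvg (fun n => - u n) (- l).
Proof. by move=> ul e /ul [N HN]; exists N => n /HN; rewrite -opprD normcN. Qed.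

Lemma ccvg_shift u l k : ccvg u l -> ccvg (fun n => u (n + k)%N) l.
Proof. by move=> ul e /ul [N HN]; exists N => n Nn; apply: HN; exact: leq_trans (leq_addr _ _). Qed.

Lemma ccvg_ext u v l : (forall n, u n = v n) -> ccvg u l -> ccvg v l.
Proof. by move=> /funext ->. Qed.

Lemma ccvg_cst l : ccvg (fun=> l) l.
Proof. by move=> e e0; exists 0%N => n _; rewrite subrr normc0 ltW. Qed.

(** Coefficients that decay faster than every geometric sequence: infinite radius of convergence. *)
Definition entire a := forall r : R, 1 <= r -> exists B : R, forall n, normc (a n) * r ^+ n <= B.
Definition psum a x n := \sum_(k < n) a k * x ^+ k.
Definition pfun a x := xget 0 [set l | ccvg (psum a x) l].

Lemma entire_r a (r : R) : entire a -> exists2 B : R, 0 <= B &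
  forall n, normc (a n) * r ^+ n <= B * 2 ^- n.
Proof.
move=> ea; have [|B HB] := ea (Num.max 1 (2 * `|r|)); first by rewrite le_max lexx.
have B0 : 0 <= B.
  by apply: le_trans (HB 0%N); rewrite mulr_ge0 ?normc_ge0 // exprn_ge0 // le_max ler01.
exists B => // n; rewrite ler_pdivlMr ?exprn_gt0 // -mulrA -exprMn.
apply: le_trans (HB n); apply: ler_wpM2l; first exact: normc_ge0.
apply: le_trans (ler_norm _) _; rewrite normrX; apply: lerXn2r; rewrite ?nnegrE ?le_max ?ler01 //.
by rewrite normrM mulrC [`|2|]ger0_norm // lexx orbT.
Qed.

Lemma geo_sum m n : \sum_(m <= k < m + n) (2 ^- k : R) <= 2 * 2 ^- m.
Proof.
suff : \sum_(m <= k < m + n) (2 ^- k : R) = 2 * 2 ^- m - 2 * 2 ^- (m + n).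
  by move=> ->; rewrite gerBl mulr_ge0 // invr_ge0 exprn_ge0.
elim: n => [|n ih]; first by rewrite addn0 big_geq // subrr.
rewrite addnS big_nat_recr ?leq_addr //= ih exprS invfM.
by field; rewrite ?expf_neq0 // pnatr_eq0.
Qed.

Lemma psum_dist a x (B : R) m n : (m <= n)%N -> 
  (forall k, normc (a k * x ^+ k) <= B * 2 ^- k) ->
  normc (psum a x n - psum a x m) <= 2 * B * 2 ^- m.
Proof.
move=> mn H; have B0 : 0 <= B.
  by have := le_trans (normc_ge0 _) (H 0%N); rewrite expr0 invr1 mulr1.
rewrite /psum -!(big_mkord xpredT (fun k => a k * x ^+ k)).
rewrite (big_cat_nat (leq0n m) mn) /= addrAC subrr add0r.
apply: le_trans (_ : \sum_(m <= k < n) (B * 2 ^- k) <= _).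
  elim/big_ind2: _ => [|? ? ? ? A1 A2|? _]; first by rewrite normc0.
    by apply: le_trans (le_normcD _ _) _; exact: lerD.
  exact: H.
rewrite -mulr_sumr [2 * B]mulrC -mulrA; apply: ler_wpM2l => //.
by rewrite -(subnKC mn); exact: geo_sum.
Qed.

Lemma half_pow (e : R) : 0 < e -> exists N, forall n, (N <= n)%N -> 2 ^- n <= e :> R.
Proof.
move=> e0; have [N HN] : exists N : nat, e^-1 <= N%:R.
  by exists (Num.truncn e^-1).+1; apply: ltW; exact: truncnS_gt.
exists N => n Nn; rewrite invf_ple ?posrE ?exprn_gt0 //; apply: le_trans HN _.
rewrite -natrX ler_nat; apply: leq_trans Nn (ltnW (ltn_expl _ _)); by [].
Qed.

Lemma pfunP a x : entire a -> ccvg (psum a x) (pfun a x).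
Proof.
move=> ea; have [B B0 HB] := entire_r (normc x) ea.
have H k : normc (a k * x ^+ k) <= B * 2 ^- k by rewrite normcM normcX.
have [l Hl] : exists l, ccvg (psum a x) l.
  have [|l Hl] := @clim_exists _ nat (psum a x) (fun m => 2 * B * 2 ^- m) 0%N.
    by move=> m n _ mn; exact: psum_dist.
  exists l => e e0.
  have B1 : 0 < 4 * B + 1 by lra.
  have [N HN] := half_pow (divr_gt0 e0 B1); exists N => n /HN.
  rewrite ler_pdivlMr // => Hn; rewrite normcBC; apply: le_trans (Hl n _) _ => //.
  have : 0 <= 2 ^- n :> R by rewrite invr_ge0 exprn_ge0.
  by move: Hn; set q := 2 ^- n; nra.
by rewrite /pfun; case: xgetP => [y _ //|/(_ l)].
Qed.

Lemma pow_taylor (r : R) x h k : 1 <= r -> normc x <= r -> normc (x + h) <= r ->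
  normc ((x + h) ^+ k - x ^+ k - k%:R * h * x ^+ k.-1) <= k%:R ^+ 2 * r ^+ k * normc h ^+ 2.
Proof.
move=> r1 xr xhr; have r0 : 0 <= r by lra.
elim: k => [|k ih].
  by rewrite !expr0 subrr !mul0r subrr normc0 expr2 !mul0r.
have -> : (x + h) ^+ k.+1 - x ^+ k.+1 - k.+1%:R * h * x ^+ k.+1.-1 =
  (x + h) * ((x + h) ^+ k - x ^+ k - k%:R * h * x ^+ k.-1) + k%:R * h ^+ 2 * x ^+ k.-1.
  case: k {ih} => [|k] /=; first by rewrite !expr0 !expr1 mulr0n mulr1n; ring.
  by rewrite -[k.+2%:R]natr1 !exprS; ring.
apply: le_trans (le_normcD _ _) _; rewrite !normcM !normcX normc_nat.
have h0 : 0 <= normc h ^+ 2 by exact: sqr_ge0.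
have A : normc x ^+ k.-1 <= r ^+ k.+1.
  apply: le_trans (_ : r ^+ k.-1 <= _).
    by apply: lerXn2r; rewrite ?nnegrE ?normc_ge0.
  by apply: ler_weXn2l => //; case: k {ih} => //= k; rewrite ltnW.
apply: le_trans (lerD (ler_pM (normc_ge0 _) (normc_ge0 _) xhr ih)
  (ler_wpM2l _ A)) _; first by rewrite mulr_ge0.
have rk : 0 <= r ^+ k.+1 by exact: exprn_ge0.
have -> : r * (k%:R ^+ 2 * r ^+ k * normc h ^+ 2) = k%:R ^+ 2 * r ^+ k.+1 * normc h ^+ 2.
  by rewrite (exprS r k); ring.
have kk : (k%:R : R) ^+ 2 + k%:R <= k.+1%:R ^+ 2.
  by rewrite -natr1; have : 0 <= k%:R :> R by []; nra.
have -> : k%:R ^+ 2 * r ^+ k.+1 * normc h ^+ 2 + k%:R * normc h ^+ 2 * r ^+ k.+1 =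
  (k%:R ^+ 2 + k%:R) * (r ^+ k.+1 * normc h ^+ 2) by ring.
by rewrite -mulrA; apply: ler_wpM2r => //; exact: mulr_ge0.
Qed.

Definition pderiv a n : R[i] := n.+1%:R * a n.+1.

Lemma entire_pderiv a : entire a -> entire (pderiv a).
Proof.
move=> ea r r1; have [B B0 HB] := entire_r r ea; exists (B + B) => n.
have r0 : 0 <= r by lra.
have H1 : (n.+1%:R : R) * 2 ^- n.+1 <= 1.
  rewrite ler_pdivrMr ?exprn_gt0 // mul1r -natrX ler_nat; exact/ltnW/ltn_expl.
have H := HB n.+1.
rewrite /pderiv normcM normc_nat.
apply: le_trans (_ : n.+1%:R * (normc (a n.+1) * r ^+ n.+1) <= _).
  rewrite -mulrA; apply: ler_wpM2l => //; apply: ler_wpM2l; first exact: normc_ge0.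
  by rewrite exprS ler_peMl // exprn_ge0.
apply: le_trans (ler_wpM2l _ H) _ => //.
by rewrite mulrCA; nra.
Qed.

Lemma holo_pfun a : entire a -> holo (pfun a) (pfun (pderiv a)).
Proof.
move=> ea r0; pose r := Num.max 1 r0.
have r1 : 1 <= r by rewrite le_max lexx.
(* The radius [4 * r] absorbs the factor k^2 of [pow_taylor], as k^2 <= 4^k. *)
have [B B0 HB] := entire_r (4 * r) ea.
exists (2 * B) => x h xr0 xhr0.
have xr : normc x <= r by rewrite le_max xr0 orbT.
have xhr : normc (x + h) <= r by rewrite le_max xhr0 orbT.
have cv := ccvgD (ccvgD (ccvg_shift 1 (pfunP (x + h) ea)) (ccvgN (ccvg_shift 1 (pfunP x ea))))
   (ccvgN (ccvgZ h (pfunP x (entire_pderiv ea)))).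
apply: (ccvg_le (N := 0%N) cv) => n _.
have -> : psum a (x + h) (n + 1) - psum a x (n + 1) - h * psum (pderiv a) x n =
  \sum_(k < n.+1) a k * ((x + h) ^+ k - x ^+ k - k%:R * h * x ^+ k.-1).
  rewrite /psum addn1 [in RHS]big_ord_recl !big_ord_recl /= !expr0.
  rewrite mulr_sumr.
  have -> : a 0 * (1 - 1 - 0 * h * 1) = 0 :> R[i] by ring.
  rewrite add0r.
  rewrite [a 0 * 1 + _]addrC addrKA -!sumrB; apply: eq_bigr => k _.
  by rewrite /pderiv /bump /= add1n; ring.
apply: le_trans (_ : \sum_(0 <= k < 0 + n.+1) (B * 2 ^- k * normc h ^+ 2) <= _).
  rewrite add0n big_mkord.
  elim/big_ind2: _ => [|? ? ? ? A1 A2|k _]; first by rewrite normc0.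
    by apply: le_trans (le_normcD _ _) _; exact: lerD.
  rewrite normcM; apply: le_trans (ler_wpM2l (normc_ge0 _) (pow_taylor k r1 xr xhr)) _.
  rewrite [_ * (_ * _)]mulrA; apply: ler_wpM2r; first exact: sqr_ge0.
  apply: le_trans (HB k); rewrite exprMn; apply: ler_wpM2l; first exact: normc_ge0.
  apply: ler_wpM2r; first by apply: exprn_ge0; lra.
  rewrite -natrX -(natrX _ 4) ler_nat (_ : 4 = 2 ^ 2)%N // -expnM mulnC expnM leq_sqr.
  exact/ltnW/ltn_expl.
rewrite -mulr_suml; apply: ler_wpM2r; first exact: sqr_ge0.
rewrite -mulr_sumr mulrC; apply: ler_wpM2r => //.
by apply: le_trans (geo_sum 0 n.+1) _; rewrite expr0 invr1 mulr1.
Qed.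

End entire_functions.

(** * The equation y'' = (x^3 - E) y *)

Section cubic_equation.
Variable R : realType.
Implicit Types (x z h E : R[i]) (c : nat -> R[i]).

(** Taylor coefficients at 0 of the solution with value [a0] and slope [a1]: n (n - 1) a_n = a_(n-5)
    - E a_(n-2). The recursion reaches back five places, hence five initial cases. *)
Fixpoint ccoef (a0 a1 E : R[i]) n : R[i] := match n with
  | 0 => a0 | 1 => a1 | 2 => - E * a0 / 2 | 3 => - E * a1 / 6
  | 4 => - E * (- E * a0 / 2) / 12
  | S (S ((S (S (S m))) as k)) =>
     (ccoef a0 a1 E m - E * ccoef a0 a1 E k) / (n%:R * n.-1%:R)
  end.

Lemma ccoef_rec a0 a1 E m : m.+4.+1%:R * m.+4%:R * ccoef a0 a1 E m.+4.+1 =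
  ccoef a0 a1 E m - E * ccoef a0 a1 E m.+3.
Proof. by rewrite /= mulrC divfK // mulf_neq0 // pnatr_eq0. Qed.

Lemma ccoef_rec4 a0 a1 E m : (m < 3)%N -> m.+2%:R * m.+1%:R * ccoef a0 a1 E m.+2 =
  - E * ccoef a0 a1 E m.
Proof. by case: m => [|[|[|]]] //= _; field. Qed.

(** After weighting by r^n the recursion costs at most the constant [M] and divides by n (n - 1),
    which exceeds [M] from some index on; so no later weighted coefficient exceeds the sum [B] of
    the first ones. *)
Lemma ccoef_entire a0 a1 E : entire (ccoef a0 a1 E).
Proof.
move=> r r1; have r0 : 0 <= r by lra.
set a := ccoef a0 a1 E; set M := r ^+ 5 + normc E * r ^+ 2.
have M0 : 0 <= M by rewrite addr_ge0 ?mulr_ge0 ?normc_ge0 ?exprn_ge0.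
have [N HN] : exists N : nat, M <= N%:R.
  by exists (Num.truncn M).+1; apply: ltW; exact: truncnS_gt.
pose b n := normc (a n) * r ^+ n.
have b0 n : 0 <= b n by rewrite mulr_ge0 ?normc_ge0 ?exprn_ge0.
exists (\sum_(k < N + 5) b k).
set B := \sum_(k < _) _.
have B0 : 0 <= B by exact: sumr_ge0.
apply: (@ltn_ind (fun n => b n <= B)) => n ih.
case: (ltnP n (N + 5)) => nN.
  by rewrite /B (bigD1 (Ordinal nN)) //= lerDl sumr_ge0.
have [m nm] : exists m, n = (m + 5)%N.
  by exists (n - 5)%N; rewrite subnK // (leq_trans _ nN) // leq_addl.
have Nm : (N <= m)%N by rewrite -(leq_add2r 5) -nm.
rewrite nm !addnS addn0 in ih *.
have pos : 0 < m.+4.+1%:R * m.+4%:R :> R by rewrite mulr_gt0.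
rewrite -(ler_pM2l pos) /b mulrA.
have -> : m.+4.+1%:R * m.+4%:R * normc (a m.+4.+1) = normc (a m - E * a m.+3).
  by rewrite -ccoef_rec !normcM !normc_nat.
have A : normc (a m - E * a m.+3) * r ^+ m.+4.+1 <= r ^+ 5 * b m + normc E * r ^+ 2 * b m.+3.
  apply: le_trans (ler_wpM2r (exprn_ge0 _ r0) (normcB _ _)) _.
  by rewrite mulrDl normcM /b !exprS expr0; set q := r ^+ m; lra.
apply: le_trans A _.
apply: le_trans (_ : M * B <= _).
  rewrite /M mulrDl; apply: lerD; apply: ler_wpM2l; rewrite ?mulr_ge0 ?normc_ge0 ?exprn_ge0 //.
    by apply: ih; rewrite ltnS; do 4! apply: leqW.
  by apply: ih; rewrite ltnS; do 1! apply: leqW.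
apply: ler_wpM2r => //; apply: le_trans HN _.
rewrite -natrM ler_nat; apply: leq_trans Nm _.
by apply: leq_trans (leq_pmulr _ _); rewrite // ; do 4! apply: leqW.
Qed.

Definition cubs a0 a1 E := pfun (ccoef a0 a1 E).
Definition cubs' a0 a1 E := pfun (pderiv (ccoef a0 a1 E)).

Lemma pfun_at0 c : entire c -> pfun c 0 = c 0.
Proof.
move=> ea; apply: (ccvg_uniq (u := fun n => psum c 0 (n + 1))).
  exact: ccvg_shift (pfunP 0 ea).
move=> e e0; exists 0%N => n _.
rewrite /psum addn1 big_ord_recl big1 ?expr0 ?mulr1 ?addr0 ?subrr ?normc0 ?ltW //.
by move=> k _; rewrite /= expr0n /= mulr0.
Qed.

Lemma cubs_ode a0 a1 E x : pfun (pderiv (pderiv (ccoef a0 a1 E))) x =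
  (x ^+ 3 - E) * cubs a0 a1 E x.
Proof.
set a := ccoef a0 a1 E; have ea : entire a by exact: ccoef_entire.
have ed := entire_pderiv (entire_pderiv ea).
apply: (ccvg_uniq (ccvg_shift 3 (pfunP x ed))).
rewrite mulrBl.
have := ccvgD (ccvgZ (x ^+ 3) (pfunP x ea)) (ccvgN (ccvgZ E (ccvg_shift 3 (pfunP x ea)))).
(* Partial sums match exactly when the second derivative and the term in [E] are summed to order n +
   3 and the term in x^3 to order n; the first three coefficients have no contribution from x^3. *)
apply: ccvg_ext => n; elim: n => [|n ih].
  rewrite /psum big_ord0 !add0n !big_ord_recr !big_ord0 /=.
  have := @ccoef_rec4 a0 a1 E 0 isT; have := @ccoef_rec4 a0 a1 E 1 isT.
  have := @ccoef_rec4 a0 a1 E 2 isT; rewrite -/a /pderiv => r2 r1 r0.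
  have -> : 1%:R * (2%:R * a 2) = - E * a 0 by rewrite -r0; ring.
  have -> : 2%:R * (3%:R * a 3) = - E * a 1 by rewrite -r1; ring.
  have -> : 3%:R * (4%:R * a 4) = - E * a 2 by rewrite -r2; ring.
  by ring.
have P c k : psum c x k.+1 = psum c x k + c k * x ^+ k by rewrite /psum big_ord_recr.
rewrite addSn !P -ih /pderiv -/(pderiv _).
have -> : (n + 3).+1%:R * ((n + 3).+2%:R * a (n + 3).+2) = a n - E * a (n + 3)%N.
  by rewrite !addn3 /a -(ccoef_rec a0 a1 E n); ring.
by rewrite exprD; ring.
Qed.

Lemma holo_ext (f f' g' : R[i] -> R[i]) : (forall x, f' x = g' x) -> holo f f' -> holo f g'.
Proof. by move=> /funext ->. Qed.

Definition csol E (y y1 : R[i] -> R[i]) :=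
  holo y y1 /\ holo y1 (fun x => (x ^+ 3 - E) * y x).

Lemma holoZ (c : R[i]) (f f' : R[i] -> R[i]) : holo f f' -> holo (fun x => c * f x) (fun x => c * f' x).
Proof.
move=> hf r; have [M HM] := hf r; exists (normc c * M) => x h xr xhr.
have -> : c * f (x + h) - c * f x - h * (c * f' x) = c * (f (x + h) - f x - h * f' x) by ring.
by rewrite normcM -mulrA; apply: ler_wpM2l; [exact: normc_ge0|exact: HM].
Qed.

Lemma holoD (f f' g g' : R[i] -> R[i]) : holo f f' -> holo g g' ->
  holo (fun x => f x + g x) (fun x => f' x + g' x).
Proof.
move=> hf hg r; have [M HM] := hf r; have [N HN] := hg r; exists (M + N) => x h xr xhr.
have -> : f (x + h) + g (x + h) - (f x + g x) - h * (f' x + g' x) =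
  (f (x + h) - f x - h * f' x) + (g (x + h) - g x - h * g' x) by ring.
by rewrite mulrDl; apply: le_trans (le_normcD _ _) _; apply: lerD; [exact: HM|exact: HN].
Qed.

Lemma holo_scale (c : R[i]) (f f' : R[i] -> R[i]) : holo f f' ->
  holo (fun x => f (c * x)) (fun x => c * f' (c * x)).
Proof.
move=> hf r; have [M HM] := hf (normc c * r); exists (M * normc c ^+ 2) => x h xr xhr.
have -> : f (c * (x + h)) - f (c * x) - h * (c * f' (c * x)) =
   f (c * x + c * h) - f (c * x) - c * h * f' (c * x) by rewrite mulrDr; ring.
have -> : M * normc c ^+ 2 * normc h ^+ 2 = M * normc (c * h) ^+ 2 by rewrite normcM; ring.
apply: HM; rewrite -?mulrDr normcM.
  by apply: ler_wpM2l => //; exact: normc_ge0.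
by apply: ler_wpM2l => //; exact: normc_ge0.
Qed.

Lemma csol_lin E a b y y1 u u1 : csol E y y1 -> csol E u u1 ->
  csol E (fun x => a * y x + b * u x) (fun x => a * y1 x + b * u1 x).
Proof.
move=> [h1 h2] [h3 h4]; split; first by apply: holoD; exact: holoZ.
apply: holo_ext (holoD (holoZ a h2) (holoZ b h4)) => x; ring.
Qed.

(* The equation is invariant under [x -> l x], [E -> E / l ^ 2] for a fifth root of unity [l]. *)
Lemma csol_rot E l y y1 : l ^+ 5 = 1 -> csol E y y1 ->
  csol (l ^+ 2 * E) (fun x => y (l * x)) (fun x => l * y1 (l * x)).
Proof.
move=> l5 [h1 h2]; split; first exact: holo_scale.
apply: holo_ext (holoZ l (holo_scale l h2)) => x.
have -> : l * (l * (((l * x) ^+ 3 - E) * y (l * x))) =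
  (l ^+ 5 * x ^+ 3 - l ^+ 2 * E) * y (l * x) by ring.
by rewrite l5 mul1r.
Qed.

Definition cosol E := cubs 1 0 E.
Definition cosol1 E := cubs' 1 0 E.
Definition sisol E := cubs 0 1 E.
Definition sisol1 E := cubs' 0 1 E.

Lemma csol_cubs a0 a1 E : csol E (cubs a0 a1 E) (cubs' a0 a1 E).
Proof.
have ea := ccoef_entire a0 a1 E; split; first exact: holo_pfun.
by apply: holo_ext (holo_pfun (entire_pderiv ea)) => x; exact: cubs_ode.
Qed.

Lemma csol_cosol E : csol E (cosol E) (cosol1 E). Proof. exact: csol_cubs. Qed.
Lemma csol_sisol E : csol E (sisol E) (sisol1 E). Proof. exact: csol_cubs. Qed.

Lemma cubs0 a0 a1 E : cubs a0 a1 E 0 = a0.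
Proof. by rewrite /cubs pfun_at0 //; exact: ccoef_entire. Qed.
Lemma cubs'0 a0 a1 E : cubs' a0 a1 E 0 = a1.
Proof.
rewrite /cubs' pfun_at0 //; last exact/entire_pderiv/ccoef_entire.
by rewrite /pderiv /= mul1r.
Qed.

Lemma cosol_0 E : cosol E 0 = 1. Proof. exact: cubs0. Qed.
Lemma cosol1_0 E : cosol1 E 0 = 0. Proof. exact: cubs'0. Qed.
Lemma sisol_0 E : sisol E 0 = 0. Proof. exact: cubs0. Qed.
Lemma sisol1_0 E : sisol1 E 0 = 1. Proof. exact: cubs'0. Qed.

Lemma ccvgJ (u : nat -> R[i]) l : ccvg u l -> ccvg (fun n => (cj (u n))) (cj l).
Proof. by move=> ul e /ul [N HN]; exists N => n /HN; rewrite -cjB normcJ'. Qed.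

Lemma pfunJ c x : entire c -> pfun (fun n => (cj (c n))) (cj x) = (cj (pfun c x)).
Proof.
move=> ec; have ec' : entire (fun n => (cj (c n))).
  by move=> r /ec [B HB]; exists B => n; rewrite normcJ'.
apply: (ccvg_uniq (pfunP _ ec')); apply: ccvg_ext (ccvgJ (pfunP x ec)) => n.
by rewrite /psum (rmorph_sum conjc); apply: eq_bigr => k _;
  rewrite -cjX -cjM.
Qed.

Lemma ccoefJ a0 a1 E n : (cj (ccoef a0 a1 E n)) = ccoef (cj a0) (cj a1) (cj E) n.
Proof.
have H (w : R[i]) k : (cj (- E * w / k%:R)) = - (cj E) * (cj w) / k%:R.
  by rewrite !cjE.
elim/ltn_ind: n => -[|[|[|[|[|m]]]]] ih //; try exact: H.
  by apply: etrans (H _ _) _; congr (_ * _ / _); exact: H.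
have nz : m.+4.+1%:R * m.+4%:R != 0 :> R[i] by rewrite mulf_neq0 // pnatr_eq0.
apply: (mulfI nz); rewrite ccoef_rec -(ih m) ?ltnS; last by do 4! apply: leqW.
rewrite -(ih m.+3) ?ltnS; last by do 1! apply: leqW.
have := congr1 conjc (ccoef_rec a0 a1 E m).
by rewrite !cjE.
Qed.

Lemma cubsJ a0 a1 E x : cubs (cj a0) (cj a1) (cj E) (cj x) = (cj (cubs a0 a1 E x)).
Proof.
rewrite /cubs -pfunJ; last exact: ccoef_entire.
by congr pfun; apply/funext => n; rewrite ccoefJ.
Qed.
Lemma cubs'J a0 a1 E x : cubs' (cj a0) (cj a1) (cj E) (cj x) = (cj (cubs' a0 a1 E x)).
Proof.
rewrite /cubs' -pfunJ; last exact/entire_pderiv/ccoef_entire.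
by congr pfun; apply/funext => n; rewrite /pderiv cjM cjn ccoefJ.
Qed.

Lemma cosolJ E x : cosol (cj E) (cj x) = (cj (cosol E x)).
Proof. by rewrite /cosol -cubsJ cj0 cj1. Qed.
Lemma cosol1J E x : cosol1 (cj E) (cj x) = (cj (cosol1 E x)).
Proof. by rewrite /cosol1 -cubs'J cj0 cj1. Qed.
Lemma sisolJ E x : sisol (cj E) (cj x) = (cj (sisol E x)).
Proof. by rewrite /sisol -cubsJ cj0 cj1. Qed.
Lemma sisol1J E x : sisol1 (cj E) (cj x) = (cj (sisol1 E x)).
Proof. by rewrite /sisol1 -cubs'J cj0 cj1. Qed.

Lemma csol_curve E y y1 (g : R -> R[i]) t d : csol E y y1 -> cder g t d ->
  cder (fun s => y (g s)) t (y1 (g t) * d) /\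
  cder (fun s => y1 (g s)) t ((g t ^+ 3 - E) * y (g t) * d).
Proof. by move=> [h1 h2] dg; split; [exact: cder_holo h1 dg|exact: cder_holo h2 dg]. Qed.

Definition wr (y y1 u u1 : R[i] -> R[i]) x := y x * u1 x - y1 x * u x.

Lemma wr_cst E y y1 u u1 x x' : csol E y y1 -> csol E u u1 ->
  wr y y1 u u1 x = wr y y1 u u1 x'.
Proof.
move=> sy su; pose g (t : R) := x' + t%:C * (x - x').
have E1 : g 1 = x by rewrite /g cC1; ring.
have E0 : g 0 = x' by rewrite /g cC0; ring.
rewrite -E1 -E0.
apply: (@cder0_cst _ (fun t => wr y y1 u u1 (g t))) => // t _.
have dg : cder g t (x - x').
  apply: cder_eq; first by rewrite /g; der.
  by rewrite /=; ring.
have [d1 d2] := csol_curve sy dg; have [d3 d4] := csol_curve su dg.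
rewrite /wr; apply: cder_eq; first by der.
by rewrite /=; ring.
Qed.

Lemma wr_cosi E x : cosol E x * sisol1 E x - cosol1 E x * sisol E x = 1.
Proof.
rewrite -/(wr _ _ _ _ x) (wr_cst x 0 (csol_cosol E) (csol_sisol E)) /wr.
by rewrite cosol_0 cosol1_0 sisol_0 sisol1_0; ring.
Qed.

End cubic_equation.

(** * The subdominant solution *)

Section wkb.
Variable R : realType.
Implicit Types (z v E : R[i]) (y : R[i] -> R[i]).

(** The weight [k] is free: with k^2 of the order of M the exponent is the length times the square
    root of M, as in WKB, instead of the length times M. *)
Lemma segment_gronwall E y y1 (x0 x1 : R[i]) (M k : R) : csol E y y1 -> 0 < k ->
  (forall s : R, 0 <= s <= 1 -> normc ((x0 + s%:C * (x1 - x0)) ^+ 3 - E) <= M) ->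
  sqn (y1 x1) + k ^+ 2 * sqn (y x1) <=
  (sqn (y1 x0) + k ^+ 2 * sqn (y x0)) * expR (normc (x1 - x0) * (M + k ^+ 2) / k).
Proof.
move=> sy k0 HM; pose g (s : R) := x0 + s%:C * (x1 - x0).
have g0 : g 0 = x0 by rewrite /g cC0; ring.
have g1 : g 1 = x1 by rewrite /g cC1; ring.
pose K := normc (x1 - x0) * (M + k ^+ 2) / k.
have dg t : cder g t (x1 - x0).
  apply: cder_eq; first (rewrite /g; der).
  by rewrite /=; ring.
have kn0 : k != 0 by rewrite gt_eqF.
have := @gronwall _ (fun s => sqn (y1 (g s)) + k ^+ 2 * sqn (y (g s)))
  (fun s => K * s)
  (fun s => 2 * dotc (y1 (g s)) ((g s ^+ 3 - E) * y (g s) * (x1 - x0)) +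
     k ^+ 2 * (2 * dotc (y (g s)) (y1 (g s) * (x1 - x0)))) (fun=> K) 0 1 ler01.
rewrite mulr0 mulr1 subr0 g0 g1; apply => s s01.
- have [d1 d2] := csol_curve sy (dg s).
  by apply: rder_eq; first (der); rewrite /=; ring.
- by apply: rder_eq; first der; rewrite /=; ring.
- have A := dotc_le (y1 (g s)) ((g s ^+ 3 - E) * y (g s) * (x1 - x0)).
  have B := dotc_le (y (g s)) (y1 (g s) * (x1 - x0)).
  rewrite !normcM in A B.
  have C := HM s s01; rewrite -/(g s) in C.
  have n0 := normc_ge0 (x1 - x0); have n1 := normc_ge0 (y1 (g s)).
  have n2 := normc_ge0 (y (g s)).
  rewrite -!normc_sqr.
  set d := normc (x1 - x0) in A B n0 *; set p := normc (y1 (g s)) in A B n1 *.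
  set q := normc (y (g s)) in A B n2 *; set c := normc (g s ^+ 3 - E) in A C.
  have D : 2 * (p * q) * k <= p ^+ 2 + k ^+ 2 * q ^+ 2.
    by have := sqr_ge0 (p - k * q); nra.
  have M0 : 0 <= M by apply: le_trans C; exact: normc_ge0.
  apply: le_trans (_ : 2 * (p * q) * (d * (M + k ^+ 2)) <= _).
    have : p * (c * q * d) <= p * q * d * M.
      have -> : p * q * d * M = p * q * d * c + p * q * d * (M - c) by ring.
      have : 0 <= p * q * d * (M - c) by rewrite !mulr_ge0 // subr_ge0.
      by move=> ?; nra.
    by move=> ?; have : k ^+ 2 * dotc (y (g s)) (y1 (g s) * (x1 - x0)) <= k ^+ 2 * (q * (p * d));
      [apply: ler_wpM2l => //; exact: sqr_ge0|nra].
  have -> : 2 * (p * q) * (d * (M + k ^+ 2)) = 2 * (p * q) * k * (d * (M + k ^+ 2) / k) by field.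
  rewrite mulrC /K -/d; apply: ler_wpM2l => //.
  by rewrite divr_ge0 ?(ltW k0) // mulr_ge0 // addr_ge0 // sqr_ge0.
Qed.

(** The WKB function x^(-3/4) exp (- (2/5) x^(5/2)) at x = exp (2 v). The logarithmic variable turns
    fractional powers into powers of [cexp v] and fixes their branch. *)
Definition am v : R[i] := cexp (- (3 / 2) * v - 2 / 5 * cexp v ^+ 5).
(** Coordinates in the basis x^(-3/4) exp (+- (2/5) x^(5/2)). [Pw] is the coefficient of the growing
    function, which is half the Wronskian of [am] and y; [Qw] is the other coefficient times
    [am v ^+ 2 * cexp v ^+ 3], a factor that makes it comparable with [Pw]. *)
Definition Pw y y1 v : R[i] :=
  1 / 2 * am v * (y1 (cexp v ^+ 2) + (3 / 4 / cexp v ^+ 2 + cexp v ^+ 3) * y (cexp v ^+ 2)).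
Definition Qw y y1 v : R[i] :=
  1 / 2 * am v * ((cexp v ^+ 3 - 3 / 4 / cexp v ^+ 2) * y (cexp v ^+ 2) - y1 (cexp v ^+ 2)).
(** The potential that [am] solves exactly, x^3 + (21/16) / x^2, minus x^3 - E. *)
Definition Vw E v : R[i] := E + 21 / 16 / cexp v ^+ 4.

Lemma PQw y y1 v : Pw y y1 v + Qw y y1 v = am v * cexp v ^+ 3 * y (cexp v ^+ 2).
Proof. by rewrite /Pw /Qw; field; rewrite cexp_neq0. Qed.

(** The coupling decays like exp (- Re v), so it is integrable along rays, and the term with exp (5
    v) damps [Qw] wherever Re exp (5 v) >= 0. *)
Lemma cder_PQ E y y1 (g : R -> R[i]) t d : csol E y y1 -> cder g t d ->
  let PQ := Pw y y1 (g t) + Qw y y1 (g t) in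
  cder (fun s => Pw y y1 (g s)) t (- (Vw E (g t) / cexp (g t) * PQ) * d) /\
  cder (fun s => Qw y y1 (g s)) t
    ((Vw E (g t) / cexp (g t) * PQ - 4 * cexp (g t) ^+ 5 * Qw y y1 (g t)) * d).
Proof.
move=> sy dg PQ.
have en0 := cexp_neq0 (g t).
have de := cder_cexp dg.
have [d1 d2] := csol_curve sy (cderX 2 de).
have da : cder (fun s => am (g s)) t (am (g t) * (- (3 / 2) - 2 * cexp (g t) ^+ 5) * d).
  apply: cder_eq; first (rewrite /am; der).
  by rewrite /= -/(am (g t)); field.
have dV n : cder (fun s => (cexp (g s) ^+ n)^-1) t (- (n%:R) / cexp (g t) ^+ n * d).
  apply: (@cder_ext _ (fun s => cexp (- n%:R * g s))) => [s|].
    by rewrite mulNr cexpN cexpMn.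
  apply: cder_eq; first der.
  by rewrite !mulNr cexpN cexpMn; field; rewrite expf_neq0.
have dV2 := dV 2.
rewrite /PQ PQw; split.
  apply: cder_eq; first (rewrite /Pw; der).
  by rewrite /Vw /=; field.
apply: cder_eq; first (rewrite /Qw; der).
by rewrite /Vw /Qw /=; field.
Qed.

Lemma dotcDr (a b c : R[i]) : dotc a (b + c) = dotc a b + dotc a c.
Proof. by rewrite /dotc !ReImE; ring. Qed.
Lemma dotcNr (a b : R[i]) : dotc a (- b) = - dotc a b.
Proof. by rewrite /dotc !ReImE; ring. Qed.
Lemma dotc_mull (a b : R[i]) : dotc b (a * b) = Re a * sqn b.
Proof. by rewrite /dotc /sqn !ReImE; ring. Qed.

Definition vv (s t : R) : R[i] := s%:C + 'i%C * t%:C.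
Definition nn y y1 v : R := sqn (Pw y y1 v) + sqn (Qw y y1 v).
Definition kE E : R := normc E + 2.
(** As x = exp (2 v) has argument 2 t, this is |arg x| <= pi / 5, where Re (x^(5/2)) >= 0. *)
Definition sector (t : R) := `|t| <= pi / 10.

Lemma kE_ge E : 2 <= kE E. Proof. by rewrite /kE lerDr normc_ge0. Qed.
Lemma normc_vv s t : normc (cexp (vv s t)) = expR s.
Proof. by rewrite normc_cexp /vv !ReImE; congr expR; ring. Qed.
Lemma Re5_vv s t : Re (cexp (vv s t) ^+ 5) = expR (5 * s) * cos (5 * t).
Proof. by rewrite -cexpMn Re_cexp /vv !ReImE; congr (expR _ * cos _); ring. Qed.

Lemma Re5_ge0 s t : sector t -> 0 <= Re (cexp (vv s t) ^+ 5).
Proof.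
rewrite /sector ler_norml => /andP[t1 t2]; rewrite Re5_vv mulr_ge0 ?expR_ge0 //.
by apply: cos_ge0_pihalf; apply/andP; split; lra.
Qed.

Lemma Vw_le E s t : 0 <= s -> normc (Vw E (vv s t) / cexp (vv s t)) <= kE E * expR (- s).
Proof.
move=> s0; rewrite normcM normcV normc_vv -expRN; apply: ler_wpM2r; first exact: expR_ge0.
apply: le_trans (le_normcD _ _) _; rewrite lerD2l normcM normcV normcX normc_vv.
have -> : normc (21 / 16 : R[i]) = 21 / 16 by rewrite normcM normcV !normc_nat.
have e1 : 1 <= expR s ^+ 4 by apply: exprn_ege1; rewrite -expR0 ler_expR.
by rewrite ler_pdivrMr; [lra|lra].
Qed.

Lemma cder_vv s t : cder (fun s => vv s t) s 1.
Proof. by apply: cder_eq; first (rewrite /vv; der); rewrite /=; ring. Qed.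
Lemma cder_vvt s t : cder (fun t => vv s t) t 'i%C.
Proof. by apply: cder_eq; first (rewrite /vv; der); rewrite /=; ring. Qed.

Lemma nn_ge0 y y1 v : 0 <= nn y y1 v. Proof. by rewrite addr_ge0 ?sqn_ge0. Qed.

Section ray.
Variables (E : R[i]) (y y1 : R[i] -> R[i]) (t : R).
Hypotheses (sy : csol E y y1) (ht : sector t).

Let P s := Pw y y1 (vv s t).
Let Q s := Qw y y1 (vv s t).
Let w s := Vw E (vv s t) / cexp (vv s t) * (P s + Q s).
Let n' s : R := 2 * dotc (P s) (- w s) + 2 * dotc (Q s) (w s - 4 * cexp (vv s t) ^+ 5 * Q s).

Lemma rder_nn s : rder (fun s => nn y y1 (vv s t)) s (n' s).
Proof.
have [dP dQ] := cder_PQ sy (cder_vv s t).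
rewrite /nn; apply: rder_eq; first der.
by rewrite /n' /w /P /Q /=; congr (2 * dotc _ _ + 2 * dotc _ _); ring.
Qed.

Lemma nn_der_le s : 0 <= s -> 
  `|n' s + 8 * Re (cexp (vv s t) ^+ 5) * sqn (Q s)| <= 4 * (kE E * expR (- s)) * nn y y1 (vv s t).
Proof.
move=> s0; rewrite /n' !dotcDr !dotcNr.
have -> : dotc (Q s) (4 * cexp (vv s t) ^+ 5 * Q s) = 4 * Re (cexp (vv s t) ^+ 5) * sqn (Q s).
  by rewrite dotc_mull; congr (_ * _); rewrite !ReImE; ring.
have -> (a b c d : R) : 2 * - a + 2 * (b - 4 * c * d) + 8 * c * d = 2 * (b - a) by ring.
have A := dotc_norm (P s) (w s); have B := dotc_norm (Q s) (w s).
have C : normc (w s) <= kE E * expR (- s) * (normc (P s) + normc (Q s)).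
  rewrite /w normcM; apply: ler_pM; rewrite ?normc_ge0 ?le_normcD //; exact: Vw_le.
rewrite /nn -!normc_sqr -/(P s) -/(Q s).
have p0 := normc_ge0 (P s); have q0 := normc_ge0 (Q s).
have k0 : 0 <= kE E * expR (- s) by rewrite mulr_ge0 ?expR_ge0 //; have := kE_ge E; lra.
set k := kE E * _ in C k0 *; set p := normc (P s) in A C p0 *; set q := normc (Q s) in B C q0 *.
rewrite normrM [`|2|]ger0_norm //.
apply: le_trans (_ : 2 * ((q + p) * normc (w s)) <= _).
  by apply: ler_wpM2l => //; apply: le_trans (ler_normB _ _) _; rewrite mulrDl lerD.
apply: le_trans (_ : 2 * ((q + p) * (k * (p + q))) <= _).
  by apply: ler_wpM2l => //; apply: ler_wpM2l => //; rewrite addr_ge0.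
have : 0 <= k * (p - q) ^+ 2 by rewrite mulr_ge0 ?sqr_ge0.
by nra.
Qed.

Lemma rder_k s : rder (fun s => - (4 * kE E) * expR (- s)) s (4 * (kE E * expR (- s))).
Proof. by apply: rder_eq; first der; rewrite /=; ring. Qed.

(** Forwards, the damping of [Qw] has the favourable sign and is dropped. *)
Lemma nn_fwd (s0 s : R) : 0 <= s0 -> s0 <= s ->
  nn y y1 (vv s t) <= nn y y1 (vv s0 t) * expR (4 * kE E * expR (- s0)).
Proof.
move=> s00 s0s; have k2 := kE_ge E.
have := @gronwall _ (fun s => nn y y1 (vv s t)) _ n' _ s0 s s0s
  (fun x _ => rder_nn x) (fun x _ => rder_k x).
move=> H; apply: le_trans (H _) _ => [x /andP[s0x _]|].
  have x0 := le_trans s00 s0x.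
  have /ler_normlP[_] := nn_der_le x0.
  have : 0 <= 8 * Re (cexp (vv x t) ^+ 5) * sqn (Q x).
    by rewrite mulr_ge0 ?sqn_ge0 // mulr_ge0 // Re5_ge0.
  lra.
apply: ler_wpM2l; first exact: nn_ge0.
rewrite ler_expR; have := expR_ge0 (- s); nra.
Qed.

(** The squared modulus of the quotient of the two WKB exponentials, growing over decaying. With
    this weight the system propagates backwards too with a controlled loss, the favourable term
    being now the one in [Pw]. *)
Definition om (s t : R) : R := expR (8 / 5 * Re (cexp (vv s t) ^+ 5)).

Lemma rder_om s : rder (om^~ t) s (8 * Re (cexp (vv s t) ^+ 5) * om s t).
Proof.
have dv := cder_vv s t.
rewrite /om; apply: rder_eq; first der.
set e := cexp _; rewrite /= -/e.
have -> : 5 * e ^+ 4 * (e * 1) = 5%:R * e ^+ 5 by ring.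
by rewrite (ReM 5%:R) Ren Imn; field.
Qed.

Lemma nn_back (s0 s : R) : 0 <= s0 -> s0 <= s ->
  om s0 t * nn y y1 (vv s0 t) <= om s t * nn y y1 (vv s t) * expR (4 * kE E * expR (- s0)).
Proof.
move=> s00 s0s; have k2 := kE_ge E.
have := @gronwall_back _ (fun s => om s t * nn y y1 (vv s t)) _
  (fun s => 8 * Re (cexp (vv s t) ^+ 5) * om s t * nn y y1 (vv s t) + om s t * n' s) _ s0 s s0s
  (fun x _ => rderM (rder_om x) (rder_nn x)) (fun x _ => rder_k x).
move=> H; apply: le_trans (H _) _ => [x /andP[s0x _]|].
  have x0 := le_trans s00 s0x.
  have o0 := expR_ge0 (8 / 5 * Re (cexp (vv x t) ^+ 5)); rewrite -/(om x t) in o0.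
  have /ler_normlP[H1 _] := nn_der_le x0.
  have r0 := Re5_ge0 x ht; have p0 := sqn_ge0 (P x).
  set r := Re _ in H1 r0 *; rewrite /nn -/(P x) -/(Q x) in H1 *.
  set kk := kE E * _ in H1 *; set pp := sqn (P x) in H1 p0 *; set qq := sqn (Q x) in H1 *.
  have : 0 <= om x t * (r * pp) by rewrite !mulr_ge0.
  have : 0 <= om x t * (n' x + 8 * r * qq + 4 * kk * (pp + qq)).
    by rewrite mulr_ge0 //; lra.
  by nra.
apply: ler_wpM2l; first by rewrite mulr_ge0 ?nn_ge0 ?expR_ge0.
rewrite ler_expR; have := expR_ge0 (- s); nra.
Qed.

Lemma PQ_le (v : R[i]) (M : R) : 0 <= M -> nn y y1 v <= M ^+ 2 -> normc (Pw y y1 v + Qw y y1 v) <= 2 * M.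
Proof.
move=> M0 H; apply: le_trans (le_normcD _ _) _; rewrite mulr2n mulrDl !mul1r.
have a : normc (Pw y y1 v) <= M.
  rewrite -(@ler_pXn2r _ 2) ?nnegrE ?normc_ge0 // normc_sqr; apply: le_trans H.
  by rewrite lerDl sqn_ge0.
have b : normc (Qw y y1 v) <= M.
  rewrite -(@ler_pXn2r _ 2) ?nnegrE ?normc_ge0 // normc_sqr; apply: le_trans H.
  by rewrite lerDr sqn_ge0.
by apply: lerD.
Qed.

Lemma P_dist (s0 s M : R) : 0 <= s0 -> s0 <= s -> 0 <= M ->
  (forall x, s0 <= x <= s -> nn y y1 (vv x t) <= M ^+ 2) ->
  normc (P s - P s0) <= 2 * M * kE E * expR (- s0).
Proof.
move=> s00 s0s M0 HM; have k2 := kE_ge E.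
pose c := 2 * M * kE E.
have := @normc_incr_le _ P (fun x => - c * expR (- x)) (fun x => - w x * 1)
  (fun x => c * expR (- x)) s0 s s0s.
move=> H; apply: le_trans (H _ _ _) _ => [x _|x _|x xs|].
- by have [dP _] := cder_PQ sy (cder_vv x t).
- by apply: rder_eq; first der; rewrite /=; ring.
- have x0 : 0 <= x by case/andP: xs => + _; exact: le_trans.
  rewrite mulr1 normcN /w normcM /c.
  have -> : 2 * M * kE E * expR (- x) = kE E * expR (- x) * (2 * M) by ring.
  by apply: ler_pM; rewrite ?normc_ge0 ?Vw_le // PQ_le // HM.
rewrite !mulNr opprK -/c addrC lerBlDr lerDl mulr_ge0 ?expR_ge0 // /c; nra.
Qed.

End ray.

(** An arc at radius exp s contributes O(exp (- s)), so the limit of [Pw] is the same on all rays of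
    the sector. *)
Lemma P_arc E y y1 (s t t' M : R) : csol E y y1 -> 0 <= s -> sector t -> sector t' -> 0 <= M ->
  (forall x, sector x -> nn y y1 (vv s x) <= M ^+ 2) ->
  normc (Pw y y1 (vv s t') - Pw y y1 (vv s t)) <= 2 * M * kE E * pi * expR (- s).
Proof.
move=> sy s0; wlog tt : t t' / t <= t'.
  by move=> H; case: (leP t t') => [|/ltW]; [exact: H|move=> tt ht ht' *; rewrite normcBC; exact: H].
move=> ht ht' M0 HM; have k2 := kE_ge E; pose c := kE E * expR (- s) * (2 * M).
have c0 : 0 <= c by rewrite /c !mulr_ge0 ?expR_ge0 //; lra.
have := @normc_incr_le _ (fun t => Pw y y1 (vv s t)) (fun x => c * x)
  (fun x => - (Vw E (vv s x) / cexp (vv s x) * (Pw y y1 (vv s x) + Qw y y1 (vv s x))) * 'i%C)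
  (fun=> c) t t' tt.
move=> H; apply: le_trans (H _ _ _) _ => [x _|x _|x /andP[tx xt]|].
- by have [dP _] := cder_PQ sy (cder_vvt s x).
- by apply: rder_eq; first der; rewrite /=; ring.
- have hx : sector x.
    by move: ht ht'; rewrite /sector !ler_norml => /andP[? ?] /andP[? ?]; apply/andP; split; lra.
  rewrite normcM normc_i mulr1 normcN normcM /c.
  by apply: ler_pM; rewrite ?normc_ge0 ?Vw_le // (@PQ_le y y1 _ M) // HM.
have -> : 2 * M * kE E * pi * expR (- s) = c * pi by rewrite /c; ring.
rewrite -mulrBr; apply: ler_wpM2l => //.
move: ht ht'; rewrite /sector !ler_norml => /andP[? ?] /andP[? ?]; have := pi_gt0 R; lra.
Qed.

End wkb.

(** * Connection coefficients between 0 and infinity *)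

Section connection.
Variable R : realType.
Implicit Types (z v E : R[i]) (y : R[i] -> R[i]).

Lemma ccvgM (u w : nat -> R[i]) l m : ccvg u l -> ccvg w m -> ccvg (fun n => u n * w n) (l * m).
Proof.
move=> ul wm e e0; pose c := normc l + normc m + 1.
have c0 : 0 < c by have := normc_ge0 l; have := normc_ge0 m; rewrite /c; lra.
have ec : 0 < Num.min 1 (e / c / 2) by rewrite lt_min ltr01 !divr_gt0.
have [N HN] := ul _ ec; have [N' HN'] := wm _ ec.
exists (maxn N N') => n; rewrite geq_max => /andP[/HN + /HN'].
rewrite !le_min => /andP[A1 A2] /andP[B1 B2].
have -> : u n * w n - l * m = (u n - l) * (w n - m) + ((u n - l) * m + l * (w n - m)) by ring.
apply: le_trans (le_normcD _ _) _; apply: le_trans (lerD (lexx _) (le_normcD _ _)) _.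
rewrite !normcM; have ecE : e = 2 * (e / c / 2) * c by field; rewrite gt_eqF.
have := normc_ge0 l; have := normc_ge0 m; have := normc_ge0 (u n - l); have := normc_ge0 (w n - m).
rewrite ecE {2}/c; move: A1 A2 B1 B2; set q := e / _ / _; rewrite /c.
set a := normc (u n - l); set b := normc (w n - m); set p := normc l; set r := normc m.
move=> A1 A2 B1 B2 b0 a0 r0 p0.
have : a * b <= q by apply: le_trans (_ : a * 1 <= _); [exact: ler_wpM2l|rewrite mulr1].
have : a * r <= q * r by exact: ler_wpM2r.
have : p * b <= p * q by exact: ler_wpM2l.
have : 0 <= q by exact: le_trans A2.
by nra.
Qed.

Lemma ccvg_exp (u : nat -> R[i]) l (B : R) : (forall n, normc (u n - l) <= B * expR (- n%:R)) -> ccvg u l.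
Proof.
move=> H e e0; pose N := (Num.truncn (`|B| / e)).+1; exists N => n Nn.
apply: le_trans (H n) _; rewrite expRN ler_pdivrMr ?expR_gt0 //.
apply: le_trans (ler_norm B) _; rewrite -ler_pdivrMl // mulrC.
have : `|B| / e < N%:R by exact: truncnS_gt.
have : (N%:R : R) <= n%:R by rewrite ler_nat.
have := expR_ge1Dx (n%:R : R); lra.
Qed.

Lemma am_le1 s t : 0 <= s -> sector t -> normc (am (vv s t) : R[i]) <= 1.
Proof.
move=> s0 ht; rewrite /am normc_cexp -expR0 ler_expR.
have := Re5_ge0 s ht; rewrite ReB.
have -> : Re (2 / 5 * cexp (vv s t) ^+ 5) = 2 / 5 * Re (cexp (vv s t) ^+ 5).
  have -> : 2 / 5 = (2 / 5 : R)%:C :> R[i] by rewrite cCM cCV !cCn.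
  by rewrite ReM ReC ImC; ring.
have -> : Re (- (3 / 2) * vv s t) = - (3 / 2) * s.
  have -> : - (3 / 2) = (- (3 / 2) : R)%:C :> R[i] by rewrite cCN cCM cCV !cCn.
  by rewrite ReM ReC ImC /vv !ReImE; ring.
by lra.
Qed.

(** Up to |x| = r^2 the equation is integrated directly from 0. The weight k = r^3 fits a potential
    of size r^6, and the exponent r^2 (2 r^6 + |E|) / r^3 is O(r^5) as long as |E| = O(r^6). *)
Lemma nn_start E y y1 (r t : R) : csol E y y1 -> 1 <= r -> sector t ->
  nn y y1 (vv (ln r) t) <=
   8 * (sqn (y1 0) + r ^+ 6 * sqn (y 0)) * expR ((2 * r ^+ 6 + normc E) / r).
Proof.
move=> sy r1 ht; have r0 : 0 < r by lra.
have lr0 : 0 <= ln r by rewrite ln_ge0.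
have er : expR (ln r) = r by rewrite lnK // posrE.
set v := vv _ t; set e := cexp v; pose x := e ^+ 2.
have ne : normc e = r by rewrite /e normc_vv.
have := @segment_gronwall _ E y y1 0 x (r ^+ 6 + normc E) (r ^+ 3) sy (exprn_gt0 3 r0).
rewrite !subr0 => H.
have {}H : sqn (y1 x) + r ^+ 6 * sqn (y x) <=
   (sqn (y1 0) + r ^+ 6 * sqn (y 0)) * expR ((2 * r ^+ 6 + normc E) / r).
  have -> : r ^+ 6 = (r ^+ 3) ^+ 2 by rewrite -exprM.
  apply: le_trans (H _) _ => [s /andP[s0 s1]|].
    rewrite add0r; apply: le_trans (normcB _ _) _; rewrite lerD2r exprMn normcM !normcX normcR ne.
    rewrite ger0_norm // -exprM ler_piMl ?exprn_ge0 ?(ltW r0) //.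
    by apply: exprn_ile1.
  rewrite /x normcX ne; have -> : r ^+ 2 * (r ^+ 6 + normc E + (r ^+ 3) ^+ 2) / r ^+ 3 =
     (2 * (r ^+ 3) ^+ 2 + normc E) / r by field; rewrite gt_eqF.
  by [].
apply: le_trans (_ : 8 * (sqn (y1 x) + r ^+ 6 * sqn (y x)) <= _); last first.
  by rewrite -mulrA; apply: ler_wpM2l.
have am1 := am_le1 lr0 ht; rewrite -/v in am1.
have c1 : normc (3 / 4 / e ^+ 2 : R[i]) <= r ^+ 3.
  rewrite !normcM !normcV normcX ne !normc_nat.
  have : 1 <= r ^+ 3 by exact: exprn_ege1.
  have : (r ^+ 2)^-1 <= 1 by rewrite invf_le1 ?exprn_gt0 // exprn_ege1.
  have : 0 <= (r ^+ 2)^-1 by rewrite invr_ge0 exprn_ge0 // ltW.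
  by lra.
have ne3 : normc (e ^+ 3) = r ^+ 3 by rewrite normcX ne.
have half : normc (1 / 2 * am v) <= 1 / 2.
  rewrite normcM; have -> : normc (1 / 2 : R[i]) = 1 / 2 by rewrite normcM normcV normc1 normc_nat.
  by lra.
have B (p : R[i]) : normc p <= 2 * r ^+ 3 * normc (y x) ->
   forall q, normc q <= normc (y1 x) -> sqn (1 / 2 * am v * (q + p)) <= 4 * (sqn (y1 x) + r ^+ 6 * sqn (y x)).
  move=> Hp q Hq; rewrite -!normc_sqr normcM.
  have -> : r ^+ 6 = (r ^+ 3) ^+ 2 by rewrite -exprM.
  have := le_normcD q p.
  have := normc_ge0 (y x); have := normc_ge0 (y1 x); have := normc_ge0 (q + p).
  have := normc_ge0 (1 / 2 * am v).
  have : 0 <= r ^+ 3 by rewrite exprn_ge0 // ltW.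
  move: half Hp Hq; set h := normc (1 / 2 * _); set a := normc (y1 x); set b := normc (y x).
  set c := normc (q + p); set k := r ^+ 3 => half Hp Hq k0 h0 c0 a0 b0 cc.
  have cab : c <= a + 2 * (k * b) by lra.
  have kb : 0 <= k * b by exact: mulr_ge0.
  have hc : h * c <= 1 / 2 * (a + 2 * (k * b)).
    by apply: ler_pM.
  have hc0 : 0 <= h * c by exact: mulr_ge0.
  have : (h * c) ^+ 2 <= (1 / 2 * (a + 2 * (k * b))) ^+ 2 by rewrite ler_pXn2r // nnegrE //; lra.
  rewrite -[k ^+ 2 * _]exprMn; have := sqr_ge0 (a - k * b); nra.
have y0 := normc_ge0 (y x).
have r3 : 0 <= r ^+ 3 by rewrite exprn_ge0 // ltW.
rewrite (_ : 8 * _ = 4 * (sqn (y1 x) + r ^+ 6 * sqn (y x)) + 4 * (sqn (y1 x) + r ^+ 6 * sqn (y x))); last by ring.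
apply: lerD.
  rewrite /Pw -/e -/x; apply: B => //.
  rewrite normcM; apply: ler_wpM2r => //; apply: le_trans (le_normcD _ _) _; lra.
rewrite /Qw -/e -/x (_ : _ - y1 x = - y1 x + (e ^+ 3 - 3 / 4 / e ^+ 2) * y x); last by ring.
apply: B; last by rewrite normcN.
rewrite normcM; apply: ler_wpM2r => //; apply: le_trans (normcB _ _) _; lra.
Qed.

Lemma nn_all E y y1 (r s t : R) : csol E y y1 -> 1 <= r -> sector t -> ln r <= s ->
  nn y y1 (vv s t) <=
   8 * (sqn (y1 0) + r ^+ 6 * sqn (y 0)) * expR ((2 * r ^+ 6 + 5 * normc E + 8) / r).
Proof.
move=> sy r1 ht rs; have r0 : 0 < r by lra.
have lr0 : 0 <= ln r by rewrite ln_ge0.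
apply: le_trans (nn_fwd sy ht lr0 rs) _.
apply: le_trans (ler_wpM2r (expR_ge0 _) (nn_start sy r1 ht)) _.
have -> : (2 * r ^+ 6 + 5 * normc E + 8) / r =
  (2 * r ^+ 6 + normc E) / r + 4 * kE E * expR (- ln r).
  by rewrite expRN lnK ?posrE // /kE; field; rewrite gt_eqF.
by rewrite expRD mulrA.
Qed.

(** The case r = 1 of [nn_all]. These crude constants give convergence with a rate; the true size of
    the limit is obtained in [conn_le] with a large r. *)
Definition MB E y y1 : R := 3 * (normc (y 0) + normc (y1 0)) * expR (5 * normc E + 10).
Definition CB E y y1 : R := (8 + 4 * pi) * MB E y y1 * kE E.

Lemma MB_ge0 E y y1 : 0 <= MB E y y1.
Proof. by rewrite /MB !mulr_ge0 ?expR_ge0 // addr_ge0 ?normc_ge0. Qed.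

Lemma nn_MB E y y1 (s t : R) : csol E y y1 -> sector t -> 0 <= s ->
  nn y y1 (vv s t) <= MB E y y1 ^+ 2.
Proof.
move=> sy ht s0; apply: le_trans (nn_all sy (lexx 1) ht _) _; first by rewrite ln1.
rewrite !expr1n divr1 mul1r /MB -!normc_sqr.
have := normc_ge0 (y 0); have := normc_ge0 (y1 0).
set a := normc (y 0); set b := normc (y1 0) => b0 a0.
have -> : 2 * 1 + 5 * normc E + 8 = 5 * normc E + 10 by ring.
have : 1 <= expR (5 * normc E + 10).
  by rewrite -[X in X <= _]expR0 ler_expR; have := normc_ge0 E; lra.
set X := expR _ => X1.
have -> : (3 * (a + b) * X) ^+ 2 = (9 * (a + b) ^+ 2 * X) * X by ring.
have h : 8 * (b ^+ 2 + a ^+ 2) <= 9 * (a + b) ^+ 2 by nra.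
apply: le_trans (_ : 9 * (a + b) ^+ 2 * X <= _); first by apply: ler_wpM2r => //; lra.
by rewrite ler_peMr // !mulr_ge0 // ?sqr_ge0 //; lra.
Qed.

(** The limit of [2 * Pw] is the Wronskian of the subdominant solution with y. The estimate is
    uniform in the sector, so any ray may be used to identify [l]. *)
Definition is_conn E y y1 l := forall t s, sector t -> 0 <= s ->
  normc (2 * Pw y y1 (vv s t) - l) <= CB E y y1 * expR (- s).

Lemma conn_exists E y y1 : csol E y y1 -> exists l, is_conn E y y1 l.
Proof.
move=> sy; have M0 := MB_ge0 E y y1; have k2 := kE_ge E.
have sec0 : sector (0 : R) by rewrite /sector normr0 divr_ge0 ?pi_ge0.
have n2 : normc (2 : R[i]) = 2 by exact: normc_nat.
(* The limit is taken on the ray t = 0 over a real parameter, then carried to the other rays by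
   [P_arc]. *)
have [|l Hl] := @clim_exists R _ R (fun s => 2 * Pw y y1 (vv s 0))
  (fun s => 2 * (2 * MB E y y1 * kE E * expR (- s))) 0.
  move=> m n m0 mn; rewrite -mulrBr normcM n2; apply: ler_wpM2l => //.
  apply: (P_dist sy m0 mn M0) => x /andP[mx _].
  by apply: nn_MB => //; exact: le_trans mx.
exists l => t s ht s0.
have A := Hl s s0.
have B : normc (Pw y y1 (vv s t) - Pw y y1 (vv s 0)) <= 2 * MB E y y1 * kE E * pi * expR (- s).
  by apply: (P_arc sy s0 sec0 ht M0) => x hx; exact: nn_MB.
have -> : 2 * Pw y y1 (vv s t) - l = 2 * (Pw y y1 (vv s t) - Pw y y1 (vv s 0)) - (l - 2 * Pw y y1 (vv s 0)) by ring.
apply: le_trans (normcB _ _) _; rewrite normcM n2 /CB; nra.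
Qed.

Definition conn E y y1 : R[i] := xget 0 [set l | is_conn E y y1 l].

Lemma connP E y y1 : csol E y y1 -> is_conn E y y1 (conn E y y1).
Proof.
by move=> /conn_exists [l Hl]; rewrite /conn; case: xgetP => [l' _ //|/(_ l)].
Qed.

Lemma conn_cvg E y y1 t : csol E y y1 -> sector t ->
  ccvg (fun n => 2 * Pw y y1 (vv n%:R t)) (conn E y y1).
Proof.
by move=> sy ht; apply: (@ccvg_exp _ _ (CB E y y1)) => n; exact: (connP sy ht (ler0n _ n)).
Qed.

Lemma conn_le E y y1 (r : R) : csol E y y1 -> 1 <= r ->
  sqn (conn E y y1) <= 32 * (sqn (y1 0) + r ^+ 6 * sqn (y 0)) * expR ((2 * r ^+ 6 + 5 * normc E + 8) / r).
Proof.
move=> sy r1; set X := (X in _ <= X).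
have r60 : 0 <= r ^+ 6 by apply: exprn_ge0; lra.
have X0 : 0 <= X.
  by rewrite /X !mulr_ge0 ?expR_ge0 // addr_ge0 ?sqn_ge0 // mulr_ge0 ?sqn_ge0.
suff : normc (conn E y y1) <= Num.sqrt X.
  by move=> H; rewrite -normc_sqr -(sqr_sqrtr X0) ler_pXn2r ?nnegrE ?normc_ge0 ?sqrtr_ge0.
have sec0 : sector (0 : R) by rewrite /sector normr0 divr_ge0 ?pi_ge0.
apply: (@ccvg_le _ _ _ _ (Num.truncn (ln r)).+1 (conn_cvg sy sec0)) => n Nn.
have rn : ln r <= n%:R.
  by apply: le_trans (ltW (truncnS_gt _)) _; rewrite ler_nat.
rewrite -(@ler_pXn2r _ 2) ?nnegrE ?normc_ge0 ?sqrtr_ge0 // sqr_sqrtr // normc_sqr sqnM.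
have := nn_all sy r1 sec0 rn; rewrite /nn.
have -> : sqn (2 : R[i]) = 4 by rewrite -normc_sqr normc_nat; ring.
have := sqn_ge0 (Qw y y1 (vv n%:R 0)); rewrite /X; lra.
Qed.

End connection.

(** * Data at 0 of the subdominant solution and the relations between them *)

Section spectral_determinant.
Variable R : realType.
Implicit Types (z v E : R[i]) (y : R[i] -> R[i]).

(* The value and the derivative at 0 of the solution that is asymptotic to [am] at infinity. *)
Definition Dd E := conn E (sisol E) (sisol1 E).
Definition Nd E := - conn E (cosol E) (cosol1 E).

(** [yL v E] is the exact solution that has the value and the derivative of [am] at x = exp (2 v);
    [DL] and [NL] are its data at 0. They approximate [Dd] and [Nd], and exact computations are
    carried out on them. *)
Definition DL v E := 2 * Pw (sisol E) (sisol1 E) v.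
Definition NL v E := - (2 * Pw (cosol E) (cosol1 E) v).
Definition yL v E x := DL v E * cosol E x + NL v E * sisol E x.
Definition yL1 v E x := DL v E * cosol1 E x + NL v E * sisol1 E x.
Definition mul v : R[i] := 3 / 4 / cexp v ^+ 2 + cexp v ^+ 3.

Lemma csol_yL v E : csol E (yL v E) (yL1 v E).
Proof. exact: csol_lin (csol_cosol E) (csol_sisol E). Qed.

Lemma yL_at v E : yL v E (cexp v ^+ 2) = am v.
Proof.
rewrite -[RHS]mulr1 -(wr_cosi E (cexp v ^+ 2)) /yL /DL /NL /Pw.
by field; rewrite ?cexp_neq0.
Qed.
Lemma yL1_at v E : yL1 v E (cexp v ^+ 2) = - mul v * am v.
Proof.
rewrite -[RHS]mulr1 -(wr_cosi E (cexp v ^+ 2)) /yL1 /DL /NL /Pw /mul.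
by field; rewrite ?cexp_neq0.
Qed.
Lemma yL_0 v E : yL v E 0 = DL v E.
Proof. by rewrite /yL cosol_0 sisol_0; ring. Qed.
Lemma yL1_0 v E : yL1 v E 0 = NL v E.
Proof. by rewrite /yL1 cosol1_0 sisol1_0; ring. Qed.

Lemma DL_cvg E t : sector t -> ccvg (fun n => DL (vv n%:R t) E) (Dd E).
Proof. exact: conn_cvg (csol_sisol E). Qed.
Lemma NL_cvg E t : sector t -> ccvg (fun n => NL (vv n%:R t) E) (Nd E).
Proof. by move=> ht; apply: ccvgN; exact: conn_cvg (csol_cosol E) ht. Qed.

Lemma DL_dist E t s : sector t -> 0 <= s ->
  normc (DL (vv s t) E - Dd E) <= CB E (sisol E) (sisol1 E) * expR (- s).
Proof. by move=> ht s0; exact: connP (csol_sisol E) _ _ ht s0. Qed.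
Lemma NL_dist E t s : sector t -> 0 <= s ->
  normc (NL (vv s t) E - Nd E) <= CB E (cosol E) (cosol1 E) * expR (- s).
Proof.
move=> ht s0; rewrite /NL /Nd -opprD normcN.
exact: connP (csol_cosol E) _ _ ht s0.
Qed.

Lemma vvJ s t : cj (vv s t) = vv s (- t) :> R[i].
Proof. by apply: eqC; rewrite /vv !ReImE; ring. Qed.

Lemma PwJ y y1 u u1 v : (forall x, u (cj x) = cj (y x)) -> (forall x, u1 (cj x) = cj (y1 x)) ->
  Pw u u1 (cj v) = cj (Pw y y1 v).
Proof.
by move=> h h1; rewrite /Pw /am !(cjE, cexpJ) -h -h1 !(cjE, cexpJ).
Qed.

Lemma DdJ E : Dd (cj E) = cj (Dd E).
Proof.
have sec0 : sector (0 : R) by rewrite /sector normr0 divr_ge0 ?pi_ge0.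
apply: (ccvg_uniq (DL_cvg (cj E) sec0)); apply: ccvg_ext (ccvgJ (DL_cvg E sec0)) => n.
rewrite /DL cjM cjn -(@PwJ _ _ (sisol (cj E)) (sisol1 (cj E))) => [|x|x].
- by rewrite vvJ oppr0.
- exact: sisolJ.
- exact: sisol1J.
Qed.
Lemma NdJ E : Nd (cj E) = cj (Nd E).
Proof.
have sec0 : sector (0 : R) by rewrite /sector normr0 divr_ge0 ?pi_ge0.
apply: (ccvg_uniq (NL_cvg (cj E) sec0)); apply: ccvg_ext (ccvgJ (NL_cvg E sec0)) => n.
rewrite /NL cjN cjM cjn -(@PwJ _ _ (cosol (cj E)) (cosol1 (cj E))) => [|x|x].
- by rewrite vvJ oppr0.
- exact: cosolJ.
- exact: cosol1J.
Qed.

Lemma cis_5 (k : R) : cis k ^+ 5 = cis (5 * k) :> R[i].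
Proof. by rewrite -cisMn. Qed.

(* The Wronskian of two neighbouring subdominant solutions is evaluated on the ray [arg x = pi / 5]
   that separates their sectors, where both are of WKB form. *)
Lemma quantum_wronskian E E' : cis (2 * pi / 5) ^+ 2 * E = E' ->
  cis (- (2 * pi / 5)) * Dd E * Nd E' - Nd E * Dd E' = 2 * cis (3 * pi / 10).
Proof.
move=> EE'; set l := cis (- (2 * pi / 5)).
have l5 : l ^+ 5 = 1.
  by rewrite cis_5 (_ : 5 * _ = - (pi + pi)); [rewrite cisN cisD cis_pi !cjE; ring|field].
have lE : l ^+ 2 * E' = E.
  rewrite -EE' mulrA -exprMn -cisD addNr cis0; ring.
have pi0 := pi_ge0 R.
have h1 : sector (pi / 10 : R) by rewrite /sector ger0_norm // divr_ge0.
have h2 : sector (- (pi / 10) : R) by rewrite /sector normrN ger0_norm // divr_ge0.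
have cv := ccvgD (ccvgZ l (ccvgM (DL_cvg E h1) (NL_cvg E' h2)))
   (ccvgN (ccvgM (NL_cvg E h1) (DL_cvg E' h2))).
rewrite -mulrA; apply: (ccvg_uniq cv); apply: ccvg_ext (ccvg_cst _) => n.
set v := vv _ _; set v' := vv _ _.
have sy := csol_yL v E; have := csol_rot l5 (csol_yL v' E'); rewrite lE => sy'.
have := wr_cst 0 (cexp v ^+ 2) sy sy'; rewrite /wr mulr0 !yL_0 !yL1_0 yL_at yL1_at => H.
have ev : cexp v' = cexp v * cis (- (pi / 5)).
  rewrite /cis -cexpD /v /v' /vv; congr cexp.
  by apply: eqC; rewrite !ReImE; field.
have lx : l * cexp v ^+ 2 = cexp v' ^+ 2.
  by rewrite ev exprMn mulrC /l -cisMn; congr (_ * cis _); field.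
rewrite lx yL_at yL1_at in H.
have l3 : l * cexp v' ^+ 3 = - cexp v ^+ 3.
  rewrite ev exprMn mulrCA -cisMn /l -cisD.
  have -> : - (2 * pi / 5) + 3 * - (pi / 5) = - pi :> R by field.
  by rewrite cisN cis_pi !cjE; ring.
have l2 : l * (3 / 4 / cexp v' ^+ 2) = 3 / 4 / cexp v ^+ 2.
  by rewrite -lx; field; rewrite cexp_neq0 /l cis_neq0.
(* On the two rays exp (5 v) is purely imaginary, with opposite values, so the exponentials cancel
   and the amplitudes remain. *)
have aa : am v * am v' = (expR (- (3 * n%:R)))%:C.
  rewrite /am -cexpD -cexpR; congr cexp.
  have ih : cis (5 * (pi / 10)) = 'i%C :> R[i].
    by rewrite (_ : 5 * _ = pi / 2) ?cis_pihalf //; field.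
  have -> : cexp v ^+ 5 = (expR (5 * n%:R))%:C * 'i%C.
    by rewrite -ih -cexpMn -polar_cexp /v /vv; congr cexp; rewrite !(cCM, cCn, cCV); field.
  have -> : cexp v' ^+ 5 = - ((expR (5 * n%:R))%:C * 'i%C).
    have -> : - ((expR (5 * n%:R))%:C * 'i%C) = (expR (5 * n%:R))%:C * cis (- (5 * (pi / 10))) :> R[i].
      by rewrite cisN ih cji; ring.
    by rewrite -cexpMn -polar_cexp /v' /vv; congr cexp; rewrite !(cCN, cCM, cCn, cCV); field.
  by rewrite /v /v' /vv !(cCN, cCM, cCn); field.
have e3 : cexp v ^+ 3 = (expR (3 * n%:R))%:C * cis (3 * pi / 10).
  by rewrite -cexpMn -polar_cexp /v /vv; congr cexp; rewrite !(cCM, cCn, cCV); field.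
transitivity (am v * (l * (- mul v' * am v')) - - mul v * am v * am v').
  have -> : am v * (l * (- mul v' * am v')) - - mul v * am v * am v' =
    am v * am v' * (mul v - l * mul v') by ring.
  rewrite /mul (mulrDr l) l2 l3 aa e3.
  have -> : (expR (- (3 * n%:R)))%:C = (expR (3 * n%:R))%:C^-1 :> R[i] by rewrite expRN cCV.
  have X0 : (expR (3 * n%:R))%:C != 0 :> R[i] by rewrite cC_eq0 gt_eqF ?expR_gt0.
  by move: X0; set X := (expR _)%:C => X0; field; rewrite ?cexp_neq0 ?X0.
rewrite -H; move: (DL v E) (NL v E) (DL v' E') (NL v' E') => a b c d; clear; ring.
Qed.

(* The identity behind the Dorey-Dunning-Tateo proof that the spectrum is real. *)
Lemma ddt_identity z : let om := cis (pi / 5) in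
  (cis (pi / 10) * Dd (om * z) * Nd (cj om * z) + cis (- (pi / 10)) * Nd (om * z) * Dd (cj om * z)) * Dd (- z) =
  2 * cis (pi / 2) * (cis (3 * pi / 10) * Dd (om * z) - cis (- (3 * pi / 10)) * Dd (cj om * z)).
Proof.
move=> o.
have h1 : cis (2 * pi / 5) ^+ 2 * (o * z) = - z.
  rewrite mulrA -cisMn /o -cisD; have -> : 2 * (2 * pi / 5) + pi / 5 = pi :> R by field.
  by rewrite cis_pi; ring.
have h2 : cis (2 * pi / 5) ^+ 2 * - z = cj o * z.
  rewrite -cisMn /o -cisN; have -> : 2 * (2 * pi / 5) = - (pi / 5) + pi :> R by field.
  by rewrite cisD cis_pi; ring.
(* Two consecutive rotations, from om z to - z and from - z to conj (om) z. They express [Nm * D0]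
   and [D0 * Np]; the two terms with [N0] that arise cancel because c^10 = -1. *)
have q1 := quantum_wronskian h1; have q2 := quantum_wronskian h2.
set Dm := Dd (o * z) in q1 *; set Dp := Dd (cj o * z) in q2 *; set D0 := Dd (- z) in q1 q2 *.
set Nm := Nd (o * z) in q1 *; set Np := Nd (cj o * z) in q2 *; set N0 := Nd (- z) in q1 q2 *.
set k := cis (3 * pi / 10) in q1 q2 *.
clearbody Dm Dp D0 Nm Np N0.
have kk : cis (- (3 * pi / 10)) = k^-1 by rewrite cisV.
have k0 : k != 0 by exact: cis_neq0.
set l := cis (- (2 * pi / 5)) in q1 q2 *; have l0 : l != 0 by exact: cis_neq0.
set c := cis (pi / 10); have c0 : c != 0 by exact: cis_neq0.
have cV : cis (- (pi / 10)) = c^-1 by rewrite cisV.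
have kE : k = c ^+ 3 by rewrite /k /c -cisMn; congr cis; field.
have lE : l^-1 = c ^+ 4 by rewrite /l -cisV -cisMn; congr cis; field.
have c10 : c ^+ 10 = -1.
  by rewrite /c -cisMn (_ : 10 * _ = pi) ?cis_pi //; field.
have c5 : cis (pi / 2) = c ^+ 5 by rewrite /c -cisMn; congr cis; field.
clearbody c k l.
have A : D0 * Np = (2 * k + N0 * Dp) * c ^+ 4.
  by rewrite -lE -q2; field.
have B : Nm * D0 = l * Dm * N0 - 2 * k by rewrite -q1; ring.
rewrite cV kk c5.
have -> : (c * Dm * Np + c^-1 * Nm * Dp) * D0 = c * Dm * (D0 * Np) + c^-1 * Dp * (Nm * D0) by ring.
rewrite A B; have -> : l = (c ^+ 4)^-1 by rewrite -lE invrK.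
rewrite kE.
have E1 : c^-1 * Dp * (Dm * N0 / c ^+ 4) = - (c ^+ 5 * Dm * N0 * Dp).
  have -> : c ^+ 5 = c ^+ 10 / c ^+ 5 by field.
  by rewrite c10; field.
have -> : c * Dm * ((2 * c ^+ 3 + N0 * Dp) * c ^+ 4) + c^-1 * Dp * ((c ^+ 4)^-1 * Dm * N0 - 2 * c ^+ 3) =
  2 * c ^+ 8 * Dm - 2 * c ^+ 2 * Dp + (c ^+ 5 * Dm * N0 * Dp + c^-1 * Dp * (Dm * N0 / c ^+ 4)) by field.
rewrite E1.
by field.
Qed.

End spectral_determinant.

(** * Primitives of continuous functions *)

Section primitives.
Variable R : realType.

Lemma primitive (f : R -> R) (a : R) : continuous f ->
  exists F : R -> R, forall x, a < x -> rder F x (f x).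
Proof.
move=> cf; exists (fun x => \int[lebesgue_measure]_(t in `[a, x]) f t)%R => x ax.
have [||D1 D2] := @continuous_FTC1_closed R f a x (x + 1) _ _ ax (cf x).
- by rewrite ltrDl.
- apply: continuous_compact_integrable; first exact: segment_compact.
  exact: continuous_subspaceT.
by apply: DeriveDef; [exact: D1|rewrite -derive1E].
Qed.

Lemma cprimitive (u : R -> R[i]) (a : R) : (forall x, exists d, cder u x d) ->
  exists U : R -> R[i], forall x, a < x -> cder U x (u x).
Proof.
move=> du.
have [|F HF] := @primitive (fun x => Re (u x)) a.
  by move=> x; have [d [dr _]] := du x; exact: rder_cont dr.
have [|G HG] := @primitive (fun x => Im (u x)) a.
  by move=> x; have [d [_ di]] := du x; exact: rder_cont di.
by exists (fun x => F x +i* G x) => x ax; split; [exact: HF|exact: HG].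
Qed.

End primitives.

(** * The derivative of the determinant in the spectral parameter *)

Section determinant_derivative.
Variable R : realType.
Implicit Types (z v E : R[i]) (y : R[i] -> R[i]).

Lemma csol_R E y y1 (t : R) : csol E y y1 ->
  cder (fun t => y t%:C) t (y1 t%:C) /\ cder (fun t => y1 t%:C) t ((t ^+ 3)%:C * y t%:C - E * y t%:C).
Proof.
move=> sy; have dg : cder (fun t : R => t%:C) t 1 by exact: cder_realc.
have [d1 d2] := csol_curve sy dg; split; first by apply: cder_eq d1 _; rewrite mulr1.
by apply: cder_eq d2 _; rewrite cCX; ring.
Qed.

Lemma csol_R_bound E y y1 (a b e : R) : csol E y y1 -> normc E <= e ->
  forall l, `|a| <= l -> `|b| <= l ->
  sqn (y1 b%:C) + sqn (y b%:C) <=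
  (sqn (y1 a%:C) + sqn (y a%:C)) * expR (`|b - a| * (l ^+ 3 + e + 1)).
Proof.
move=> sy Ee l al bl.
have := @segment_gronwall _ E y y1 a%:C b%:C (l ^+ 3 + e) 1 sy ltr01.
rewrite expr1n !mul1r divr1 => H.
have -> : `|b - a| = normc (b%:C - a%:C : R[i]) by rewrite -normcR cCD cCN.
apply: H => s /andP[s0 s1]; apply: le_trans (normcB _ _) _; apply: lerD => //.
rewrite normcX; apply: lerXn2r; rewrite ?nnegrE ?normc_ge0 //; first exact: le_trans al.
have -> : a%:C + s%:C * (b%:C - a%:C) = ((1 - s) * a + s * b)%:C :> R[i].
  by rewrite !(cCD, cCM, cCN, cC1); ring.
rewrite normcR; apply: le_trans (ler_normD _ _) _; rewrite !normrM (ger0_norm s0) ger0_norm ?subr_ge0 //.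
have := ler_wpM2l s0 bl; have := @ler_wpM2l _ (1 - s) _ _ _ al; rewrite subr_ge0 => /(_ s1); lra.
Qed.

Variable s : R.
Hypothesis s0 : 0 <= s.
Let v : R[i] := vv s 0.
Let l : R := expR (2 * s).

Lemma cexp_v2 : cexp v ^+ 2 = l%:C.
Proof. by rewrite -cexpMn /v /vv /l -cexpR; congr cexp; rewrite !(cCM, cCn, cC0); ring. Qed.

Lemma yL_l E : yL v E l%:C = am v. Proof. by rewrite -cexp_v2 yL_at. Qed.
Lemma yL1_l E : yL1 v E l%:C = - mul v * am v. Proof. by rewrite -cexp_v2 yL1_at. Qed.

Lemma l_ge1 : 1 <= l. Proof. by rewrite /l -[X in X <= _]expR0 ler_expR mulr_ge0. Qed.

Lemma bound_exists (e : R) : exists2 M : R, 1 <= M & forall E t, normc E <= e -> 0 <= t <= l ->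
  [/\ normc (sisol E t%:C) <= M, normc (cosol E t%:C) <= M & normc (yL v E t%:C) <= M].
Proof.
have l1 := l_ge1.
pose X := expR (l * (l ^+ 3 + e + 1)).
pose M := 1 + X + (normc (mul v * am v) ^+ 2 + normc (am v) ^+ 2) * X.
have X0 : 0 < X by exact: expR_gt0.
have A0 : 0 <= normc (mul v * am v) ^+ 2 + normc (am v) ^+ 2 by rewrite addr_ge0 ?sqr_ge0.
have AX : 0 <= (normc (mul v * am v) ^+ 2 + normc (am v) ^+ 2) * X by rewrite mulr_ge0 // ltW.
have M1 : 1 <= M by rewrite /M; lra.
exists M => // E t Ee /andP[t0 tl].
have aux y y1 (a : R) c : csol E y y1 -> 0 <= a <= l -> sqn (y1 a%:C) + sqn (y a%:C) <= c -> 0 <= c ->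
    c * X <= M -> normc (y t%:C) <= M.
  move=> sy /andP[a0 al] Hc c0 cM.
  have := csol_R_bound sy Ee (l := l) (a := a) (b := t).
  rewrite (ger0_norm a0) (ger0_norm t0) => /(_ al tl) H.
  have ta : `|t - a| <= l by rewrite ler_norml; apply/andP; split; lra.
  have e0 : 0 <= e by apply: le_trans Ee; exact: normc_ge0.
  have l3 : 0 <= l ^+ 3 by rewrite exprn_ge0 //; lra.
  have : normc (y t%:C) ^+ 2 <= c * X.
    rewrite normc_sqr; apply: le_trans (_ : sqn (y1 t%:C) + sqn (y t%:C) <= _).
      by rewrite lerDr sqn_ge0.
    apply: le_trans H _; apply: ler_pM => //; rewrite ?(addr_ge0 (sqn_ge0 _) (sqn_ge0 _)) ?expR_ge0 //.
    by rewrite /X ler_expR; apply: ler_wpM2r => //; lra.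
  have := normc_ge0 (y t%:C); nra.
have ll : 0 <= l <= l by apply/andP; split; lra.
have zl : (0 : R) <= 0 <= l by apply/andP; split; lra.
split.
- apply: (aux _ _ 0 1 (csol_sisol E)) => //; last by rewrite /M; lra.
  by rewrite cC0 sisol_0 sisol1_0 -!normc_sqr normc0 normc1; lra.
- apply: (aux _ _ 0 1 (csol_cosol E)) => //; last by rewrite /M; lra.
  by rewrite cC0 cosol_0 cosol1_0 -!normc_sqr normc0 normc1; lra.
- apply: (aux _ _ l _ (csol_yL v E) ll (lexx _)); rewrite ?(addr_ge0 (sqn_ge0 _) (sqn_ge0 _)) //.
  by rewrite yL_l yL1_l mulNr sqnN -!normc_sqr /M; lra.
Qed.

(** For y = [yL v E2] and u = [sisol E1] this Wronskian runs from [DL v E2] at 0 to [DL v E1] at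
    [l], because the data of [yL] at [l] do not depend on the parameter. This is where the
    derivative of [DL] comes from. *)
Lemma cder_wr2 E1 E2 y y1 u u1 t : csol E2 y y1 -> csol E1 u u1 ->
  cder (fun t => wr y y1 u u1 t%:C) t ((E2 - E1) * (y t%:C * u t%:C)).
Proof.
move=> sy su; have [d1 d2] := csol_R t sy; have [d3 d4] := csol_R t su.
by apply: cder_eq; [rewrite /wr; der|rewrite /=; ring].
Qed.

Lemma wr_yL0 E1 E2 : wr (yL v E2) (yL1 v E2) (sisol E1) (sisol1 E1) 0 = DL v E2.
Proof. by rewrite /wr sisol_0 sisol1_0 yL_0; ring. Qed.
Lemma wr_yLl E1 E2 : wr (yL v E2) (yL1 v E2) (sisol E1) (sisol1 E1) l%:C = DL v E1.
Proof.
rewrite /wr yL_l yL1_l -cexp_v2 /DL /Pw /mul.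
by field; rewrite cexp_neq0.
Qed.

Lemma int_le (u U : R -> R[i]) (a b M : R) : a <= b -> 
  (forall x, a <= x <= b -> cder U x (u x)) -> (forall x, a <= x <= b -> normc (u x) <= M) ->
  normc (U b - U a) <= M * (b - a).
Proof.
move=> ab dU uM.
have := @normc_incr_le _ U (fun x => M * x) u (fun=> M) a b ab dU.
rewrite mulrBr; apply => // x _.
by apply: rder_eq; [der|rewrite /=; ring].
Qed.

(** Variation of constants starting from [l], where [yL v E1] and [yL v E2] agree together with
    their derivatives. *)
Lemma yL_diff (e M : R) E1 E2 t : 1 <= M -> 
  (forall E t, normc E <= e -> 0 <= t <= l ->
  [/\ normc (sisol E t%:C) <= M, normc (cosol E t%:C) <= M & normc (yL v E t%:C) <= M]) ->
  normc E1 <= e -> normc E2 <= e -> 0 <= t <= l ->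
  normc (yL v E2 t%:C - yL v E1 t%:C) <= 2 * l * M ^+ 3 * normc (E2 - E1).
Proof.
move=> M1 HM h1 h2 tl.
have W u u1 : csol E1 u u1 -> (forall t, 0 <= t <= l -> normc (u t%:C) <= M) ->
    normc (wr (yL v E2) (yL1 v E2) u u1 t%:C - wr (yL v E1) (yL1 v E1) u u1 t%:C) <=
    l * M ^+ 2 * normc (E2 - E1).
  move=> su Hu.
  pose U x := wr (yL v E2) (yL1 v E2) u u1 x%:C - wr (yL v E1) (yL1 v E1) u u1 x%:C.
  have Ul : U l = 0 by rewrite /U /wr !yL_l !yL1_l subrr.
  have /andP[t0 tl'] := tl.
  have := @int_le (fun x => (E2 - E1) * (yL v E2 x%:C * u x%:C)) U t l (normc (E2 - E1) * M ^+ 2) tl'.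
  rewrite Ul sub0r normcN -/(U t) => H.
  apply: le_trans (H _ _) _ => [x xl|x /andP[tx xl]|].
  - have d1 := cder_wr2 x (csol_yL v E2) su; have d2 := cder_wr2 x (csol_yL v E1) su.
    by apply: cder_eq; [rewrite /U; der|rewrite subrr; ring].
  - have xl' : 0 <= x <= l by rewrite xl (le_trans t0).
    have [_ _ Hy] := HM E2 x h2 xl'.
    rewrite !normcM; apply: ler_wpM2l; rewrite ?normc_ge0 // expr2.
    by apply: ler_pM; rewrite ?normc_ge0 // Hu.
  - rewrite mulrC -[l * _ * _]mulrA; apply: ler_pM => //.
    + lra.
    + by rewrite mulr_ge0 ?normc_ge0 // exprn_ge0 //; lra.
    + lra.
    + by rewrite mulrC.
have W1 := W _ _ (csol_sisol E1) (fun t Ht => let: And3 h _ _ := HM E1 t h1 Ht in h).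
have W2 := W _ _ (csol_cosol E1) (fun t Ht => let: And3 _ h _ := HM E1 t h1 Ht in h).
have [Hs Hc _] := HM E1 t h1 tl.
set w1 := _ - _ in W1; set w2 := _ - _ in W2.
have -> : yL v E2 t%:C - yL v E1 t%:C = w1 * cosol E1 t%:C - w2 * sisol E1 t%:C.
  rewrite -[LHS]mulr1 -(wr_cosi E1 t%:C) /w1 /w2 /wr; ring.
apply: le_trans (normcB _ _) _; rewrite !normcM.
have -> : 2 * l * M ^+ 3 * normc (E2 - E1) = l * M ^+ 2 * normc (E2 - E1) * M + l * M ^+ 2 * normc (E2 - E1) * M by ring.
by apply: lerD; apply: ler_pM; rewrite ?normc_ge0.
Qed.

(** [IL E] is the integral of yL * sisol over [0, l], held as the increment of a primitive; the
    primitive exists beyond -1 so as to be differentiable at 0 as well. *)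
Definition isIL (IL : R[i] -> R[i]) := forall E, exists U : R -> R[i], 
  [/\ forall x, -1 < x -> cder U x (yL v E x%:C * sisol E x%:C), U 0 = 0 & U l = IL E].

Lemma IL_exists : exists IL, isIL IL.
Proof.
have H E : exists U : R -> R[i], (forall x, -1 < x -> cder U x (yL v E x%:C * sisol E x%:C)) /\ U 0 = 0.
  have [|U HU] := @cprimitive R (fun x => yL v E x%:C * sisol E x%:C) (-1).
    move=> x; have [d1 _] := csol_R x (csol_yL v E); have [d2 _] := csol_R x (csol_sisol E).
    by eexists; der.
  exists (fun x => U x - U 0); split; last by rewrite subrr.
  by move=> x x1; have dU := HU x x1; apply: cder_eq; [der|rewrite addr0].
exists (fun E => sval (cid (H E)) l) => E; case: cid => U [HU U0] /=.
by exists U.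
Qed.

Lemma holo_DL IL : isIL IL -> holo (DL v) (fun E => - IL E).
Proof.
move=> hIL e; have [M M1 HM] := bound_exists e.
have l1 := l_ge1.
exists (l * (2 * l * M ^+ 3 * M)) => E1 h h1 h2.
set E2 := E1 + h in h2 *.
have [U [dU U0 Ul]] := hIL E1.
have hE : h = E2 - E1 by rewrite /E2; ring.
rewrite hE.
pose J x := wr (yL v E2) (yL1 v E2) (sisol E1) (sisol1 E1) x%:C - (E2 - E1) * U x.
have J0 : J 0 = DL v E2 by rewrite /J cC0 wr_yL0 U0; ring.
have Jl : J l = DL v E1 - (E2 - E1) * IL E1 by rewrite /J wr_yLl Ul.
have -> : DL v E2 - DL v E1 - (E2 - E1) * - IL E1 = - (J l - J 0) by rewrite J0 Jl; ring.
rewrite normcN.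
have := @int_le (fun x => (E2 - E1) * ((yL v E2 x%:C - yL v E1 x%:C) * sisol E1 x%:C)) J 0 l
  (normc (E2 - E1) ^+ 2 * (2 * l * M ^+ 3 * M)).
move=> H; apply: le_trans (H _ _ _) _ => [|x /andP[x0 xl]|x xl|].
- by rewrite /l expR_ge0.
- have d1 := cder_wr2 x (csol_yL v E2) (csol_sisol E1).
  have d2 : cder U x (yL v E1 x%:C * sisol E1 x%:C) by apply: dU; lra.
  by apply: cder_eq; [rewrite /J; der|rewrite /=; ring].
- have [Hs _ _] := HM E1 x h1 xl.
  have Hd := yL_diff M1 HM h1 h2 xl.
  rewrite !normcM expr2 -mulrA; apply: ler_wpM2l; first exact: normc_ge0.
  rewrite mulrA [_ * (_ * _ * _)]mulrC; apply: ler_pM; rewrite ?normc_ge0 //.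
- by rewrite subr0 le_eqVlt; apply/orP; left; apply/eqP; ring.
Qed.

End determinant_derivative.

(** * Growth of the modulus of the determinant with the argument *)

Section determinant_bounds.
Variable R : realType.
Implicit Types (z v E : R[i]) (y : R[i] -> R[i]).

(** A time during which a solution with normalized data at 0 stays close to its tangent, the
    coefficient x^3 - E being at most 1 + |E| on [0, 1]. *)
Definition tau E : R := (8 * (1 + normc E))^-1.

Lemma tau_gt0 E : 0 < tau E.
Proof. by rewrite /tau invr_gt0; have := normc_ge0 E; lra. Qed.
Lemma tau_le E : tau E <= 1 / 8.
Proof.
rewrite /tau mul1r lef_pV2 ?posrE; have := normc_ge0 E; lra.
Qed.
Lemma tauE E : tau E * (1 + normc E) = 1 / 8.
Proof. by rewrite /tau; field; have := normc_ge0 E; lra. Qed.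

Lemma short_time E y y1 t : csol E y y1 -> 0 <= t <= tau E ->
  sqn (y1 0) + sqn (y 0) = 1 ->
  [/\ normc (y1 t%:C - y1 0) <= 1 / 4, normc (y t%:C - y 0 - t%:C * y1 0) <= t / 4 &
      normc (y t%:C) <= 5 / 4].
Proof.
move=> sy /andP[t0 tt] y01.
have tl := tau_le E; have te := tauE E; have n0 := normc_ge0 E; have tp := tau_gt0 E.
have B x : 0 <= x <= t -> normc (y x%:C) <= 5 / 4.
  move=> /andP[x0 xt].
  have := csol_R_bound sy (lexx _) (l := 1) (a := 0) (b := x).
  rewrite normr0 subr0 ger0_norm // ler01 cC0 y01 mul1r => H.
  have {}H : sqn (y1 x%:C) + sqn (y x%:C) <= expR (x * (1 ^+ 3 + normc E + 1)) by apply: H => //; lra.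
  have : x * (1 ^+ 3 + normc E + 1) <= 1 / 4.
    have : x * (1 + normc E) <= 1 / 8 by rewrite -te ler_wpM2r; lra.
    by rewrite expr1n; lra.
  rewrite -ler_expR => H2.
  have : expR (1 / 4 : R) <= 4 / 3.
    have := expR_ge1Dx (- (1 / 4) : R); rewrite expRN => H3.
    have e0 := expR_gt0 (1 / 4 : R).
    have : (1 + - (1 / 4)) * expR (1 / 4 : R) <= (expR (1 / 4))^-1 * expR (1 / 4) by apply: ler_wpM2r => //; exact: ltW.
    by rewrite mulVf ?gt_eqF //; lra.
  rewrite -(normc_sqr (y _)) in H.
  by have := sqn_ge0 (y1 x%:C); have := normc_ge0 (y x%:C); nra.
have D1 x : 0 <= x <= t -> normc (y1 x%:C - y1 0) <= 1 / 4.
  move=> /andP[x0 xt].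
  have := @int_le R (fun u => (u ^+ 3)%:C * y u%:C - E * y u%:C) (fun u => y1 u%:C) 0 x (5 / 4 * (1 + normc E)) x0.
  rewrite cC0 subr0 => H; apply: le_trans (H _ _) _ => [u _|u /andP[u0 ux]|].
  - by have [_ d] := csol_R u sy.
  - rewrite -mulrBl normcM mulrC; apply: ler_pM; rewrite ?normc_ge0 //.
      by apply: B; rewrite u0 (le_trans ux).
    apply: le_trans (normcB _ _) _; rewrite lerD2r normcR ger0_norm ?exprn_ge0 //.
    by apply: exprn_ile1 => //; lra.
  - have : (1 + normc E) * x <= 1 / 8 by rewrite mulrC -te ler_wpM2r; lra.
    by lra.
have tt' : 0 <= t <= t by rewrite t0 lexx.
split; [exact: D1| |exact: B].
have := @int_le R (fun u => y1 u%:C - y1 0) (fun u => y u%:C - y 0 - u%:C * y1 0) 0 t (1 / 4) t0.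
rewrite cC0 mul0r subrr !subr0 => H; apply: le_trans (H _ _) _ => [u _|u ut|].
- by have [d _] := csol_R u sy; apply: cder_eq; [der|rewrite /=; ring].
- exact: D1.
- lra.
Qed.

Section lower_bound.
Variable s : R.
Hypothesis s0 : 0 <= s.
Let v : R[i] := vv s 0.
Let l : R := expR (2 * s).

(** For Im E >= 0 both are monotone by [rder_pair]: [af] increases from 0, and [bf] decreases to a
    nonnegative value at [l]. *)
Let af E t : R := Im (E * sisol E t%:C * cj (sisol1 E t%:C)).
Let bf E t : R := - Im (E * yL v E t%:C * cj (yL1 v E t%:C)).

(** The remaining term |E|^2 |y|^2 is real and drops out of the imaginary part. *)
Lemma rder_pair E y y1 t : csol E y y1 ->
  rder (fun t => Im (E * y t%:C * cj (y1 t%:C))) t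
    (Im E * (sqn (y1 t%:C) + t ^+ 3 * sqn (y t%:C))).
Proof.
move=> sy; have [d1 d2] := csol_R t sy.
apply: rder_eq; first by der.
by rewrite /= /sqn !ReImE; ring.
Qed.

Lemma af_ge0 E t : 0 <= Im E -> 0 <= t -> 0 <= af E t.
Proof.
move=> E0 t0; have <- : af E 0 = 0 by rewrite /af cC0 sisol_0 mulr0 mul0r Im0.
apply: (nondecr t0 (fun x _ => rder_pair x (csol_sisol E))) => x /andP[x0 _].
by rewrite mulr_ge0 // addr_ge0 ?sqn_ge0 // mulr_ge0 ?sqn_ge0 // exprn_ge0.
Qed.

Lemma am_real : am v = (Re (am v))%:C.
Proof.
have : am v = cexp (- (3 / 2) * s - 2 / 5 * expR s ^+ 5)%:C.
  have e : cexp v = (expR s)%:C by rewrite -cexpR /v /vv; congr cexp; rewrite cC0; ring.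
  rewrite /am e; congr cexp; rewrite !(cCD, cCM, cCN, cCV, cCn, cCX) /v /vv cC0; ring.
by rewrite cexpR => ->; rewrite ReC.
Qed.

Lemma bf_l E : 0 <= Im E -> 0 <= bf E l.
Proof.
move=> E0; rewrite /bf yL_l yL1_l am_real.
have -> : mul v = (3 / 4 / expR s ^+ 2 + expR s ^+ 3)%:C.
  have e : cexp v = (expR s)%:C by rewrite -cexpR /v /vv; congr cexp; rewrite cC0; ring.
  by rewrite /mul e !(cCD, cCM, cCV, cCn, cCX).
set m := 3 / 4 / _ + _; set p := Re _.
have m0 : 0 <= m by rewrite addr_ge0 ?exprn_ge0 ?expR_ge0 // divr_ge0 ?exprn_ge0 ?expR_ge0.
have -> : Im (E * p%:C * cj (- m%:C * p%:C)) = - (Im E * (m * p ^+ 2)) by rewrite !ReImE; ring.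
by rewrite opprK; apply: mulr_ge0 => //; apply: mulr_ge0 => //; exact: sqr_ge0.
Qed.

Lemma bf_ge E t t' : 0 <= Im E -> 0 <= t -> t <= t' -> t' <= l -> 0 <= bf E t' /\ bf E t' <= bf E t.
Proof.
move=> E0 t0 tt' tl.
have mono (u w : R) : 0 <= u -> u <= w -> bf E w <= bf E u.
  move=> u0 uw; rewrite lerN2.
  apply: (nondecr uw (fun x _ => rder_pair x (csol_yL v E))) => x /andP[ux _].
  by rewrite mulr_ge0 // addr_ge0 ?sqn_ge0 // mulr_ge0 ?sqn_ge0 // exprn_ge0 // (le_trans u0).
split; last exact: mono.
by apply: le_trans (bf_l E0) (mono _ _ _ tl); exact: le_trans tt'.
Qed.

(** Writing [DL v E] as the Wronskian at t splits the integrand into two terms that are nonnegative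
    for Im E >= 0. Integrated over [0, l], twice the left side is the derivative of [sqn (DL v E)]
    in arg E. *)
Lemma IL_identity E t : Im (E * cj (DL v E) * (yL v E t%:C * sisol E t%:C)) =
  sqn (yL v E t%:C) * af E t + sqn (sisol E t%:C) * bf E t.
Proof.
rewrite -(wr_yL0 s E E) (wr_cst 0 t%:C (csol_yL v E) (csol_sisol E)) /wr /af /bf -/v.
move: (yL v E t%:C) (yL1 v E t%:C) (sisol E t%:C) (sisol1 E t%:C) => y y1 u u1.
rewrite /sqn !ReImE; ring.
Qed.

(** Only [0, tau E] is kept from the integral. If |NL| <= |DL| the term with [af] is used, with |yL|
    >= |DL| / 2; otherwise the term with [bf], with |yL1| >= |NL| / 2. The fourth power of [tau] is
    that of the second case, and 1/1000 covers both. *)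
Lemma IL_ge IL E : isIL s IL -> 0 <= Im E ->
  Im E * tau E ^+ 4 / 1000 * (sqn (DL v E) + sqn (NL v E)) <= Im (E * cj (DL v E) * IL E).
Proof.
have aux1 (p q : R) : (3 / 4) ^+ 2 <= p -> 0 <= q -> 9 / 16 <= p + q by lra.
have aux2 (m p q : R) : (m / 2) ^+ 2 <= p -> 0 <= q -> 1 / 4 * m ^+ 2 <= p + q by lra.
have aux3 (e T d n : R) : e * T ^+ 4 * n ^+ 2 <= e * T ^+ 4 * d ^+ 2 -> e * d ^+ 2 * T ^+ 4 <= e * d ^+ 2 * T ^+ 2 ->
  0 <= e * d ^+ 2 * T ^+ 2 -> e * T ^+ 4 / 1000 * (d ^+ 2 + n ^+ 2) <= 9 / 128 * e * d ^+ 2 * T ^+ 2 by lra.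
have aux4 (e d x p q : R) : (d / 2) ^+ 2 * (9 / 16 * e * x) <= p -> 0 <= q -> 9 / 64 * e * d ^+ 2 * x <= p + q by lra.
have aux5 (e T d n : R) : e * T ^+ 4 * d ^+ 2 <= e * T ^+ 4 * n ^+ 2 -> 0 <= e * T ^+ 4 * n ^+ 2 ->
  e * T ^+ 4 / 1000 * (d ^+ 2 + n ^+ 2) <= 9 / 64 * e * n ^+ 2 * (T ^+ 4 / 12) by lra.
have aux6 (e n T x p q : R) : (3 / 4 * x) ^+ 2 * (1 / 4 * e * n ^+ 2 * (T - x)) <= q -> 0 <= p ->
  9 / 64 * e * n ^+ 2 * (T * x ^+ 2 - x ^+ 3) <= p + q by lra.
move=> hIL E0; have [U [dU U0 Ul]] := hIL E.
have l1 : 1 <= l by rewrite /l -[X in X <= _]expR0 ler_expR mulr_ge0.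
have t0 := tau_gt0 E; have t8 := tau_le E.
set T := tau E in t0 t8 *; have Tl : T <= l by lra.
pose G t : R := Im (E * cj (DL v E) * U t).
have dG t : 0 <= t -> rder G t (sqn (yL v E t%:C) * af E t + sqn (sisol E t%:C) * bf E t).
  move=> t0'; have d : cder U t (yL v E t%:C * sisol E t%:C) by apply: dU; lra.
  apply: rder_eq; first (rewrite /G; der).
  by rewrite -IL_identity; congr Im; rewrite /=; ring.
have G'0 t : 0 <= t -> t <= l -> 0 <= sqn (yL v E t%:C) * af E t + sqn (sisol E t%:C) * bf E t.
  move=> t0' tl; have [b0 _] := bf_ge E0 t0' (lexx t) tl.
  by rewrite addr_ge0 ?mulr_ge0 ?sqn_ge0 // af_ge0.
have G0 : G 0 = 0 by rewrite /G U0 mulr0 Im0.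
have Gl : G T <= Im (E * cj (DL v E) * IL E).
  rewrite -Ul -/(G l); apply: (@nondecr _ G _ T l) => [|t /andP[Tt tl]|t /andP[Tt tl]]; first lra.
    by apply: dG; lra.
  by apply: G'0; lra.
apply: le_trans _ Gl.
have ST t : 0 <= t <= T -> [/\ normc (sisol1 E t%:C - 1) <= 1 / 4, normc (sisol E t%:C - t%:C) <= t / 4,
   normc (cosol1 E t%:C) <= 1 / 4 & normc (cosol E t%:C - 1) <= t / 4].
  move=> tT.
  have [|A1 A2 _] := short_time (csol_sisol E) tT.
    by rewrite sisol_0 sisol1_0 sqn0 /sqn !ReImE; ring.
  have [|B1 B2 _] := short_time (csol_cosol E) tT.
    by rewrite cosol_0 cosol1_0 sqn0 /sqn !ReImE; ring.
  rewrite sisol1_0 sisol_0 in A1 A2; rewrite cosol1_0 cosol_0 in B1 B2.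
  by split => //; [move: A2; rewrite subr0 mulr1|move: B1; rewrite subr0|move: B2; rewrite mulr0 subr0].
have lowr (p q : R[i]) (e : R) : normc (p - q) <= e -> normc q - e <= normc p.
  move=> H; have := normc_distl q (p - q); have -> : q + (p - q) = p by ring.
  by lra.
have S1 t : 0 <= t <= T -> 3 / 4 <= normc (sisol1 E t%:C).
  by move=> /ST [/lowr + _ _ _]; rewrite normc1; lra.
have S0 t : 0 <= t <= T -> 3 / 4 * t <= normc (sisol E t%:C).
  move=> tT; have [_ + _ _] := ST t tT; case/andP: tT => t0' _.
  by move/lowr; rewrite normcR (ger0_norm t0'); lra.
have sq (p : R[i]) (c : R) : 0 <= c -> c <= normc p -> c ^+ 2 <= sqn p.
  by move=> c0 cp; rewrite -normc_sqr; apply: lerXn2r; rewrite ?nnegrE // normc_ge0.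
have d0 := normc_ge0 (DL v E); have n0 := normc_ge0 (NL v E).
rewrite -!normc_sqr; set d := normc (DL v E) in d0 *; set n := normc (NL v E) in n0 *.
have T4 : T ^+ 4 <= T ^+ 2 by apply: ler_wiXn2l => //; lra.
have E4 : 0 <= Im E * T ^+ 4 by rewrite mulr_ge0 // exprn_ge0 // ltW.
case: (leP n d) => nd.
-  have yb t : 0 <= t <= T -> d / 2 <= normc (yL v E t%:C).
    move=> tT; have [_ A2 _ B2] := ST t tT.
    have /andP[t0' tT'] := tT.
    have : normc (yL v E t%:C - DL v E) <= d * (t / 4) + n * (5 / 4 * t).
      have -> : yL v E t%:C - DL v E = DL v E * (cosol E t%:C - 1) + NL v E * sisol E t%:C.
        by rewrite /yL; ring.
      apply: le_trans (le_normcD _ _) _; rewrite (normcM (DL v E)) (normcM (NL v E)) -/d -/n.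
      apply: lerD; first exact: (ler_wpM2l d0 B2).
      apply: (ler_wpM2l n0).
      have := le_normcD (sisol E t%:C - t%:C) t%:C; rewrite subrK normcR (ger0_norm t0'); lra.
    move/lowr; rewrite -/d.
    have : d * t <= d * (1 / 8) by apply: ler_wpM2l => //; lra.
    have : n * t <= d * (1 / 8) by apply: ler_pM => //; lra.
    lra.
  have ab t : 0 <= t <= T -> 9 / 16 * Im E * t <= af E t.
    move=> /andP[t0' tT].
    have := @nondecr_le R (fun t => 9 / 16 * Im E * t) (af E) (fun=> 9 / 16 * Im E)
       (fun t => Im E * (sqn (sisol1 E t%:C) + t ^+ 3 * sqn (sisol E t%:C))) 0 t t0'.
    rewrite mulr0 subr0 => H; apply: le_trans (H _ _ _) _ => [x _|x _|x /andP[x0 xt]|].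
    + by apply: rder_eq; [der|rewrite /=; ring].
    + exact: rder_pair (csol_sisol E).
    + rewrite mulrC; apply: ler_wpM2l => //.
      have : (3 / 4) ^+ 2 <= sqn (sisol1 E x%:C) by have xT := le_trans xt tT; apply: (sq _ (3 / 4)) => //; apply: S1; rewrite x0 xT.
      by move/aux1; apply; rewrite mulr_ge0 ?sqn_ge0 // exprn_ge0.
    + by rewrite lerBlDr lerDl af_ge0.
  have := @nondecr_le R (fun t => 9 / 128 * Im E * d ^+ 2 * t ^+ 2) G (fun t => 9 / 64 * Im E * d ^+ 2 * t)
    (fun t => sqn (yL v E t%:C) * af E t + sqn (sisol E t%:C) * bf E t) 0 T (ltW t0).
  rewrite G0 expr0n mulr0 !subr0 => H.
  apply: le_trans (H _ _ _) => [|x _|x /andP[x0 _]|x xT]; last 3 first.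
  + by apply: rder_eq; [der; exact: rder_id|rewrite /=; field].
  + exact: dG.
  + have /andP[x0 xT'] := xT.
    have A := ab x xT; have B := sq _ _ _ (yb x xT).
    have {}B : (d / 2) ^+ 2 <= sqn (yL v E x%:C) by apply: B; lra.
    have [b0 _] := bf_ge E0 x0 (lexx x) (le_trans xT' Tl).
    have X : 0 <= sqn (sisol E x%:C) * bf E x by apply: mulr_ge0; [exact: sqn_ge0|].
    apply: aux4 X; apply: ler_pM => //; by rewrite !mulr_ge0.
  + have dT4 : Im E * T ^+ 4 * n ^+ 2 <= Im E * T ^+ 4 * d ^+ 2.
      by apply: ler_wpM2l => //; apply: lerXn2r; rewrite ?nnegrE // ltW.
    have dT2 : Im E * d ^+ 2 * T ^+ 4 <= Im E * d ^+ 2 * T ^+ 2.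
      by apply: ler_wpM2l => //; rewrite mulr_ge0 // sqr_ge0.
    by apply: aux3 dT4 dT2 _; apply: mulr_ge0; [apply: mulr_ge0; [exact: E0|exact: sqr_ge0]|exact: sqr_ge0].
-  have yb t : 0 <= t <= T -> n / 2 <= normc (yL1 v E t%:C).
    move=> tT; have [A1 _ B1 _] := ST t tT.
    have : normc (yL1 v E t%:C - NL v E) <= d * (1 / 4) + n * (1 / 4).
      have -> : yL1 v E t%:C - NL v E = DL v E * cosol1 E t%:C + NL v E * (sisol1 E t%:C - 1).
        by rewrite /yL1; ring.
      by apply: le_trans (le_normcD _ _) _; rewrite (normcM (DL v E)) (normcM (NL v E)) -/d -/n; apply: lerD; [exact: (ler_wpM2l d0 B1)|exact: (ler_wpM2l n0 A1)].
    by move/lowr; rewrite -/n; lra.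
  have bb t : 0 <= t <= T -> 1 / 4 * Im E * n ^+ 2 * (T - t) <= bf E t.
    move=> /andP[t0' tT].
    have := @nondecr_le R (fun t => 1 / 4 * Im E * n ^+ 2 * t) (fun t => Im (E * yL v E t%:C * cj (yL1 v E t%:C)))
       (fun=> 1 / 4 * Im E * n ^+ 2)
       (fun t => Im E * (sqn (yL1 v E t%:C) + t ^+ 3 * sqn (yL v E t%:C))) t T tT.
    rewrite -mulrBr => H; apply: le_trans (H _ _ _) _ => [x _|x _|x /andP[tx xT]|].
    + by apply: rder_eq; [der; exact: rder_id|rewrite /=; ring].
    + exact: rder_pair (csol_yL v E).
    + rewrite -mulrA mulrCA; apply: ler_wpM2l => //.
      have x0 : 0 <= x by exact: le_trans tx.
      have : (n / 2) ^+ 2 <= sqn (yL1 v E x%:C) by apply: (sq _ (n / 2)); [exact: divr_ge0|apply: yb; rewrite x0 xT].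
      by move/aux2; apply; rewrite mulr_ge0 ?sqn_ge0 // exprn_ge0.
    + have [|bT _] := bf_ge E0 (ltW t0) (lexx T); first exact: Tl.
      by rewrite gerDr -oppr_ge0.
  have := @nondecr_le R (fun t => 9 / 64 * Im E * n ^+ 2 * (T * t ^+ 3 / 3 - t ^+ 4 / 4)) G
    (fun t => 9 / 64 * Im E * n ^+ 2 * (T * t ^+ 2 - t ^+ 3))
    (fun t => sqn (yL v E t%:C) * af E t + sqn (sisol E t%:C) * bf E t) 0 T (ltW t0).
  rewrite G0 !expr0n /= !(mulr0, mul0r, subr0) => H.
  apply: le_trans (H _ _ _) => [|x _|x /andP[x0 _]|x xT]; last 3 first.
  + by apply: rder_eq; [der; exact: rder_id|rewrite /=; field].
  + exact: dG.
  + have /andP[x0 xT'] := xT.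
    have A := bb x xT; have B := sq _ _ _ (S0 x xT).
    have {}B : (3 / 4 * x) ^+ 2 <= sqn (sisol E x%:C) by apply: B; lra.
    have X : 0 <= sqn (yL v E x%:C) * af E x by apply: mulr_ge0; [exact: sqn_ge0|exact: af_ge0].
    apply: aux6 X; apply: ler_pM => //; first exact: sqr_ge0.
    apply: mulr_ge0; last by rewrite subr_ge0.
    by rewrite !mulr_ge0 ?sqr_ge0.
  + have dT4 : Im E * T ^+ 4 * d ^+ 2 <= Im E * T ^+ 4 * n ^+ 2.
      by apply: ler_wpM2l => //; apply: lerXn2r; rewrite ?nnegrE // ltW.
    have -> : T * T ^+ 3 / 3 - T ^+ 4 / 4 = T ^+ 4 / 12 by field.
    by apply: aux5 dT4 _; apply: mulr_ge0; [exact: E4|exact: sqr_ge0].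
Qed.

End lower_bound.
End determinant_bounds.

(** * Size of the connection coefficients *)

Section determinant_growth.
Variable R : realType.
Implicit Types (z v E : R[i]) (y : R[i] -> R[i]).

Lemma sec0 : sector (0 : R). Proof. by rewrite /sector normr0 divr_ge0 ?pi_ge0. Qed.

(** The constant [CB] for normalized data, as a function of |E| alone: convergence is uniform on
    discs. *)
Definition CBr (r : R) : R := (8 + 4 * pi) * (3 * expR (5 * r + 10)) * (r + 2).

Lemma CBr_mono r r' : 0 <= r -> r <= r' -> CBr r <= CBr r'.
Proof.
move=> r0 rr; have p0 := pi_ge0 R; rewrite /CBr; apply: ler_pM; rewrite ?mulr_ge0 ?expR_ge0 //; try lra.
apply: ler_wpM2l; first lra.
by apply: ler_wpM2l; rewrite // ler_expR; lra.
Qed.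

Lemma DL_unif E s : 0 <= s -> normc (DL (vv s 0) E - Dd E) <= CBr (normc E) * expR (- s).
Proof.
move=> s0; apply: le_trans (DL_dist E sec0 s0) _.
by rewrite /CB /MB /CBr /kE sisol_0 sisol1_0 normc0 normc1 add0r mulr1.
Qed.
Lemma NL_unif E s : 0 <= s -> normc (NL (vv s 0) E - Nd E) <= CBr (normc E) * expR (- s).
Proof.
move=> s0; apply: le_trans (NL_dist E sec0 s0) _.
by rewrite /CB /MB /CBr /kE cosol_0 cosol1_0 normc0 normc1 addr0 mulr1.
Qed.

Lemma eventually_small (B e : R) : 0 < e -> exists N, forall n, (N <= n)%N -> B * expR (- n%:R) <= e.
Proof.
move=> e0; exists (Num.truncn (`|B| / e)).+1 => n Nn.
rewrite expRN ler_pdivrMr ?expR_gt0 //.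
apply: le_trans (ler_norm B) _; rewrite -ler_pdivrMl // mulrC.
have : `|B| / e < ((Num.truncn (`|B| / e)).+1)%:R by exact: truncnS_gt.
have : (((Num.truncn (`|B| / e)).+1)%:R : R) <= n%:R by rewrite ler_nat.
have := expR_ge1Dx (n%:R : R); lra.
Qed.

Lemma sqnE z : (sqn z)%:C = z * cj z.
Proof. by apply: eqC; rewrite /sqn !ReImE; ring. Qed.

Lemma ccvg_ge0 (x : nat -> R) l N : ccvg (fun n => (x n)%:C) l%:C ->
  (forall n, (N <= n)%N -> 0 <= x n) -> 0 <= l.
Proof.
move=> xl H; rewrite -(opprK l) oppr_ge0; apply/ler_addgt0Pl => e e0; rewrite addr0.
have [M HM] := xl _ e0.
have A := HM _ (leq_maxl M N); have B := H _ (leq_maxr M N).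
move: A; rewrite -cCN -cCD normcR => /ler_normlP[]; lra.
Qed.

Lemma ccvg_sqn (u : nat -> R[i]) l : ccvg u l -> ccvg (fun n => (sqn (u n))%:C) (sqn l)%:C.
Proof.
move=> ul; rewrite sqnE; apply: ccvg_ext (ccvgM ul (ccvgJ ul)) => n.
by rewrite sqnE.
Qed.

Lemma sqn_lim_le (u w : nat -> R[i]) a b (k : R) N : ccvg u a -> ccvg w b ->
  (forall n, (N <= n)%N -> sqn (u n) + k <= sqn (w n)) -> sqn a + k <= sqn b.
Proof.
move=> ua wb H; rewrite -subr_ge0.
have cv := ccvgD (ccvg_sqn wb) (ccvgN (ccvgD (ccvg_sqn ua) (ccvg_cst k%:C))).
apply: (@ccvg_ge0 (fun n => sqn (w n) - (sqn (u n) + k)) _ N).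
  rewrite (cCD (sqn b)) cCN (cCD (sqn a)); apply: (ccvg_ext _ cv) => n /=.
  by rewrite (cCD (sqn (w n))) cCN (cCD (sqn (u n))).
by move=> n /H; rewrite subr_ge0.
Qed.

Definition ray r (phi : R) : R[i] := r%:C * cis phi.

Lemma normc_ray r phi : 0 <= r -> normc (ray r phi) = r.
Proof. by move=> r0; rewrite normcM normc_cis mulr1 normcR ger0_norm. Qed.
Lemma Im_ray r phi : Im (ray r phi) = r * sin phi.
Proof. by rewrite ImM Im_cis ReC ImC; ring. Qed.

Lemma normc_near z w : normc z - normc (w - z) <= normc w.
Proof. by have := normc_distl z (w - z); rewrite (addrC w) addrA subrr add0r. Qed.

Lemma rate_aux (m I t S q X : R) : 0 <= m -> m <= I -> 0 <= t -> 0 <= q -> q <= S ->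
  I * t / 1000 * S <= X -> m * t / 500 * q <= 2 * X.
Proof.
move=> m0 mI t0 q0 qS; have A : m * t <= I * t by exact: ler_wpM2r.
have B : m * t * q <= I * t * S by apply: ler_pM => //; exact: mulr_ge0.
lra.
Qed.

Lemma rate_aux2 (x y d0 n0 d n e q : R) : x <= e -> y <= e -> d0 - x <= d -> n0 - y <= n ->
  2 * q <= d0 + n0 -> e <= q / 4 -> 0 <= q -> q ^+ 2 <= d ^+ 2 + n ^+ 2.
Proof.
move=> H1 H2 H3 H4 H5 H6 q0; have : 3 / 2 * q <= d + n by lra.
have := sqr_ge0 (d - n); nra.
Qed.

(** [IL_ge] integrated over an arc at finite level, then passed to the limit. With c = q = 0 it is
    plain monotonicity; a positive [q] makes it quantitative. *)
Lemma determinant_rate r (p1 p2 c q : R) : 0 <= r -> p1 <= p2 -> 0 <= c -> 0 <= q ->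
  (forall p, p1 <= p <= p2 -> c <= sin p /\ 2 * q <= normc (Dd (ray r p)) + normc (Nd (ray r p))) ->
  sqn (Dd (ray r p1)) + (p2 - p1) * (r * c * (8 * (1 + r))^-1 ^+ 4 / 500 * q ^+ 2) <= sqn (Dd (ray r p2)).
Proof.
move=> r0 p12 c0 q0 H.
(* The error at level n is measured against [q], so the case q = 0 stands apart. *)
have [N HN] : exists N, forall n, (N <= n)%N -> CBr r * expR (- n%:R) <= q / 4 \/ q = 0.
  move: q0; rewrite le_eqVlt => /orP[/eqP <-|q0]; first by exists 0%N => n _; right.
  by have [N HN] := eventually_small (CBr r) (divr_gt0 q0 (ltr0Sn R 3)); exists N => n /HN; left.
apply: (sqn_lim_le (DL_cvg _ sec0) (DL_cvg _ sec0)) => n; move: n.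
have [IL hIL] : exists IL : nat -> R[i] -> R[i], forall n, isIL n%:R (IL n).
  have [|f Hf] := @choice _ _ (fun n IL => isIL (n%:R : R) IL).
    by move=> n; exact: IL_exists.
  by exists f.
move=> n Nn; have n0 : 0 <= n%:R :> R by [].
set k := _ * q ^+ 2; rewrite -lerBrDl.
have -> : (p2 - p1) * k = k * p2 - k * p1 by ring.
apply: (@nondecr_le R (fun p => k * p) (fun p => sqn (DL (vv n%:R 0) (ray r p))) (fun=> k)
  (fun p => 2 * Im (ray r p * cj (DL (vv n%:R 0) (ray r p)) * IL n (ray r p))) p1 p2 p12) => p pp.
- by apply: rder_eq; [der; exact: rder_id|rewrite /=; ring].
- have d1 : cder (fun p => ray r p) p ('i%C * ray r p).
    by apply: cder_eq (cderM (cder_cst r%:C p) (cder_cis (rder_id p))) _; rewrite cC1 /ray; ring.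
  have d2 := cder_holo (holo_DL n0 (hIL n)) d1.
  apply: rder_eq (rder_sqn d2) _ => /=.
  move: (ray r p) (DL _ _) (IL _ _) => E D I; rewrite /dotc !ReImE; ring.
have [cp qp] := H p pp.
have ic : 0 <= Im (ray r p) by rewrite Im_ray mulr_ge0 //; exact: le_trans cp.
have := IL_ge n0 (hIL n) ic.
have a := DL_unif (ray r p) n0; have b := NL_unif (ray r p) n0.
rewrite normc_ray // in a b.
rewrite /tau normc_ray // => HI.
apply: rate_aux HI; rewrite ?sqr_ge0 ?exprn_ge0 ?invr_ge0 //; first exact: mulr_ge0.
- by rewrite Im_ray; apply: ler_wpM2l.
- by apply: mulr_ge0 => //; apply: addr_ge0.
have [small|->] := HN n Nn; last by rewrite expr0n addr_ge0 ?sqn_ge0.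
have D := normc_near (Dd (ray r p)) (DL (vv n%:R 0) (ray r p)).
have M := normc_near (Nd (ray r p)) (NL (vv n%:R 0) (ray r p)).
by rewrite -!normc_sqr; exact: rate_aux2 a b D M qp small q0.
Qed.

(** The scale of all later estimates: products add exponents, and powers of [rho] are absorbed by
    [poly_le_eb]. [KD], [KI], [KT], [KG], [K0] and [KA] are exponents on this scale, independent of
    [rho]. *)
Definition eb (k rho : R) : R := expR (k * rho ^+ 5).

Lemma ebD k k' rho : eb (k + k') rho = eb k rho * eb k' rho.
Proof. by rewrite /eb mulrDl expRD. Qed.
Lemma ebN k rho : eb (- k) rho = (eb k rho)^-1.
Proof. by rewrite /eb mulNr expRN. Qed.
Lemma eb_gt0 k rho : 0 < eb k rho. Proof. exact: expR_gt0. Qed.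
Lemma eb_ge0 k rho : 0 <= eb k rho. Proof. exact: expR_ge0. Qed.
Lemma eb_le k k' rho : 1 <= rho -> k <= k' -> eb k rho <= eb k' rho.
Proof.
by move=> r1 kk; rewrite /eb ler_expR ler_wpM2r // exprn_ge0 //; lra.
Qed.
Lemma eb_ge1 k rho : 1 <= rho -> 0 <= k -> 1 <= eb k rho.
Proof.
move=> r1 k0; rewrite /eb -[X in X <= _]expR0 ler_expR mulr_ge0 // exprn_ge0 //; lra.
Qed.
Lemma ebX k rho n : eb k rho ^+ n = eb (n%:R * k) rho.
Proof. by rewrite /eb -expRM_natl mulrA. Qed.

Lemma poly_le_eb c (rho : R) n : 0 <= c -> 1 <= rho -> c * rho ^+ n <= eb (c + n%:R) rho.
Proof.
move=> c0 r1; rewrite ebD.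
have r5 : rho <= rho ^+ 5 by rewrite -[X in X <= _]expr1; apply: ler_weXn2l.
have r5' : 1 <= rho ^+ 5 by exact: exprn_ege1.
have r0 : 0 <= rho by lra.
apply: ler_pM => //; first exact: exprn_ge0.
  have := expR_ge1Dx (c * rho ^+ 5); rewrite -/(eb c rho); nra.
have -> : eb n%:R rho = eb 1 rho ^+ n by rewrite ebX mulr1.
apply: lerXn2r; rewrite ?nnegrE ?eb_ge0 //.
by have := expR_ge1Dx (1 * rho ^+ 5); rewrite -/(eb 1 rho); lra.
Qed.

Lemma exponent_le (kp rho : R) E : 1 <= rho -> normc E <= kp * rho ^+ 6 ->
  expR ((2 * rho ^+ 6 + 5 * normc E + 8) / rho) <= eb (10 + 5 * kp) rho.
Proof.
move=> r1 HE; have r0 : 0 < rho by lra.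
rewrite /eb ler_expR ler_pdivrMr // -mulrA -exprSr.
have : 1 <= rho ^+ 6 by exact: exprn_ege1.
nra.
Qed.

(** Half of (32 + 6) + (10 + 5 kp), rounded up; half, because [conn_le] bounds the square. *)
Definition KD (kp : R) : R := 25 + 3 * kp.

Lemma Dd_le (kp rho : R) E : 0 <= kp -> 1 <= rho -> normc E <= kp * rho ^+ 6 ->
  normc (Dd E) <= eb (KD kp) rho /\ normc (Nd E) <= eb (KD kp) rho.
Proof.
move=> k0 r1 HE; have X := exponent_le r1 HE.
have r6 : 1 <= rho ^+ 6 by exact: exprn_ege1.
have P := @poly_le_eb 32 rho 6 (ler0n _ _) r1.
have sq (z : R[i]) : sqn z <= 32 * rho ^+ 6 * eb (10 + 5 * kp) rho -> normc z <= eb (KD kp) rho.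
  move=> H; rewrite -(@ler_pXn2r _ 2) ?nnegrE ?normc_ge0 ?eb_ge0 // normc_sqr ebX.
  apply: le_trans H _; apply: le_trans (ler_wpM2r (eb_ge0 _ _) P) _.
  by rewrite -ebD; apply: eb_le => //; rewrite /KD; lra.
have e0 := eb_ge0 (10 + 5 * kp) rho.
split; last rewrite /Nd normcN; apply: sq.
- apply: le_trans (conn_le (csol_sisol E) r1) _; rewrite sisol_0 sisol1_0 sqn0 mulr0 addr0.
  rewrite (_ : sqn 1 = 1); last by rewrite /sqn !ReImE; ring.
  by apply: ler_pM; rewrite ?expR_ge0 //; lra.
- apply: le_trans (conn_le (csol_cosol E) r1) _; rewrite cosol_0 cosol1_0 sqn0 add0r.
  rewrite (_ : sqn 1 = 1); last by rewrite /sqn !ReImE; ring.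
  by apply: ler_pM; rewrite ?expR_ge0 //; lra.
Qed.

(** In [quantum_wronskian] the data at the rotated point are at most [eb (KD kp) rho]; were those at
    [E] smaller than stated, the right side could not have modulus 2. *)
Lemma Dd_Nd_ge (kp rho : R) E : 0 <= kp -> 1 <= rho -> normc E <= kp * rho ^+ 6 ->
  2 * eb (- KD kp) rho <= normc (Dd E) + normc (Nd E).
Proof.
move=> k0 r1 HE.
have HE' : normc (cis (2 * pi / 5) ^+ 2 * E) <= kp * rho ^+ 6.
  by rewrite normcM normcX normc_cis expr1n mul1r.
have [D1 N1] := Dd_le k0 r1 HE'.
have := quantum_wronskian (erefl (cis (2 * pi / 5) ^+ 2 * E)).
set D' := Dd (_ * E) in D1 *; set N' := Nd (_ * E) in N1 * => Q.
have : 2 <= normc (Dd E) * normc N' + normc (Nd E) * normc D'.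
  have <- : normc (2 * cis (3 * pi / 10) : R[i]) = 2 by rewrite normcM normc_cis mulr1 normc_nat.
  rewrite -Q; apply: le_trans (normcB _ _) _; rewrite !normcM normc_cis mul1r //.
have d0 := normc_ge0 (Dd E); have n0 := normc_ge0 (Nd E).
move=> H; have : 2 <= (normc (Dd E) + normc (Nd E)) * eb (KD kp) rho.
  rewrite mulrDl; apply: le_trans H _; apply: lerD; exact: ler_wpM2l.
by rewrite ebN -ler_pdivrMr ?eb_gt0.
Qed.

End determinant_growth.

(** * Lipschitz bounds for the determinant *)

Section lipschitz.
Variable R : realType.
Implicit Types (z v E : R[i]) (y : R[i] -> R[i]).

Lemma nn_yL v E : nn (yL v E) (yL1 v E) v = sqn (am v ^+ 2 * cexp v ^+ 3).
Proof.
rewrite /nn /Pw /Qw yL_at yL1_at /mul.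
have -> : 1 / 2 * am v * (- (3 / 4 / cexp v ^+ 2 + cexp v ^+ 3) * am v +
   (3 / 4 / cexp v ^+ 2 + cexp v ^+ 3) * am v) = 0 by ring.
rewrite sqn0 add0r; congr sqn; move: (am v) (cexp v ^+ 3) (3 / 4 / _) => a c b.
by field.
Qed.

Lemma cexp_vv0 s : cexp (vv s 0) = (expR s)%:C :> R[i].
Proof. by rewrite /vv cC0 mulr0 addr0 cexpR. Qed.

Lemma Re5_0 (s : R) : Re (cexp (vv s 0) ^+ 5) = expR s ^+ 5.
Proof. by rewrite cexp_vv0 -cCX. Qed.

Lemma sqn_am s : sqn (am (vv s 0)) ^+ 2 = expR (- 6 * s) * (om s 0)^-1 :> R.
Proof.
have E : - (3 / 2) * vv s 0 - 2 / 5 * cexp (vv s 0) ^+ 5 = (- (3 / 2) * s - 2 / 5 * expR s ^+ 5)%:C :> R[i].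
  by rewrite cexp_vv0 /vv cC0 mulr0 addr0 -cCX -[2]cCn -[3]cCn -[5]cCn -!cCV -!cCM -!cCN -!cCM -!cCD.
rewrite /am E sqn_cexp ReC /om Re5_0 -expRN -expRD -expRM_natl; congr expR.
by field.
Qed.

Lemma sqn_PQ E y y1 (s : R) : sqn (am (vv s 0)) * expR s ^+ 6 * sqn (y (expR (2 * s))%:C) <= 2 * nn y y1 (vv s 0).
Proof.
have := sqnD_le (Pw y y1 (vv s 0)) (Qw y y1 (vv s 0)).
rewrite PQw !cexp_vv0 -!cCX (sqnM (_ * _)) (sqnM (am _)) sqnC -exprM.
by have -> : expR s ^+ 2 = expR (2 * s) by rewrite -expRM_natl.
Qed.

Lemma normc_le_sqn z (c : R) : 0 <= c -> sqn z <= c ^+ 2 -> normc z <= c.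
Proof. by move=> c0 H; rewrite -(@ler_pXn2r _ 2) ?nnegrE ?normc_ge0 // normc_sqr. Qed.

Lemma ler_sqr_prod (a b B p q m : R) : 0 <= p -> 0 <= q -> 0 < m -> 0 <= B ->
  m * p <= 2 * a -> m * q <= 2 * b -> 0 <= a -> 0 <= b -> a * b <= B -> p * q <= 4 * B / m ^+ 2.
Proof.
move=> p0 q0 m0 B0 Hp Hq a0 b0 ab; rewrite ler_pdivlMr ?exprn_gt0 //.
have -> : p * q * m ^+ 2 = (m * p) * (m * q) by ring.
apply: (@le_trans _ _ ((2 * a) * (2 * b))); last by lra.
by apply: ler_pM => //; apply: mulr_ge0 => //; exact: ltW.
Qed.

(** Forward propagation bounds [sisol], weighted backward propagation bounds [yL] from its end
    point, and the weights [om] cancel in the product. In terms of the position exp (2 x) the bound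
    is its power -3/2, integrable at infinity uniformly in [s]. *)
Lemma yL_sisol_tail (kp rho s x : R) E : 0 <= kp -> 1 <= rho -> normc E <= kp * rho ^+ 6 ->
  ln rho <= x -> x <= s ->
  normc (yL (vv s 0) E (expR (2 * x))%:C * sisol E (expR (2 * x))%:C) <= 2 * eb (18 + 5 * kp) rho * expR (- 3 * x).
Proof.
move=> k0 r1 HE lx xs; have l0 : 0 <= ln rho by exact: ln_ge0.
have x0 : 0 <= x by lra.
set B := eb _ rho; have B0 : 0 <= B by exact: eb_ge0.
have X := exponent_le r1 HE.
have nS : nn (sisol E) (sisol1 E) (vv x 0) <= B.
  apply: le_trans (nn_all (csol_sisol E) r1 (sec0 R) lx) _; rewrite sisol_0 sisol1_0 sqn0 mulr0 addr0.
  have -> : sqn (1 : R[i]) = 1 by rewrite /sqn !ReImE; ring.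
  have P := @poly_le_eb R 8 rho 0 (ler0n _ _) r1; rewrite expr0 addr0 in P.
  have EB : 8 + (10 + 5 * kp) = 18 + 5 * kp by ring.
  rewrite /B -EB ebD.
  by apply: ler_pM => //; rewrite ?expR_ge0 ?mulr1.
have o0 : 0 < om x 0 :> R by exact: expR_gt0.
have nY : om x 0 * nn (yL (vv s 0) E) (yL1 (vv s 0) E) (vv x 0) <= B.
  apply: le_trans (nn_back (csol_yL (vv s 0) E) (sec0 R) x0 xs) _.
  (* At its own end point [yL] has no growing component, and its weighted size is exactly 1. *)
  have -> : om s 0 * nn (yL (vv s 0) E) (yL1 (vv s 0) E) (vv s 0) = 1.
    rewrite nn_yL sqnM cexp_vv0 -cCX sqnC [sqn (am _ ^+ 2)]sqnM -expr2 sqn_am -exprM.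
    have e6 : expR (- 6 * s) * expR s ^+ (3 * 2) = 1.
      by rewrite -expRM_natl -expRD (_ : _ + _ = 0) ?expR0 //; ring.
    have os : om s 0 != 0 :> R by rewrite gt_eqF // expR_gt0.
    by rewrite mulrAC e6 mul1r mulfV.
  rewrite mul1r /B /eb ler_expR.
  have rx : rho^-1 >= expR (- x).
    by rewrite expRN lef_pV2 ?posrE ?expR_gt0 ?(lt_le_trans ltr01) // -ler_ln ?posrE ?expR_gt0 ?(lt_le_trans ltr01) // expRK.
  have kE0 := kE_ge E.
  apply: (@le_trans _ _ (4 * kE E * rho^-1)); first by apply: ler_wpM2l rx; lra.
  rewrite -/(_ / rho) ler_pdivrMr ?(lt_le_trans ltr01) // -mulrA -exprSr /kE.
  have := @exprn_ege1 _ 6 rho r1; nra.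
set m := sqn (am (vv x 0)) * expR x ^+ 6.
have a0 : 0 < sqn (am (vv x 0)) by apply: sqn_gt0; exact: cexp_neq0.
have m0 : 0 < m by rewrite mulr_gt0 // exprn_gt0 // expR_gt0.
have m2 : m ^+ 2 = (om x 0)^-1 * expR (3 * x) ^+ 2.
  rewrite /m exprMn sqn_am -exprM -!expRM_natl mulrAC mulrC; congr (_ * _).
  by rewrite -expRD; congr expR; ring.
apply: normc_le_sqn.
  by rewrite mulr_ge0 ?expR_ge0 // mulr_ge0.
rewrite sqnM.
have oB : nn (yL (vv s 0) E) (yL1 (vv s 0) E) (vv x 0) * nn (sisol E) (sisol1 E) (vv x 0) <= (om x 0)^-1 * B ^+ 2.
  rewrite mulrC -ler_pdivrMl ?invr_gt0 // invrK mulrCA expr2.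
  by apply: ler_pM => //; rewrite ?nn_ge0 // mulr_ge0 ?nn_ge0 // ltW.
apply: le_trans (ler_sqr_prod (sqn_ge0 _) (sqn_ge0 _) m0 _ (sqn_PQ E (yL (vv s 0) E) (yL1 (vv s 0) E) x)
  (sqn_PQ E (sisol E) (sisol1 E) x) (nn_ge0 _ _ _) (nn_ge0 _ _ _) oB) _.
  by rewrite mulr_ge0 ?invr_ge0 ?(ltW o0) // sqr_ge0.
rewrite m2 mulNr expRN; have := expR_gt0 (3 * x).
move: (om x 0) (expR _) o0 => o e o0 e0; rewrite le_eqVlt; apply/orP; left; apply/eqP.
by field; rewrite !gt_eqF.
Qed.

Lemma local_bound (kp rho : R) E (x : R) : 0 <= kp -> 1 <= rho -> normc E <= kp * rho ^+ 6 -> 0 <= x <= rho ^+ 2 ->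
  normc (sisol E x%:C) <= eb (2 + kp) rho /\ normc (cosol E x%:C) <= eb (2 + kp) rho.
Proof.
move=> k0 r1 HE /andP[x0 xr]; have r0 : 0 < rho by lra.
have r6 : 1 <= rho ^+ 6 by exact: exprn_ege1.
have r3 : 0 < rho ^+ 3 by exact: exprn_gt0.
have G y y1 : csol E y y1 -> sqn (y1 0) + rho ^+ 6 * sqn (y 0) <= rho ^+ 6 -> normc (y x%:C) <= eb (2 + kp) rho.
  move=> sy ini.
  have := @segment_gronwall R E y y1 0 x%:C ((1 + kp) * rho ^+ 6) (rho ^+ 3) sy r3.
  have k1 : 1 <= eb (2 + kp) rho by apply: eb_ge1 => //; lra.
  move=> H; apply: normc_le_sqn; first lra.
  have {}H := H _; rewrite subr0 normcR ger0_norm // in H.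
  have Hb : forall s, 0 <= s <= 1 -> normc ((0 + s%:C * x%:C) ^+ 3 - E) <= (1 + kp) * rho ^+ 6.
    move=> s /andP[s0 s1]; apply: le_trans (normcB _ _) _.
    rewrite add0r -cCM -cCX normcR ger0_norm ?exprn_ge0 ?mulr_ge0 // mulrDl mul1r.
    apply: lerD => //; have -> : rho ^+ 6 = (rho ^+ 2) ^+ 3 by rewrite -exprM.
    apply: lerXn2r; rewrite ?nnegrE ?mulr_ge0 ?exprn_ge0 ?(ltW r0) //.
    by rewrite -[X in _ <= X]mul1r; apply: ler_pM.
  have {}H := H Hb; rewrite -exprM in H.
  have : rho ^+ 6 * sqn (y x%:C) <= rho ^+ 6 * eb (2 + kp) rho.
    apply: le_trans (_ : _ <= sqn (y1 x%:C) + rho ^+ 6 * sqn (y x%:C)) _; first by rewrite lerDr sqn_ge0.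
    apply: le_trans H _; apply: ler_pM => //; rewrite ?expR_ge0 ?(addr_ge0 (sqn_ge0 _) (mulr_ge0 _ (sqn_ge0 _))) //.
      by apply: exprn_ge0; lra.
    rewrite ler_expR ler_pdivrMr // -mulrA -exprD.
    have -> : rho ^+ (5 + 3) = rho ^+ 2 * rho ^+ 6 by rewrite -exprD.
    have -> : (1 + kp) * rho ^+ 6 + rho ^+ (3 * 2) = (2 + kp) * rho ^+ 6 by ring.
    by rewrite mulrCA; apply: ler_wpM2l; [lra|apply: ler_wpM2r; lra].
  rewrite ler_pM2l; last lra.
  move=> /le_trans; apply; rewrite expr2 -[X in X <= _]mulr1; apply: ler_wpM2l => //; lra.
split; [apply: (G _ _ (csol_sisol E))|apply: (G _ _ (csol_cosol E))].
  rewrite sisol_0 sisol1_0 sqn0 mulr0 addr0.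
  by have -> : sqn (1 : R[i]) = 1 by rewrite /sqn !ReImE; ring.
rewrite cosol_0 cosol1_0 sqn0 add0r.
by have -> : sqn (1 : R[i]) = 1 by [rewrite /sqn !ReImE; ring]; rewrite mulr1.
Qed.

Lemma DL_le (kp rho s : R) E : 0 <= kp -> 1 <= rho -> normc E <= kp * rho ^+ 6 -> ln rho <= s ->
  normc (DL (vv s 0) E) <= eb (KD kp) rho /\ normc (NL (vv s 0) E) <= eb (KD kp) rho.
Proof.
move=> k0 r1 HE ls; have X := exponent_le r1 HE.
have r6 : 1 <= rho ^+ 6 by exact: exprn_ege1.
have P := @poly_le_eb R 32 rho 6 (ler0n _ _) r1.
have e0 := eb_ge0 (10 + 5 * kp) rho.
have G y y1 : csol E y y1 -> sqn (y1 0) + rho ^+ 6 * sqn (y 0) <= rho ^+ 6 ->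
    normc (2 * Pw y y1 (vv s 0)) <= eb (KD kp) rho.
  move=> sy ini; apply: normc_le_sqn; first exact: eb_ge0.
  have -> : sqn (2 * Pw y y1 (vv s 0)) = 4 * sqn (Pw y y1 (vv s 0)).
    by rewrite sqnM; congr (_ * _); rewrite /sqn !ReImE; ring.
  have nP : sqn (Pw y y1 (vv s 0)) <= nn y y1 (vv s 0) by rewrite lerDl sqn_ge0.
  have N := nn_all sy r1 (sec0 R) ls.
  apply: (@le_trans _ _ (32 * rho ^+ 6 * eb (10 + 5 * kp) rho)).
    apply: (@le_trans _ _ (4 * (8 * (rho ^+ 6) * eb (10 + 5 * kp) rho))); last by rewrite !mulrA; lra.
    apply: ler_wpM2l => //; apply: le_trans nP _; apply: le_trans N _.
    apply: ler_pM => //; rewrite ?expR_ge0 //.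
      by rewrite mulr_ge0 // (addr_ge0 (sqn_ge0 _) (mulr_ge0 _ (sqn_ge0 _))) //; lra.
    exact: ler_wpM2l.
  rewrite ebX; apply: le_trans (ler_wpM2r (eb_ge0 _ _) P) _.
  by rewrite -ebD; apply: eb_le => //; rewrite /KD; lra.
have s1 : sqn (1 : R[i]) = 1 by rewrite /sqn !ReImE; ring.
split; last rewrite /NL normcN; [apply: (G _ _ (csol_sisol E))|apply: (G _ _ (csol_cosol E))].
  by rewrite sisol_0 sisol1_0 sqn0 mulr0 addr0 s1.
by rewrite cosol_0 cosol1_0 sqn0 add0r s1 mulr1.
Qed.

Definition KI (kp : R) : R := 35 + 5 * kp.

(** The integral is split at rho^2: [local_bound] below, [yL_sisol_tail] above, where the
    logarithmic substitution turns the integrand into exp (- x). *)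
Lemma IL_le (kp rho s : R) IL E : 0 <= kp -> 1 <= rho -> normc E <= kp * rho ^+ 6 -> ln rho <= s -> isIL s IL ->
  normc (IL E) <= eb (KI kp) rho.
Proof.
move=> k0 r1 HE ls hIL; have r0 : 0 < rho by lra.
have l0 : 0 <= ln rho by exact: ln_ge0.
have [U [dU U0 Ul]] := hIL E.
have r2 : rho ^+ 2 = expR (2 * ln rho) by rewrite expRM_natl lnK.
have [D N] := DL_le k0 r1 HE ls.
set e := eb (2 + kp) rho; have e0 : 0 <= e by exact: eb_ge0.
set d := eb (KD kp) rho in D N; have d0 : 0 <= d by exact: eb_ge0.
have A : normc (U (rho ^+ 2) - U 0) <= (2 * d * e) * e * (rho ^+ 2 - 0).
  apply: (int_le (u := fun x => yL (vv s 0) E x%:C * sisol E x%:C)); first exact: sqr_ge0.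
    by move=> x /andP[x0 _]; apply: dU; lra.
  move=> x xx; have [S C] := local_bound k0 r1 HE xx.
  rewrite (normcM (yL _ _ _)); apply: ler_pM => //; rewrite ?normc_ge0 //.
  rewrite /yL; apply: le_trans (le_normcD _ _) _; rewrite (normcM (DL _ _)) (normcM (NL _ _)).
  have -> : 2 * d * e = d * e + d * e by ring.
  by apply: lerD; apply: ler_pM => //; rewrite ?normc_ge0.
set B := eb (18 + 5 * kp) rho; have B0 : 0 <= B by exact: eb_ge0.
have T : normc (U (expR (2 * s)) - U (expR (2 * ln rho))) <= (- 4 * B * expR (- s)) - (- 4 * B * expR (- ln rho)).
  apply: (normc_incr_le (u := fun x => U (expR (2 * x))) (g := fun x => - 4 * B * expR (- x))
    (u' := fun x => (2 * expR (2 * x))%:C * (yL (vv s 0) E (expR (2 * x))%:C * sisol E (expR (2 * x))%:C))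
    (g' := fun x => 4 * B * expR (- x)) ls) => x /andP[lx xs].
  - have dd : rder (fun x => expR (2 * x)) x (2 * expR (2 * x)).
      by apply: rder_eq (rder_expR (rderM (rder_cst 2 x) (rder_id x))) _; ring.
    apply: cder_comp dd _; apply: dU; have := expR_gt0 (2 * x); lra.
  - by apply: rder_eq (rderM (rder_cst (- 4 * B) x) (rder_expR (rder_opp x))) _; ring.
  - rewrite normcM normcR ger0_norm ?mulr_ge0 ?expR_ge0 //.
    have Y := yL_sisol_tail k0 r1 HE lx xs.
    apply: le_trans (ler_wpM2l _ Y) _; first by rewrite mulr_ge0 ?expR_ge0.
    have -> : 2 * expR (2 * x) * (2 * eb (18 + 5 * kp) rho * expR (-3 * x)) =
       4 * eb (18 + 5 * kp) rho * (expR (2 * x) * expR (- 3 * x)) by ring.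
    by rewrite -expRD /B (_ : 2 * x + _ = - x) //; ring.
have e1 : expR (- ln rho) <= 1 by rewrite -[X in _ <= X]expR0 ler_expR; lra.
have e2 := expR_ge0 (- s).
rewrite -Ul -[U _]subr0 -U0.
have -> : U (expR (2 * s)) - U 0 = (U (expR (2 * s)) - U (expR (2 * ln rho))) + (U (rho ^+ 2) - U 0).
  by rewrite r2; ring.
apply: le_trans (le_normcD _ _) _.
apply: le_trans (lerD T A) _; rewrite subr0.
have P2 := @poly_le_eb R 2 rho 2 (ler0n _ _) r1.
have P4 := @poly_le_eb R 4 rho 0 (ler0n _ _) r1.
have Q1 : 2 * d * e * e * rho ^+ 2 <= eb (33 + 5 * kp) rho.
  have -> : 2 * d * e * e * rho ^+ 2 = (2 * rho ^+ 2) * (d * e * e) by ring.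
  apply: le_trans (ler_wpM2r _ P2) _; first by rewrite !mulr_ge0.
  by rewrite /d /e -!ebD; apply: eb_le => //; rewrite /KD; lra.
have Q2 : - 4 * B * expR (- s) - - 4 * B * expR (- ln rho) <= eb (33 + 5 * kp) rho.
  apply: (@le_trans _ _ (4 * rho ^+ 0 * B)).
    rewrite expr0 mulr1; have := mulr_ge0 B0 e2; have := ler_wpM2l B0 e1; nra.
  apply: le_trans (ler_wpM2r B0 P4) _; rewrite /B -ebD; apply: eb_le => //; lra.
have P := @poly_le_eb R 2 rho 0 (ler0n _ _) r1; rewrite expr0 addr0 mulr1 in P.
apply: le_trans (lerD Q2 Q1) _.
have -> : KI kp = 2 + (33 + 5 * kp) by rewrite /KI; ring.
rewrite (ebD 2); have := ler_wpM2r (eb_ge0 (33 + 5 * kp) rho) P.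
by rewrite mulrDl mul1r.
Qed.

Lemma DL_lip (kp rho s : R) E1 E2 : 0 <= kp -> 1 <= rho -> normc E1 <= kp * rho ^+ 6 -> normc E2 <= kp * rho ^+ 6 ->
  ln rho <= s -> normc (DL (vv s 0) E2 - DL (vv s 0) E1) <= eb (KI kp) rho * normc (E2 - E1).
Proof.
move=> k0 r1 H1 H2 ls; have l0 : 0 <= ln rho by exact: ln_ge0.
have s0 : 0 <= s by lra.
have [IL hIL] := IL_exists s.
have d t : cder (fun t => E1 + t%:C * (E2 - E1)) t (E2 - E1).
  by apply: cder_eq; [der|rewrite /= ?cC1; ring].
have := @normc_incr_le R (fun t => DL (vv s 0) (E1 + t%:C * (E2 - E1))) (fun t => eb (KI kp) rho * normc (E2 - E1) * t)
  (fun t => - IL (E1 + t%:C * (E2 - E1)) * (E2 - E1)) (fun=> eb (KI kp) rho * normc (E2 - E1)) 0 1 ler01.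
rewrite cC0 cC1 mul0r mul1r addr0 mulr0 mulr1 subr0 (addrC E1) subrK; apply.
- by move=> t _; exact: (cder_holo (holo_DL s0 hIL) (d t)).
- by move=> t _; apply: rder_eq; [der; exact: rder_id|rewrite /=; ring].
- move=> t /andP[t0 t1]; rewrite (normcM (- IL _)) normcN; apply: ler_wpM2r; first exact: normc_ge0.
  apply: (IL_le k0 r1 _ ls hIL).
  have -> : E1 + t%:C * (E2 - E1) = (1 - t)%:C * E1 + t%:C * E2 by rewrite cCD cCN cC1; ring.
  apply: le_trans (le_normcD _ _) _; rewrite !normcM !normcR !ger0_norm ?subr_ge0 //.
  have -> : kp * rho ^+ 6 = (1 - t) * (kp * rho ^+ 6) + t * (kp * rho ^+ 6) by ring.
  by apply: lerD; apply: ler_wpM2l => //; rewrite subr_ge0.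
Qed.

Lemma Dd_lip (kp rho : R) E1 E2 : 0 <= kp -> 1 <= rho -> normc E1 <= kp * rho ^+ 6 -> normc E2 <= kp * rho ^+ 6 ->
  normc (Dd E2 - Dd E1) <= eb (KI kp) rho * normc (E2 - E1).
Proof.
move=> k0 r1 H1 H2.
have cv := ccvgD (DL_cvg E2 (sec0 R)) (ccvgN (DL_cvg E1 (sec0 R))).
apply: (ccvg_le (N := (Num.truncn (ln rho)).+1) cv) => n Nn.
apply: DL_lip => //; apply: ltW; apply: lt_le_trans (truncnS_gt _) _.
by rewrite ler_nat.
Qed.

End lipschitz.

(** * The spectral determinant *)

Section polar.
Variable R : realType.
Implicit Types (z : R[i]).

Lemma polar z : 0 < Re z -> 0 <= Im z -> exists2 th : R, 0 <= th <= pi / 2 & z = ray (normc z) th.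
Proof.
move=> x0 y0; have nz : 0 < normc z by exact: lt_le_trans x0 (Re_le z).
have ns := normc_sqr z; rewrite /sqn in ns.
have c1 : 0 < Re z / normc z <= 1.
  by rewrite divr_gt0 //= ler_pdivrMr // mul1r Re_le.
have c1' : -1 <= Re z / normc z <= 1 by lra.
have p0 := pi_ge2 R.
have c : cos (acos (Re z / normc z)) = Re z / normc z by rewrite acosK // in_itv.
exists (acos (Re z / normc z)).
  rewrite acos_ge0 //= leNgt; apply/negP => H.
  have a1 : acos (Re z / normc z) \in `[0, pi] by rewrite in_itv /= acos_ge0 // acos_lepi.
  have a2 : (pi / 2 : R) \in `[0, pi] by rewrite in_itv /=; lra.
  have E : (cos (acos (Re z / normc z)) < cos (pi / 2)) = (pi / 2 < acos (Re z / normc z)) := ltr_cos a2 a1.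
  by move: E; rewrite H cos_pihalf c; lra.
apply: eqC; rewrite /ray !ReImE Re_cis Im_cis c mul0r.
  by rewrite subr0 mulrCA mulfV ?gt_eqF // mulr1.
rewrite sin_acos // addr0; have -> : 1 - (Re z / normc z) ^+ 2 = (Im z / normc z) ^+ 2.
  have n2 : normc z ^+ 2 != 0 by rewrite expf_neq0 // gt_eqF.
  by rewrite !expr_div_n -[X in X - _](mulfV n2) -mulrBl {1}ns addrAC subrr add0r.
by rewrite sqrtr_sqr ger0_norm ?divr_ge0 ?(ltW nz) // mulrCA mulfV ?gt_eqF // mulr1.
Qed.

Lemma sin_le_id (t : R) : 0 <= t -> sin t <= t.
Proof.
move=> t0; have := @nondecr_le R sin id cos (fun=> 1) 0 t t0.
rewrite sin0 !subr0; apply => x _; last exact: cos_le1.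
  by apply: rder_eq (rder_sin (rder_id x)) _; rewrite mulr1.
exact: rder_id.
Qed.

Lemma sin_ge_pi5 (p : R) : pi / 5 <= p <= 4 * (pi / 5) -> sin (pi / 5) <= sin p.
Proof.
move=> /andP[p1 p2]; have p0 := pi_ge2 R.
rewrite -(cosBpihalf p) -(cosBpihalf (pi / 5)) -(cosN (pi / 5 - _)).
have E (x : R) : cos x = cos `|x| by case: (ger0P x) => _; rewrite ?cosN.
rewrite (E (p - _)); have A : `|p - pi / 2| <= - (pi / 5 - pi / 2) by rewrite ler_norml; lra.
have m1 : `|p - pi / 2| \in `[0, pi] by rewrite in_itv /= normr_ge0 /=; apply: le_trans A _; lra.
have m2 : (- (pi / 5 - pi / 2) : R) \in `[0, pi] by rewrite in_itv /=; lra.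
move: A; rewrite le_eqVlt => /orP[/eqP ->//|A]; apply: ltW.
by have := ltr_cos m1 m2; rewrite /= => ->.
Qed.

Lemma sin_pi5_gt0 : 0 < sin (pi / 5) :> R.
Proof. by have := pi_ge2 R; move=> p0; apply: sin_gt0_pi; lra. Qed.

Lemma continuous_lip (f : R -> R) :
  (forall t, exists2 L, 0 <= L & forall u, `|u - t| <= 1 -> `|f u - f t| <= L * `|u - t|) -> continuous f.
Proof.
move=> H t; have [L L0 HL] := H t; apply/cvgrPdist_le => /= e e0.
have L1 : 0 < L + 1 by lra.
near=> u.
have : `|t - u| < Num.min 1 (e / (L + 1)).
  near: u; apply/nbhs_ballP; exists (Num.min 1 (e / (L + 1))) => //=.
  by rewrite lt_min ltr01 divr_gt0.
rewrite lt_min distrC => /andP[/ltW u1]; rewrite ltr_pdivlMr // => u2.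
rewrite distrC; apply: le_trans (HL u u1) _.
have := normr_ge0 (u - t); nra.
Unshelve. all: by end_near.
Qed.

End polar.

(** * Lower bounds for the connection determinant *)

Section connection_determinant.
Variable R : realType.
Implicit Types (z E : R[i]) (kp rho : R).

Definition wf z : R[i] := cis (3 * pi / 10) * Dd (cis (pi / 5) * z).
(** On the real axis the two terms are conjugate, by [DdJ]; so the real zeros are the points where
    [wf] is real. *)
Definition Psi z : R[i] := cis (3 * pi / 10) * Dd (cis (pi / 5) * z) -
  cis (- (3 * pi / 10)) * Dd (cj (cis (pi / 5)) * z).

Lemma Psi_real (x : R) : Psi x%:C = 'i%C * (2 * Im (wf x%:C))%:C.
Proof.
rewrite /Psi cisN -[cj (cis (pi / 5)) * _]cjK cjM cjC cjK DdJ -cjM -/(wf _).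
by move: (wf _) => w; apply: eqC; rewrite !ReImE; ring.
Qed.

Lemma small_const (c rho : R) : 0 < c -> 1 <= rho -> eb (- c^-1) rho <= c.
Proof.
move=> c0 r1; rewrite ebN -[X in _ <= X]invrK lef_pV2 ?posrE ?invr_gt0 ?eb_gt0 //.
have := expR_ge1Dx (c^-1 * rho ^+ 5); rewrite -/(eb _ rho).
have : c^-1 * 1 <= c^-1 * rho ^+ 5 by apply: ler_wpM2l; [rewrite invr_ge0 ltW|exact: exprn_ege1].
lra.
Qed.

Definition KT kp : R := 8 * (kp + 1) + 6.
(** In [rate_ge] the factors sin (pi / 5), the fourth power, 1/1000 and [eb (- KD kp) rho ^+ 2]
    contribute one summand each, in this order. *)
Definition KG kp : R := (sin (pi / 5))^-1 + 4 * KT kp + 30 + 2 * KD kp.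

Lemma KG_ge kp : 0 <= kp -> 30 <= KG kp.
Proof.
by move=> k0; have s0 := sin_pi5_gt0 R; rewrite /KG /KT /KD; have : 0 <= (sin (pi / 5))^-1 :> R by [rewrite invr_ge0 ltW]; lra.
Qed.

Lemma rate_ge kp rho (r : R) : 0 <= kp -> 1 <= rho -> 0 <= r -> r <= kp * rho ^+ 6 ->
  eb (- KG kp) rho <= sin (pi / 5) * (8 * (1 + r))^-1 ^+ 4 / 1000 * eb (- KD kp) rho ^+ 2.
Proof.
move=> k0 r1 r0 rk.
have T : eb (- KT kp) rho <= (8 * (1 + r))^-1.
  rewrite ebN lef_pV2 ?posrE ?eb_gt0 //; last by lra.
  apply: le_trans (@poly_le_eb R (8 * (kp + 1)) rho 6 _ r1); last by lra.
  have := @exprn_ege1 _ 6 rho r1; nra.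
have S := small_const (sin_pi5_gt0 R) r1.
have M : eb (- 10) rho ^+ 3 <= 1000^-1.
  have H10 : 0 < 10^-1 :> R by rewrite invr_gt0.
  have := small_const H10 r1; rewrite invrK => M.
  have -> : 1000^-1 = 10^-1 ^+ 3 :> R by field.
  by apply: lerXn2r; rewrite ?nnegrE ?eb_ge0 ?(ltW H10).
have -> : - KG kp = - (sin (pi / 5))^-1 + 4%:R * - KT kp + 3%:R * - 10 + 2%:R * - KD kp.
  by rewrite /KG; ring.
rewrite (ebD _ (2%:R * _)) (ebD _ (3%:R * _)) (ebD _ (4%:R * _)) -!ebX.
apply: ler_wpM2r; first by rewrite exprn_ge0 // eb_ge0.
have e1 := eb_ge0 (- (sin (pi / 5))^-1) rho.
have e2 : 0 <= eb (- KT kp) rho ^+ 4 by rewrite exprn_ge0 // eb_ge0.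
have e3 : 0 <= eb (- 10) rho ^+ 3 by rewrite exprn_ge0 // eb_ge0.
apply: (ler_pM (mulr_ge0 e1 e2) e3 _ M).
apply: (ler_pM e1 e2 S); apply: lerXn2r => //; rewrite nnegrE ?eb_ge0 // invr_ge0; lra.
Qed.

Section finite_level.
Variables (kp rho s : R) (IL : R[i] -> R[i]).
Hypotheses (k0 : 0 <= kp) (r1 : 1 <= rho) (ls : ln rho <= s) (hIL : isIL s IL).
Let wn (t : R) : R[i] := cis (3 * pi / 10) * DL (vv s 0) (cis (pi / 5) * t%:C).
Let wn' (t : R) : R[i] := - (cis (3 * pi / 10) * cis (pi / 5)) * IL (cis (pi / 5) * t%:C).

Lemma s_ge0 : 0 <= s. Proof. exact: le_trans (ln_ge0 r1) ls. Qed.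

Lemma cder_wn t : cder wn t (wn' t).
Proof.
have d : cder (fun t => cis (pi / 5) * t%:C) t (cis (pi / 5)).
  by apply: cder_eq; [der|rewrite /= ?cC1; ring].
apply: cder_eq (cderM (cder_cst (cis (3 * pi / 10)) t) (cder_holo (holo_DL s_ge0 hIL) d)) _.
by rewrite /wn'; ring.
Qed.

Lemma normc_om (t : R) : normc (cis (pi / 5) * t%:C) = `|t|.
Proof. by rewrite normcM normc_cis mul1r normcR. Qed.

Lemma wn'_le t : `|t| <= kp * rho ^+ 6 -> normc (wn' t) <= eb (KI kp) rho.
Proof.
move=> tk; rewrite /wn' mulNr normcN !(normcM (cis _ * _)) (normcM (cis _)) !normc_cis !mul1r.
by apply: (IL_le k0 r1 _ ls hIL); rewrite normc_om.
Qed.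

Hypothesis close : CBr (kp * rho ^+ 6) * expR (- s) <= eb (- KD kp) rho / 4.

(** The left side is |wn|^2 times the derivative of arg wn: along the axis [wn] turns clockwise at a
    definite rate. By the Cauchy-Riemann equations this is the growth of |DL| with arg E, that is
    [IL_ge] on the ray of argument pi / 5. *)
Lemma wn_rotates t : 1 / 2 <= t -> t <= kp * rho ^+ 6 -> Im (cj (wn t) * wn' t) <= - eb (- KG kp) rho.
Proof.
move=> t0 tk; have tp : 0 < t by lra.
have tn : `|t| = t by rewrite ger0_norm ?ltW.
have t8 : 0 <= 8 * (1 + t) by lra.
have k1 : 0 <= t by lra.
pose E : R[i] := cis (pi / 5) * t%:C.
have nE : normc E = t by rewrite normc_om tn.
have iE : Im E = t * sin (pi / 5) by rewrite ImM ReC ImC Im_cis; ring.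
have E0 : 0 <= Im E by rewrite iE mulr_ge0 ?(ltW tp) // ltW // sin_pi5_gt0.
have X0 : 0 <= t * sin (pi / 5) * (8 * (1 + t))^-1 ^+ 4 / 1000.
  apply: mulr_ge0; last by rewrite invr_ge0; exact: ler0n.
  have p5 := mulr_ge0 (ltW tp) (ltW (sin_pi5_gt0 R)).
  by apply: (mulr_ge0 p5); apply: exprn_ge0; rewrite invr_ge0.
have H := IL_ge s_ge0 hIL E0.
have -> : Im (cj (wn t) * wn' t) = - (t^-1 * Im (E * cj (DL (vv s 0) E) * IL E)).
  rewrite /wn /wn' -/E cjM.
  have -> : cj (cis (3 * pi / 10)) * cj (DL (vv s 0) E) * (- (cis (3 * pi / 10) * cis (pi / 5)) * IL E) =
     - ((cis (3 * pi / 10) * cj (cis (3 * pi / 10))) * (cis (pi / 5) * cj (DL (vv s 0) E) * IL E)) by ring.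
  rewrite -sqnE sqn_cis cC1 mul1r ImN; congr (- _).
  have -> : E * cj (DL (vv s 0) E) * IL E = t%:C * (cis (pi / 5) * cj (DL (vv s 0) E) * IL E) by rewrite /E; ring.
  by rewrite [Im (t%:C * _)]ImM ReC ImC mul0r addr0 mulrA mulVf ?mul1r // gt_eqF.
rewrite lerN2.
apply: le_trans (rate_ge k0 r1 k1 tk) _.
rewrite -ler_pdivrMl ?invr_gt0 // invrK.
apply: le_trans _ H; rewrite /tau nE iE.
have -> : t * (sin (pi / 5) * (8 * (1 + t))^-1 ^+ 4 / 1000 * eb (- KD kp) rho ^+ 2) =
   (t * sin (pi / 5) * (8 * (1 + t))^-1 ^+ 4 / 1000) * eb (- KD kp) rho ^+ 2 by ring.
apply: ler_wpM2l; first exact: X0.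
have a := DL_unif E s_ge0; have b := NL_unif E s_ge0.
have C : CBr (normc E) * expR (- s) <= eb (- KD kp) rho / 4.
  by apply: le_trans close; apply: ler_wpM2r; [exact: expR_ge0|apply: CBr_mono; rewrite nE].
have D := normc_near (Dd E) (DL (vv s 0) E).
have M := normc_near (Nd E) (NL (vv s 0) E).
rewrite -!normc_sqr; apply: (rate_aux2 a b D M _ C (eb_ge0 _ _)).
by apply: Dd_Nd_ge => //; rewrite nE.
Qed.

End finite_level.

(** With [A] near Re w the product A Im w' is Re w Im w' up to kap L, and Re w Im w' is Im (conj w
    w') up to 2 kap L; the total error 3 g / 8 is below g / 2. *)
Lemma slope_aux (A kap g L : R) (w w' : R[i]) : 0 <= g -> 0 <= L -> 0 <= kap -> kap * L = g / 8 ->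
  Im (cj w * w') <= - g -> `|A - Re w| <= kap -> `|Im w| <= 2 * kap -> normc w' <= L ->
  A * Im w' <= - (g / 2).
Proof.
move=> g0 L0 k0 kL; rewrite !ReImE => H a b c.
have r := le_trans (Re_normc w') c; have i := le_trans (Im_normc w') c.
have X : `|(A - Re w) * Im w'| <= kap * L by rewrite normrM; apply: ler_pM.
have Y : `|Im w * Re w'| <= 2 * kap * L by rewrite normrM; apply: ler_pM.
move: X Y; rewrite !ler_norml => /andP[_ X] /andP[_ Y]; nra.
Qed.

Lemma step_aux (a1 a2 f1 f2 g h t1 t2 : R) : a2 - a1 <= - (g / 2) * t2 - - (g / 2) * t1 ->
  `|a1 - f1| <= h * g / 8 -> `|a2 - f2| <= h * g / 8 -> f2 - f1 <= - (g / 2) * (t2 - t1) + h * g / 4.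
Proof. rewrite !ler_norml => H /andP[a b] /andP[c d]; lra. Qed.

Lemma ivt_aux (a b c h g : R) : b - a <= - (g / 2) * h + h * g / 4 -> a - c <= - (g / 2) * h + h * g / 4 ->
  `|a| <= h * g / 4 -> b <= 0 /\ 0 <= c.
Proof. by rewrite ler_norml => H1 H2 /andP[H3 H4]; split; lra. Qed.

Lemma gg_aux (c T q r : R) : 1 <= r -> 0 <= c * T * q -> c * T / 1000 * q <= r * c * T / 500 * q.
Proof. nra. Qed.

Lemma ivt_aux2 (h g : R) : 0 <= - (g / 2) * h + h * g / 4 -> h * g <= 0.
Proof. lra. Qed.

Lemma ivt_aux3 (x y h e : R) : x - h <= y -> y <= x + h -> h <= e -> `|x - y| <= e.
Proof. by rewrite ler_norml; lra. Qed.

Lemma normc_cisM (a : R) z : normc (cis a * z) = normc z.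
Proof. by rewrite normcM normc_cis mul1r. Qed.

Lemma wf_lip kp rho (x t : R) : 0 <= kp -> 1 <= rho -> `|x| <= kp * rho ^+ 6 -> `|t| <= kp * rho ^+ 6 ->
  normc (wf t%:C - wf x%:C) <= eb (KI kp) rho * `|t - x|.
Proof.
move=> k0 r1 xk tk; rewrite /wf -mulrBr normcM normc_cis mul1r.
have := @Dd_lip R kp rho (cis (pi / 5) * x%:C) (cis (pi / 5) * t%:C) k0 r1.
by rewrite !normc_om -mulrBr -cCN -cCD normc_om; apply.
Qed.

Lemma wf_continuous (A : R) : continuous (fun t : R => A * Im (wf t%:C)).
Proof.
apply: continuous_lip => t.
have k0 : 0 <= `|t| + 1 by rewrite addr_ge0.
exists (`|A| * eb (KI (`|t| + 1)) 1); first by rewrite mulr_ge0 ?eb_ge0.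
move=> u u1; rewrite -mulrBr normrM -mulrA; apply: ler_wpM2l => //.
rewrite -ImB; apply: le_trans (Im_normc _) _; apply: wf_lip => //; rewrite expr1n mulr1.
  by rewrite lerDl.
have := ler_normD (u - t) t; rewrite subrK; lra.
Qed.

(** Chosen so that |Re wf| |Im wf| <= h g / 4 in [real_zero], where |Re wf| is at most eb KD, g = eb
    (- KG) and h = eb (- KG - 2 KI) / 16. The value at [kp + 1] leaves room for a neighbourhood of
    x. *)
Definition K0 kp : R := 2 * KG (kp + 1) + 2 * KI (kp + 1) + KD (kp + 1) + 64.

Lemma small_exp (n : nat) rho : 1 <= rho -> (0 < n)%N -> eb (- n%:R) rho <= n%:R^-1.
Proof.
move=> r1 n0; have := @small_const (n%:R^-1) rho; rewrite invrK; apply => //.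
by rewrite invr_gt0 ltr0n.
Qed.

(** Near x the function Re wf(x) Im wf(t) of t decreases at rate g / 2, since [wf] turns while its
    real part stays near Re wf(x); a small value at x thus forces a change of sign within h. The
    derivative is taken at finite level, and the two functions differ by at most h g / 8. *)
Lemma real_zero kp rho (x : R) : 0 <= kp -> 1 <= rho -> 1 <= x -> x <= kp * rho ^+ 6 ->
  `|Im (wf x%:C)| <= eb (- K0 kp) rho ->
  exists y : R, [/\ 1 / 2 <= y, Psi y%:C = 0 & `|x - y| <= expR (- rho ^+ 5) / 2].
Proof.
move=> k0 r1 x1 xk wx; have r0 : 0 < rho by lra.
set kq := kp + 1; have q0 : 0 <= kq by rewrite /kq; lra.
have r6 : 1 <= rho ^+ 6 by exact: exprn_ege1.
set g := eb (- KG kq) rho; have g0 : 0 < g by exact: eb_gt0.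
set L := eb (KI kq) rho; have L0 : 0 < L by exact: eb_gt0.
have Gk := KG_ge q0; have Ik : 0 <= KI kq by rewrite /KI; lra.
have Dk : 0 <= KD kq by rewrite /KD; lra.
have E8 : - K0 kp <= - KG kq + - KI kq + - 8%:R by rewrite /K0 -/kq; lra.
have E64 : KD kq + - K0 kp <= - KG kq - 2 * KI kq + - KG kq + - 64%:R by rewrite /K0 -/kq; lra.
have LV : L^-1 = eb (- KI kq) rho by rewrite ebN.
(* [kap] is the tolerance of [slope_aux]. Within distance [h] the Lipschitz constant [L] uses half
   of it; the other half is left for the error of the finite level. *)
pose kap := g / (8 * L); pose h := kap / (2 * L).
have kap0 : 0 < kap by rewrite divr_gt0 // mulr_gt0.
have h0 : 0 < h by rewrite divr_gt0 // mulr_gt0.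
have kapL : kap * L = g / 8 by rewrite /kap; field; rewrite gt_eqF.
have hL : h * L = kap / 2 by rewrite /h; field; rewrite gt_eqF.
have L1 : 1 <= L by exact: eb_ge1.
have hE : h = eb (- KG kq - 2 * KI kq) rho / 16.
  have -> : - KG kq - 2 * KI kq = - KG kq + - KI kq + - KI kq by ring.
  by rewrite !ebD -/g -LV /h /kap; field; rewrite gt_eqF.
have h1 : h <= expR (- rho ^+ 5) / 2.
  have : eb (- KG kq - 2 * KI kq) rho <= eb (-1) rho by apply: eb_le => //; lra.
  rewrite /eb mulN1r hE; have := expR_ge0 (- rho ^+ 5); rewrite -/(eb _ _); lra.
have h2 : h <= 1 / 2.
  have : expR (- rho ^+ 5) <= 1 by rewrite -[X in _ <= X]expR0 ler_expR oppr_le0 exprn_ge0 ?ltW.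
  lra.
have xh1 : 1 / 2 <= x - h by lra.
set A := Re (wf x%:C).
have rk : kp * rho ^+ 6 + 1 <= kq * rho ^+ 6 by rewrite /kq; lra.
have Ale : `|A| <= eb (KD kq) rho.
  apply: le_trans (Re_normc _) _; rewrite /wf normcM normc_cis mul1r.
  by have [] := @Dd_le R kq rho (cis (pi / 5) * x%:C) q0 r1 _; rewrite // normc_om ger0_norm; lra.
have d0 := eb_gt0 (KD kq) rho.
(* Three demands on the level: half of [kap], the hypothesis of [wn_rotates], and an error h g / 8
   after multiplication by |A|. *)
pose e := Num.min (kap / 2) (Num.min (eb (- KD kq) rho / 4) (h * g / 8 / eb (KD kq) rho)).
have e0 : 0 < e.
  by rewrite !lt_min !divr_gt0 ?eb_gt0 // mulr_gt0.
have [N HN] := eventually_small (CBr (kq * rho ^+ 6)) e0.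
pose n := maxn N (Num.truncn (ln rho)).+1.
have ls : ln rho <= n%:R.
  by apply: ltW; apply: lt_le_trans (truncnS_gt _) _; rewrite ler_nat leq_maxr.
have := HN n (leq_maxl _ _); rewrite /e !le_min => /andP[e1 /andP[e2 e3]].
have [IL hIL] := IL_exists (n%:R : R).
pose wn (t : R) : R[i] := cis (3 * pi / 10) * DL (vv n%:R 0) (cis (pi / 5) * t%:C).
have wnw t : `|t| <= kq * rho ^+ 6 -> normc (wn t - wf t%:C) <= CBr (kq * rho ^+ 6) * expR (- n%:R).
  move=> tk; rewrite /wn /wf -mulrBr normcM normc_cis mul1r.
  apply: le_trans (DL_unif _ (ler0n _ _)) _; apply: ler_wpM2r; first exact: expR_ge0.
  by apply: CBr_mono; rewrite ?normc_ge0 // normc_om.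
have slope t : `|t - x| <= h -> A * Im (- (cis (3 * pi / 10) * cis (pi / 5)) * IL (cis (pi / 5) * t%:C)) <= - (g / 2).
  rewrite ler_norml => /andP[t1 t2].
  have tp : 1 / 2 <= t by lra.
  have tk : t <= kq * rho ^+ 6 by lra.
  have tn : `|t| = t by rewrite ger0_norm; lra.
  have tn' : `|t| <= kq * rho ^+ 6 by rewrite tn.
  have xn : `|x| <= kq * rho ^+ 6 by rewrite ger0_norm; lra.
  have B : normc (wn t - wf x%:C) <= kap.
    have -> : wn t - wf x%:C = (wn t - wf t%:C) + (wf t%:C - wf x%:C) by rewrite addrA subrK.
    apply: le_trans (le_normcD _ _) _.
    have -> : kap = kap / 2 + kap / 2 by field.
    apply: lerD; first exact: le_trans (wnw t tn') e1.
    apply: le_trans (wf_lip q0 r1 xn tn') _; rewrite -hL mulrC; apply: ler_wpM2r; first exact: ltW.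
    by rewrite ler_norml; lra.
  apply: (slope_aux (kap := kap) (L := L) (ltW g0) (ltW L0) (ltW kap0) kapL
    (wn_rotates q0 r1 ls hIL e2 tp tk)).
  - have := le_trans (Re_normc _) B; rewrite ReB distrC; exact.
  - have := le_trans (Im_normc _) B; rewrite ImB => B'.
    have K : eb (- K0 kp) rho <= kap.
      have -> : kap = eb (- KG kq) rho * eb (- KI kq) rho * 8^-1 by rewrite -/g -LV /kap; field; rewrite gt_eqF.
      rewrite -ebD; apply: le_trans (ler_wpM2l (eb_ge0 _ _) (@small_exp 8 rho r1 isT)).
      by rewrite -ebD; exact: (eb_le r1 E8).
    have := ler_normD (Im (wn t) - Im (wf x%:C)) (Im (wf x%:C)); rewrite subrK => X.
    apply: le_trans X _; have -> : 2 * kap = kap + kap by ring.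
    by apply: lerD => //; exact: le_trans wx K.
  - exact: (wn'_le q0 r1 ls hIL tn').
pose f (t : R) := A * Im (wf t%:C).
have step t1 t2 : t1 <= t2 -> `|t1 - x| <= h -> `|t2 - x| <= h -> f t2 - f t1 <= - (g / 2) * (t2 - t1) + h * g / 4.
  move=> t12 H1 H2.
  have := @nondecr_le R (fun t => A * Im (wn t)) (fun t => - (g / 2) * t) 
     (fun t => A * Im (- (cis (3 * pi / 10) * cis (pi / 5)) * IL (cis (pi / 5) * t%:C))) (fun=> - (g / 2)) t1 t2 t12.
  move=> HH; have H' : A * Im (wn t2) - A * Im (wn t1) <= - (g / 2) * t2 - - (g / 2) * t1.
    apply: HH => t tt.
    - apply: rder_eq (rderM (rder_cst A t) (rder_Im (cder_wn r1 ls hIL t))) _; rewrite mul0r add0r //.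
    - by apply: rder_eq (rderM (rder_cst _ t) (rder_id t)) _; ring.
    - apply: slope; move: H1 H2 tt; rewrite !ler_norml; lra.
  have near t : `|t - x| <= h -> `|A * Im (wn t) - f t| <= h * g / 8.
    move=> H; have tk : `|t| <= kq * rho ^+ 6.
      by move: H; rewrite !ler_norml; lra.
    rewrite /f -mulrBr -ImB normrM.
    apply: (@le_trans _ _ (eb (KD kq) rho * (h * g / 8 / eb (KD kq) rho))).
      apply: ler_pM => //; apply: le_trans (Im_normc _) _; exact: le_trans (wnw t tk) e3.
    by rewrite mulrCA mulfV ?mulr1 // gt_eqF.
  exact: step_aux H' (near _ H1) (near _ H2).
have hx0 : `|x - x| <= h by rewrite subrr normr0 ltW.
have nh : `|x + h - x| <= h by rewrite addrAC subrr add0r (ger0_norm (ltW h0)).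
have nh' : `|x - h - x| <= h by rewrite addrAC subrr add0r normrN (ger0_norm (ltW h0)).
have xph : x <= x + h by rewrite lerDl ltW.
have xmh : x - h <= x by rewrite gerBl ltW.
have S1 := step _ _ xph hx0 nh; have S2 := step _ _ xmh nh' hx0.
rewrite (addrC x h) addrK (addrC h x) in S1; rewrite subKr in S2.
have fx : `|f x| <= h * g / 4.
  rewrite /f normrM; apply: (@le_trans _ _ (eb (KD kq) rho * eb (- K0 kp) rho)); first exact: ler_pM.
  have -> : h * g / 4 = eb (- KG kq - 2 * KI kq) rho * eb (- KG kq) rho * 64^-1 by rewrite hE /g; field.
  rewrite -!ebD; apply: le_trans (ler_wpM2l (eb_ge0 _ _) (@small_exp 64 rho r1 isT)).
  by rewrite -ebD; exact: (eb_le r1 E64).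
have [fp fm] := ivt_aux S1 S2 fx.
have xh : x - h <= x + h by rewrite lerBlDr -addrA lerDl addr_ge0 // ltW.
have [|y] := @IVT R f (x - h) (x + h) 0 xh (continuous_subspaceT (@wf_continuous A)).
  by apply/andP; split; [rewrite ge_min; apply/orP; right; exact: fp|rewrite le_max; apply/orP; left; exact: fm].
rewrite in_itv /= => /andP[y1 y2] fy.
exists y; split; first exact: le_trans xh1 y1.
  (* With [A] zero the function [f] would vanish identically, against its strict decrease [S1]. *)
  have A0 : A != 0.
    apply/eqP => A0; have Z t : f t = 0 by rewrite /f A0 mul0r.
    by move: S1; rewrite (Z (x + h)) (Z x) subrr => H; have := ivt_aux2 H; rewrite leNgt (mulr_gt0 h0 g0).
  move/eqP: fy; rewrite /f mulf_eq0 (negbTE A0) /= => /eqP w0.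
  by rewrite Psi_real w0 mulr0 cC0 mulr0.
exact: ivt_aux3 y1 y2 h1.
Qed.

Lemma off_aux (a b P d G m : R) : 0 <= a -> 0 <= b -> a <= d -> b <= d -> 0 <= P -> b - a <= P -> a ^+ 2 <= m ->
  m + G <= b ^+ 2 -> G * (1 / 2) <= P * d.
Proof.
move=> a0 b0 ad bd P0 bP am mb; have d0 : 0 <= d by lra.
case: (leP b a) => ab.
  have : b ^+ 2 <= a ^+ 2 by apply: lerXn2r.
  have := mulr_ge0 P0 d0; lra.
have : (b - a) * (b + a) <= P * (2 * d) by apply: ler_pM; lra.
lra.
Qed.

Definition KA kp (k4 : R) : R := k4 + kp + 9 + KG kp + KD kp + 2.

Lemma cis_diff (a b : R) (u v : R[i]) : normc u - normc v <= normc (cis a * u - cis b * v).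
Proof. by have := normc_distl (cis a * u) (- (cis b * v)); rewrite normcN !normc_cisM. Qed.

(** By conjugation |Dd| at argument th - pi / 5 equals |Dd| at |th - pi / 5| <= max (th, pi / 5) <=
    th + pi / 5. Plain monotonicity serves the first interval. The second has length min (th, pi /
    5) and lies in [pi / 5, 4 pi / 5], where the gain is quantitative. *)
Lemma Psi_off_axis kp rho (k4 : R) z : 0 <= kp -> 1 <= rho -> 0 <= k4 -> 1 <= Re z ->
  eb (- k4) rho <= Im z -> normc z <= kp * rho ^+ 6 -> eb (- KA kp k4) rho <= normc (Psi z).
Proof.
move=> k0 r1 k40 x1 y0 zk; have p0 := pi_ge2 R; have p15 : 1 / 5 <= pi / 5 :> R by lra.
have S5 : eb (- (k4 + kp + 9)) rho <= 1 / 5.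
  apply: (@le_trans _ _ (eb (- 5) rho)); first by apply: eb_le => //; lra.
  by rewrite mul1r; exact: (@small_exp 5 rho r1 isT).
have S2 : eb (- 2) rho <= 1 / 2 by rewrite mul1r; exact: (@small_exp 2 rho r1 isT).
have E46 : - (k4 + kp + 9) <= - (kp + 6) + - k4 by lra.
have z1 : 1 <= normc z by exact: le_trans x1 (Re_le z).
have y0' : 0 <= Im z by exact: le_trans (eb_ge0 _ _) y0.
have [|th /andP[t0 t1] zth] := polar _ y0'; first by lra.
have sp : 0 <= th <= pi by lra.
set r := normc z in zk z1 zth; have rp : 0 <= r by lra.
have om2 a : cis (pi / 5) * ray r a = ray r (a + pi / 5) by rewrite /ray cisD; ring.
have om3 a : cj (cis (pi / 5)) * ray r a = ray r (a - pi / 5) by rewrite /ray cisD cisN; ring.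
have even a : sqn (Dd (ray r a)) = sqn (Dd (ray r `|a|)).
  have [a0|a0] := leP 0 a; first by rewrite (ger0_norm a0).
  rewrite (ltr0_norm a0); have -> : ray r (- a) = cj (ray r a) by rewrite /ray cisN cjM cjC.
  by rewrite DdJ sqnJ.
set c0 := sin (pi / 5) : R; have c00 : 0 < c0 by exact: sin_pi5_gt0.
pose m := Num.max th (pi / 5); pose p1 := `|th - pi / 5|; pose p2 := th + pi / 5.
have m1 : p1 <= m by rewrite le_max !ler_norml; case: (leP (pi / 5) th) => ?; apply/orP; [left|right]; lra.
have m0 : pi / 5 <= m by rewrite le_max lexx orbT.
have m2 : m <= p2 by rewrite ge_max /p2; lra.
have p10 : 0 <= p1 by exact: normr_ge0.
have p2p : p2 <= 4 * (pi / 5) by rewrite /p2; lra.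
have mpi : m <= pi by lra.
have t8 : 0 <= 8 * (1 + r) by lra.
have A1 := @determinant_rate R r p1 m 0 0 rp m1 (lexx 0) (lexx 0).
have {}A1 : sqn (Dd (ray r p1)) <= sqn (Dd (ray r m)).
  apply: le_trans (A1 _) => [|p /andP[q1 q2]]; first by rewrite !(mulr0, mul0r) addr0.
  split; last by rewrite mulr0 addr_ge0 // normc_ge0.
  by apply: sin_ge0_pi; rewrite (le_trans p10 q1) (le_trans q2 mpi).
have A2 : sqn (Dd (ray r m)) + (p2 - m) * (r * c0 * (8 * (1 + r))^-1 ^+ 4 / 500 * eb (- KD kp) rho ^+ 2) <= sqn (Dd (ray r p2)).
  apply: determinant_rate => //; [exact: ltW|exact: eb_ge0|].
  move=> p /andP[q1 q2]; split; first by apply: sin_ge_pi5; rewrite (le_trans m0 q1) (le_trans q2 p2p).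
  by apply: Dd_Nd_ge; rewrite // normc_ray.
have G := rate_ge k0 r1 rp zk; rewrite -/c0 in G.
have gap : eb (- (k4 + kp + 9)) rho <= p2 - m.
  have -> : p2 - m = Num.min th (pi / 5).
    by rewrite /p2 /m; case: (leP th (pi / 5)) => _; ring.
  rewrite le_min; apply/andP; split; last first.
    apply: (le_trans _ p15).
    exact: S5.
  (* th >= sin th = Im z / |z|, and |z| is at most polynomial in [rho]. *)
  apply: le_trans (sin_le_id t0).
  have : eb (- k4) rho <= r * sin th by rewrite -Im_ray -zth.
  have s0 : 0 <= sin th by exact: sin_ge0_pi sp.
  have : r * sin th <= eb (kp + 6) rho * sin th.
    by apply: ler_wpM2r => //; apply: le_trans zk _; exact: poly_le_eb.
  move=> H1 H2; have := le_trans H2 H1; rewrite -ler_pdivrMl ?eb_gt0 // -ebN -ebD.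
  by apply: le_trans; exact: eb_le.
set gain := (p2 - m) * _ in A2.
have GG : eb (- (k4 + kp + 9)) rho * eb (- KG kp) rho <= gain.
  apply: ler_pM; rewrite ?eb_ge0 //; apply: le_trans G _.
  set q := eb (- KD kp) rho ^+ 2; have q0 : 0 <= q by rewrite exprn_ge0 // eb_ge0.
  set T := _ ^+ 4; have T0 : 0 <= T by rewrite exprn_ge0 // invr_ge0.
  have cT := mulr_ge0 (mulr_ge0 (ltW c00) T0) q0.
  exact: gg_aux z1 cT.
have D1 : normc (Dd (ray r (th - pi / 5))) <= eb (KD kp) rho.
  by have [] := @Dd_le R kp rho (ray r (th - pi / 5)) k0 r1 _; rewrite // normc_ray.
have D2 : normc (Dd (ray r p2)) <= eb (KD kp) rho.
  by have [] := @Dd_le R kp rho (ray r p2) k0 r1 _; rewrite // normc_ray.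
have P : normc (Dd (ray r p2)) - normc (Dd (ray r (th - pi / 5))) <= normc (Psi z).
  rewrite /Psi {1 2}zth om2 om3 -/p2.
  exact: cis_diff.
have A1' : normc (Dd (ray r (th - pi / 5))) ^+ 2 <= sqn (Dd (ray r m)) by rewrite normc_sqr even; exact: A1.
have A2' : sqn (Dd (ray r m)) + gain <= normc (Dd (ray r p2)) ^+ 2 by rewrite normc_sqr; exact: A2.
have -> : - KA kp k4 = (- (k4 + kp + 9) + - KG kp) + - KD kp + - 2 by rewrite /KA; ring.
rewrite (ebD _ (- 2)) (ebD _ (- KD kp)) (ebD (- (k4 + kp + 9))) (ebN (KD kp)).
have d0 := eb_gt0 (KD kp) rho.
have e0 : 0 <= (eb (- (k4 + kp + 9)) rho * eb (- KG kp) rho) / eb (KD kp) rho.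
  by rewrite divr_ge0 ?mulr_ge0 // eb_ge0.
apply: le_trans (ler_wpM2l e0 S2) _.
rewrite mulrAC ler_pdivrMr //; apply: le_trans (ler_wpM2r _ GG) _ => //.
exact: (off_aux (normc_ge0 _) (normc_ge0 _) D1 D2 (normc_ge0 _) P A1' A2').
Qed.

Lemma fin_aux (a b n P e : R) : 2 * a - n <= P -> n <= 2 * b -> b <= e / 2 -> e < a -> e <= P.
Proof. lra. Qed.

Lemma subr4 (a b c d : R[i]) : a - b - (c - d) = (a - c) - (b - d).
Proof. by ring. Qed.

Lemma psi_low kp : 0 <= kp -> exists2 K : R, 0 <= K & forall rho z, 1 <= rho -> 1 <= Re z -> 0 <= Im z ->
  normc z <= kp * rho ^+ 6 -> eb (- K) rho <= normc (Psi z) \/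
  exists y : R, [/\ 1 / 2 <= y, Psi y%:C = 0 & normc (z - y%:C) <= expR (- rho ^+ 5)].
Proof.
move=> k0; have I0 : 0 <= KI kp by rewrite /KI; lra.
have K00 : 0 <= K0 kp.
  by have := @KG_ge (kp + 1); rewrite /K0 /KI /KD; lra.
(* Below the height eb (- k4), moving from z to Re z changes [Psi] by at most eb (- K0), less than
   half of the value 2 |Im wf| that is present when [real_zero] does not apply. *)
pose k4 := K0 kp + KI kp + 2.
have A0 : K0 kp <= KA kp k4 by have := KG_ge k0; rewrite /KA /KD /k4; lra.
exists (KA kp k4); first by lra.
move=> rho z r1 x1 y0 zk.
case: (leP (eb (- k4) rho) (Im z)) => yk.
  by left; apply: Psi_off_axis => //; rewrite /k4; lra.
have xk : Re z <= kp * rho ^+ 6 by exact: le_trans (Re_le z) zk.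
have zE : z - (Re z)%:C = 'i%C * (Im z)%:C by apply: eqC; rewrite !ReImE; ring.
have zn : normc (z - (Re z)%:C) = Im z by rewrite zE normcM normc_i mul1r normcR ger0_norm.
have S2 : eb (- 2) rho <= 1 / 2 by rewrite mul1r; exact: small_exp.
have Ek : eb (- k4) rho = eb (- K0 kp) rho * eb (- KI kp) rho * eb (- 2) rho.
  by rewrite -!ebD; congr (eb _ rho); rewrite /k4; ring.
have [wx|wx] := leP `|Im (wf (Re z)%:C)| (eb (- K0 kp) rho).
  right; have [y [y1 y2 y3]] := real_zero k0 r1 x1 xk wx.
  exists y; split => //.
  have -> : z - y%:C = (z - (Re z)%:C) + (Re z - y)%:C by rewrite cCD cCN addrA subrK.
  apply: le_trans (le_normcD _ _) _; rewrite zn normcR.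
  have : eb (- k4) rho <= expR (- rho ^+ 5) / 2.
    have -> : expR (- rho ^+ 5) = eb (- 1) rho by rewrite /eb mulN1r.
    rewrite Ek; have e1 : eb (- K0 kp) rho * eb (- KI kp) rho <= eb (- 1) rho.
      by rewrite -ebD; apply: eb_le => //; have := @KG_ge (kp + 1); rewrite /K0 /KI /KD; lra.
    by apply: ler_pM; rewrite ?mulr_ge0 ?eb_ge0 //; lra.
  lra.
left; apply: (@le_trans _ _ (eb (- K0 kp) rho)); first by apply: eb_le => //; lra.
have Lz : normc (Psi z - Psi (Re z)%:C) <= 2 * (eb (KI kp) rho * Im z).
  have L1 : forall c : R[i], normc c = 1 -> normc (Dd (c * z) - Dd (c * (Re z)%:C)) <= eb (KI kp) rho * Im z.
    move=> c c1; have := @Dd_lip R kp rho (c * (Re z)%:C) (c * z) k0 r1.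
    rewrite -mulrBr !(normcM c) c1 !mul1r zn normcR; apply => //.
    by rewrite ger0_norm // ; lra.
  have -> : Psi z - Psi (Re z)%:C = cis (3 * pi / 10) * (Dd (cis (pi / 5) * z) - Dd (cis (pi / 5) * (Re z)%:C))
     - cis (- (3 * pi / 10)) * (Dd (cj (cis (pi / 5)) * z) - Dd (cj (cis (pi / 5)) * (Re z)%:C)).
    by rewrite /Psi !mulrBr; exact: subr4.
  apply: le_trans (normcB _ _) _.
  have -> : 2 * (eb (KI kp) rho * Im z) = eb (KI kp) rho * Im z + eb (KI kp) rho * Im z by ring.
  apply: lerD; rewrite normc_cisM; apply: L1; rewrite ?normcJ'; exact: normc_cis.
have Px : normc (Psi (Re z)%:C) = 2 * `|Im (wf (Re z)%:C)|.
  by rewrite Psi_real normcM normc_i mul1r normcR normrM ger0_norm.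
have N : 2 * `|Im (wf (Re z)%:C)| - normc (Psi z - Psi (Re z)%:C) <= normc (Psi z).
  by rewrite -Px; exact: normc_near.
have : eb (KI kp) rho * Im z <= eb (- K0 kp) rho / 2.
  apply: (@le_trans _ _ (eb (KI kp) rho * eb (- k4) rho)); first by apply: ler_wpM2l; [exact: eb_ge0|exact: ltW].
  rewrite Ek (ebN (KI kp)); move: (eb_gt0 (KI kp) rho) (eb_ge0 (- K0 kp) rho) S2.
  move: (eb (KI kp) rho) (eb (- K0 kp) rho) (eb (- 2) rho) => a b c a0 b0 c2.
  have -> : a * (b * a^-1 * c) = b * c by field; rewrite gt_eqF.
  by apply: (ler_wpM2l b0); move: c2; rewrite mul1r.
move=> e2; exact: fin_aux N Lz e2 wx.
Qed.

End connection_determinant.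

(** * Solutions of the eigenvalue equation *)

Section decaying_solutions.
Variable R : realType.
Implicit Types (z E X : R[i]) (tau p : R).

(** Since lam^5 = i, the substitution x = lam X turns y'' = (x^3 - E) y into y'' = (i X^3 - lam^2 E)
    y; thus z = lam^2 E. *)
Definition lam : R[i] := cis (pi / 10).
Definition asol z (y y1 : R[i] -> R[i]) := holo y y1 /\ holo y1 (fun X => ('i%C * X ^+ 3 - z) * y X).
Definition pE z : R[i] := cj (cis (pi / 5)) * z.

Lemma lam2 : lam ^+ 2 = cis (pi / 5).
Proof. by rewrite /lam -cisMn; congr cis; field. Qed.
Lemma lam5 : lam ^+ 5 = 'i%C.
Proof. by rewrite /lam -cisMn -cis_pihalf; congr cis; field. Qed.
Lemma om_pE z : cis (pi / 5) * pE z = z.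
Proof. by rewrite /pE mulrA -sqnE sqn_cis mul1r. Qed.
Lemma normc_lam : normc lam = 1. Proof. exact: normc_cis. Qed.

Lemma asol_csol z y y1 : csol (pE z) y y1 -> asol z (fun X => y (lam * X)) (fun X => lam * y1 (lam * X)).
Proof.
move=> [h1 h2]; split; first exact: holo_scale.
apply: holo_ext (holoZ lam (holo_scale lam h2)) => X.
have -> : lam * (lam * (((lam * X) ^+ 3 - pE z) * y (lam * X))) =
  (lam ^+ 5 * X ^+ 3 - lam ^+ 2 * pE z) * y (lam * X) by ring.
by rewrite lam5 lam2 om_pE.
Qed.

Definition Yd E x := Dd E * cosol E x + Nd E * sisol E x.
Definition Yd1 E x := Dd E * cosol1 E x + Nd E * sisol1 E x.
Definition pp z X := Yd (pE z) (lam * X).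
Definition pp1 z X := lam * Yd1 (pE z) (lam * X).
(** The symmetry X -> - conj X, z -> conj z of the equation exchanges the two ends of the real
    line. *)
Definition mp z X := cj (pp (cj z) (- cj X)).
Definition mp1 z X := - cj (pp1 (cj z) (- cj X)).

Lemma asol_pp z : asol z (pp z) (pp1 z).
Proof.
exact: (asol_csol (csol_lin (Dd (pE z)) (Nd (pE z)) (csol_cosol (pE z)) (csol_sisol (pE z)))).
Qed.

Lemma holo_reflect (f f' : R[i] -> R[i]) : holo f f' ->
  holo (fun X => cj (f (- cj X))) (fun X => - cj (f' (- cj X))).
Proof.
move=> hf r; have [M HM] := hf r; exists M => x h xr xhr.
have -> : cj (f (- cj (x + h))) - cj (f (- cj x)) - h * - cj (f' (- cj x)) =
  cj (f (- cj x + - cj h) - f (- cj x) - (- cj h) * f' (- cj x)).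
  by rewrite !cjE opprD; ring.
have E : normc (- cj x + - cj h) = normc (x + h) by rewrite -opprD normcN -cjD normcJ'.
by rewrite normcJ'; apply: le_trans (HM (- cj x) (- cj h) _ _) _; rewrite ?E ?normcN ?normcJ'.
Qed.

Lemma asol_mp z : asol z (mp z) (mp1 z).
Proof.
have [h1 h2] := asol_pp (cj z); split; first exact: holo_reflect h1.
have h3 := holoZ (- 1) (holo_reflect h2).
have e (X : R[i]) : -1 * cj (pp1 (cj z) (- cj X)) = mp1 z X by rewrite mulN1r.
have -> : mp1 z = (fun X => -1 * cj (pp1 (cj z) (- cj X))) by apply/funext => X; rewrite e.
apply: holo_ext h3 => X; rewrite /mp; move: (pp (cj z) (- cj X)) => u; rewrite !cjE; ring.
Qed.

Lemma asol_curve z y y1 (g : R -> R[i]) t d : asol z y y1 -> cder g t d ->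
  cder (fun s => y (g s)) t (y1 (g t) * d) /\
  cder (fun s => y1 (g s)) t (('i%C * g t ^+ 3 - z) * y (g t) * d).
Proof. by move=> [h1 h2] dg; split; [exact: cder_holo h1 dg|exact: cder_holo h2 dg]. Qed.

(** On this line i X^3 has real part 3 tau x^2 - tau^3, whereas it is purely imaginary on the real
    axis. *)
Definition line tau (x : R) : R[i] := x%:C - 'i%C * tau%:C.

Lemma cder_line tau x : cder (line tau) x 1.
Proof. by apply: cder_eq (cderD (cder_realc x) (cder_cst _ x)) _; rewrite addr0. Qed.

Lemma asol_line z y y1 tau x : asol z y y1 ->
  cder (fun x => y (line tau x)) x (y1 (line tau x)) /\
  cder (fun x => y1 (line tau x)) x (('i%C * line tau x ^+ 3 - z) * y (line tau x)).
Proof.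
by move=> s; have := asol_curve s (cder_line tau x); rewrite !mulr1.
Qed.

Definition awr (y y1 u u1 : R[i] -> R[i]) X := y X * u1 X - y1 X * u X.

Lemma awr_cst z y y1 u u1 X X' : asol z y y1 -> asol z u u1 -> awr y y1 u u1 X = awr y y1 u u1 X'.
Proof.
move=> sy su; pose g (t : R) := X' + t%:C * (X - X').
have E1 : g 1 = X by rewrite /g cC1; ring.
have E0 : g 0 = X' by rewrite /g cC0; ring.
rewrite -E1 -E0; apply: (cder0_cst ler01 (u := fun t => awr y y1 u u1 (g t))) => t _.
have dg : cder g t (X - X').
  by apply: cder_eq (cderD (cder_cst X' t) (cderM (cder_realc t) (cder_cst (X - X') t))) _; ring.
have [a b] := asol_curve sy dg; have [c d] := asol_curve su dg.
apply: cder_eq (cderD (cderM a d) (cderN (cderM b c))) _.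
by move: (g t) (y _) (y1 _) (u _) (u1 _) => *; ring.
Qed.

Definition Wz z X := awr (mp z) (mp1 z) (pp z) (pp1 z) X.

Lemma Yd_0 E : Yd E 0 = Dd E.
Proof. by rewrite /Yd cosol_0 sisol_0; ring. Qed.
Lemma Yd1_0 E : Yd1 E 0 = Nd E.
Proof. by rewrite /Yd1 cosol1_0 sisol1_0; ring. Qed.
Lemma pp_0 z : pp z 0 = Dd (cj (cis (pi / 5)) * z).
Proof. by rewrite /pp mulr0 Yd_0. Qed.
Lemma pp1_0 z : pp1 z 0 = lam * Nd (cj (cis (pi / 5)) * z).
Proof. by rewrite /pp1 mulr0 Yd1_0. Qed.
Lemma mp_0 z : mp z 0 = Dd (cis (pi / 5) * z).
Proof. by rewrite /mp cj0 oppr0 pp_0 -cjM DdJ cjK. Qed.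
Lemma mp1_0 z : mp1 z 0 = - (cj lam * Nd (cis (pi / 5) * z)).
Proof. by rewrite /mp1 cj0 oppr0 pp1_0 -cjM NdJ cjM cjK. Qed.

Lemma Wz_Psi z X : Wz z X * Dd (- z) = 2 * cis (pi / 2) * Psi z.
Proof.
rewrite /Wz (awr_cst X 0 (asol_mp z) (asol_pp z)) /awr pp_0 pp1_0 mp_0 mp1_0 /Psi -ddt_identity; congr (_ * _).
rewrite -/lam (cisN (pi / 10)) -/lam.
by move: (Dd _) (Nd _) (Dd _) (Nd _) => a b c d; ring.
Qed.

Lemma subst_three (P : R -> R -> R -> Prop) a b n a' b' n' : a = a' -> b = b' -> n' = n -> P a' b' n' -> P a b n.
Proof. by move=> -> -> ->. Qed.

Lemma pp_segment z (X0 X1 : R[i]) (M k : R) : 0 < k ->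
  (forall s : R, 0 <= s <= 1 -> normc ('i%C * (X0 + s%:C * (X1 - X0)) ^+ 3 - z) <= M) ->
  sqn (pp1 z X1) + k ^+ 2 * sqn (pp z X1) <=
  (sqn (pp1 z X0) + k ^+ 2 * sqn (pp z X0)) * expR (normc (X1 - X0) * (M + k ^+ 2) / k).
Proof.
move=> k0 H.
have sy : csol (pE z) (Yd (pE z)) (Yd1 (pE z)) by exact: csol_lin (csol_cosol (pE z)) (csol_sisol (pE z)).
have sl : sqn lam = 1 by exact: sqn_cis.
have E1 X : sqn (pp1 z X) = sqn (Yd1 (pE z) (lam * X)) by rewrite /pp1 sqnM sl mul1r.
have N : normc (lam * X1 - lam * X0) = normc (X1 - X0) by rewrite -mulrBr normcM normc_lam mul1r.
have G := @segment_gronwall R _ _ _ (lam * X0) (lam * X1) M k sy k0.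
apply: (subst_three (P := fun a b n => a + k ^+ 2 * sqn (pp z X1) <= (b + k ^+ 2 * sqn (pp z X0)) * expR (n * (M + k ^+ 2) / k))
  (E1 X1) (E1 X0) N); refine (G _).
move=> s /H; congr (_ <= _).
have -> : 'i%C * (X0 + s%:C * (X1 - X0)) ^+ 3 - z = cis (pi / 5) * ((lam * X0 + s%:C * (lam * X1 - lam * X0)) ^+ 3 - pE z).
  by rewrite -lam5 -[in LHS](om_pE z) -lam2; ring.
by rewrite normc_cisM.
Qed.

Lemma sin_small (th : R) : 0 <= th <= pi / 2 -> sin th <= sin (pi / 6) -> th <= pi / 6.
Proof.
move=> /andP[a b] H; rewrite leNgt; apply/negP => c; move: H; rewrite leNgt => /negP; apply.
have p2 := pi_ge2 R.
have m1 : pi / 6 \in `[- (pi / 2), pi / 2 : R] by rewrite in_itv /=; lra.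
have m2 : th \in `[- (pi / 2), pi / 2 : R] by rewrite in_itv /=; lra.
by have := ltr_sin m1 m2; rewrite /= => ->.
Qed.

Lemma cos_pi4_gt0 : 0 < cos (pi / 4) :> R.
Proof. by apply: cos_gt0_pihalf; have := pi_ge2 R; lra. Qed.

Lemma cos_ge_pi4 (a : R) : 0 <= a <= pi / 4 -> cos (pi / 4) <= cos a.
Proof.
move=> /andP[a0]; rewrite le_eqVlt => /orP[/eqP ->//|a1]; apply: ltW.
have p2 := pi_ge2 R.
have m1 : a \in `[0, pi : R] by rewrite in_itv /=; lra.
have m2 : pi / 4 \in `[0, pi : R] by rewrite in_itv /=; lra.
by have := ltr_cos m1 m2; rewrite /= => ->.
Qed.

Lemma approx_aux (a b c d : R) : 0 <= a -> 0 <= b -> 0 <= d -> c <= a + c + (b + d).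
Proof. lra. Qed.

(** Far out on the line, [lam * line tau L] has argument pi / 10 - th with 0 <= th <= pi / 6, which
    is inside the sector. There [- lam * mul v] is the logarithmic derivative of the approximating
    solution; the leading part of [lam * mul v] has argument pi / 4 - (3/2) th, between 0 and pi /
    4. *)
Lemma approximants tau M : 0 <= tau -> 0 <= M -> forall n : nat, exists v (L : R),
  [/\ M <= L, cexp v ^+ 2 = lam * line tau L, exists2 st : R * R, v = vv st.1 st.2 & sector st.2 /\ n%:R <= st.1,
     M <= Re (lam * mul v) & M <= Re (lam * mul v) + Im (lam * mul v)].
Proof.
move=> t0 M0 n; have p2 := pi_ge2 R.
have s6 : 0 < sin (pi / 6) :> R by apply: sin_gt0_pi; lra.
have c4 := cos_pi4_gt0; have c41 : cos (pi / 4) <= 1 :> R by exact: cos_le1.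
(* One summand per demand: [tau] for th <= pi / 6 and [M] for the size of [lam * mul v]; the
   exponential factor pushes the real part of v beyond n. *)
pose L := (1 + tau / sin (pi / 6) + M / cos (pi / 4)) * expR (2 * n%:R).
have ts : 0 <= tau / sin (pi / 6) by rewrite divr_ge0 // ltW.
have mc : 0 <= M / cos (pi / 4) by rewrite divr_ge0 // ltW.
have e1 : 1 <= expR (2 * n%:R) :> R by rewrite -[X in X <= _]expR0 ler_expR mulr_ge0.
have k1 : 0 <= 1 + tau / sin (pi / 6) + M / cos (pi / 4) by lra.
have Le : expR (2 * n%:R) <= L.
  by rewrite -[X in X <= _]mul1r; apply: ler_wpM2r; [lra|lra].
have Lk : 1 + tau / sin (pi / 6) + M / cos (pi / 4) <= L.
  by rewrite -[X in X <= _]mulr1; apply: ler_wpM2l.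
have L1 : 1 <= L by lra.
have LM : M <= cos (pi / 4) * L by rewrite mulrC -ler_pdivrMr //; lra.
have Lt : tau <= sin (pi / 6) * L by rewrite mulrC -ler_pdivrMr //; lra.
have ReX : Re (cj (line tau L)) = L by rewrite /line !ReImE; ring.
have ImX : Im (cj (line tau L)) = tau by rewrite /line !ReImE; ring.
have px : 0 < Re (cj (line tau L)) by rewrite ReX; lra.
have py : 0 <= Im (cj (line tau L)) by rewrite ImX.
have [th th0 Xth] := polar px py.
set r := normc _ in Xth.
have rL : L <= r by rewrite -ReX; exact: Re_le.
have r0 : 0 < r by lra.
have th1 : th <= pi / 6.
  apply: sin_small => //; have : r * sin th = tau by rewrite -Im_ray -Xth ImX.
  move=> E; have : r * sin th <= r * sin (pi / 6).
    by rewrite E; apply: le_trans Lt _; rewrite mulrC; apply: ler_wpM2r => //; exact: ltW.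
  by rewrite ler_pM2l.
have {}th0 : 0 <= th by case/andP: th0.
pose s := ln r / 2; pose t := pi / 20 - th / 2.
have es : expR s ^+ 2 = r by rewrite -expRM_natl /s mulrCA mulfV ?mulr1 ?lnK.
have sn : n%:R <= s.
  by rewrite /s ler_pdivlMr // mulrC -ler_expR lnK //; exact: le_trans Le rL.
have vE : cexp (vv s t) = (expR s)%:C * cis t by exact: polar_cexp.
have sec : sector t by rewrite /sector ler_norml /t; lra.
have X2 : lam * line tau L = r%:C * cis (pi / 10 - th).
  by rewrite -[line tau L]cjK Xth /ray cjM cjC -cisN cisD /lam; ring.
have V2 : cexp (vv s t) ^+ 2 = r%:C * cis (pi / 10 - th).
  by rewrite vE exprMn -cCX es -cisMn; congr (_ * cis _); rewrite /t; field.
pose a := pi / 4 - 3 / 2 * th.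
have mE : lam * mul (vv s t) = (3 / 4 / r)%:C * cis th + (expR s ^+ 3)%:C * cis a.
  rewrite /mul V2 vE exprMn -!cCX -cisMn invfM -cisV.
  have -> : lam * (3 / 4 * (r%:C^-1 * cis (- (pi / 10 - th))) + (expR s ^+ 3)%:C * cis (3%:R * t)) =
     (3 / 4 * r%:C^-1) * (lam * cis (- (pi / 10 - th))) + (expR s ^+ 3)%:C * (lam * cis (3%:R * t)) by ring.
  rewrite /lam -!cisD; congr (_ * cis _ + _ * cis _); [|ring|by rewrite /a /t; field].
  by rewrite !cCM !cCV !cCn.
have a0 : 0 <= a <= pi / 4 by rewrite /a; lra.
have ca := cos_ge_pi4 a0.
have sa : 0 <= sin a by apply: sin_ge0_pi; lra.
have sth : 0 <= sin th by apply: sin_ge0_pi; lra.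
have cth : 0 <= cos th by apply: le_trans (cos_ge_pi4 (a := th) _); lra.
have q0 : 0 <= 3 / 4 / r by rewrite divr_ge0 // ltW.
have e3 : L <= expR s ^+ 3.
  apply: le_trans rL _; rewrite exprS es -[X in X <= _]mul1r; apply: ler_wpM2r; first exact: ltW.
  by rewrite -[X in X <= _]expR0 ler_expR; apply: le_trans sn; exact: ler0n.
have key : M <= expR s ^+ 3 * cos a.
  apply: le_trans LM _; rewrite mulrC; apply: ler_pM => //; lra.
have e30 : 0 <= expR s ^+ 3 by lra.
have P1 := mulr_ge0 q0 cth; have P2 := mulr_ge0 q0 sth; have P3 := mulr_ge0 e30 sa.
exists (vv s t), L; split.
- by have : M <= M / cos (pi / 4) by [rewrite ler_pdivlMr // -[X in _ <= X]mulr1; exact: ler_wpM2l]; lra.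
- by rewrite V2 X2.
- by exists (s, t); split.
- by rewrite mE !ReImE !Re_cis !Im_cis !mul0r !subr0; apply: le_trans key _; rewrite lerDr.
- rewrite mE !ReImE !Re_cis !Im_cis !mul0r !subr0 !addr0; apply: le_trans key _.
  exact: approx_aux.
Qed.

End decaying_solutions.

(** * Energy forms along a line *)

Section energy.
Variable R : realType.
Implicit Types (z w X : R[i]).

(** This is Re ((1 - i e) w1 conj w) + p |w|^2. The multiplier 1 - i e lets Im V help where Re V has
    the wrong sign; for e = 0 a nonpositive value means decay of |w| at rate [p]. *)
Definition QF (e p : R) (w w1 : R[i]) : R := Re (w1 * cj w) + e * Im (w1 * cj w) + p * sqn w.

Lemma QF_le e p (w w1 : R[i]) : 0 <= e <= 1 -> 0 <= p -> - QF e p w w1 <= 2 * (normc w * normc w1).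
Proof.
move=> /andP[e0 e1] p0; have s0 := mulr_ge0 p0 (sqn_ge0 w).
have r := Re_normc (w1 * cj w); have i := Im_normc (w1 * cj w).
rewrite normcM normcJ' (mulrC (normc w1)) in r i; have n0 := mulr_ge0 (normc_ge0 w) (normc_ge0 w1).
move: r i; rewrite /QF !ler_norml => /andP[a _] /andP[b _].
have := ler_wpM2l e0 b; have := ler_wpM2r n0 e1.
move: (Re _) (Im _) (p * _) s0 (normc w * _) n0 a b => x y q q0 n n0 a b; lra.
Qed.

Lemma quad_ge (A e q n m : R) : 0 <= q -> 0 <= n -> 0 <= m -> q ^+ 2 <= 4 * A -> `|e| <= q * (n * m) ->
  0 <= A * n ^+ 2 + m ^+ 2 + e.
Proof.
move=> q0 n0 m0 qA; rewrite ler_norml => /andP[E _].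
have := sqr_ge0 (q * n - 2 * m); have : q ^+ 2 * n ^+ 2 <= 4 * A * n ^+ 2 by apply: ler_wpM2r; rewrite ?sqr_ge0.
lra.
Qed.

Lemma rder_QF (u u1 V : R -> R[i]) (g : R -> R[i]) (e : R -> R) (x e' p : R) : cder u x (u1 x) -> cder u1 x (V x * u x - g x) ->
  rder e x e' ->
  rder (fun x => QF (e x) p (u x) (u1 x)) x
    ((Re (V x) + e x * Im (V x)) * sqn (u x) + sqn (u1 x) +
     (e' * Im (u1 x * cj (u x)) + 2 * p * dotc (u x) (u1 x)) - (Re (g x * cj (u x)) + e x * Im (g x * cj (u x)))).
Proof.
move=> d1 d2 de.
have dw := cderM d2 (cderJ d1).
apply: rder_eq (rderD (rderD (rder_Re dw) (rderM de (rder_Im dw))) (rderM (rder_cst p x) (rder_sqn d1))) _.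
move: (u x) (u1 x) (V x) (g x) (e x) => a b v f c; rewrite /sqn /dotc !ReImE; ring.
Qed.

(** The derivative is at least a quadratic form in |u| and |u1| with diagonal [A], 1 and mixed
    coefficient at most 2 p + eta; the discriminant condition makes it nonnegative. *)
Lemma QF_mono (u u1 V : R -> R[i]) (e e' : R -> R) x0 L (A p eta : R) : x0 <= L -> 0 <= p -> 0 <= eta ->
  (2 * p + eta) ^+ 2 <= 4 * A ->
  (forall x, x0 <= x <= L -> [/\ cder u x (u1 x), cder u1 x (V x * u x), rder e x (e' x),
     `|e' x| <= eta & A <= Re (V x) + e x * Im (V x)]) ->
  QF (e x0) p (u x0) (u1 x0) <= QF (e L) p (u L) (u1 L).
Proof.
move=> x0L p0 eta0 pA H.
pose D x := (Re (V x) + e x * Im (V x)) * sqn (u x) + sqn (u1 x) +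
     (e' x * Im (u1 x * cj (u x)) + 2 * p * dotc (u x) (u1 x)) - (Re (0 * cj (u x)) + e x * Im (0 * cj (u x))).
apply: (@nondecr R (fun x => QF (e x) p (u x) (u1 x)) D x0 L x0L) => x /H [d1 d2 de eb' hA].
  by apply: (rder_QF (V := V) (g := fun=> 0)) => //; rewrite subr0.
rewrite /D mul0r Re0 Im0 mulr0 addr0 subr0.
have q0 : 0 <= 2 * p + eta by lra.
have M : A * sqn (u x) <= (Re (V x) + e x * Im (V x)) * sqn (u x) by apply: ler_wpM2r; rewrite ?sqn_ge0.
have i1 := Im_normc (u1 x * cj (u x)); rewrite normcM normcJ' in i1.
have i2 := dotc_norm (u x) (u1 x).
have B : `|e' x * Im (u1 x * cj (u x)) + 2 * p * dotc (u x) (u1 x)| <= (2 * p + eta) * (normc (u x) * normc (u1 x)).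
  apply: le_trans (ler_normD _ _) _; have -> : (2 * p + eta) * (normc (u x) * normc (u1 x)) = eta * (normc (u x) * normc (u1 x)) + 2 * p * (normc (u x) * normc (u1 x)) by ring.
  apply: lerD.
    by rewrite normrM (mulrC (normc (u x))); apply: ler_pM.
  by rewrite normrM (ger0_norm (mulr_ge0 (ler0n R 2) p0)); apply: ler_wpM2l => //; rewrite mulr_ge0.
have := quad_ge q0 (normc_ge0 (u x)) (normc_ge0 (u1 x)) pA B; rewrite !normc_sqr => K.
apply: le_trans K _; by rewrite lerD2r lerD2r.
Qed.

Lemma forced_aux (A W n g r i m G : R) : A * n <= W * n -> r <= m -> i <= m -> 0 <= g -> 2 * m <= A / 2 * n + G ->
  A / 2 * n <= W * n + g - (r + i) + G.
Proof. lra. Qed.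

(** The same identity with e = 1 and p = 0; Young's inequality takes half of A |u|^2 to absorb the
    forcing. *)
Lemma QF_forced (u u1 V : R -> R[i]) (g : R -> R[i]) (U G : R -> R) x0 L (A : R) : x0 <= L -> 0 < A ->
  (forall x, x0 <= x <= L -> [/\ cder u x (u1 x), cder u1 x (V x * u x - g x), A <= Re (V x) + Im (V x),
     rder U x (sqn (u x)) & rder G x (sqn (g x))]) ->
  A / 2 * (U L - U x0) <= QF 1 0 (u L) (u1 L) - QF 1 0 (u x0) (u1 x0) + 2 / A * (G L - G x0).
Proof.
move=> x0L A0 H.
pose D x := (Re (V x) + 1 * Im (V x)) * sqn (u x) + sqn (u1 x) +
     (0 * Im (u1 x * cj (u x)) + 2 * 0 * dotc (u x) (u1 x)) - (Re (g x * cj (u x)) + 1 * Im (g x * cj (u x))).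
have := @nondecr_le R (fun x => A / 2 * U x) (fun x => QF 1 0 (u x) (u1 x) + 2 / A * G x)
  (fun x => A / 2 * sqn (u x)) (fun x => D x + 2 / A * sqn (g x)) x0 L x0L.
move=> K; have {K} : A / 2 * U L - A / 2 * U x0 <=
   QF 1 0 (u L) (u1 L) + 2 / A * G L - (QF 1 0 (u x0) (u1 x0) + 2 / A * G x0).
  apply: K => x /H [d1 d2 hA dU dG].
  - by apply: rder_eq (rderM (rder_cst (A / 2) x) dU) _; rewrite mul0r add0r.
  - apply: rderD (rder_QF (V := V) 0 d1 d2 (rder_cst 1 x)) _.
    by apply: rder_eq (rderM (rder_cst (2 / A) x) dG) _; rewrite mul0r add0r.
  - rewrite /D mul1r mul0r mulr0 mul0r !addr0 mul1r.
    have M : A * sqn (u x) <= (Re (V x) + Im (V x)) * sqn (u x) by apply: ler_wpM2r; rewrite ?sqn_ge0.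
    have r := Re_le (g x * cj (u x)); have i := Im_le (g x * cj (u x)).
    rewrite normcM normcJ' in r i.
    have s1 := sqn_ge0 (u1 x).
    have Q : 2 * (normc (g x) * normc (u x)) <= A / 2 * sqn (u x) + 2 / A * sqn (g x).
      rewrite -!normc_sqr -subr_ge0.
      have -> : A / 2 * normc (u x) ^+ 2 + 2 / A * normc (g x) ^+ 2 - 2 * (normc (g x) * normc (u x)) =
        (A * normc (u x) - 2 * normc (g x)) ^+ 2 / (2 * A) by field; rewrite gt_eqF.
      by rewrite divr_ge0 ?sqr_ge0 // mulr_ge0 // ltW.
    exact: forced_aux M r i s1 Q.
by move: (QF _ _ _ _) (QF _ _ _ _) => a b; lra.
Qed.

(** The mean value inequality with (s |f|^2 + |p|^2 / s) / 2 as bound on the derivative, for every s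
    > 0, followed by the best choice of s. *)
Lemma cauchy_schwarz (w : R -> R[i]) (f p : R -> R[i]) (F P : R -> R) a b : a <= b ->
  (forall x, a <= x <= b -> [/\ cder w x (f x * p x), rder F x (sqn (f x)) & rder P x (sqn (p x))]) ->
  sqn (w b - w a) <= (F b - F a) * (P b - P a).
Proof.
move=> ab H.
have F0 : 0 <= F b - F a.
  rewrite subr_ge0; apply: (@nondecr R F (fun x => sqn (f x)) a b ab) => x /H [] //.
  by move=> *; exact: sqn_ge0.
have P0 : 0 <= P b - P a.
  rewrite subr_ge0; apply: (@nondecr R P (fun x => sqn (p x)) a b ab) => x /H [] //.
  by move=> *; exact: sqn_ge0.
have am (s : R) : 0 < s -> 2 * normc (w b - w a) <= s * (F b - F a) + s^-1 * (P b - P a).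
  move=> s0; have := @normc_incr_le R w (fun x => (s * F x + s^-1 * P x) / 2) (fun x => f x * p x)
    (fun x => (s * sqn (f x) + s^-1 * sqn (p x)) / 2) a b ab.
  move=> K; have {K} : normc (w b - w a) <= (s * F b + s^-1 * P b) / 2 - (s * F a + s^-1 * P a) / 2.
    apply: K => x /H [dw dF dP] //.
      apply: rder_eq (rderM (rderD (rderM (rder_cst s x) dF) (rderM (rder_cst s^-1 x) dP)) (rder_cst 2^-1 x)) _.
      by ring.
    rewrite normcM -!normc_sqr ler_pdivlMr // -subr_ge0.
    have -> : s * normc (f x) ^+ 2 + s^-1 * normc (p x) ^+ 2 - normc (f x) * normc (p x) * 2 =
      (s * normc (f x) - normc (p x)) ^+ 2 / s by field; rewrite gt_eqF.
    by rewrite divr_ge0 ?sqr_ge0 // ltW.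
  move: (normc _) (s^-1) => n t; lra.
rewrite -normc_sqr; move: (normc_ge0 (w b - w a)) (F b - F a) (P b - P a) F0 P0 am.
move: (normc _) => d d0 A B A0 B0 am.
move: d0; rewrite le_eqVlt => /orP[/eqP <-|d0]; first by rewrite expr0n mulr_ge0.
move: A0; rewrite le_eqVlt => /orP[/eqP A0|A0]; last first.
  have := am (d / A) (divr_gt0 d0 A0); rewrite invf_div divfK ?gt_eqF // => K.
  have : d <= A / d * B by lra.
  by rewrite mulrAC ler_pdivlMr // -expr2.
have Bd : 0 < (B + 1) / d by rewrite divr_gt0 //; lra.
have := am _ Bd; rewrite -A0 mulr0 add0r invf_div mulrAC ler_pdivlMr; last lra.
nra.
Qed.

End energy.

(** * Decay of the subdominant solution along lines *)

Section decaying_estimates.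
Variable R : realType.
Implicit Types (z X : R[i]).

Definition VV z tau (x : R) : R[i] := 'i%C * line tau x ^+ 3 - z.

Lemma ccvg_Re (v : nat -> R[i]) l : ccvg v l -> ccvg (fun n => (Re (v n))%:C) (Re l)%:C.
Proof.
move=> vl e e0; have [N HN] := vl e e0; exists N => n /HN; apply: le_trans.
by rewrite -cCN -cCD normcR -ReB; exact: Re_normc.
Qed.

Lemma QF_lim e p (w w1 : nat -> R[i]) l l1 : ccvg w l -> ccvg w1 l1 -> (forall n, QF e p (w n) (w1 n) <= 0) ->
  QF e p l l1 <= 0.
Proof.
move=> wl wl1 H; rewrite -oppr_ge0.
have E (a b : R[i]) : - QF e p a b = Re ((- 1 + 'i%C * e%:C) * (b * cj a) + (- p)%:C * (a * cj a)).
  by rewrite /QF /sqn !ReImE; ring.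
rewrite E; apply: (@ccvg_ge0 R (fun n => - QF e p (w n) (w1 n)) _ 0); last by move=> n _; rewrite oppr_ge0.
apply: (ccvg_ext (u := fun n => (Re ((- 1 + 'i%C * e%:C) * (w1 n * cj (w n)) + (- p)%:C * (w n * cj (w n))))%:C)).
  by move=> n; rewrite E.
apply: ccvg_Re; apply: ccvgD; apply: ccvgZ; apply: ccvgM => //; exact: ccvgJ.
Qed.

Lemma convex_aux (a b e p m : R) : m <= a -> m <= b -> 0 <= e -> e <= 1 -> p <= m -> p <= (1 - e) * a + e * b.
Proof. move=> *; nra. Qed.

Lemma Ap_aux (A p eta : R) : 0 <= p -> 0 <= eta -> (2 * p + eta) ^+ 2 <= 4 * A -> p ^+ 2 <= A.
Proof. move=> p0 e0; have := mulr_ge0 p0 e0; have := sqr_ge0 eta; lra. Qed.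

Lemma seg_aux (x0 x s d : R) : 0 <= s -> s <= 1 -> x0 <= x -> x <= x0 + d -> x0 <= x + s * (x0 - x) /\ x + s * (x0 - x) <= x0 + d.
Proof. by move=> *; split; nra. Qed.

Lemma slope_aux2 (A W n m eta p e F : R) : F <= m ^+ 2 + p ^+ 2 * n ^+ 2 ->
  A * n ^+ 2 <= W * n ^+ 2 -> `|e| <= eta * (m * n) -> p ^+ 2 <= A -> eta <= p -> 0 <= p -> 0 <= m -> 0 <= n ->
  F / 2 <= W * n ^+ 2 + m ^+ 2 + e.
Proof.
move=> B M; rewrite ler_norml => /andP[Y _] Ap ep p0 m0 n0.
have X : eta * (m * n) <= p * (m * n) by apply: ler_wpM2r => //; exact: mulr_ge0.
have Z : p ^+ 2 * n ^+ 2 <= A * n ^+ 2 by apply: ler_wpM2r => //; exact: sqr_ge0.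
have := sqr_ge0 (p * n - m); lra.
Qed.

Lemma log_aux (n m p e F : R) : 0 <= n -> 0 <= m -> 0 < p -> 0 < e -> e^-1 * F / 2 / p <= n * m -> m ^+ 2 <= F -> 0 <= F ->
  F <= 4 * p ^+ 2 * e ^+ 2 * n ^+ 2.
Proof.
move=> n0 m0 p0 e0; have pe : 0 < 2 * p * e by rewrite !mulr_gt0.
have -> : e^-1 * F / 2 / p = F / (2 * p * e) by field; rewrite !gt_eqF.
rewrite ler_pdivrMr // => K mF.
have P : 0 <= 4 * p ^+ 2 * e ^+ 2 * n ^+ 2 by apply: mulr_ge0; [apply: mulr_ge0; [apply: mulr_ge0 => //|]|]; exact: sqr_ge0.
rewrite le_eqVlt => /orP[/eqP <-|F0] //.
have : F ^+ 2 <= (n * m * (2 * p * e)) ^+ 2.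
  by apply: lerXn2r; rewrite ?nnegrE ?mulr_ge0 // ltW.
have -> : (n * m * (2 * p * e)) ^+ 2 = (4 * p ^+ 2 * e ^+ 2 * n ^+ 2) * m ^+ 2 by ring.
move=> H; have := le_trans H (ler_wpM2l P mF); rewrite expr2 ler_pM2r //.
Qed.

Lemma CB_ge0 E (y y1 : R[i] -> R[i]) : 0 <= CB E y y1.
Proof.
have p2 := pi_ge2 R; have k2 := kE_ge E.
by rewrite /CB; apply: mulr_ge0; [apply: mulr_ge0; [lra|exact: MB_ge0]|lra].
Qed.

(** The approximating solutions have the sign at their starting point; [QF_mono] carries it inwards
    to [x0], and it persists in the limit. *)
Lemma pp_QF z tau (x0 A p eta : R) (e e' : R -> R) : 0 <= tau -> 0 <= p -> 0 <= eta -> (2 * p + eta) ^+ 2 <= 4 * A ->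
  (forall x, x0 <= x -> [/\ rder e x (e' x), `|e' x| <= eta, 0 <= e x <= 1 & A <= Re (VV z tau x) + e x * Im (VV z tau x)]) ->
  QF (e x0) p (pp z (line tau x0)) (pp1 z (line tau x0)) <= 0.
Proof.
move=> t0 p0 eta0 pA H.
have M0 : 0 <= `|x0| + p by rewrite addr_ge0.
have [v Hv] := @choice _ _ _ (approximants t0 M0).
have [L HL] := @choice _ _ _ Hv.
pose yn n X := DL (v n) (pE z) * cosol (pE z) (lam R * X) + NL (v n) (pE z) * sisol (pE z) (lam R * X).
pose yn1 n X := lam R * (DL (v n) (pE z) * cosol1 (pE z) (lam R * X) + NL (v n) (pE z) * sisol1 (pE z) (lam R * X)).
have cD : ccvg (fun n => DL (v n) (pE z)) (Dd (pE z)).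
  apply: (@ccvg_exp R _ _ (CB (pE z) (sisol (pE z)) (sisol1 (pE z)))) => n.
  have [_ _ [[s t] -> [/= sec ns]] _ _] := HL n.
  have s0 : 0 <= s by exact: le_trans (ler0n _ _) ns.
  apply: le_trans (DL_dist (pE z) sec s0) _; apply: ler_wpM2l; last by rewrite ler_expR lerN2.
  exact: CB_ge0.
have cN : ccvg (fun n => NL (v n) (pE z)) (Nd (pE z)).
  apply: (@ccvg_exp R _ _ (CB (pE z) (cosol (pE z)) (cosol1 (pE z)))) => n.
  have [_ _ [[s t] -> [/= sec ns]] _ _] := HL n.
  have s0 : 0 <= s by exact: le_trans (ler0n _ _) ns.
  apply: le_trans (NL_dist (pE z) sec s0) _; apply: ler_wpM2l; last by rewrite ler_expR lerN2.
  exact: CB_ge0.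
apply: (@QF_lim (e x0) p (fun n => yn n (line tau x0)) (fun n => yn1 n (line tau x0))).
- by rewrite /yn /pp /Yd; apply: ccvgD; apply: ccvgM => //; exact: ccvg_cst.
- by rewrite /yn1 /pp1 /Yd1; apply: ccvgZ; apply: ccvgD; apply: ccvgM => //; exact: ccvg_cst.
move=> n; have [ML VL _ m1 m2] := HL n.
have xL : x0 <= L n by apply: le_trans ML; apply: le_trans (ler_norm _) _; rewrite lerDl.
have pL : p <= `|x0| + p by rewrite lerDr.
have sy : asol z (yn n) (yn1 n) by exact: (asol_csol (csol_yL (v n) (pE z))).
apply: le_trans (QF_mono (V := VV z tau) (u := fun x => yn n (line tau x)) (u1 := fun x => yn1 n (line tau x))
  (e := e) (e' := e') (A := A) xL p0 eta0 pA _) _.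
  move=> x /andP[x0x _]; have [? ? ? ?] := H x x0x.
  by have [? ?] := asol_line tau x sy; split.
have E0 : yn n (line tau (L n)) = am (v n) by rewrite /yn -VL; exact: yL_at.
have E1 : yn1 n (line tau (L n)) = - (lam R * mul (v n)) * am (v n).
  by rewrite /yn1 -VL -[X in lam R * X]/(yL1 (v n) (pE z) (cexp (v n) ^+ 2)) yL1_at; ring.
have [_ _ /andP[e0 e1] _] := H (L n) xL.
rewrite /= E0 E1; move: (am (v n)) (lam R * mul (v n)) m1 m2 => a m m1 m2.
have -> : QF (e (L n)) p a (- m * a) = - ((1 - e (L n)) * Re m + e (L n) * (Re m + Im m) - p) * sqn a.
  by rewrite /QF /sqn !ReImE; ring.
rewrite mulNr oppr_le0 mulr_ge0 ?sqn_ge0 // subr_ge0.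
exact: convex_aux m1 m2 e0 e1 pL.
Qed.

(** The derivative cannot be large at [x0] where the value nearly vanishes. Over a length 1 / p the
    energy keeps a fixed fraction of its initial size, so the form with p = 0 grows by a definite
    amount and still ends nonpositive; hence - Re (u1 conj u), and with it |u| |u1|, is at least
    that amount at [x0]. *)
Lemma log_bound z tau (x0 A p eta M : R) (e e' : R -> R) : 0 <= tau -> 0 < p -> 0 <= eta -> eta <= p -> (2 * p + eta) ^+ 2 <= 4 * A ->
  (forall x, x0 <= x -> [/\ rder e x (e' x), `|e' x| <= eta, 0 <= e x <= 1 & A <= Re (VV z tau x) + e x * Im (VV z tau x)]) ->
  e x0 = 0 -> (forall x, x0 <= x <= x0 + p^-1 -> normc (VV z tau x) <= M * p ^+ 2) ->
  sqn (pp1 z (line tau x0)) + p ^+ 2 * sqn (pp z (line tau x0)) <= 4 * p ^+ 2 * expR (2 * (M + 1)) * sqn (pp z (line tau x0)).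
Proof.
move=> t0 p0 eta0 etap pA H e00 HM.
have p0' := ltW p0.
have pV : 0 < p^-1 by rewrite invr_gt0.
have xx : x0 <= x0 + p^-1 by rewrite lerDl ltW.
have Ap : p ^+ 2 <= A by exact: Ap_aux pA.
set E := fun x => sqn (pp1 z (line tau x)) + p ^+ 2 * sqn (pp z (line tau x)).
have E0 x : 0 <= E x by rewrite /E addr_ge0 ?sqn_ge0 // mulr_ge0 ?sqn_ge0 ?sqr_ge0.
have back x : x0 <= x <= x0 + p^-1 -> E x0 <= E x * expR (M + 1).
  move=> /andP[x1 x2]; have := @pp_segment R z (line tau x) (line tau x0) (M * p ^+ 2) p p0.
  have d : line tau x0 - line tau x = (x0 - x)%:C by rewrite /line cCD cCN; ring.
  rewrite d normcR ler0_norm ?subr_le0 // opprB => K.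
  apply: le_trans (K _) _.
    move=> s /andP[s0 s1].
    have -> : line tau x + s%:C * (x0 - x)%:C = line tau (x + s * (x0 - x)).
      by rewrite /line -cCM (cCD x) addrAC.
    by apply: HM; apply/andP; exact: seg_aux.
  apply: (ler_wpM2l (E0 x)); rewrite ler_expR.
  have -> : (x - x0) * (M * p ^+ 2 + p ^+ 2) / p = ((x - x0) * p) * (M + 1) by field; rewrite gt_eqF.
  have M1 : 0 <= M + 1.
    have := HM x0; rewrite lexx xx => /(_ isT) h; have := le_trans (normc_ge0 _) h.
    by rewrite (pmulr_lge0 _ (exprn_gt0 2 p0)) => M0; exact: addr_ge0 M0 ler01.
  rewrite -[X in _ <= X]mul1r; apply: ler_wpM2r => //.
  by rewrite -ler_pdivlMr // mul1r lerBlDr addrC.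
have end0 : QF (e (x0 + p^-1)) 0 (pp z (line tau (x0 + p^-1))) (pp1 z (line tau (x0 + p^-1))) <= 0.
  apply: (@pp_QF z tau (x0 + p^-1) A 0 eta e e') => //.
    apply: le_trans pA; rewrite mulr0 add0r; apply: lerXn2r; rewrite ?nnegrE //; lra.
  by move=> x xl; apply: H; exact: le_trans xl.
have slope : expR (- (M + 1)) * E x0 / 2 * (x0 + p^-1) - expR (- (M + 1)) * E x0 / 2 * x0 <=
  QF (e (x0 + p^-1)) 0 (pp z (line tau (x0 + p^-1))) (pp1 z (line tau (x0 + p^-1))) -
  QF (e x0) 0 (pp z (line tau x0)) (pp1 z (line tau x0)).
  pose D x := (Re (VV z tau x) + e x * Im (VV z tau x)) * sqn (pp z (line tau x)) + sqn (pp1 z (line tau x)) +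
     (e' x * Im (pp1 z (line tau x) * cj (pp z (line tau x))) + 2 * 0 * dotc (pp z (line tau x)) (pp1 z (line tau x))) -
     (Re (0 * cj (pp z (line tau x))) + e x * Im (0 * cj (pp z (line tau x)))).
  apply: (@nondecr_le R (fun x => expR (- (M + 1)) * E x0 / 2 * x)
    (fun x => QF (e x) 0 (pp z (line tau x)) (pp1 z (line tau x))) (fun=> expR (- (M + 1)) * E x0 / 2) D _ _ xx) => x xb.
  - by apply: rder_eq (rderM (rder_cst _ x) (rder_id x)) _; ring.
  - have [xl _] := andP xb; have [de _ _ _] := H x xl.
    have [d1 d2] := asol_line tau x (asol_pp z).
    apply: (rder_QF (u := fun x => pp z (line tau x)) (u1 := fun x => pp1 z (line tau x)) (V := VV z tau) (g := fun=> 0)) => //.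
    by rewrite subr0.
  - have [xl _] := andP xb; have [_ he _ hA] := H x xl.
    rewrite /D !(mulr0, mul0r) ?Re0 ?Im0 !(mulr0, addr0, subr0).
    have B := back x xb.
    have {}B : expR (- (M + 1)) * E x0 <= E x.
      by rewrite expRN -ler_pdivlMl ?invr_gt0 ?expR_gt0 // invrK mulrC.
    have M' : A * sqn (pp z (line tau x)) <= (Re (VV z tau x) + e x * Im (VV z tau x)) * sqn (pp z (line tau x)).
      by apply: ler_wpM2r; rewrite ?sqn_ge0.
    have i := Im_normc (pp1 z (line tau x) * cj (pp z (line tau x))); rewrite normcM normcJ' in i.
    have Y : `|e' x * Im (pp1 z (line tau x) * cj (pp z (line tau x)))| <= eta * (normc (pp1 z (line tau x)) * normc (pp z (line tau x))).
      by rewrite normrM; apply: ler_pM.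
    have {}B : expR (- (M + 1)) * E x0 <= normc (pp1 z (line tau x)) ^+ 2 + p ^+ 2 * normc (pp z (line tau x)) ^+ 2.
      by rewrite (normc_sqr (pp1 z _)) (normc_sqr (pp z _)); exact: B.
    rewrite -(normc_sqr (pp z (line tau x))) in M' *; rewrite -(normc_sqr (pp1 z (line tau x))).
    exact: (slope_aux2 B M' Y Ap etap p0' (normc_ge0 _) (normc_ge0 _)).
have dx : x0 + p^-1 - x0 = p^-1 by rewrite addrC addKr.
rewrite -mulrBr dx e00 in slope.
have Q := QF_le (pp z (line tau x0)) (pp1 z (line tau x0)) (e := 0) (p := 0).
have q := Re_normc (pp1 z (line tau x0) * cj (pp z (line tau x0))); rewrite normcM normcJ' in q.
have K : expR (- (M + 1)) * E x0 / 2 / p <= normc (pp z (line tau x0)) * normc (pp1 z (line tau x0)).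
  apply: (le_trans slope); apply: (@le_trans _ _ (- QF 0 0 (pp z (line tau x0)) (pp1 z (line tau x0)))).
    by rewrite -[X in _ <= X]add0r lerD2r.
  have QE (a b : R[i]) : QF 0 0 a b = Re (b * cj a) by rewrite /QF !mul0r !addr0.
  rewrite QE (mulrC (normc (pp z _))) lerNl.
  by have /andP[] : - (normc (pp1 z (line tau x0)) * normc (pp z (line tau x0))) <= Re (pp1 z (line tau x0) * cj (pp z (line tau x0)))
     <= normc (pp1 z (line tau x0)) * normc (pp z (line tau x0)) by rewrite -ler_norml.
have Ee : expR (2 * (M + 1)) = expR (M + 1) ^+ 2 by rewrite expRM_natl.
rewrite expRN in K; rewrite Ee -(normc_sqr (pp z (line tau x0))).
have F1 : normc (pp1 z (line tau x0)) ^+ 2 <= E x0.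
  by rewrite (normc_sqr (pp1 z _)) lerDl; apply: mulr_ge0; [exact: sqr_ge0|exact: sqn_ge0].
have := log_aux (normc_ge0 _) (normc_ge0 _) p0 (expR_gt0 _) K F1 (E0 x0).
by rewrite /E (normc_sqr (pp z _)).
Qed.

End decaying_estimates.

(** * A priori estimates *)

Section apriori.
Variable R : realType.
Implicit Types (z : R[i]) (U F P : R -> R).

Definition tdata (u u' u'' : R -> R[i]) (X : R) := [/\ forall x, cder u x (u' x), forall x, cder u' x (u'' x) &
  forall x, X <= `|x| -> [/\ u x = 0, u' x = 0 & u'' x = 0]].

(** This is (H - z) u, since VV z 0 x = i x^3 - z. *)
Definition fz z (u u'' : R -> R[i]) (x : R) : R[i] := VV z 0 x * u x - u'' x.

(* [M] bounds the square of the norm of the resolvent on test functions. *)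
Definition apr z (M : R) := forall u u' u'' X U F, 0 <= X -> tdata u u' u'' X ->
  (forall x, rder U x (sqn (u x))) -> (forall x, rder F x (sqn (fz z u u'' x))) ->
  U X - U (- X) <= M * (F X - F (- X)).

Lemma line0 (x : R) : line 0 x = x%:C.
Proof. by rewrite /line cC0 mulr0 subr0. Qed.

Lemma fz_u z (u u'' : R -> R[i]) x : u'' x = VV z 0 x * u x - fz z u u'' x.
Proof. by rewrite /fz opprB addrC subrK. Qed.

Lemma rder_ge0_mono F (f : R -> R) a b : (forall x, rder F x (f x)) -> (forall x, 0 <= f x) -> a <= b -> F a <= F b.
Proof. by move=> dF f0 ab; apply: (@nondecr R F f a b ab) => x _. Qed.

Lemma rder_le_bound F (f : R -> R) a b (c : R) : (forall x, rder F x (f x)) -> a <= b ->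
  (forall x, a <= x <= b -> f x <= c) -> F b - F a <= c * (b - a).
Proof.
move=> dF ab fc; rewrite mulrBr.
apply: (@nondecr_le R F (fun x => c * x) f (fun=> c) a b ab) => x xab //; last exact: fc.
by apply: rder_eq (rderM (rder_cst c x) (rder_id x)) _; ring.
Qed.

Lemma rder_cst_on F (f : R -> R) a b : (forall x, rder F x (f x)) -> a <= b ->
  (forall x, a <= x <= b -> f x = 0) -> F b = F a.
Proof.
move=> dF ab f0; apply/eqP; rewrite eq_le; apply/andP; split.
  rewrite -subr_le0; have := rder_le_bound dF ab (c := 0); rewrite mul0r; apply.
  by move=> x /f0 ->.
by apply: (@nondecr R F f a b ab) => x // /f0 ->.
Qed.

Lemma reflect_rder F (f : R -> R) : (forall x, rder F x (f x)) -> forall x, rder (fun x => - F (- x)) x (f (- x)).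
Proof.
by move=> dF x; apply: rder_eq (rderN (rder_comp (rder_opp x) (dF (- x)))) _; ring.
Qed.

Lemma reflect_cder (u u' : R -> R[i]) : (forall x, cder u x (u' x)) -> forall x, cder (fun x => cj (u (- x))) x (- cj (u' (- x))).
Proof.
move=> du x; apply: cder_eq (cderJ (cder_comp (rder_opp x) (du (- x)))) _.
by rewrite cCN cC1 mulN1r cjN.
Qed.

Lemma reflect_tdata (u u' u'' : R -> R[i]) X : tdata u u' u'' X ->
  tdata (fun x => cj (u (- x))) (fun x => - cj (u' (- x))) (fun x => cj (u'' (- x))) X.
Proof.
move=> [h1 h2 h3]; split; first exact: reflect_cder.
  move=> x; apply: cder_eq (cderN (reflect_cder h2 x)) _; by rewrite opprK.
by move=> x; rewrite -normrN => /h3 [-> -> ->]; rewrite cj0 oppr0.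
Qed.

Lemma VV_reflect z (x : R) : VV (cj z) 0 x = cj (VV z 0 (- x)).
Proof. by rewrite /VV !line0 !cjE cCN; ring. Qed.

Lemma sqn_fz_reflect z (u u'' : R -> R[i]) x :
  sqn (fz (cj z) (fun x => cj (u (- x))) (fun x => cj (u'' (- x))) x) = sqn (fz z u u'' (- x)).
Proof. by rewrite /fz VV_reflect -cjM -cjB sqnJ. Qed.

Lemma apr_reflect z M : apr z M -> apr (cj z) M.
Proof.
move=> H u u' u'' X U F X0 td dU dF.
have := H _ _ _ X (fun x => - U (- x)) (fun x => - F (- x)) X0 (reflect_tdata td).
rewrite !opprK (addrC _ (U X)) (addrC _ (F X)); apply.
  by move=> x; apply: rder_eq (reflect_rder dU x) _; rewrite sqnJ.
move=> x; apply: rder_eq (reflect_rder dF x) _.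
by have := sqn_fz_reflect (cj z) u u'' x; rewrite cjK => ->.
Qed.

(** Beyond [r] the form is coercive, and u vanishes at [X], so a boundary term is left at [r]
    only. *)
Lemma outer z (u u' u'' : R -> R[i]) X U F (r A : R) : 0 < A -> tdata u u' u'' X ->
  (forall x, rder U x (sqn (u x))) -> (forall x, rder F x (sqn (fz z u u'' x))) ->
  (forall x, r <= x -> A <= Re (VV z 0 x) + Im (VV z 0 x)) -> 0 <= X -> r <= X ->
  A / 2 * (U X - U r) <= 2 * (normc (u r) * normc (u' r)) + 2 / A * (F X - F r).
Proof.
move=> A0 [h1 h2 h3] dU dF hA X0 rX.
have := @QF_forced R u u' (VV z 0) (fz z u u'') U F r X A rX A0.
move=> H; apply: le_trans (H _) _.
  by move=> x /andP[rx _]; split; rewrite -?fz_u //; exact: hA.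
apply: lerD => //; have [|-> -> _] := h3 X; first by rewrite ger0_norm.
have -> : QF 1 0 (0 : R[i]) 0 = 0 by rewrite /QF /sqn !ReImE; ring.
by rewrite sub0r; apply: QF_le; rewrite ?ler01 ?lexx.
Qed.

Lemma outer_aux (k A n m PX E Q Q0 : R) : 0 < k -> 0 < A -> 0 <= n -> 0 <= m -> A / 2 * PX <= Q - Q0 + 2 / A * (0 - 0) -> Q <= 0 ->
  - Q0 <= 2 * (n * m) -> k ^+ 2 * n ^+ 2 <= E -> m ^+ 2 <= E -> PX <= 4 / (k * A) * E.
Proof.
rewrite subrr mulr0 addr0 => k0 A0 n0 m0 H Q1 Q2 a b.
have : A / 2 * PX <= 2 * (n * m) by lra.
have nm : n * m * k <= E.
  have := sqr_ge0 (k * n - m); nra.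
have -> : 4 / (k * A) * E = (4 * E) / (k * A) by ring.
rewrite ler_pdivlMr ?mulr_gt0 // => K.
have : k * (A / 2 * PX) <= k * (2 * (n * m)) by apply: ler_wpM2l => //; exact: ltW.
lra.
Qed.

Lemma window_aux (x0 n l X : R) : - n <= x0 <= n -> n + l <= X ->
  [/\ x0 + l <= X, - X <= x0 - l, - x0 + l <= X & - X <= - x0 - l].
Proof. by move=> /andP[a b] c; split; lra. Qed.

Lemma l2_aux (x0 l x : R) : x0 - l <= x -> x0 + l - x <= 2 * l. Proof. lra. Qed.
Lemma refl_aux (x0 l x : R) : - x0 - l <= x -> x <= - x0 + l -> x0 - l <= - x <= x0 + l.
Proof. by move=> a b; apply/andP; split; lra. Qed.
Lemma lin_aux (a b c d : R[i]) (A B : R) : sqn b <= A -> sqn d <= B ->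
  sqn (a * b + c * d) <= 2 * (sqn a * A + sqn c * B).
Proof.
move=> bA dB; apply: le_trans (sqnD_le _ _) _; rewrite !sqnM; apply: ler_wpM2l => //.
by apply: lerD; apply: ler_wpM2l; rewrite ?sqn_ge0.
Qed.
Lemma lw_aux (x0 l : R) : 0 <= l -> x0 - l <= x0 + l. Proof. lra. Qed.

Lemma prod_bound (N kp Ep Em k2 q p q1 p1 G S : R) : 0 <= k2 -> 0 <= N * kp -> 0 <= Ep -> 0 <= Em ->
  0 <= q -> 0 <= p -> 0 <= q1 -> 0 <= p1 -> p1 + k2 * p <= Ep -> q1 + k2 * q <= Em -> Ep * Em <= G * S ->
  k2 * (2 * (q * (N * (kp * Ep)) + p * (N * (kp * Em)))) <= S * (4 * N * kp * G) /\
  2 * (q1 * (N * (kp * Ep)) + p1 * (N * (kp * Em))) <= S * (4 * N * kp * G).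
Proof.
move=> k20 C0 E0 E0' q0 p0 q10 p10 bp bq hG.
have kp0 := mulr_ge0 k20 p0; have kq0 := mulr_ge0 k20 q0.
have a1 : (k2 * q) * Ep <= Em * Ep by apply: ler_wpM2r => //; lra.
have a2 : (k2 * p) * Em <= Ep * Em by apply: ler_wpM2r => //; lra.
have a3 : q1 * Ep <= Em * Ep by apply: ler_wpM2r => //; lra.
have a4 : p1 * Em <= Ep * Em by apply: ler_wpM2r => //; lra.
have b1 : N * kp * (k2 * q * Ep + k2 * p * Em) <= N * kp * (2 * (G * S)) by apply: ler_wpM2l => //; lra.
have b2 : N * kp * (q1 * Ep + p1 * Em) <= N * kp * (2 * (G * S)) by apply: ler_wpM2l => //; lra.
split; lra.
Qed.

Lemma prod_aux (k n m B : R) : 0 < k -> 0 <= n -> 0 <= m -> k ^+ 2 * n ^+ 2 <= B -> m ^+ 2 <= B -> n * m <= B / k.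
Proof.
move=> k0 n0 m0 a b; rewrite ler_pdivlMr //; have := sqr_ge0 (k * n - m); nra.
Qed.

Lemma out_aux (A D nm B N f : R) : 0 < A -> A / 2 * D <= 2 * nm + 2 / A * f -> nm <= B -> f <= N ->
  D <= 4 * B / A + 4 / A ^+ 2 * N.
Proof.
move=> A0 H b fN; have A2 : 0 < 2 / A by rewrite divr_gt0.
have : 2 / A * (A / 2 * D) <= 2 / A * (2 * B + 2 / A * N).
  apply: ler_wpM2l; first exact: ltW.
  by apply: le_trans H _; apply: lerD; [lra|apply: ler_wpM2l => //; exact: ltW].
have -> : 2 / A * (A / 2 * D) = D by field; rewrite gt_eqF.
move/le_trans; apply; rewrite le_eqVlt; apply/orP; left; apply/eqP; field; by rewrite gt_eqF.
Qed.

Lemma final_aux (l k A G N K B : R) : 0 <= l -> 0 < k -> 0 < A -> 0 <= G -> 0 <= N ->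
  K = 2 * l / k ^+ 2 + 4 / (k * A) -> B = 4 * N * K * G ->
  4 * (B / k) / A + 4 / A ^+ 2 * N + B / k ^+ 2 * (2 * l) + (4 * (B / k) / A + 4 / A ^+ 2 * N) <=
  (8 * G * K ^+ 2 + 8 / A ^+ 2) * N.
Proof.
move=> l0 k0 A0 G0 N0 KE ->; rewrite -subr_ge0.
have K0 : 0 <= K by rewrite KE addr_ge0 // divr_ge0 ?mulr_ge0 ?exprn_ge0 // ltW.
have -> : (8 * G * K ^+ 2 + 8 / A ^+ 2) * N - (4 * (4 * N * K * G / k) / A + 4 / A ^+ 2 * N +
     4 * N * K * G / k ^+ 2 * (2 * l) + (4 * (4 * N * K * G / k) / A + 4 / A ^+ 2 * N)) =
   8 * G * K * N * (l / k ^+ 2) + 8 * G * K * N * (K - (2 * l / k ^+ 2 + 4 / (k * A))).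
  by field; rewrite !gt_eqF.
by rewrite -KE subrr mulr0 addr0 !mulr_ge0 ?invr_ge0 ?exprn_ge0 // ltW.
Qed.

Section half_line.
Variables (z : R[i]) (u u' u'' : R -> R[i]) (X : R) (F : R -> R) (x0 l k A Mv : R).
Hypotheses (l0 : 0 <= l) (k0 : 0 < k) (A0 : 0 < A) (td : tdata u u' u'' X) (X0 : 0 <= X).
Hypotheses (dF : forall x, rder F x (sqn (fz z u u'' x))).
Hypotheses (rX : x0 + l <= X) (lX : - X <= x0 - l).
Hypothesis hV : forall x, x0 - l <= x <= x0 + l -> normc (VV z 0 x) <= Mv.
Hypothesis hA : forall x, x0 + l <= x -> A <= Re (VV z 0 x) + Im (VV z 0 x).

Definition en z (k x : R) : R := sqn (pp1 z (line 0 x)) + k ^+ 2 * sqn (pp z (line 0 x)).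
Let Ep := en z k x0 * expR (l * (Mv + k ^+ 2) / k).
(** The squared norm of the decaying solution per unit of its energy: 2 l / k^2 from a window of
    length 2 l, and 4 / (k A) from the coercive region beyond it. *)
Definition kap (l k A : R) : R := 2 * l / k ^+ 2 + 4 / (k * A).

Lemma en_ge0 w (q x : R) : 0 <= en w q x.
Proof. by rewrite /en addr_ge0 ?sqn_ge0 // mulr_ge0 ?sqn_ge0 ?sqr_ge0. Qed.

Lemma window_en x : x0 - l <= x <= x0 + l -> en z k x <= Ep.
Proof.
move=> xw.
have d : line 0 x - line 0 x0 = (x - x0)%:C by rewrite !line0 cCD cCN.
have xl : `|x - x0| <= l by rewrite ler_distl.
have K := @pp_segment R z (line 0 x0) (line 0 x) Mv k k0; rewrite d normcR in K.
apply: le_trans (K _) _ => {K}.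
  move=> s /andP[s0 s1].
  have -> : line 0 x0 + s%:C * (x - x0)%:C = line 0 (x0 + s * (x - x0)) by rewrite !line0 -cCM -cCD.
  apply: hV; rewrite -ler_distl addrAC subrr add0r normrM ger0_norm //.
  by rewrite -[X in _ <= X]mul1r; apply: ler_pM.
have Mv0 : 0 <= Mv by apply: le_trans (normc_ge0 (VV z 0 x)) (hV xw).
apply: ler_wpM2l; first exact: en_ge0.
rewrite ler_expR; apply: ler_wpM2r; first by rewrite invr_ge0 ltW.
by apply: ler_wpM2r => //; rewrite addr_ge0 ?sqr_ge0.
Qed.

Lemma Ep_ge0 : 0 <= Ep. Proof. by rewrite /Ep mulr_ge0 ?en_ge0 ?expR_ge0. Qed.

(** The Wronskian of u and [pp] has derivative [fz * pp] and vanishes at [X]; Cauchy-Schwarz bounds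
    it by the norms of the two factors on [x, X]. *)
Lemma half_line x : x0 - l <= x <= x0 + l ->
  sqn (u x * pp1 z (line 0 x) - u' x * pp z (line 0 x)) <= (F X - F (- X)) * (kap l k A * Ep).
Proof.
move=> xw; have [x1 x2] := andP xw; have [h1 h2 h3] := td.
have E0 := Ep_ge0; have k2 : 0 < k ^+ 2 by rewrite exprn_gt0.
have cont : continuous (fun x => sqn (pp z (line 0 x))).
  by move=> t; have [d _] := asol_line 0 t (asol_pp z); exact: rder_cont (rder_sqn d).
have [P dP] := primitive (- X - 1) cont.
have dP' t : - X <= t -> rder P t (sqn (pp z (line 0 t))).
  by move=> Xt; apply: dP; apply: lt_le_trans Xt; rewrite gtrBl.
have Xx : - X <= x by exact: le_trans lX x1.
have xX : x <= X by exact: le_trans x2 rX.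
have Xr : - X <= x0 + l by exact: le_trans Xx x2.
have ppE t : x0 - l <= t <= x0 + l -> k ^+ 2 * sqn (pp z (line 0 t)) <= Ep /\ sqn (pp1 z (line 0 t)) <= Ep.
  move=> /window_en W; split; apply: le_trans W; rewrite /en ?lerDr ?sqn_ge0 // lerDl.
  by rewrite mulr_ge0 ?sqn_ge0 ?ltW.
have P1 : P (x0 + l) - P x <= 2 * l / k ^+ 2 * Ep.
  have : P (x0 + l) - P x <= Ep / k ^+ 2 * (x0 + l) - Ep / k ^+ 2 * x.
    apply: (@nondecr_le R P (fun t => Ep / k ^+ 2 * t) (fun t => sqn (pp z (line 0 t))) (fun=> Ep / k ^+ 2) x (x0 + l) x2) => t /andP[t1 t2].
    - by apply: dP'; exact: le_trans t1.
    - by apply: rder_eq (rderM (rder_cst _ t) (rder_id t)) _; ring.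
    - have [|+ _] := ppE t; first by rewrite (le_trans x1 t1).
      by rewrite ler_pdivlMr // mulrC.
  rewrite -mulrBr => H; apply: le_trans H _.
  have -> : 2 * l / k ^+ 2 * Ep = Ep / k ^+ 2 * (2 * l) by ring.
  apply: ler_wpM2l; first by rewrite divr_ge0 // ltW.
  exact: l2_aux.
have P2 : P X - P (x0 + l) <= 4 / (k * A) * Ep.
  have K : A / 2 * (P X - P (x0 + l)) <= QF 1 0 (pp z (line 0 X)) (pp1 z (line 0 X)) - QF 1 0 (pp z (line 0 (x0 + l))) (pp1 z (line 0 (x0 + l))) + 2 / A * (0 - 0).
    apply: (@QF_forced R (fun t => pp z (line 0 t)) (fun t => pp1 z (line 0 t)) (VV z 0) (fun=> 0) P (fun=> 0) (x0 + l) X A rX A0) => t /andP[t1 t2]; have [? ?] := asol_line 0 t (asol_pp z); split => //.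
    + by rewrite subr0.
    + exact: hA.
    + by apply: dP'; exact: le_trans t1.
    + by rewrite sqn0; exact: rder_cst.
  have QX : QF 1 0 (pp z (line 0 X)) (pp1 z (line 0 X)) <= 0.
    apply: (@pp_QF R z 0 X A 0 0 (fun=> 1) (fun=> 0)) => //.
      by rewrite mulr0 addr0 expr0n /= mulr_ge0 // ltW.
    move=> t Xt; split; rewrite ?normr0 ?ler01 ?lexx //; first exact: rder_cst.
    by rewrite mul1r; apply: hA; exact: le_trans Xt.
  have h01 : 0 <= (1 : R) <= 1 by rewrite ler01 lexx.
  have Qr := @QF_le R 1 0 (pp z (line 0 (x0 + l))) (pp1 z (line 0 (x0 + l))) h01 (lexx 0).
  have [|a b] := ppE (x0 + l); first by rewrite lexx andbT; exact: lw_aux.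
  rewrite -!normc_sqr in a b.
  exact: outer_aux k0 A0 (normc_ge0 _) (normc_ge0 _) K QX Qr a b.
have PP : P X - P x <= kap l k A * Ep.
  rewrite /kap mulrDl; have -> : P X - P x = (P (x0 + l) - P x) + (P X - P (x0 + l)).
    by rewrite [RHS]addrC addrA subrK.
  exact: lerD.
pose w t := u t * pp1 z (line 0 t) - u' t * pp z (line 0 t).
have wX : w X = 0.
  by rewrite /w; have [|-> -> _] := h3 X; [rewrite ger0_norm|rewrite !mul0r subr0].
have CS : sqn (w X - w x) <= (F X - F x) * (P X - P x).
  apply: (@cauchy_schwarz R w (fz z u u'') (fun t => pp z (line 0 t)) F P x X xX) => t /andP[t1 t2]; split => //.
    have [d1 d2] := asol_line 0 t (asol_pp z).
    apply: cder_eq (cderD (cderM (h1 t) d2) (cderN (cderM (h2 t) d1))) _.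
    rewrite (fz_u z u u'' t) /VV; move: (fz _ _ _ _) ('i%C * _ - _) (pp _ _) (pp1 _ _) (u t) (u' t) => *; ring.
  by apply: dP'; exact: le_trans t1.
rewrite wX sub0r sqnN in CS; apply: le_trans CS _.
have FX : F X - F x <= F X - F (- X).
  by apply: lerB => //; apply: (rder_ge0_mono dF _ Xx) => t; exact: sqn_ge0.
have F0 : 0 <= F X - F x by rewrite subr_ge0; apply: (rder_ge0_mono dF _ xX) => t; exact: sqn_ge0.
have P0 : 0 <= P X - P x.
  rewrite subr_ge0; apply: (@nondecr R P (fun t => sqn (pp z (line 0 t))) x X xX) => t /andP[t1 _].
    by apply: dP'; exact: le_trans t1.
  exact: sqn_ge0.
exact: ler_pM.
Qed.

End half_line.

Lemma mp_line z (x : R) : mp z (line 0 x) = cj (pp (cj z) (line 0 (- x))) /\ mp1 z (line 0 x) = - cj (pp1 (cj z) (line 0 (- x))).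
Proof. by rewrite /mp /mp1 !line0 cjC -cCN. Qed.

(** In the window, u and u' are recovered from their Wronskians with the two decaying solutions, the
    determinant of this linear system being [Wz]. Outside, [outer] bounds u by its values at the
    ends of the window. [Gam] is the bound on the product of the energies over |Wz|^2, as for a
    Green function. *)
Lemma apriori_large z (x0 l k A Mv Gam : R) u u' u'' X U F : 0 <= l -> 0 < k -> 0 < A -> 0 <= Gam ->
  (forall x, x0 - l <= x <= x0 + l -> normc (VV z 0 x) <= Mv) ->
  (forall x, x0 + l <= x -> A <= Re (VV z 0 x) + Im (VV z 0 x)) ->
  (forall x, x <= x0 - l -> A <= Re (VV z 0 x) - Im (VV z 0 x)) ->
  Wz z 0 != 0 ->
  en z k x0 * en (cj z) k (- x0) * expR (l * (Mv + k ^+ 2) / k) ^+ 2 <= Gam * sqn (Wz z 0) ->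
  `|x0| + l <= X -> tdata u u' u'' X ->
  (forall x, rder U x (sqn (u x))) -> (forall x, rder F x (sqn (fz z u u'' x))) ->
  U X - U (- X) <= (8 * Gam * kap l k A ^+ 2 + 8 / A ^+ 2) * (F X - F (- X)).
Proof.
move=> l0 k0 A0 G0 hV hR hL W0 hG xX td dU dF.
have X0 : 0 <= X by apply: le_trans xX; rewrite addr_ge0.
have nx : - `|x0| <= x0 <= `|x0| by rewrite -ler_norml.
have [rX lX rX' lX'] := window_aux nx xX.
set N := F X - F (- X).
have N0 : 0 <= N by rewrite subr_ge0; apply: (rder_ge0_mono dF) => [t|]; [exact: sqn_ge0|apply: (@le_trans _ _ 0) => //; rewrite oppr_le0].
have k2 : 0 < k ^+ 2 by rewrite exprn_gt0.
set e := expR _ in hG; have e0 : 0 <= e by exact: expR_ge0.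
set Ep := en z k x0 * e; set Em := en (cj z) k (- x0) * e.
have Ep0 : 0 <= Ep by rewrite mulr_ge0 // en_ge0.
have Em0 : 0 <= Em by rewrite mulr_ge0 // en_ge0.
set kp := kap l k A; have kp0 : 0 <= kp.
  by rewrite /kp /kap addr_ge0 // divr_ge0 ?mulr_ge0 ?(ltW k0) ?(ltW A0) ?(ltW k2).
have hG' : Ep * Em <= Gam * sqn (Wz z 0).
  by rewrite /Ep /Em mulrACA -expr2.
have hV' x : - x0 - l <= x <= - x0 + l -> normc (VV (cj z) 0 x) <= Mv.
  by move=> /andP[a b]; rewrite VV_reflect normcJ'; apply: hV; exact: refl_aux.
have hR' x : - x0 + l <= x -> A <= Re (VV (cj z) 0 x) + Im (VV (cj z) 0 x).
  by move=> a; rewrite VV_reflect ReJ ImJ; apply: hL; rewrite lerNl opprB addrC.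
pose v t := cj (u (- t)); pose v' t := - cj (u' (- t)); pose v'' t := cj (u'' (- t)).
have tv : tdata v v' v'' X by exact: reflect_tdata.
pose U2 t := - U (- t); pose F2 t := - F (- t).
have dU2 t : rder U2 t (sqn (v t)) by apply: rder_eq (reflect_rder dU t) _; rewrite sqnJ.
have dF2 t : rder F2 t (sqn (fz (cj z) v v'' t)).
  by apply: rder_eq (reflect_rder dF t) _; rewrite sqn_fz_reflect.
have N2 : F2 X - F2 (- X) = N by rewrite /F2 /N !opprK addrC.
have W1 := half_line l0 k0 A0 td X0 dF rX lX hV hR.
have W2 := half_line l0 k0 A0 tv X0 dF2 rX' lX' hV' hR'.
have B1 := window_en k0 hV; have B2 := window_en k0 hV'.
have main x : x0 - l <= x <= x0 + l -> k ^+ 2 * sqn (u x) <= 4 * N * kp * Gam /\ sqn (u' x) <= 4 * N * kp * Gam.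
  move=> xw; have [x1 x2] := andP xw.
  have xw' : - x0 - l <= - x <= - x0 + l by rewrite -opprD lerN2 x2 /= lerNl opprD opprK.
  have w1 := W1 x xw; have w2 := W2 (- x) xw'; have b1 := B1 x xw; have b2 := B2 (- x) xw'.
  rewrite -/e -/Ep -/kp in w1 b1; rewrite -/e -/Em -/kp N2 in w2 b2.
  have [Em_ Em1_] := mp_line z x.
  set q := pp (cj z) (line 0 (- x)) in w2 Em_; set q1 := pp1 (cj z) (line 0 (- x)) in w2 Em1_.
  have bq : sqn q1 + k ^+ 2 * sqn q <= Em by exact: b2.
  set p := pp z (line 0 x) in w1; set p1 := pp1 z (line 0 x) in w1.
  have bp : sqn p1 + k ^+ 2 * sqn p <= Ep by exact: b1.
  have WE : Wz z 0 = cj q * p1 + cj q1 * p.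
    by rewrite /Wz (awr_cst 0 (line 0 x) (asol_mp z) (asol_pp z)) /awr Em_ Em1_ mulNr opprK.
  have wE : sqn (u x * cj q1 + u' x * cj q) <= N * (kp * Em).
    apply: le_trans w2; rewrite /v /v' opprK -[X in X <= _]sqnJ; rewrite le_eqVlt; apply/orP; left; apply/eqP; congr sqn.
    by rewrite !cjE; ring.
  have s0 := sqn_gt0 W0.
  have A1 : sqn (Wz z 0) * sqn (u x) <= 2 * (sqn q * (N * (kp * Ep)) + sqn p * (N * (kp * Em))).
    rewrite -sqnM; have -> : Wz z 0 * u x = cj q * (u x * p1 - u' x * p) + p * (u x * cj q1 + u' x * cj q) by rewrite WE; ring.
    have := @lin_aux (cj q) _ p _ _ _ w1 wE; rewrite (sqnJ q); exact.
  have A2 : sqn (Wz z 0) * sqn (u' x) <= 2 * (sqn q1 * (N * (kp * Ep)) + sqn p1 * (N * (kp * Em))).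
    rewrite -sqnM; have -> : Wz z 0 * u' x = - cj q1 * (u x * p1 - u' x * p) + p1 * (u x * cj q1 + u' x * cj q) by rewrite WE; ring.
    have := @lin_aux (- cj q1) _ p1 _ _ _ w1 wE; rewrite (sqnN (cj q1)) (sqnJ q1); exact.
  have Nk := mulr_ge0 N0 kp0.
  have [r1 r2] := prod_bound (ltW k2) Nk Ep0 Em0 (sqn_ge0 q) (sqn_ge0 p) (sqn_ge0 q1) (sqn_ge0 p1) bp bq hG'.
  split; rewrite -(ler_pM2l s0); last exact: le_trans A2 r2.
  by rewrite mulrCA; apply: le_trans r1; exact: (ler_wpM2l (ltW k2) A1).
set B := 4 * N * kp * Gam in main.
have B0 : 0 <= B by rewrite /B !mulr_ge0.
have lw : x0 - l <= x0 + l by exact: lw_aux.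
have I1 : U (x0 + l) - U (x0 - l) <= B / k ^+ 2 * (2 * l).
  have -> : 2 * l = (x0 + l) - (x0 - l) by ring.
  apply: (rder_le_bound dU lw) => x xw; rewrite ler_pdivlMr // mulrC; by have [] := main x xw.
have prod x : x0 - l <= x <= x0 + l -> normc (u x) * normc (u' x) <= B / k.
  move=> xw; have [a b] := main x xw; rewrite -!normc_sqr in a b.
  exact: prod_aux k0 (normc_ge0 _) (normc_ge0 _) a b.
have O1 := outer A0 td dU dF hR X0 rX.
have O2 := outer A0 tv dU2 dF2 hR' X0 rX'.
have p1 : normc (u (x0 + l)) * normc (u' (x0 + l)) <= B / k by apply: prod; rewrite lw lexx.
have p2 : normc (v (- x0 + l)) * normc (v' (- x0 + l)) <= B / k.
  by rewrite /v /v' normcN !normcJ' opprD opprK; apply: prod; rewrite lexx lw.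
have F1 : F X - F (x0 + l) <= N.
  by apply: lerB => //; apply: (rder_ge0_mono dF) => [t|]; [exact: sqn_ge0|exact: le_trans lw].
have F3 : F2 X - F2 (- x0 + l) <= N.
  rewrite -N2; apply: lerB => //; apply: (rder_ge0_mono dF2) => [t|]; first exact: sqn_ge0.
  by apply: le_trans lX' _; exact: lw_aux.
have E2 : U2 X - U2 (- x0 + l) = U (x0 - l) - U (- X) by rewrite /U2 opprK opprD opprK addrC.
rewrite E2 in O2.
have -> : U X - U (- X) = (U X - U (x0 + l)) + (U (x0 + l) - U (x0 - l)) + (U (x0 - l) - U (- X)) by ring.
have C1 := out_aux A0 O1 p1 F1; have C2 := out_aux A0 O2 p2 F3.
apply: le_trans (lerD (lerD C1 I1) C2) _; rewrite /B /kp.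
exact: (final_aux l0 k0 A0 G0 N0 (erefl _) (erefl _)).
Qed.

Lemma apriori z (x0 l k A Mv Gam : R) : 0 <= l -> 0 < k -> 0 < A -> 0 <= Gam ->
  (forall x, x0 - l <= x <= x0 + l -> normc (VV z 0 x) <= Mv) ->
  (forall x, x0 + l <= x -> A <= Re (VV z 0 x) + Im (VV z 0 x)) ->
  (forall x, x <= x0 - l -> A <= Re (VV z 0 x) - Im (VV z 0 x)) ->
  Wz z 0 != 0 ->
  en z k x0 * en (cj z) k (- x0) * expR (l * (Mv + k ^+ 2) / k) ^+ 2 <= Gam * sqn (Wz z 0) ->
  apr z (8 * Gam * kap l k A ^+ 2 + 8 / A ^+ 2).
Proof.
move=> l0 k0 A0 G0 hV hR hL W0 hG u u' u'' X U F X0 td dU dF.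
(* The support may be taken large enough to contain the window, as the primitives are constant
   outside [- X, X]. *)
have XX : X <= X + (`|x0| + l) by rewrite lerDl addr_ge0.
have X'0 : 0 <= X + (`|x0| + l) by exact: le_trans XX.
have [h1 h2 h3] := td.
have td' : tdata u u' u'' (X + (`|x0| + l)) by split => // x hx; apply: h3; exact: le_trans hx.
have out (G : R -> R) (g : R -> R) : (forall x, rder G x (g x)) -> (forall x, X <= `|x| -> g x = 0) ->
    G (X + (`|x0| + l)) = G X /\ G (- (X + (`|x0| + l))) = G (- X).
  move=> dG g0; split.
    by apply: (rder_cst_on dG XX) => x /andP[a _]; apply: g0; rewrite ger0_norm // (le_trans X0).
  apply/esym; have XX' : - (X + (`|x0| + l)) <= - X by rewrite lerN2.
  apply: (rder_cst_on dG XX') => x /andP[_ a]; apply: g0; rewrite ler0_norm; first by rewrite lerNr.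
  by apply: le_trans a _; rewrite oppr_le0.
have [U1 U2] := out _ _ dU (fun x hx => let: And3 a _ _ := h3 x hx in etrans (f_equal (@sqn R) a) (sqn0 R)).
have f0 x : X <= `|x| -> sqn (fz z u u'' x) = 0.
  by move=> /h3 [a _ b]; rewrite /fz a b mulr0 subr0 sqn0.
have [F1 F2] := out _ _ dF f0.
have := @apriori_large z x0 l k A Mv Gam u u' u'' (X + (`|x0| + l)) U F l0 k0 A0 G0 hV hR hL W0 hG.
by rewrite U1 U2 F1 F2; apply; rewrite // lerDr.
Qed.

End apriori.

(** * Inequalities for the potential and for the parameters *)

Section resolvent_regions.
Variable R : realType.
Implicit Types (z : R[i]) (rho : R).

Lemma Re_VV z (tau x : R) : Re (VV z tau x) = 3 * tau * x ^+ 2 - tau ^+ 3 - Re z.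
Proof. by rewrite /VV /line !exprS expr0 !ReImE; ring. Qed.
Lemma Im_VV z (tau x : R) : Im (VV z tau x) = x ^+ 3 - 3 * x * tau ^+ 2 - Im z.
Proof. by rewrite /VV /line !exprS expr0 !ReImE; ring. Qed.

Lemma line_reflect (tau x : R) : - cj (line tau x) = line tau (- x) :> R[i].
Proof. by apply: eqC; rewrite /line !ReImE; ring. Qed.

Lemma VV_reflect' z (tau x : R) : VV (cj z) tau (- x) = cj (VV z tau x).
Proof. by apply: eqC; rewrite ?ReJ ?ImJ !(Re_VV, Im_VV) ?ReJ ?ImJ; ring. Qed.

Lemma cube_norm (x l : R) : `|x| <= l -> `|x ^+ 3| <= l ^+ 3.
Proof. by move=> xl; rewrite normrX; apply: lerXn2r; rewrite ?nnegrE // (le_trans _ xl). Qed.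

Lemma cube_mono (x y : R) : x <= y -> x ^+ 3 <= y ^+ 3.
Proof.
move=> xy; rewrite -subr_ge0; have -> : y ^+ 3 - x ^+ 3 = (y - x) * ((y + x / 2) ^+ 2 + 3 / 4 * x ^+ 2) by field.
by rewrite mulr_ge0 ?subr_ge0 // addr_ge0 ?sqr_ge0 // mulr_ge0 ?sqr_ge0.
Qed.

Lemma const_le_eb (c rho : R) : 0 <= c -> 1 <= rho -> c <= eb c rho.
Proof. by move=> c0 r1; have := @poly_le_eb R c rho 0 c0 r1; rewrite expr0 mulr1 addr0. Qed.

Lemma Dd_Nd_neq0 (E : R[i]) : Dd E = 0 -> Nd E = 0 -> False.
Proof.
move=> D0 N0; have := @Dd_Nd_ge R (normc E) 1 E (normc_ge0 _) (lexx 1).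
rewrite expr1n mulr1 => /(_ (lexx _)); rewrite D0 N0 normc0 addr0.
by rewrite leNgt mulr_gt0 ?eb_gt0.
Qed.

(** Vanishing data at X would propagate to 0, against [Dd_Nd_neq0]. *)
Lemma pp_neq0 z (X : R[i]) : sqn (pp1 z X) + 1 ^+ 2 * sqn (pp z X) != 0.
Proof.
apply/eqP => H0.
have H1 s : 0 <= s <= 1 -> normc ('i%C * (X + s%:C * (0 - X)) ^+ 3 - z) <= normc X ^+ 3 + normc z.
  move=> /andP[s0 s1]; apply: le_trans (normcB _ _) _; apply: lerD => //; rewrite normcM normc_i mul1r normcX.
  apply: lerXn2r; rewrite ?nnegrE ?normc_ge0 //.
  have -> : X + s%:C * (0 - X) = (1 - s)%:C * X by rewrite cCD cCN cC1; ring.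
  rewrite normcM normcR ger0_norm ?subr_ge0 //; have := normc_ge0 X; nra.
have K := @pp_segment R z X 0 (normc X ^+ 3 + normc z) 1 ltr01 H1.
have H : sqn (pp1 z 0) + sqn (pp z 0) <= 0.
  apply: le_trans (_ : _ <= sqn (pp1 z 0) + 1 ^+ 2 * sqn (pp z 0)) _; first by rewrite expr1n (mul1r (sqn _)).
  apply: (le_trans K); rewrite le_eqVlt; apply/orP; left; apply/eqP.
  exact: (etrans (f_equal (fun y => y * expR _) H0) (mul0r _)).
have E : sqn (pp1 z 0) + sqn (pp z 0) = 0 by apply/eqP; rewrite eq_le H addr_ge0 ?sqn_ge0.
move/eqP: E; rewrite paddr_eq0 ?sqn_ge0 // => /andP[/eqP/sqn_eq0 + /eqP/sqn_eq0].
rewrite pp_0 pp1_0 => /eqP; rewrite mulf_eq0 (negbTE (cis_neq0 _)) /= => /eqP N0 D0.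
exact: Dd_Nd_neq0 D0 N0.
Qed.

Lemma near_aux1 (P q h y a : R) : 0 < P -> 0 < q -> q <= 1 / 100 -> 0 <= h -> h <= 1 -> - (1 / 100) <= y -> y <= 1 / 100 ->
  - P <= a <= P -> `|P * (3 * h * (1 + y) ^+ 2) - h ^+ 3 * (P * q ^+ 2) - a| <= 5 * P.
Proof.
move=> P0 q0 q1 h0 h1 y0 y1 a01.
have s1 : (1 + y) ^+ 2 <= 103 / 100 by nra.
have q2 : q ^+ 2 <= 1 / 100 by nra.
have k1 := ler_pM h0 (sqr_ge0 (1 + y)) h1 s1.
have h3 : h ^+ 3 <= 1 by apply: exprn_ile1.
have k2 := ler_pM (exprn_ge0 3 h0) (sqr_ge0 q) h3 q2.
have k10 := mulr_ge0 h0 (sqr_ge0 (1 + y)); have k20 := mulr_ge0 (exprn_ge0 3 h0) (sqr_ge0 q).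
have -> : P * (3 * h * (1 + y) ^+ 2) - h ^+ 3 * (P * q ^+ 2) - a = P * (3 * (h * (1 + y) ^+ 2) - h ^+ 3 * q ^+ 2) - a by ring.
move: (h * _) (h ^+ 3 * _) k1 k10 k2 k20 => m n m1 m0 n1 n0.
have u1 : 3 * m - n <= 4 by lra.
have u2 : - 1 <= 3 * m - n by lra.
have := ler_wpM2l (ltW P0) u1; have := ler_wpM2l (ltW P0) u2; case/andP: a01 => a0 a1.
move: (P * (3 * m - n)) => X; rewrite ler_norml; move: P0 a0 a1 => P0 a0 a1 X1 X2; apply/andP; split; lra.
Qed.

Lemma near_aux2 (P q h y d : R) : 0 < P -> 0 < q -> q <= 1 / 100 -> 0 <= h -> h <= 1 -> - (1 / 100) <= y -> y <= 1 / 100 ->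
  `|d| <= P -> `|d * (3 + 3 * y + y ^+ 2) - 3 * h ^+ 2 * (1 + y) * (P * q)| <= 4 * P.
Proof.
move=> P0 q0 q1 h0 h1 y0 y1 dP.
have g0 : 0 <= 3 + 3 * y + y ^+ 2 by have := sqr_ge0 y; lra.
have g1 : 3 + 3 * y + y ^+ 2 <= 304 / 100 by nra.
have B1 : `|d * (3 + 3 * y + y ^+ 2)| <= P * (304 / 100).
  by rewrite normrM (ger0_norm g0); apply: ler_pM.
have h2 : h ^+ 2 <= 1 by apply: exprn_ile1.
have y2 : 0 <= 1 + y by lra.
have y3 : 1 + y <= 101 / 100 by lra.
have k3 := ler_pM (sqr_ge0 h) y2 h2 y3.
have k30 := mulr_ge0 (sqr_ge0 h) y2.
have k4 := ler_pM k30 (ltW q0) k3 q1; have k40 := mulr_ge0 k30 (ltW q0).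
have B2 : `|3 * h ^+ 2 * (1 + y) * (P * q)| <= P * (6 / 100).
  have -> : 3 * h ^+ 2 * (1 + y) * (P * q) = P * (3 * (h ^+ 2 * (1 + y) * q)) by ring.
  rewrite normrM (ger0_norm (ltW P0)); apply: ler_wpM2l; first exact: ltW.
  by move: (_ * q) k4 k40 => X X1 X0; rewrite ger0_norm; lra.
apply: le_trans (ler_normB _ _) _; apply: le_trans (lerD B1 B2) _; rewrite -mulrDr mulrC; apply: ler_wpM2r; first exact: ltW.
by lra.
Qed.

Lemma near_aux (P q h y a d : R) : 0 < P -> 0 < q -> q <= 1 / 100 -> 0 <= h <= 1 -> - (1 / 100) <= y <= 1 / 100 ->
  - P <= a <= P -> `|d| <= P ->
  `|P * (3 * h * (1 + y) ^+ 2) - h ^+ 3 * (P * q ^+ 2) - a| + `|d * (3 + 3 * y + y ^+ 2) - 3 * h ^+ 2 * (1 + y) * (P * q)| <= 9 * P.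
Proof.
move=> P0 q0 q1 /andP[h0 h1] /andP[y0 y1] a01 dP.
have := near_aux1 P0 q0 q1 h0 h1 y0 y1 a01; have := near_aux2 P0 q0 q1 h0 h1 y0 y1 dP.
move: `|_| `|_| => X Y; lra.
Qed.

Lemma right_aux (P q a T : R) : 0 < q -> q <= 1 / 100 -> 0 < P -> a <= P -> P <= T ->
  51 / 50 * P <= 3 * T - P * q ^+ 2 - a.
Proof. by move=> q0 q1 P0 aP PT; have q2 : q ^+ 2 <= 1 / 100 by [nra]; have := ler_wpM2l (ltW P0) q2; lra. Qed.

Lemma left_b1 (Q w : R) : 0 <= Q -> Q <= 1 / 10000 -> 0 <= w -> Q * (1 - 35 * w + 36 * w ^+ 2) <= 1 / 10000 * (1 + 36 * w ^+ 2).
Proof.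
move=> Q0 Q1 w0; apply: (@le_trans _ _ (Q * (1 + 36 * w ^+ 2))); first by apply: ler_wpM2l => //; lra.
by apply: ler_wpM2r => //; have := sqr_ge0 w; lra.
Qed.

Lemma left_b2 (w : R) : 10 * w ^+ 2 <= 33 * w ^+ 2 - 33 * w ^+ 3 + 12 * w ^+ 4.
Proof.
rewrite -subr_ge0; have -> : 33 * w ^+ 2 - 33 * w ^+ 3 + 12 * w ^+ 4 - 10 * w ^+ 2 =
   w ^+ 2 * (12 * (w - 11 / 8) ^+ 2 + 5 / 16) by field.
by apply: mulr_ge0; [exact: sqr_ge0|have := sqr_ge0 (w - 11 / 8); lra].
Qed.

Lemma left_b3 (X w : R) : 0 <= w -> X <= 1 / 10000 * (1 + 36 * w ^+ 2) -> 10 * w ^+ 2 <= 33 * w ^+ 2 - 33 * w ^+ 3 + 12 * w ^+ 4 ->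
  0 <= (97 / 100 - 503 / 100 * w + 33 * w ^+ 2 - 33 * w ^+ 3 + 12 * w ^+ 4) - X.
Proof. have := sqr_ge0 (w - 2516 / 10000); lra. Qed.

(** Divided by [P] this is a quartic inequality in [w], with q^2 <= 1/10000 as a perturbation.
    [left_b2] lowers the quartic to a parabola without real roots, and the square in [left_b3] sits
    at its minimum near w = 1/4. *)
Lemma left_aux (P q a w : R) : 0 < q -> q <= 1 / 100 -> 0 < P -> a <= P -> 0 <= w ->
  51 / 50 * P <= P * (3 * (w - 1) ^+ 2 - q ^+ 2 + 12 * (w / (1 + w)) * (1 + (w - 1) ^+ 3) - 36 * q ^+ 2 * (w / (1 + w)) * (w - 1)) - a.
Proof.
move=> q0 q1 P0 aP w0; have w1 : 0 < 1 + w by lra.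
have q2 : q ^+ 2 <= 1 / 10000 by nra.
have q20 := sqr_ge0 q.
suff : 203 / 100 <= 3 * (w - 1) ^+ 2 - q ^+ 2 + 12 * (w / (1 + w)) * (1 + (w - 1) ^+ 3) - 36 * q ^+ 2 * (w / (1 + w)) * (w - 1).
  by move=> H; have := ler_wpM2l (ltW P0) H; lra.
have -> : 3 * (w - 1) ^+ 2 - q ^+ 2 + 12 * (w / (1 + w)) * (1 + (w - 1) ^+ 3) - 36 * q ^+ 2 * (w / (1 + w)) * (w - 1) =
  ((3 * (w - 1) ^+ 2 - q ^+ 2) * (1 + w) + 12 * w * (1 + (w - 1) ^+ 3) - 36 * q ^+ 2 * w * (w - 1)) / (1 + w).
  by field; rewrite gt_eqF.
rewrite ler_pdivlMr // -subr_ge0.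
have -> : (3 * (w - 1) ^+ 2 - q ^+ 2) * (1 + w) + 12 * w * (1 + (w - 1) ^+ 3) - 36 * q ^+ 2 * w * (w - 1) - 203 / 100 * (1 + w) =
  (97 / 100 - 503 / 100 * w + 33 * w ^+ 2 - 33 * w ^+ 3 + 12 * w ^+ 4) - q ^+ 2 * (1 - 35 * w + 36 * w ^+ 2) by field.
have ww := sqr_ge0 w.
exact: left_b3 w0 (left_b1 q20 q2 w0) (left_b2 w).
Qed.

(** The two terms of the Wronskian cannot cancel for solutions that decay in opposite directions:
    multiplied by v conj u, it has real part at most - 2 p |u|^2 |v|^2. *)
Lemma wronskian_aux (p e : R) (u u1 v v1 : R[i]) : 0 < p -> 0 < e ->
  Re (u1 * cj u) + p * sqn u <= 0 -> sqn u1 + p ^+ 2 * sqn u <= 4 * p ^+ 2 * e * sqn u ->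
  Re (v1 * cj v) + p * sqn v <= 0 -> sqn v1 + p ^+ 2 * sqn v <= 4 * p ^+ 2 * e * sqn v ->
  sqn u1 + 1 ^+ 2 * sqn u != 0 -> sqn v1 + 1 ^+ 2 * sqn v != 0 ->
  cj v * u1 + cj v1 * u != 0 /\
  (sqn u1 + p ^+ 2 * sqn u) * (sqn v1 + p ^+ 2 * sqn v) <= 4 * p ^+ 2 * e ^+ 2 * sqn (cj v * u1 + cj v1 * u).
Proof.
move=> p0 e0 A1 B1 A2 B2 N1 N2; set W := cj v * u1 + cj v1 * u.
have pos (a b : R[i]) : sqn b + p ^+ 2 * sqn a <= 4 * p ^+ 2 * e * sqn a -> sqn b + 1 ^+ 2 * sqn a != 0 -> 0 < sqn a.
  move=> B N; rewrite lt_def sqn_ge0 andbT; apply/eqP => a0; move: B N; rewrite a0 !mulr0 addr0 => b0.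
  have b0' : sqn b = 0 by apply/eqP; rewrite eq_le b0 sqn_ge0.
  by rewrite b0' eqxx.
have u0 := pos _ _ B1 N1; have v0 := pos _ _ B2 N2.
have key : 2 * p * (sqn u * sqn v) <= normc W * (normc u * normc v).
  have : Re (- (W * (v * cj u))) <= normc (W * (v * cj u)) by rewrite -normcN; exact: Re_le.
  rewrite !normcM normcJ' (mulrC (normc v)); apply: le_trans.
  have -> : Re (- (W * (v * cj u))) = - (sqn v * Re (u1 * cj u) + sqn u * Re (v1 * cj v)).
    by rewrite /W /sqn !ReImE; ring.
  have a1 := ler_wpM2l (ltW v0) A1; have a2 := ler_wpM2l (ltW u0) A2; lra.
have n0 : 0 < normc u by rewrite normc_gt0; apply/eqP => u0'; move: u0; rewrite u0' sqn0 ltxx.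
have m0 : 0 < normc v by rewrite normc_gt0; apply/eqP => v0'; move: v0; rewrite v0' sqn0 ltxx.
have k2 : 2 * p * (normc u * normc v) <= normc W.
  have nm : 0 < normc u * normc v by exact: mulr_gt0.
  by rewrite -(ler_pM2r nm); move: key; rewrite -!normc_sqr; apply: le_trans; rewrite le_eqVlt; apply/orP; left; apply/eqP; ring.
have W2 : 4 * p ^+ 2 * (sqn u * sqn v) <= sqn W.
  rewrite -!normc_sqr; have -> : 4 * p ^+ 2 * (normc u ^+ 2 * normc v ^+ 2) = (2 * p * (normc u * normc v)) ^+ 2 by ring.
  by apply: lerXn2r; rewrite ?nnegrE ?normc_ge0 // !mulr_ge0 ?normc_ge0 // ltW.
split.
  apply/eqP => W0; move: W2; rewrite W0 sqn0 leNgt mulr_gt0 ?mulr_gt0 ?exprn_gt0 //.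
apply: (@le_trans _ _ ((4 * p ^+ 2 * e * sqn u) * (4 * p ^+ 2 * e * sqn v))).
  by apply: ler_pM => //; apply: addr_ge0; rewrite ?sqn_ge0 // mulr_ge0 ?sqn_ge0 ?sqr_ge0.
have -> : 4 * p ^+ 2 * e * sqn u * (4 * p ^+ 2 * e * sqn v) = (4 * p ^+ 2 * e ^+ 2) * (4 * p ^+ 2 * (sqn u * sqn v)) by ring.
by apply: ler_wpM2l => //; rewrite -mulrA -exprMn mulr_ge0 // sqr_ge0.
Qed.

(** Parameters for Im z = c^3: [c] is the real turning point when Re z is neglected, and [p]
    dominates rho^3, hence the square root of |Re z|, as well as c^(2/3), the Airy rate at [c].
    Writing c = t^3 keeps exponents integral. *)
Lemma param_pos (rho t c p : R) : 1 <= rho -> 4 <= t -> c = t ^+ 3 -> p = rho ^+ 3 + t ^+ 2 ->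
  [/\ 64 <= c, t ^+ 2 <= p, 17 <= p, rho ^+ 3 <= p & 1024 <= t ^+ 5].
Proof.
move=> r1 t4 -> ->; have r3 : 1 <= rho ^+ 3 by exact: exprn_ege1.
have t2 : 16 <= t ^+ 2 by rewrite expr2; have : 4 * 4 <= t * t by [apply: ler_pM]; lra.
have t3 : 64 <= t ^+ 3 by rewrite exprS; have : 4 * 16 <= t * t ^+ 2 by [apply: ler_pM]; lra.
have t5 : 1024 <= t ^+ 5.
  have -> : t ^+ 5 = t ^+ 3 * t ^+ 2 by rewrite -exprD.
  have : 64 * 16 <= t ^+ 3 * t ^+ 2 by apply: ler_pM.
  lra.
by split; lra.
Qed.

Lemma param_ratio (rho t p : R) : 1 <= rho -> 4 <= t -> p = rho ^+ 3 + t ^+ 2 -> 1000 * rho ^+ 6 <= t ^+ 9 -> 1024 <= t ^+ 5 ->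
  p ^+ 2 / t ^+ 9 <= 1 / 100 /\ p ^+ 2 <= t ^+ 12.
Proof.
move=> r1 t4 pE ht t5.
have r6 : rho ^+ 6 = (rho ^+ 3) ^+ 2 by rewrite -exprM.
have e4 : t ^+ 4 = (t ^+ 2) ^+ 2 by rewrite -exprM.
have t9 : t ^+ 9 = t ^+ 5 * t ^+ 4 by rewrite -exprD.
have t0 : 0 < t by lra.
have p9 : 0 < t ^+ 9 by exact: exprn_gt0.
have k1 : 1024 * t ^+ 4 <= t ^+ 9 by rewrite t9; apply: ler_wpM2r => //; rewrite exprn_ge0 // ltW.
have p2 : p ^+ 2 <= 2 * rho ^+ 6 + 2 * t ^+ 4.
  by rewrite r6 e4 pE; have := sqr_ge0 (rho ^+ 3 - t ^+ 2); move: (rho ^+ 3) (t ^+ 2) => x y; lra.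
have k2 : p ^+ 2 <= t ^+ 9 / 100 by move: p2 k1 ht p9; move: (rho ^+ 6) (t ^+ 4) (t ^+ 9) (p ^+ 2) => x y u v; lra.
split; first by rewrite ler_pdivrMr // mulrC mul1r.
apply: le_trans k2 _; have -> : t ^+ 12 = t ^+ 9 * t ^+ 3 by rewrite -exprD.
have t3 : 1 <= t ^+ 3 by apply: exprn_ege1; lra.
by apply: ler_wpM2l; [exact: ltW|lra].
Qed.

(** With c = t^3 this quotient is tau p, the exponent for crossing the height tau at rate p. The
    part t^6 of p^3 gives a constant; the part rho^9 gives O(rho^5), as rho^4 <= t^6. *)
Lemma param_growth (rho t p : R) : 1 <= rho -> 4 <= t -> p = rho ^+ 3 + t ^+ 2 -> 1000 * rho ^+ 6 <= t ^+ 9 ->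
  p ^+ 3 / t ^+ 6 <= 8 * rho ^+ 5.
Proof.
move=> r1 t4 pE ht.
have t0 : 0 < t by lra. have r0 : 0 < rho by lra.
have r6 : 0 < rho ^+ 6 by exact: exprn_gt0.
have tr : rho ^+ 2 <= t ^+ 3.
  have e1 : (rho ^+ 2) ^+ 3 = rho ^+ 6 by rewrite -exprM.
  have e2 : (t ^+ 3) ^+ 3 = t ^+ 9 by rewrite -exprM.
  rewrite -(@ler_pXn2r _ 3) ?nnegrE ?exprn_ge0 ?(ltW r0) ?(ltW t0) // e1 e2; apply: le_trans ht; move: r6; move: (rho ^+ _) => x; lra.
have t64 : rho ^+ 4 <= t ^+ 6.
  have -> : rho ^+ 4 = (rho ^+ 2) ^+ 2 by rewrite -exprM.
  have -> : t ^+ 6 = (t ^+ 3) ^+ 2 by rewrite -exprM.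
  by apply: lerXn2r => //; rewrite ?nnegrE ?exprn_ge0 ?(ltW r0) ?(ltW t0).
have t6 : 0 < t ^+ 6 by exact: exprn_gt0.
have r5 : 1 <= rho ^+ 5 by exact: exprn_ege1.
have p3 : p ^+ 3 <= 4 * (rho ^+ 3) ^+ 3 + 4 * (t ^+ 2) ^+ 3.
  rewrite pE; move: (exprn_gt0 3 r0) (exprn_gt0 2 t0); move: (rho ^+ 3) (t ^+ 2) => x y x0 y0.
  rewrite -subr_ge0; have -> : 4 * x ^+ 3 + 4 * y ^+ 3 - (x + y) ^+ 3 = 3 * (x + y) * (x - y) ^+ 2 by ring.
  by rewrite mulr_ge0 ?sqr_ge0 // mulr_ge0 // addr_ge0 // ltW.
rewrite -!exprM in p3; rewrite ler_pdivrMr //; apply: le_trans p3 _.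
have -> : rho ^+ (3 * 3) = rho ^+ 5 * rho ^+ 4 by rewrite -exprD.
have a1 : rho ^+ 5 * rho ^+ 4 <= rho ^+ 5 * t ^+ 6 by apply: ler_wpM2l => //; apply: le_trans r5.
have a2 : 1 * t ^+ 6 <= rho ^+ 5 * t ^+ 6 by apply: ler_wpM2r => //; exact: ltW.
have e6 : t ^+ (2 * 3) = t ^+ 6 by [].
rewrite e6; lra.
Qed.

Lemma apr_mono z (M M' : R) : M <= M' -> apr z M -> apr z M'.
Proof.
move=> MM H u u' u'' X U F X0 td dU dF; apply: le_trans (H _ _ _ _ _ _ X0 td dU dF) _.
apply: ler_wpM2r => //; rewrite subr_ge0; apply: (rder_ge0_mono dF) => [t|]; first exact: sqn_ge0.
by apply: (@le_trans _ _ 0) => //; rewrite oppr_le0.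
Qed.

Lemma cube_near (c l x P : R) : 0 <= c -> 0 <= l -> l <= c * (3 / 100) -> l * c ^+ 2 = 3 * P -> c - l <= x -> x <= c + l ->
  `|x ^+ 3 - c ^+ 3| <= 10 * P.
Proof.
move=> c0 l0 lq lc x1 x2; have -> : x ^+ 3 - c ^+ 3 = (x - c) * (x ^+ 2 + x * c + c ^+ 2) by ring.
have xl : `|x - c| <= l by rewrite ler_norml; lra.
have y1 : x <= c * (103 / 100) by lra.
have y0 : 0 <= x by lra.
have a1 : x ^+ 2 <= (c * (103 / 100)) ^+ 2 by apply: lerXn2r; rewrite ?nnegrE // mulr_ge0.
have a2 : x * c <= c * (103 / 100) * c by apply: ler_wpM2r.
have b0 : 0 <= x ^+ 2 + x * c + c ^+ 2 by rewrite !addr_ge0 ?sqr_ge0 // mulr_ge0.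
have b1 : x ^+ 2 + x * c + c ^+ 2 <= 10 / 3 * c ^+ 2 by have := sqr_ge0 c; lra.
rewrite normrM (ger0_norm b0); apply: le_trans (ler_pM _ b0 xl b1) _ => //.
by move: lc; move: (c ^+ 2) => y; lra.
Qed.

Lemma cube_right (c l P a X : R) : 0 <= c -> 0 <= l -> l * c ^+ 2 = 3 * P -> 0 <= P -> a <= P -> (c + l) ^+ 3 <= X -> P <= - a + (X - c ^+ 3).
Proof.
move=> c0 l0 lc P0 aP; have -> : (c + l) ^+ 3 = c ^+ 3 + 3 * (l * c ^+ 2) + 3 * (c * l ^+ 2) + l ^+ 3 by ring.
by rewrite lc; have := mulr_ge0 c0 (sqr_ge0 l); have := exprn_ge0 3 l0; lra.
Qed.

Lemma cube_left (c l P a X : R) : 0 <= c -> 0 <= l -> l <= c * (3 / 100) -> l * c ^+ 2 = 3 * P -> 0 <= P -> a <= P -> X <= (c - l) ^+ 3 ->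
  P <= - a - (X - c ^+ 3).
Proof.
move=> c0 l0 lq lc P0 aP; have -> : (c - l) ^+ 3 = c ^+ 3 - 3 * (l * c ^+ 2) + 3 * (l * (c * l)) - l ^+ 3 by ring.
have : l * (c * l) <= l * (c * (c * (3 / 100))) by apply: ler_wpM2l => //; exact: ler_wpM2l.
have -> : l * (c * (c * (3 / 100))) = (l * c ^+ 2) * (3 / 100) by ring.
by rewrite lc; have := exprn_ge0 3 l0; lra.
Qed.

Lemma sum_aux (P e K8 P8 : R) : K8 * P <= 100 -> 1 <= e -> P8 <= 8 -> 8 * (4 * P * e) * K8 + P8 <= 32 * 101 * e.
Proof.
move=> k e1 p8; have : (K8 * P) * e <= 100 * e by apply: ler_wpM2r => //; lra.
lra.
Qed.

Lemma out_III (k P a b L X : R) : 0 < P -> a <= P -> b <= k * P -> (k + 3) * P <= L -> L <= X -> P <= - a + (X - b).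
Proof. lra. Qed.
Lemma out_III' (k P a b L X : R) : 0 <= k -> 0 < P -> a <= P -> 0 <= b -> (k + 3) * P <= L -> X <= - L -> P <= - a - (X - b).
Proof. by move=> k0 P0 *; have := mulr_ge0 k0 (ltW P0); lra. Qed.
Lemma en_aux (d n e P : R) : 0 <= d -> 0 <= n -> d <= e -> n <= e -> 1 <= P -> n ^+ 2 + P * d ^+ 2 <= 2 * P * e ^+ 2.
Proof.
move=> d0 n0 de ne P1; have a : d ^+ 2 <= e ^+ 2 by apply: lerXn2r; rewrite ?nnegrE //; lra.
have b : n ^+ 2 <= e ^+ 2 by apply: lerXn2r; rewrite ?nnegrE //; lra.
have : P * d ^+ 2 <= P * e ^+ 2 by apply: ler_wpM2l => //; lra.
have : 1 * e ^+ 2 <= P * e ^+ 2 by apply: ler_wpM2r => //; exact: sqr_ge0.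
lra.
Qed.
Lemma nine_aux (x y : R) : 1 <= x -> 9 <= y -> x + 8 <= y * x.
Proof. by move=> x1 y9; have : 9 * x <= y * x by [apply: ler_wpM2r => //; lra]; lra. Qed.

End resolvent_regions.

(** * The resolvent for large imaginary part *)

Section strip_far.
Variable R : realType.
Implicit Types (z : R[i]) (rho : R).

Lemma kap_ge0 (l k A : R) : 0 <= l -> 0 < k -> 0 < A -> 0 <= kap l k A.
Proof.
move=> l0 k0 A0; rewrite /kap; apply: addr_ge0; apply: divr_ge0.
- exact: mulr_ge0.
- exact: sqr_ge0.
- by [].
- by apply: mulr_ge0; exact: ltW.
Qed.

Lemma exponent_ge (y : R) : 0 <= y -> 0 <= 40 + 100 * y.
Proof. lra. Qed.

Lemma exponent_total : 32 * 101 + 840 <= 4100 :> R.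
Proof. lra. Qed.

Lemma exponent_small (y u : R) : y <= 8 * u -> 1 <= u -> 40 + 100 * y <= 840 * u.
Proof. lra. Qed.

Section region_II.
Variables (a rho t : R).
Hypotheses (r1 : 1 <= rho) (ha : `|a| <= rho ^+ 6) (t4 : 4 <= t) (ht : 1000 * rho ^+ 6 <= t ^+ 9).
Let c := t ^+ 3.
Let p := rho ^+ 3 + t ^+ 2.
(** With tau c^2 = p^2, the real part of the potential on the shifted line is at least 3 p^2 - tau^3
    - Re z beyond [c]; the ratio [q] = tau / c is small. *)
Let tau := p ^+ 2 / c ^+ 2.
Let q := p ^+ 2 / c ^+ 3.
Let z : R[i] := a +i* c ^+ 3.

Let facts := param_pos r1 t4 (erefl c) (erefl p).
Let c64 : 64 <= c. Proof. by have [] := facts. Qed.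
Let p17 : 17 <= p. Proof. by have [] := facts. Qed.
Let c0 : 0 < c. Proof. exact: lt_le_trans c64. Qed.
Let p0 : 0 < p. Proof. exact: lt_le_trans p17. Qed.
Let cp : c ^+ 2 <= p ^+ 3.
Proof.
have [_ tp _ _ _] := facts; have -> : c ^+ 2 = (t ^+ 2) ^+ 3 by rewrite /c -!exprM.
by apply: lerXn2r; rewrite ?nnegrE ?sqr_ge0 // (ltW p0).
Qed.
Let ap : `|a| <= p ^+ 2.
Proof.
have [_ _ _ rp _] := facts; apply: le_trans ha _; have -> : rho ^+ 6 = (rho ^+ 3) ^+ 2 by rewrite -exprM.
by apply: lerXn2r; rewrite ?nnegrE ?(ltW p0) // exprn_ge0 // (le_trans ler01).
Qed.
Let q1 : q <= 1 / 100.
Proof. by have [_ _ _ _ t5] := facts; have [+ _] := param_ratio r1 t4 (erefl p) ht t5; rewrite /q /c -exprM. Qed.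
Let p2c : p ^+ 2 <= c ^+ 4.
Proof. by have [_ _ _ _ t5] := facts; have [_] := param_ratio r1 t4 (erefl p) ht t5; rewrite /c -exprM. Qed.
Let pg : p ^+ 3 / c ^+ 2 <= 8 * rho ^+ 5.
Proof. by have := param_growth r1 t4 (erefl p) ht; rewrite /c -exprM. Qed.
Let pc : 100 <= p * c.
Proof. by apply: (@le_trans _ _ (17 * 64)); [lra|apply: ler_pM]. Qed.
Let q0 : 0 < q. Proof. by rewrite divr_gt0 // exprn_gt0. Qed.
Let tau0 : 0 < tau. Proof. by rewrite divr_gt0 // exprn_gt0. Qed.
Let tc : tau * c ^+ 2 = p ^+ 2. Proof. by rewrite /tau divfK // expf_neq0 // gt_eqF. Qed.
Let qc : q * c ^+ 3 = p ^+ 2. Proof. by rewrite /q divfK // expf_neq0 // gt_eqF. Qed.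
Let t3 : tau ^+ 3 = p ^+ 2 * q ^+ 2. Proof. by rewrite /tau /q; field; rewrite gt_eqF. Qed.
Let ct2 : c * tau ^+ 2 = p ^+ 2 * q. Proof. by rewrite /tau /q; field; rewrite gt_eqF. Qed.

Lemma vv_near (s x : R) : 0 <= s -> s <= tau -> c - p^-1 <= x <= c + p^-1 -> normc (VV z s x) <= 9 * p ^+ 2.
Proof.
move=> s0 st /andP[x1 x2].
have p20 : 0 < p ^+ 2 by exact: exprn_gt0.
have [y xE] : exists y, x = c * (1 + y) by exists (x / c - 1); field; rewrite gt_eqF.
have dc : p^-1 <= c / 100.
  by rewrite -[X in X <= _]mul1r ler_pdivrMr // mulrAC ler_pdivlMr // mul1r mulrC.
have y1 : - (1 / 100) <= y <= 1 / 100.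
  move: x1 x2; rewrite xE mulrDr mulr1 => x1 x2.
  have a1 : c * y <= c * (1 / 100) by lra.
  have a2 : c * (- (1 / 100)) <= c * y by lra.
  by move: a1 a2; rewrite !ler_pM2l // => -> ->.
have cy : `|c ^+ 3 * y| <= p ^+ 2.
  have : `|c * y| <= p^-1 by rewrite ler_norml; move: x1 x2; rewrite xE mulrDr mulr1; lra.
  move=> H; have -> : c ^+ 3 * y = c ^+ 2 * (c * y) by ring.
  rewrite normrM ger0_norm ?sqr_ge0 //.
  apply: (@le_trans _ _ (p ^+ 3 * p^-1)); first by apply: ler_pM; rewrite ?sqr_ge0.
  by rewrite exprS mulrAC mulfV ?mul1r // gt_eqF.
have s1 : 0 <= s / tau <= 1 by rewrite divr_ge0 ?(ltW tau0) //= ler_pdivrMr // mul1r.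
set h := s / tau in s1; have sE : s = h * tau by rewrite /h divfK // gt_eqF.
have a1 := ap; rewrite ler_norml in a1.
apply: le_trans (normc_ReIm _) _; rewrite Re_VV Im_VV /z /= -/c.
have E1 : 3 * s * x ^+ 2 - s ^+ 3 - a = p ^+ 2 * (3 * h * (1 + y) ^+ 2) - h ^+ 3 * (p ^+ 2 * q ^+ 2) - a.
  by rewrite -t3 -tc sE xE; ring.
have E2 : x ^+ 3 - 3 * x * s ^+ 2 - c ^+ 3 = (c ^+ 3 * y) * (3 + 3 * y + y ^+ 2) - 3 * h ^+ 2 * (1 + y) * (p ^+ 2 * q).
  by rewrite -ct2 sE xE; ring.
have -> : Re (a +i* c ^+ 3) = a by [].
have -> : Im (a +i* c ^+ 3) = c ^+ 3 by [].
rewrite E1 E2; exact: near_aux p20 q0 q1 s1 y1 a1 cy.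
Qed.

Lemma right_ge x : c <= x -> 51 / 50 * p ^+ 2 <= Re (VV z tau x) + 0 * Im (VV z tau x).
Proof.
move=> cx; rewrite mul0r addr0 Re_VV t3.
have : tau * c ^+ 2 <= tau * x ^+ 2.
  by apply: ler_wpM2l; [exact: ltW|apply: lerXn2r; rewrite ?nnegrE ?(le_trans (ltW c0) cx) // ltW].
rewrite tc; have -> : Re z = a by [].
move: (ap); rewrite ler_norml => /andP[_ a1].
by move=> T; rewrite -(mulrA 3); apply: (right_aux q0 q1 (exprn_gt0 2 p0) a1).
Qed.

(** The multiplier for the reflected problem on [- c, infinity). Near x = 0 the real part of the
    potential fails, but the imaginary part is about c^3 and q c^3 = p^2. It vanishes at - c, as
    [log_bound] requires. *)
Let ee (x : R) : R := 12 * q * (((x + c) / c) / (1 + (x + c) / c)).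
Let ee' (x : R) : R := 12 * q / c * (1 + (x + c) / c) ^- 2.

Lemma left_facts x : - c <= x -> [/\ rder ee x (ee' x), `|ee' x| <= p / 100, 0 <= ee x <= 1 &
  51 / 50 * p ^+ 2 <= Re (VV (cj z) tau x) + ee x * Im (VV (cj z) tau x)].
Proof.
move=> xc; pose w := (x + c) / c.
have w0 : 0 <= w by apply: divr_ge0; [rewrite -lerBlDr sub0r|exact: ltW].
have w1 : 0 < 1 + w by lra.
have xE : x = c * (w - 1) by rewrite /w; field; rewrite gt_eqF.
split.
- have dw : rder (fun x => (x + c) / c) x (c^-1).
    by apply: rder_eq (rderM (rderD (rder_id x) (rder_cst c x)) (rder_cst c^-1 x)) _; ring.
  have n0 : 1 + (x + c) / c != 0 by rewrite gt_eqF.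
  have -> : ee = (fun x => 12 * q * ((x + c) / c * (1 + (x + c) / c)^-1)) by [].
  apply: rder_eq; [apply: rderM; [exact: rder_cst|apply: rderM; [exact: dw|apply: rderV; [exact: n0|apply: rderD; [exact: rder_cst|exact: dw]]]]|].
  by rewrite /ee' -/w; field; rewrite (gt_eqF w1) gt_eqF.
- have k0 : 0 <= 12 * q / c by apply: divr_ge0; [apply: mulr_ge0 => //; exact: ltW|exact: ltW].
  have kw : 0 <= (1 + w) ^- 2 by rewrite invr_ge0 exprn_ge0 // ltW.
  rewrite /ee' -/w (ger0_norm (mulr_ge0 k0 kw)).
  have : (1 + w) ^- 2 <= 1 by rewrite invf_le1 ?exprn_gt0 // exprn_ege1 // lerDl.
  have : 12 * q / c <= p / 100.
    rewrite ler_pdivrMr //; have := pc; have := q1; lra.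
  move=> H1 H2; apply: le_trans H1; rewrite -[X in _ <= X]mulr1; exact: ler_wpM2l.
- rewrite /ee -/w.
  have f1 : 0 <= w / (1 + w) <= 1 by rewrite divr_ge0 ?(ltW w1) //= ler_pdivrMr // mul1r lerDr.
  move: q0 q1 f1; move: (w / (1 + w)) => f q0' q1' /andP[f1 f2].
  have qf := ler_pM (ltW q0') f1 q1' f2; have qf0 := mulr_ge0 (ltW q0') f1; apply/andP; split; lra.
rewrite Re_VV Im_VV ReJ ImJ /ee -/w.
have -> : Re z = a by []. have -> : Im z = c ^+ 3 by [].
have [_ a1] : - p ^+ 2 <= a /\ a <= p ^+ 2 by move: (ap); rewrite ler_norml => /andP[].
have E : 3 * tau * x ^+ 2 - tau ^+ 3 - a + 12 * q * (w / (1 + w)) * (x ^+ 3 - 3 * x * tau ^+ 2 - - c ^+ 3) =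
  p ^+ 2 * (3 * (w - 1) ^+ 2 - q ^+ 2 + 12 * (w / (1 + w)) * (1 + (w - 1) ^+ 3) - 36 * q ^+ 2 * (w / (1 + w)) * (w - 1)) - a.
  have e1 : tau * x ^+ 2 = p ^+ 2 * (w - 1) ^+ 2 by rewrite -tc xE; ring.
  have e2 : q * x ^+ 3 = p ^+ 2 * (w - 1) ^+ 3 by rewrite -qc xE; ring.
  have e3 : x * tau ^+ 2 = p ^+ 2 * q * (w - 1) by rewrite -ct2 xE; ring.
  rewrite t3; move: (w / (1 + w)) => f.
  have -> : 3 * tau * x ^+ 2 - p ^+ 2 * q ^+ 2 - a + 12 * q * f * (x ^+ 3 - 3 * x * tau ^+ 2 - - c ^+ 3) =
    3 * (tau * x ^+ 2) - p ^+ 2 * q ^+ 2 - a + 12 * f * (q * x ^+ 3 - 3 * q * (x * tau ^+ 2) + q * c ^+ 3) by ring.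
  by rewrite e1 e2 e3 qc; ring.
rewrite E; exact: left_aux q0 q1 (exprn_gt0 2 p0) a1 w0.
Qed.

Lemma shifted_bounds (w : R[i]) (x0 : R) (e e' : R -> R) : 
  (forall x, x0 <= x -> [/\ rder e x (e' x), `|e' x| <= p / 100, 0 <= e x <= 1 & 51 / 50 * p ^+ 2 <= Re (VV w tau x) + e x * Im (VV w tau x)]) ->
  e x0 = 0 -> (forall x, x0 <= x <= x0 + p^-1 -> normc (VV w tau x) <= 9 * p ^+ 2) ->
  Re (pp1 w (line tau x0) * cj (pp w (line tau x0))) + p * sqn (pp w (line tau x0)) <= 0 /\
  sqn (pp1 w (line tau x0)) + p ^+ 2 * sqn (pp w (line tau x0)) <= 4 * p ^+ 2 * expR (2 * (9 + 1)) * sqn (pp w (line tau x0)).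
Proof.
move=> H e0 HM.
have p50 : 0 <= p / 100 by rewrite divr_ge0 // ltW.
have p50' : p / 100 <= p by rewrite ler_pdivrMr //; have := p0; lra.
(* 2.01^2 = 4.0401 is below 4 * 51/50 = 4.08: the slope p / 100 of the multiplier fits the margin of
   coercivity. *)
have qd : (2 * p + p / 100) ^+ 2 <= 4 * (51 / 50 * p ^+ 2) by have := sqr_ge0 p; lra.
split.
  have := pp_QF (ltW tau0) (ltW p0) p50 qd H; rewrite /QF e0 mul0r addr0; exact.
exact: log_bound (ltW tau0) p0 p50 p50' qd H e0 HM.
Qed.

Lemma wronskian_II : Wz z 0 != 0 /\
  (sqn (pp1 z (line tau c)) + p ^+ 2 * sqn (pp z (line tau c))) *
  (sqn (pp1 (cj z) (line tau (- c))) + p ^+ 2 * sqn (pp (cj z) (line tau (- c)))) <=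
  4 * p ^+ 2 * expR (2 * (9 + 1)) ^+ 2 * sqn (Wz z 0).
Proof.
have R1 x : c <= x -> [/\ rder (fun=> 0 : R) x ((fun=> 0) x), `|(fun=> 0 : R) x| <= p / 100, 0 <= (fun=> 0 : R) x <= 1 &
    51 / 50 * p ^+ 2 <= Re (VV z tau x) + (fun=> 0 : R) x * Im (VV z tau x)].
  by move=> cx; split; rewrite /= ?normr0 ?lexx ?ler01 ?divr_ge0 ?(ltW p0) //; [exact: rder_cst|exact: right_ge].
have V1 x : c <= x <= c + p^-1 -> normc (VV z tau x) <= 9 * p ^+ 2.
  move=> /andP[x1 x2]; apply: vv_near; rewrite ?(ltW tau0) // x2 andbT.
  by apply: le_trans x1; rewrite gerBl invr_ge0 ltW.
have V2 x : - c <= x <= - c + p^-1 -> normc (VV (cj z) tau x) <= 9 * p ^+ 2.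
  move=> /andP[x1 x2]; rewrite -(opprK x) VV_reflect' normcJ'; apply: vv_near; rewrite ?(ltW tau0) //.
  rewrite lerNr opprB addrC x2 /= lerNl; apply: le_trans x1; rewrite opprD gerBl invr_ge0 ltW //.
have e0 : ee (- c) = 0 by rewrite /ee addNr !mul0r mulr0.
have [A1 B1] := shifted_bounds R1 (erefl _) V1.
have [A2 B2] := shifted_bounds left_facts e0 V2.
have WE : Wz z 0 = cj (pp (cj z) (line tau (- c))) * pp1 z (line tau c) + cj (pp1 (cj z) (line tau (- c))) * pp z (line tau c).
  by rewrite /Wz (awr_cst 0 (line tau c) (asol_mp z) (asol_pp z)) /awr /mp /mp1 line_reflect mulNr opprK.
have N1 := pp_neq0 z (line tau c); have N2 := pp_neq0 (cj z) (line tau (- c)).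
rewrite WE; move: (pp z _) (pp1 z _) (pp (cj z) _) (pp1 (cj z) _) A1 B1 A2 B2 N1 N2 => u u1 v v1 A1 B1 A2 B2 N1 N2.
exact: wronskian_aux p0 (expR_gt0 _) A1 B1 A2 B2 N1 N2.
Qed.

(** The energies return from the shifted line to the real axis along vertical segments of length
    tau; |V| <= 9 p^2 and the weight p give the exponent 10 tau p for each. *)
Lemma base_II : en z p c * en (cj z) p (- c) <= 4 * p ^+ 2 * expR (40 + 20 * (p ^+ 3 / c ^+ 2)) * sqn (Wz z 0).
Proof.
have [_ W] := wronskian_II; set S := p ^+ 3 / c ^+ 2.
have step (w : R[i]) (x0 : R) : (forall s, 0 <= s <= tau -> normc (VV w s x0) <= 9 * p ^+ 2) ->
    en w p x0 <= (sqn (pp1 w (line tau x0)) + p ^+ 2 * sqn (pp w (line tau x0))) * expR (10 * S).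
  move=> H; have d : line 0 x0 - line tau x0 = 'i%C * tau%:C by rewrite /line cC0; ring.
  have K := @pp_segment R w (line tau x0) (line 0 x0) (9 * p ^+ 2) p p0.
  rewrite d normcM normc_i mul1r normcR ger0_norm ?(ltW tau0) // in K.
  have H' s : 0 <= s <= 1 -> normc ('i%C * (line tau x0 + s%:C * ('i%C * tau%:C)) ^+ 3 - w) <= 9 * p ^+ 2.
    move=> /andP[s0 s1]; have -> : line tau x0 + s%:C * ('i%C * tau%:C) = line ((1 - s) * tau) x0.
      by rewrite /line (cCM (1 - s) tau) (cCD 1) cCN cC1; ring.
    by apply: H; rewrite mulr_ge0 ?subr_ge0 ?(ltW tau0) //= ler_piMl ?(ltW tau0) // lerBlDr lerDl.
  apply: le_trans (K H') _; rewrite le_eqVlt; apply/orP; left; apply/eqP; congr (_ * expR _).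
  by rewrite /S /tau; field; rewrite !gt_eqF.
have cc : c - p^-1 <= c <= c + p^-1.
  have pV : 0 <= p^-1 by rewrite invr_ge0 ltW.
  by rewrite gerBl lerDl pV.
have E1 : en z p c <= (sqn (pp1 z (line tau c)) + p ^+ 2 * sqn (pp z (line tau c))) * expR (10 * S).
  by apply: step => s /andP[s0 s1]; exact: vv_near.
have E2 : en (cj z) p (- c) <= (sqn (pp1 (cj z) (line tau (- c))) + p ^+ 2 * sqn (pp (cj z) (line tau (- c)))) * expR (10 * S).
  by apply: step => s /andP[s0 s1]; rewrite VV_reflect' normcJ'; exact: vv_near.
apply: le_trans (ler_pM (en_ge0 _ _ _) (en_ge0 _ _ _) E1 E2) _.
rewrite mulrACA -expRD; apply: le_trans (ler_wpM2r (expR_ge0 _) W) _.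
have -> : 4 * p ^+ 2 * expR (2 * (9 + 1)) ^+ 2 * sqn (Wz z 0) * expR (10 * S + 10 * S) =
   4 * p ^+ 2 * (expR (2 * (9 + 1)) ^+ 2 * expR (10 * S + 10 * S)) * sqn (Wz z 0) by ring.
rewrite -expRM_natl -expRD; apply: ler_wpM2r; first exact: sqn_ge0.
apply: ler_wpM2l; first by rewrite mulr_ge0 ?sqr_ge0.
by rewrite ler_expR le_eqVlt; apply/orP; left; apply/eqP; rewrite /S; ring.
Qed.

Lemma apr_II : apr z (eb 4100 rho).
Proof.
(* 40 + 20 S comes from [base_II] and 2 * 39 S from the window. *)
set S := p ^+ 3 / c ^+ 2; set e := expR (40 + 100 * S).
have c2 : 0 < c ^+ 2 by exact: exprn_gt0. have p2 : 0 < p ^+ 2 by exact: exprn_gt0.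
have p3 : 0 < p ^+ 3 by exact: exprn_gt0. have c4 : 0 < c ^+ 4 by exact: exprn_gt0.
have S0 : 0 <= S by apply: divr_ge0; exact: ltW.
(* At distance [l] from [c] the cube has changed by about 3 l c^2 = 9 p^2, enough to dominate |Re z|
   <= p^2. *)
pose l := 3 * p ^+ 2 / c ^+ 2.
have l0 : 0 <= l by rewrite divr_ge0 ?(ltW c2) // mulr_ge0 // ltW.
have lE : l = c * (3 * q) by rewrite /l /q; field; rewrite gt_eqF.
have lq : l <= c * (3 / 100) by rewrite lE; apply: ler_wpM2l; [exact: ltW|have := q1; lra].
have lc : l * c ^+ 2 = 3 * p ^+ 2 by rewrite /l divfK // gt_eqF.
have [a0 a1] : - p ^+ 2 <= a /\ a <= p ^+ 2 by move: (ap); rewrite ler_norml => /andP[].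
have Rz : Re z = a by []. have Iz : Im z = c ^+ 3 by [].
have RV x : Re (VV z 0 x) = - a by rewrite Re_VV Rz expr0n /= mulr0 mul0r subr0 sub0r.
have IV x : Im (VV z 0 x) = x ^+ 3 - c ^+ 3 by rewrite Im_VV Iz expr0n /= mulr0 subr0.
have W0 : Wz z 0 != 0 by have [] := wronskian_II.
have hV x : c - l <= x <= c + l -> normc (VV z 0 x) <= 12 * p ^+ 2.
  move=> /andP[x1 x2]; apply: le_trans (normc_ReIm _) _; rewrite RV IV normrN.
  apply: le_trans (lerD ap (cube_near (ltW c0) l0 lq lc x1 x2)) _.
  by move: p2; move: (p ^+ 2) => y; lra.
have hR x : c + l <= x -> p ^+ 2 <= Re (VV z 0 x) + Im (VV z 0 x).
  move=> xl; rewrite RV IV; have := cube_mono xl; exact: cube_right (ltW c0) l0 lc (ltW p2) a1.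
have hL x : x <= c - l -> p ^+ 2 <= Re (VV z 0 x) - Im (VV z 0 x).
  move=> xl; rewrite RV IV; have := cube_mono xl; exact: cube_left (ltW c0) l0 lq lc (ltW p2) a1.
have G0 : 0 <= 4 * p ^+ 2 * e by rewrite mulr_ge0 ?expR_ge0 // mulr_ge0 // ltW.
have hG : en z p c * en (cj z) p (- c) * expR (l * (12 * p ^+ 2 + p ^+ 2) / p) ^+ 2 <= 4 * p ^+ 2 * e * sqn (Wz z 0).
  apply: le_trans (ler_wpM2r (exprn_ge0 2 (expR_ge0 _)) base_II) _.
  rewrite -expRM_natl; have -> : l * (12 * p ^+ 2 + p ^+ 2) / p = 39 * S by rewrite /l /S; field; rewrite !gt_eqF.
  have reorder (A x y w : R) : A * x * w * y = A * (x * y) * w by ring.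
  rewrite (reorder (4 * p ^+ 2)) -expRD; apply: ler_wpM2r; first exact: sqn_ge0.
  apply: ler_wpM2l; first by rewrite mulr_ge0 // ltW.
  by rewrite ler_expR -/S; move: S0; move: (S) => y; lra.
have := apriori l0 p0 p2 G0 hV hR hL W0 hG.
apply: apr_mono.
have kp : kap l p (p ^+ 2) <= 10 / c ^+ 2.
  rewrite /kap; have -> : 2 * l / p ^+ 2 = 6 / c ^+ 2 by rewrite /l; field; rewrite !gt_eqF.
  have -> : p * p ^+ 2 = p ^+ 3 by rewrite exprS.
  have pV : (p ^+ 3)^-1 <= (c ^+ 2)^-1 by rewrite lef_pV2 ?posrE.
  have -> : 10 / c ^+ 2 = 6 / c ^+ 2 + 4 / c ^+ 2 by rewrite -mulrDl -natrD.
  by apply: lerD => //; apply: ler_wpM2l.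
have kp0 : 0 <= kap l p (p ^+ 2) by exact: kap_ge0.
have k2 : kap l p (p ^+ 2) ^+ 2 * p ^+ 2 <= 100.
  have : kap l p (p ^+ 2) ^+ 2 <= (10 / c ^+ 2) ^+ 2 by apply: lerXn2r; rewrite ?nnegrE // divr_ge0 // ltW.
  move=> H; apply: le_trans (ler_wpM2r (ltW p2) H) _.
  have -> : (10 / c ^+ 2) ^+ 2 * p ^+ 2 = 100 * p ^+ 2 / c ^+ 4 by field; rewrite gt_eqF.
  by rewrite ler_pdivrMr //; apply: ler_wpM2l.
have e1 : 1 <= e by rewrite -[X in X <= _]expR0 ler_expR; exact: exponent_ge S0.
have p4 : 8 / (p ^+ 2) ^+ 2 <= 8.
  have p1 : 1 <= p by apply: le_trans p17; rewrite ler1n.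
  have pp2 : 1 <= (p ^+ 2) ^+ 2 by rewrite -exprM; exact: exprn_ege1.
  by rewrite ler_pdivrMr ?(lt_le_trans ltr01 pp2) // ler_peMr.
apply: (@le_trans _ _ ((32 * 101) * e)); first exact: sum_aux k2 e1 p4.
have r5 : 1 <= rho ^+ 5 by exact: exprn_ege1.
have e840 : e <= eb 840 rho.
  by rewrite /e /eb ler_expR; exact: exponent_small pg r5.
have C : 32 * 101 <= eb (32 * 101) rho by apply: const_le_eb => //; exact: mulr_ge0.
apply: le_trans (ler_pM (mulr_ge0 (ler0n _ _) (ler0n _ _)) (expR_ge0 _) C e840) _.
by rewrite -ebD; apply: eb_le => //; exact: exponent_total.
Qed.

End region_II.

Lemma strip_II rho z : 1 <= rho -> `|Re z| <= rho ^+ 6 -> 4 ^+ 9 * rho ^+ 6 <= Im z -> apr z (eb 4100 rho).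
Proof.
move=> r1 ha hb; have r6 : 1 <= rho ^+ 6 by exact: exprn_ege1.
have b9 : 4 ^+ 9 <= Im z by apply: le_trans hb; rewrite ler_peMr // exprn_ge0.
pose t : R := Im z `^ 9%:R^-1.
have b0 : 0 <= Im z by apply: le_trans b9; exact: exprn_ge0.
have t0 : 0 <= t by exact: powR_ge0.
have t9 : t ^+ 9 = Im z by rewrite -powR_mulrn // /t -powRrM mulVf ?powRr1 // pnatr_eq0.
have t4 : 4 <= t by rewrite -(@ler_pXn2r _ 9) ?nnegrE // t9.
have ht : 1000 * rho ^+ 6 <= t ^+ 9.
  by rewrite t9; apply: le_trans hb; apply: ler_wpM2r; [exact: exprn_ge0 (le_trans ler01 r1)|lra].
have := apr_II r1 ha t4 ht; rewrite -exprM t9.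
by have -> : Re z +i* Im z = z by case: (z).
Qed.

End strip_far.

(** * The resolvent for imaginary part of order rho^6 *)

Section strip_near.
Variable R : realType.
Implicit Types (z : R[i]) (rho : R).

Lemma kap_III (La rho : R) : 1 <= rho -> 0 <= La -> kap (La * rho ^+ 2) (rho ^+ 3) (rho ^+ 6) <= 2 * La + 4.
Proof.
move=> r1 La0; have r0 : 0 < rho by exact: lt_le_trans r1.
have h2 : rho ^+ 2 <= (rho ^+ 3) ^+ 2 by rewrite -exprM; apply: ler_weXn2l.
have h9 : 1 <= rho ^+ 3 * rho ^+ 6 by rewrite -exprD; exact: exprn_ege1.
have e1 : 2 * (La * rho ^+ 2) <= 2 * La * (rho ^+ 3) ^+ 2 by rewrite mulrA; apply: ler_wpM2l => //; exact: mulr_ge0.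
have p6 : 0 < (rho ^+ 3) ^+ 2 by rewrite !exprn_gt0.
have p9 : 0 < rho ^+ 3 * rho ^+ 6 by exact: lt_le_trans h9.
rewrite /kap; apply: lerD; first by rewrite ler_pdivrMr.
by rewrite ler_pdivrMr // ler_peMr.
Qed.

Lemma strip_III (kp0 : R) : 0 <= kp0 -> exists2 K : R, 0 <= K & forall rho z, 1 <= rho -> 1 <= Re z -> Re z <= rho ^+ 6 ->
  0 <= Im z -> Im z <= kp0 * rho ^+ 6 -> apr z (eb K rho) \/
  exists y : R, [/\ 1 / 2 <= y, Psi y%:C = 0 & normc (z - y%:C) <= expR (- rho ^+ 5)].
Proof.
move=> k00; pose kp := kp0 + 1; have k0 : 0 <= kp by rewrite /kp; lra.
have [K1 K10 HK] := psi_low k0.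
(* La^3 >= kp0 + 3: outside the window |x|^3 exceeds Im z by 3 rho^6, which pays for Re z and for
   A. *)
pose La := kp0 + 3; pose KW := K1 + KD kp; pose X := La * (La ^+ 3 + kp + 1).
have La1 : 3 <= La by rewrite /La; lra.
have La4 : 0 <= 2 * La + 4 by lra.
have X0 : 0 <= X by rewrite mulr_ge0 ?addr_ge0 ?exprn_ge0 //; lra.
have D0 : 0 <= KD kp by rewrite /KD; lra.
pose KG := 4 * KD kp + 2 * X + 2 * KW; pose cc := 32 * (2 * La + 4) ^+ 2.
have cc0 : 0 <= cc by rewrite mulr_ge0 // sqr_ge0.
have G00 : 0 <= KG by rewrite /KG /KW; lra.
have cK0 : 0 <= cc + 12 + KG by lra.
exists (9 + (cc + 12 + KG)); first by lra.
move=> rho z r1 a1 ar b0 bk.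
have r6 : 1 <= rho ^+ 6 by exact: exprn_ege1.
have zk : normc z <= kp * rho ^+ 6.
  apply: le_trans (normc_ReIm _) _; rewrite !ger0_norm //; last by lra.
  by rewrite /kp mulrDl mul1r addrC; exact: lerD.
have [W|] := HK rho z r1 a1 b0 zk; last by right.
left; pose l := La * rho ^+ 2; have r0 : 0 < rho by lra.
have l0 : 0 <= l by rewrite mulr_ge0 ?sqr_ge0 //; lra.
have l3 : l ^+ 3 = La ^+ 3 * rho ^+ 6 by rewrite exprMn -exprM.
have La3 : La <= La ^+ 3 by rewrite -[X in X <= _]expr1; apply: ler_weXn2l => //; lra.
have l3' : (kp0 + 3) * rho ^+ 6 <= l ^+ 3 by rewrite l3; apply: ler_wpM2r => //; lra.
have Rv x : Re (VV z 0 x) = - Re z by rewrite Re_VV expr0n /= mulr0 mul0r subr0 sub0r.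
have Iv x : Im (VV z 0 x) = x ^+ 3 - Im z by rewrite Im_VV expr0n /= mulr0 subr0.
have r3 : 0 < rho ^+ 3 by exact: exprn_gt0. have r60 : 0 < rho ^+ 6 by exact: exprn_gt0.
have hV x : 0 - l <= x <= 0 + l -> normc (VV z 0 x) <= (La ^+ 3 + kp) * rho ^+ 6.
  rewrite sub0r add0r -ler_norml => xl; apply: le_trans (normcB _ _) _; rewrite mulrDl -l3; apply: lerD => //.
  by rewrite line0 normcM normc_i mul1r -cCX normcR; exact: cube_norm.
have hR x : 0 + l <= x -> rho ^+ 6 <= Re (VV z 0 x) + Im (VV z 0 x).
  by rewrite add0r Rv Iv => /cube_mono xl; exact: out_III r60 ar bk l3' xl.
have hL x : x <= 0 - l -> rho ^+ 6 <= Re (VV z 0 x) - Im (VV z 0 x).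
  rewrite sub0r Rv Iv => /cube_mono; have -> : (- l) ^+ 3 = - l ^+ 3 by ring.
  by move=> xl; exact: out_III' k00 r60 ar b0 l3' xl.
have [Dm _] : normc (Dd (- z)) <= eb (KD kp) rho /\ normc (Nd (- z)) <= eb (KD kp) rho by apply: Dd_le; rewrite ?normcN.
have Wl : eb (- KW) rho <= normc (Wz z 0).
  have := f_equal (@normc R) (Wz_Psi z 0); rewrite (normcM (Wz z 0)) (normcM (2 * _)) (normcM 2) normc_cis mulr1 normc_nat => E.
  rewrite /KW opprD ebD ebN (ebN (KD kp)) ler_pdivrMr ?eb_gt0 //; rewrite -ebN.
  apply: le_trans W _; apply: (@le_trans _ _ (2 * normc (Psi z))); first by rewrite ler_peMl ?normc_ge0 // ler1n.
  by rewrite -E; apply: ler_wpM2l => //; exact: normc_ge0.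
have W0 : Wz z 0 != 0 by rewrite -normc_gt0; exact: lt_le_trans (eb_gt0 _ _) Wl.
have W2 : 1 <= eb (2 * KW) rho * sqn (Wz z 0).
  rewrite -normc_sqr -(ebX KW) -exprMn; apply: exprn_ege1.
  by rewrite -ler_pdivrMl ?eb_gt0 // mulr1 -ebN.
have enb w : normc w <= kp * rho ^+ 6 -> en w (rho ^+ 3) 0 <= 2 * rho ^+ 6 * eb (2 * KD kp) rho.
  move=> wk; rewrite /en line0 cC0 pp_0 pp1_0 sqnM sqn_cis mul1r -exprM -(ebX (KD kp)).
  have [a b] : normc (Dd (cj (cis (pi / 5)) * w)) <= eb (KD kp) rho /\ normc (Nd (cj (cis (pi / 5)) * w)) <= eb (KD kp) rho.
    by apply: Dd_le => //; rewrite normcM normcJ' normc_cis mul1r.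
  rewrite -!normc_sqr; exact: en_aux (normc_ge0 _) (normc_ge0 _) a b r6.
have E1 := enb z zk; have E2 := enb (cj z); rewrite normcJ' in E2; have {}E2 := E2 zk.
pose Gam := 4 * rho ^+ 12 * eb KG rho.
have Gam0 : 0 <= Gam by rewrite !mulr_ge0 ?eb_ge0 ?exprn_ge0 // ltW.
have hG : en z (rho ^+ 3) 0 * en (cj z) (rho ^+ 3) (- 0) * expR (l * ((La ^+ 3 + kp) * rho ^+ 6 + (rho ^+ 3) ^+ 2) / rho ^+ 3) ^+ 2 <= Gam * sqn (Wz z 0).
  have -> : expR (l * ((La ^+ 3 + kp) * rho ^+ 6 + (rho ^+ 3) ^+ 2) / rho ^+ 3) = eb X rho.
    by rewrite /eb; congr expR; rewrite /l /X; field; rewrite gt_eqF.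
  rewrite oppr0 (ebX X); apply: le_trans (ler_wpM2r (eb_ge0 _ _) (ler_pM (en_ge0 _ _ _) (en_ge0 _ _ _) E1 E2)) _.
  have -> : 2 * rho ^+ 6 * eb (2 * KD kp) rho * (2 * rho ^+ 6 * eb (2 * KD kp) rho) * eb (2%:R * X) rho =
     4 * rho ^+ 12 * (eb (2 * KD kp) rho * eb (2 * KD kp) rho * eb (2 * X) rho) * 1.
    have -> : rho ^+ 12 = rho ^+ 6 * rho ^+ 6 by rewrite -exprD.
    move: (rho ^+ 6) (eb _ _) (eb _ _) => u v w; ring.
  have -> : Gam * sqn (Wz z 0) = 4 * rho ^+ 12 * (eb (2 * KD kp) rho * eb (2 * KD kp) rho * eb (2 * X) rho) * (eb (2 * KW) rho * sqn (Wz z 0)).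
    rewrite /Gam -!ebD (_ : KG = 2 * KD kp + 2 * KD kp + 2 * X + 2 * KW); last by rewrite /KG; ring.
    by rewrite (ebD _ (2 * KW)) !mulrA.
  by apply: ler_wpM2l W2; rewrite !mulr_ge0 ?eb_ge0 ?exprn_ge0 // ltW.
have := apriori l0 r3 r60 Gam0 hV hR hL W0 hG; apply: apr_mono.
have kpb : kap l (rho ^+ 3) (rho ^+ 6) <= 2 * La + 4 by apply: kap_III => //; exact: le_trans La1.
have kp00 : 0 <= kap l (rho ^+ 3) (rho ^+ 6) by exact: kap_ge0.
have k2 : kap l (rho ^+ 3) (rho ^+ 6) ^+ 2 <= (2 * La + 4) ^+ 2 by apply: lerXn2r => //; rewrite nnegrE.
have B1 : 8 * Gam * kap l (rho ^+ 3) (rho ^+ 6) ^+ 2 <= eb (cc + 12 + KG) rho.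
  apply: (@le_trans _ _ (cc * rho ^+ 12 * eb KG rho)).
    have -> : cc * rho ^+ 12 * eb KG rho = 8 * Gam * (2 * La + 4) ^+ 2 by rewrite /cc /Gam; ring.
    by apply: ler_wpM2l k2; rewrite mulr_ge0.
  rewrite (ebD _ KG); apply: ler_wpM2r; first exact: eb_ge0.
  exact: (@poly_le_eb R cc rho 12 cc0 r1).
have B2 : 8 / (rho ^+ 6) ^+ 2 <= 8 by rewrite ler_pdivrMr ?exprn_gt0 // ler_peMr // exprn_ege1.
have B3 : 1 <= eb (cc + 12 + KG) rho by exact: eb_ge1.
have B9 : 9 <= eb 9 rho by exact: const_le_eb.
rewrite (ebD 9); apply: le_trans (lerD B1 B2) _.
exact: nine_aux B3 B9.
Qed.

End strip_near.

(** * Nonvanishing on the negative axis, decay at both ends, accretivity *)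

Section decay.
Variable R : realType.
Implicit Types (z w : R[i]) (F f : R -> R).

Lemma rder_near f g (x d : R) : (\forall t \near x, f t = g t) -> rder f x d -> rder g x d.
Proof.
by move=> fg; exact: near_eq_is_derive.
Qed.

Lemma rder_near0 f (x d : R) : (\forall t \near x, f t = 0) -> rder f x d -> d = 0.
Proof. by move=> f0 df; apply: rder_uniq df _; apply: rder_near (rder_cst 0 x); apply: filterS f0. Qed.

Lemma near_between (a b c : R) : a < c < b -> \forall t \near c, a < t < b.
Proof.
move=> /andP[ac cb].
have A : \forall t \near c, a < t by first [exact: lt_nbhsr|exact: lt_nbhsl|exact: gt_nbhsl|exact: (cvgr_gt c cvg_id)].
have B : \forall t \near c, t < b by first [exact: lt_nbhsl|exact: lt_nbhsr|exact: gt_nbhsr|exact: (cvgr_lt c cvg_id)].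
by apply: filterS2 A B => t -> ->.
Qed.

Lemma flat F f (a b c : R) : (forall x, a <= x <= b -> rder F x (f x)) -> (forall x, a <= x <= b -> 0 <= f x) ->
  F b <= F a -> a < c < b -> f c = 0.
Proof.
move=> dF f0 ba ac.
have mono u v : a <= u -> u <= v -> v <= b -> F u <= F v.
  by move=> au uv vb; apply: (nondecr uv) => x /andP[ux xv]; [apply: dF|apply: f0]; rewrite (le_trans au ux) (le_trans xv vb).
have cst t : a < t < b -> F t = F a.
  move=> /andP[/ltW at_ /ltW tb]; apply/le_anti; rewrite (mono a t) // andbT.
  exact: le_trans (mono _ _ at_ tb (lexx _)) ba.
have dc : rder F c (f c) by apply: dF; case/andP: ac => /ltW -> /ltW ->.
apply: (@rder_near0 (fun t => F t - F a) c).
  by apply: filterS (near_between ac) => t /cst ->; rewrite subrr.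
by apply: rder_eq (rderD dc (rder_cst (- F a) c)) (addr0 _).
Qed.

Lemma csol_Yd (E : R[i]) : csol E (Yd E) (Yd1 E).
Proof. exact: csol_lin (csol_cosol E) (csol_sisol E). Qed.

(* On the real half line, Re (Y' conj Y) increases up to a nonpositive limit. *)
Lemma Yd_QF (y t : R) : 0 <= y -> 0 <= t <= 1 -> QF 0 0 (Yd (- y%:C) t%:C) (Yd1 (- y%:C) t%:C) <= 0.
Proof.
move=> y0 /andP[t0 t1]; set E := - y%:C.
pose v n : R[i] := vv n%:R 0.
have cD := DL_cvg E (sec0 R); have cN := NL_cvg E (sec0 R).
apply: (@QF_lim R 0 0 (fun n => yL (v n) E t%:C) (fun n => yL1 (v n) E t%:C)).
- by rewrite /Yd; apply: ccvgD; apply: ccvgM => //; exact: ccvg_cst.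
- by rewrite /Yd1; apply: ccvgD; apply: ccvgM => //; exact: ccvg_cst.
move=> n; have n0 : 0 <= n%:R :> R by [].
have tl : t <= expR (2 * n%:R) by exact: le_trans t1 (l_ge1 n0).
apply: le_trans (QF_mono (V := fun t => t%:C ^+ 3 - E) (u := fun t => yL (v n) E t%:C) (u1 := fun t => yL1 (v n) E t%:C)
  (e := fun=> 0) (e' := fun=> 0) (A := 0) (eta := 0) tl (lexx 0) (lexx 0) _ _) _.
- by rewrite mulr0 addr0 expr0n mulr0.
- move=> x /andP[tx _]; have [d1 d2] := csol_R x (csol_yL (v n) E).
  split => //; [by apply: cder_eq d2 _; rewrite -cCX; ring|exact: rder_cst|by rewrite normr0|].
  rewrite mul0r addr0 /E -cCX !ReImE; have := exprn_ge0 3 (le_trans t0 tx); lra.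
rewrite /= yL_l yL1_l (am_real n%:R) /QF mul0r addr0 mul0r addr0.
have -> : mul (v n) = (3 / 4 / expR n%:R ^+ 2 + expR n%:R ^+ 3)%:C.
  have e : cexp (v n) = (expR n%:R)%:C by rewrite -cexpR /v /vv; congr cexp; rewrite cC0; ring.
  by rewrite /mul e !(cCD, cCM, cCV, cCn, cCX).
set m := 3 / 4 / _ + _; set p := Re (am _).
have m0 : 0 <= m by rewrite addr_ge0 ?exprn_ge0 ?expR_ge0 // divr_ge0 ?exprn_ge0 ?expR_ge0.
have -> : Re (- m%:C * p%:C * cj p%:C) = - (m * p ^+ 2) by rewrite !ReImE; ring.
by rewrite oppr_le0 mulr_ge0 ?sqr_ge0.
Qed.

Lemma sum_zero (a b c : R) : 0 < a -> 0 <= b -> 0 <= c -> a * b + c = 0 -> b = 0 /\ c = 0.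
Proof.
move=> a0 b0 c0 /eqP; rewrite paddr_eq0 ?mulr_ge0 // ?(ltW a0) // mulf_eq0 gt_eqF //= => /andP[/eqP -> /eqP ->] //.
Qed.

Lemma bound_zero (a b n d K : R) : a = 0 -> b = 0 -> n + d <= (a + b) * K -> 0 <= n -> 0 <= d -> n = 0.
Proof. by move=> -> -> ; rewrite addr0 mul0r => nd n0 d0; lra. Qed.

Lemma half_cube (y : R) : 0 <= y -> 0 < (1 / 2) ^+ 3 + y.
Proof. by move=> y0; rewrite ltr_wpDr // exprn_gt0. Qed.

(** If [Dd] vanished, Re (Y' conj Y) would start at 0 and be nonpositive at 1, although its
    derivative (x^3 + y) |Y|^2 + |Y'|^2 is nonnegative; so Y and Y' would vanish inside, hence also
    at 0. *)
Lemma Dd_real_neq0 (y : R) : 0 <= y -> Dd (- y%:C) != 0.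
Proof.
move=> y0; have h0 : 0 < 1 / 2 :> R by lra. have h1 : 1 / 2 < 1 :> R by lra.
have h01 := introT andP (conj h0 h1).
have b0 : `|(1 / 2 : R)| <= 1 by rewrite ger0_norm; lra.
apply/eqP => D0; set E := - y%:C in D0 *.
pose Q (t : R) := QF 0 0 (Yd E t%:C) (Yd1 E t%:C).
pose f (t : R) := (t ^+ 3 + y) * sqn (Yd E t%:C) + sqn (Yd1 E t%:C).
have dQ t : rder Q t (f t).
  have [d1 d2] := csol_R t (csol_Yd E).
  have d2' : cder (fun t => Yd1 E t%:C) t ((t ^+ 3 + y)%:C * Yd E t%:C - 0).
    by apply: cder_eq d2 _; rewrite cCD /E; ring.
  apply: rder_eq (@rder_QF R _ _ (fun t => (t ^+ 3 + y)%:C) (fun=> 0) (fun=> 0) t 0 0 d1 d2' (rder_cst 0 t)) _.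
  by cbv beta; rewrite ReC !mul0r mulr0 Re0 mul0r /f; ring.
have hf t : 0 <= t <= 1 -> 0 <= f t.
  by move=> /andP[t0 _]; rewrite addr_ge0 ?sqn_ge0 // mulr_ge0 ?sqn_ge0 // addr_ge0 // exprn_ge0.
have Q0 : Q 0 = 0 by rewrite /Q /QF cC0 Yd_0 D0 sqn0 cj0 !mulr0 Re0; ring.
have Q1 : Q 1 <= Q 0 by rewrite Q0; apply: Yd_QF => //; rewrite ler01 lexx.
have f0 := flat (fun x _ => dQ x) hf Q1 h01.
have [y2 y1] := sum_zero (half_cube y0) (sqn_ge0 _) (sqn_ge0 _) f0.
have b1 : `|(0 : R)| <= 1 by rewrite normr0.
have n0 := bound_zero y1 y2 (csol_R_bound (csol_Yd E) (lexx (normc E)) b0 b1) (sqn_ge0 _) (sqn_ge0 _).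
apply: (Dd_Nd_neq0 D0); rewrite -(Yd1_0 E); exact: sqn_eq0 n0.
Qed.

Lemma Wz_real_zero (y : R) : 0 <= y -> Psi y%:C = 0 -> Wz y%:C 0 = 0.
Proof.
move=> y0 P0; have /eqP := Wz_Psi y%:C 0.
by rewrite P0 mulr0 mulf_eq0 (negPf (Dd_real_neq0 y0)) orbF => /eqP.
Qed.

Lemma prop_pair (a b c d : R[i]) : a * d - b * c = 0 -> sqn b + 1 ^+ 2 * sqn a != 0 ->
  exists k, c = k * a /\ d = k * b.
Proof.
move=> W n0; have [a0|a0] := eqVneq a 0.
  have b0 : b != 0 by apply: contra_neq n0 => ->; rewrite a0 sqn0 mulr0 addr0.
  exists (d / b); rewrite divfK //; split => //; rewrite a0 mulr0.
  move: W; rewrite a0 mul0r sub0r => /eqP; rewrite oppr_eq0 mulf_eq0 (negPf b0) /= => /eqP //.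
exists (c / a); rewrite divfK //; split => //; rewrite mulrAC [c * b]mulrC.
have -> : b * c = a * d by apply/eqP; rewrite eq_sym -subr_eq0 W.
by rewrite mulrAC divff // mul1r.
Qed.

Lemma QF_far z (x0 : R) : x0 = 1 + `|Re z| + `|Im z| -> forall x, x0 <= x ->
  1 <= Re (VV z 0 x) + 1 * Im (VV z 0 x).
Proof.
move=> -> x hx; rewrite Re_VV Im_VV expr0n /= !(mulr0, mul0r, subr0) mul1r sub0r.
have a := ler_norm (Re z); have b := ler_norm (Im z); have a0 := normr_ge0 (Re z); have b0 := normr_ge0 (Im z).
have x1 : 1 <= x by lra.
have : x <= x ^+ 3 by rewrite -[X in X <= _]expr1; apply: ler_weXn2l.
move: (x ^+ 3) => X; lra.
Qed.

Lemma pp_decay z (x : R) : 1 + `|Re z| + `|Im z| <= x -> QF 1 0 (pp z (line 0 x)) (pp1 z (line 0 x)) <= 0.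
Proof.
move=> hx; have := @pp_QF R z 0 x 1 0 0 (fun=> 1) (fun=> 0) (lexx 0) (lexx 0) (lexx 0); apply.
  by rewrite mulr0 addr0 expr0n mulr1 ler0n.
move=> t xt; split; [exact: rder_cst|by rewrite normr0|by rewrite ler01 lexx|].
exact: (QF_far erefl (le_trans hx xt)).
Qed.

Lemma QF_scale (e p : R) (k w w1 : R[i]) : QF e p (k * w) (k * w1) = sqn k * QF e p w w1.
Proof. rewrite /QF sqnM; rewrite /sqn !ReImE; ring. Qed.

Lemma decay_L2 z (u u1 : R -> R[i]) (x0 X : R) P : x0 = 1 + `|Re z| + `|Im z| -> x0 <= X ->
  (forall x, cder u x (u1 x)) -> (forall x, cder u1 x (VV z 0 x * u x)) -> QF 1 0 (u X) (u1 X) <= 0 ->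
  (forall x, x0 <= x <= X -> rder P x (sqn (u x))) -> P X - P x0 <= - 2 * QF 1 0 (u x0) (u1 x0).
Proof.
move=> x0E x0X d1 d2 qX dP.
have H : 1 / 2 * (P X - P x0) <= QF 1 0 (u X) (u1 X) - QF 1 0 (u x0) (u1 x0) + 2 / 1 * (0 - 0).
  apply: (@QF_forced R u u1 (VV z 0) (fun=> 0) P (fun=> 0) x0 X 1 x0X ltr01) => x xx; split => //.
  - by apply: cder_eq (d2 x) _; rewrite subr0.
  - by case/andP: xx => xx _; have := QF_far x0E xx; rewrite mul1r.
  - exact: dP.
  by rewrite sqn0; exact: rder_cst.
lra.
Qed.

(** A vanishing Wronskian makes [pp] proportional to [mp], so that it decays at minus infinity
    too. *)
Lemma pp_L2 z : Wz z 0 = 0 -> exists x0 B : R, 0 <= x0 /\ forall X P, x0 <= X ->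
  (forall x, - X <= x <= X -> rder P x (sqn (pp z (line 0 x)))) -> P X - P x0 <= B /\ P (- x0) - P (- X) <= B.
Proof.
move=> W0; pose x0 := 1 + `|Re z| + `|Im z|.
have x00 : 0 <= x0 by rewrite !addr_ge0.
pose u x := pp z (line 0 x); pose u1 x := pp1 z (line 0 x).
have du x : cder u x (u1 x) by have [] := asol_line 0 x (asol_pp z).
have du1 x : cder u1 x (VV z 0 x * u x) by have [] := asol_line 0 x (asol_pp z).
pose v x := cj (u (- x)); pose v1 x := - cj (u1 (- x)).
have dv x : cder v x (v1 x) by exact: reflect_cder du x.
have dv1 x : cder v1 x (VV (cj z) 0 x * v x).
  apply: cder_eq (cderN (reflect_cder (u := u1) (u' := fun x => VV z 0 x * u x) du1 x)) _.
  by rewrite opprK cjM VV_reflect.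
have x0J : x0 = 1 + `|Re (cj z)| + `|Im (cj z)| by rewrite ReJ ImJ normrN.
have vd x : x0 <= x -> QF 1 0 (v x) (v1 x) <= 0.
  move=> xx; have W : Wz z (line 0 (- x)) = 0.
    by rewrite -W0; exact: awr_cst (asol_mp z) (asol_pp z).
  have [mpE mp1E] := mp_line z (- x).
  have nz : sqn (mp1 z (line 0 (- x))) + 1 ^+ 2 * sqn (mp z (line 0 (- x))) != 0.
    by rewrite mpE mp1E sqnN !sqnJ opprK; exact: pp_neq0.
  have [k [k0 k1]] := prop_pair W nz.
  have -> : v x = cj k * pp (cj z) (line 0 x) by rewrite /v /u k0 mpE cjM cjK opprK.
  have -> : v1 x = cj k * pp1 (cj z) (line 0 x) by rewrite /v1 /u1 k1 mp1E cjM cjN cjK opprK mulrN opprK.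
  rewrite QF_scale; apply: mulr_ge0_le0; first exact: sqn_ge0.
  by move: xx; rewrite x0J; exact: pp_decay.
exists x0, (Num.max (- 2 * QF 1 0 (u x0) (u1 x0)) (- 2 * QF 1 0 (v x0) (v1 x0))); split=> // X P xX dP.
split; rewrite le_max; apply/orP; [left|right].
  apply: (decay_L2 (z := z) (u := u) (u1 := u1) erefl xX du du1 (pp_decay xX)) => x /andP[a b].
  by apply: dP; rewrite b andbT; apply: le_trans (le_trans x00 a); rewrite oppr_le0; exact: le_trans x00 xX.
have := decay_L2 (P := fun x => - P (- x)) x0J xX dv dv1 (vd X xX); rewrite opprK addrC; apply => x /andP[a b].
rewrite /v sqnJ.
have mx : - X <= - x <= X by rewrite lerN2 b /=; apply: le_trans (le_trans x00 xX); rewrite oppr_le0; exact: le_trans x00 a.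
apply: rder_eq (rderN (rder_comp (rder_opp x) (dP _ mx))) _; by rewrite mulrN1 opprK.
Qed.

(** The real part of u' conj u has derivative - Re z |u|^2 + |u'|^2 - Re (f conj u), to which i x^3
    contributes nothing; its increment over the support is 0. *)
Lemma apr_left z : Re z <= -1 -> apr z 1.
Proof.
move=> z1 u u' u'' X U F X0 [du du' supp] dU dF.
have XX : - X <= X by lra.
have [uX u'X _] := supp X (ler_norm X).
have [uX' u'X' _] := supp (- X) (ltac:(by rewrite normrN ler_norm)).
pose Q x := QF 0 0 (u x) (u' x).
have QX : Q X = 0 by rewrite /Q /QF uX cj0 sqn0 mulr0 Re0 Im0; ring.
have QX' : Q (- X) = 0 by rewrite /Q /QF uX' cj0 sqn0 mulr0 Re0 Im0; ring.
have dQ x : rder Q x (Re (VV z 0 x) * sqn (u x) + sqn (u' x) - Re (fz z u u'' x * cj (u x))).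
  have d2 : cder u' x (VV z 0 x * u x - fz z u u'' x) by apply: cder_eq (du' x) (fz_u z u u'' x).
  by apply: rder_eq (rder_QF 0 (du x) d2 (rder_cst 0 x)) _; ring.
have dG x : rder (fun x => U x / 2 - F x / 2) x (sqn (u x) / 2 - sqn (fz z u u'' x) / 2).
  apply: rderD; last apply: rderN.
    by apply: rder_eq (rderM (dU x) (rder_cst 2^-1 x)) _; ring.
  by apply: rder_eq (rderM (dF x) (rder_cst 2^-1 x)) _; ring.
have := nondecr_le XX (fun x _ => dG x) (fun x _ => dQ x); rewrite QX QX' subrr mul1r => H.
suff : (U X / 2 - F X / 2) - (U (- X) / 2 - F (- X) / 2) <= 0 by lra.
apply: H => x _; rewrite Re_VV expr0n /=.
have a := normc_sqr (u x); have b := normc_sqr (fz z u u'' x).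
have c := Re_le (fz z u u'' x * cj (u x)); rewrite normcM normcJ' -a -b in c *.
have p := sqn_ge0 (u' x).
move: (normc (u x)) (normc (fz z u u'' x)) (Re (fz z u u'' x * cj (u x))) (sqn (u' x)) c p => n m r s c p.
have h : 0 <= (- Re z - 1) * n ^+ 2 by rewrite mulr_ge0 ?sqr_ge0 //; lra.
rewrite !(mulr0, mul0r, subr0, sub0r); have := sqr_ge0 (n - m); rewrite sqrrB => h2; lra.
Qed.

End decay.

(** * Square integrable functions *)

Lemma ae_cL2norm d (T : measurableType d) (R : realType) (mu : {measure set T -> \bar R}) (f g : T -> R[i]) : cmeasurable f -> cmeasurable g -> {ae mu, forall x, f x = g x} ->
  cL2norm mu f = cL2norm mu g.
Proof.
move=> mf mg fg; rewrite /cL2norm unlock; congr poweR; apply: ae_eq_integral => //.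
- apply: (measurableT_comp (measurable_poweR _)) => //; apply: measurableT_comp => //.
  exact/measurable_EFinP/measurable_normc.
- apply: (measurableT_comp (measurable_poweR _)) => //; apply: measurableT_comp => //.
  exact/measurable_EFinP/measurable_normc.
- by apply: filterS fg => x /= ->.
Qed.

Section square_integrable.
Local Open Scope quotient_scope.
Variable R : realType.
Local Notation leb := (@lebesgue_measure R).
Local Notation L2R := (L2C leb).
Implicit Types (z c : R[i]) (u v w : L2R) (f g : R -> R[i]).

Definition nrm (u : L2R) : R := fine (cL2norm leb u).

Lemma nrmE u : `|u| = (nrm u)%:C :> R[i]. Proof. by []. Qed.
Lemma nrm_ge0 u : 0 <= nrm u. Proof. by rewrite fine_ge0 // cL2norm_ge0. Qed.

Lemma nrmD u v : nrm (u + v) <= nrm u + nrm v.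
Proof. by rewrite -lecR cCD -!nrmE; exact: ler_normD. Qed.
Lemma nrmZ c u : nrm (c *: u) = normc c * nrm u.
Proof. by have := normrZ c u; rewrite !nrmE -[`|c|]/((normc c)%:C) -cCM => -[]. Qed.
Lemma nrmN u : nrm (- u) = nrm u.
Proof. by rewrite -scaleN1r nrmZ normcN (@normc_nat R 1) mul1r. Qed.

Lemma L2_add u v : {ae leb, forall x, (u + v : L2R) x = u x + v x}.
Proof.
have -> : u + v = \pi_(L2C leb) (repr u + repr v) by rewrite -L2C_addE !reprK.
exact: reprL2.
Qed.
Lemma L2_scale c u : {ae leb, forall x, (c *: u : L2R) x = c * u x}.
Proof. exact: (reprL2 (c *: repr u)). Qed.
Lemma L2_opp u : {ae leb, forall x, (- u : L2R) x = - u x}.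
Proof. by rewrite -scaleN1r; apply: filterS (L2_scale (-1) u) => x ->; rewrite mulN1r. Qed.

Lemma cL2norm_integral f (I : R) : (\int[leb]_x (sqn (f x))%:E = I%:E)%E -> cL2norm leb f = (Num.sqrt I)%:E.
Proof.
move=> fI; have I0 : 0 <= I.
  by rewrite -lee_fin -fI integral_ge0 // => x _; rewrite lee_fin sqn_ge0.
rewrite /cL2norm unlock.
under eq_integral => x _.
  rewrite /= ger0_norm ?normc_ge0 // powR_mulrn ?normc_ge0 // normc_sqr.
  over.
by rewrite fI poweR_EFin powR12_sqrt.
Qed.

Lemma continuous_cmeasurable f : continuous (@complex.Re R \o f) -> continuous (@complex.Im R \o f) -> cmeasurable f.
Proof. by split; exact: continuous_measurable_fun. Qed.

Lemma continuous_sqn f : continuous (@complex.Re R \o f) -> continuous (@complex.Im R \o f) -> continuous (fun x => sqn (f x)).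
Proof. 
have sq (h : R -> R) : continuous h -> continuous (fun x => h x ^+ 2).
  move=> ch x; rewrite (_ : (fun x => h x ^+ 2) = (fun x => h x * h x)); first exact: cvgM (ch x) (ch x).
  by apply/funext => y; rewrite expr2.
by move=> cr ci x; apply: cvgD; [exact: (sq _ cr x)|exact: (sq _ ci x)]. Qed.

Lemma integral_sqn f (X : R) G : 0 <= X -> continuous (@complex.Re R \o f) -> continuous (@complex.Im R \o f) ->
  (forall x, X <= `|x| -> f x = 0) -> (forall x, rder G x (sqn (f x))) ->
  (\int[leb]_x (sqn (f x))%:E = (G X - G (- X))%:E)%E.
Proof.
move=> X0 cr ci f0 dG; have cs := continuous_sqn cr ci.
have out x : X <= `|x| -> sqn (f x) = 0 by move=> /f0 ->; rewrite sqn0.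
have X1 : X <= X + 1 by lra. have X2 : - (X + 1) <= - X by lra. have X3 : - (X + 1) < X + 1 by lra.
have -> : G X = G (X + 1).
  symmetry; apply: (rder_cst_on dG X1) => x /andP[xX _]; apply: out; apply: le_trans xX (ler_norm _).
have -> : G (- X) = G (- (X + 1)).
  apply: (rder_cst_on dG X2) => x /andP[_ xX]; apply: out; rewrite -normrN; apply: le_trans (ler_norm _); lra.
rewrite EFinB -(@continuous_FTC2 R (fun x => sqn (f x)) G (- (X + 1)) (X + 1) X3).
- rewrite [RHS]integral_mkcond; apply: eq_integral => x _; rewrite patchE; case: ifPn => // /negP xn.
  rewrite out //; rewrite leNgt; apply/negP => xX; apply: xn; rewrite inE /= in_itv /= -ler_norml.
  by apply: le_trans (ltW xX) X1.
- exact: continuous_subspaceT.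
- split => [x _||]; first by have [] := dG x.
  + by apply: cvg_at_right_filter; exact: rder_cont (dG _).
  + by apply: cvg_at_left_filter; exact: rder_cont (dG _).
- by move=> x _; rewrite derive1E; have [_ ->] := dG x.
Qed.

Lemma nrm_compact w f (X : R) G : 0 <= X -> continuous (@complex.Re R \o f) -> continuous (@complex.Im R \o f) ->
  (forall x, X <= `|x| -> f x = 0) -> (forall x, rder G x (sqn (f x))) -> {ae leb, forall x, w x = f x} ->
  nrm w ^+ 2 = G X - G (- X).
Proof.
move=> X0 cr ci f0 dG wf; have H := integral_sqn X0 cr ci f0 dG.
have E : cL2norm leb w = cL2norm leb f.
  by apply: ae_cL2norm; [exact: cL2fun_meas|exact: continuous_cmeasurable|exact: wf].
rewrite /nrm E (cL2norm_integral H) /= sqr_sqrtr //.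
have X2 : - X <= X by lra.
by rewrite subr_ge0; apply: (rder_ge0_mono dG) => // x; exact: sqn_ge0.
Qed.

(** [primitive] works on a half line; left of the support the primitive is constant and is extended
    by that value. *)
Lemma primitive_compact (h : R -> R) (X : R) : continuous h -> (forall x, X <= `|x| -> h x = 0) ->
  exists G, forall x, rder G x (h x).
Proof.
move=> ch h0; have [F dF] := primitive (- X - 1) ch.
have F0 t : - X - 1 < t -> t <= - X -> F t = F (- X).
  move=> t1 t2; symmetry.
  have H := @nondecr_le R F (fun=> F t) h (fun=> 0) t (- X) t2 _ _ _.
  have H' := @nondecr_le R (fun=> F t) F (fun=> 0) h t (- X) t2 _ _ _.
  have z x : t <= x <= - X -> h x = 0.
    by move=> /andP[_ xX]; apply: h0; rewrite -normrN; apply: le_trans (ler_norm _); lra.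
  have d x : t <= x <= - X -> rder F x (h x) by move=> /andP[tx _]; apply: dF; exact: lt_le_trans tx.
  apply/le_anti/andP; split.
    rewrite -subr_le0 -[X in _ <= X](subrr (F t)); apply: H => // [x _|x /z ->//]; exact: rder_cst.
  rewrite -subr_ge0 -[X in X <= _](subrr (F t)); apply: H' => // [x _|x /z ->//]; exact: rder_cst.
exists (fun x => if - X - 1 < x then F x else F (- X)) => x.
have [x1|x1] := ltP (- X - 1) x.
  apply: rder_near (dF x x1).
  have A : \forall t \near x, - X - 1 < t < x + 1 by apply: near_between; rewrite x1 ltrDl ltr01.
  by apply: filterS A => t /andP[-> _].
rewrite h0; last by rewrite -normrN; apply: le_trans (ler_norm _); lra.
apply: rder_near (rder_cst (F (- X)) x).
have A : \forall t \near x, x - 1 < t < - X by apply: near_between; apply/andP; split; lra.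
by apply: filterS A => t /andP[_ tX]; case: ifPn => // t1; rewrite F0 // ltW.
Qed.

Definition dC n f x : R[i] := derive1n n (@complex.Re R \o f) x +i* derive1n n (@complex.Im R \o f) x.

Lemma test_rder (h : R -> R) n x : test_function h -> rder (derive1n n h) x (derive1n n.+1 h x).
Proof. by move=> [dh _]; have := derivableP (dh n x); rewrite -derive1E. Qed.

Lemma test_support (h : R -> R) : test_function h -> exists2 X : R, 0 <= X & forall n x, X <= `|x| -> derive1n n h x = 0.
Proof.
move=> th; have [M [_ HM]] := compact_bounded th.2.
have HN : forall x, closure [set x | h x != 0] x -> `|x| <= `|M| + 1 by apply: HM; have := ler_norm M; lra.
exists (`|M| + 2); first by rewrite addr_ge0.
have H n : forall x, `|M| + 1 < `|x| -> derive1n n h x = 0.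
  elim: n => [x xM|n ih x xM].
    apply/eqP; apply: contraLR xM => h0; rewrite -leNgt; apply: HN; exact: subset_closure.
  apply: rder_near0 (test_rder n x th).
  have A : \forall t \near x, `|M| + 1 < `|t| by exact: (cvgr_gt `|x| (cvg_norm (@cvg_id _ (nbhs x)))).
  by apply: filterS A => t /ih.
by move=> n x xM; apply: H; apply: lt_le_trans xM; lra.
Qed.

Lemma dC_cder f n x : ctest_function f -> cder (dC n f) x (dC n.+1 f x).
Proof. by move=> [fr fi]; split; exact: test_rder. Qed.

Lemma dC0 f x : dC 0 f x = f x. Proof. by rewrite /dC /=; case: (f x). Qed.

Lemma ctest_tdata f : ctest_function f -> exists2 X : R, 0 <= X & tdata f (dC 1 f) (dC 2 f) X.
Proof.
move=> tf; have [X X0 HX] := test_support tf.1; have [Y Y0 HY] := test_support tf.2.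
exists (Num.max X Y); first by rewrite le_max X0.
split => x; [exact: cder_ext (dC0 f) (dC_cder 0 x tf)|exact: dC_cder|].
rewrite ge_max => /andP[xX xY].
have z n : dC n f x = 0 by rewrite /dC HX // HY.
by split; rewrite ?z // -dC0 z.
Qed.

Lemma cder_continuous f f' : (forall x, cder f x (f' x)) ->
  continuous (@complex.Re R \o f) /\ continuous (@complex.Im R \o f).
Proof. by move=> df; split => x; have [a b] := df x; [exact: rder_cont a|exact: rder_cont b]. Qed.

Lemma test_pair_apr z (M : R) u v : apr z M -> cubic_oscillator_test R (u, v) ->
  nrm u ^+ 2 <= M * nrm (z *: u - v) ^+ 2.
Proof.
move=> zM [f tf [/= uf vf]].
have [X X0 td] := ctest_tdata tf; have [df df' supp] := td.
have [cr ci] := cder_continuous df.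
have dV x : cder (VV z 0) x (3 * 'i%C * line 0 x ^+ 2).
  apply: cder_eq (cderD (cderM (cder_cst _ _) (cderX 3 (cder_line 0 x))) (cder_cst _ _)) _ => /=; ring.
have [gr gi] := cder_continuous (fun x => cderD (cderM (dV x) (df x)) (cderN (dC_cder 2 x tf))).
have f0 x : X <= `|x| -> f x = 0 by move=> /supp[].
have g0 x : X <= `|x| -> fz z f (dC 2 f) x = 0 by move=> /supp[a _ b]; rewrite /fz a b mulr0 subr0.
have [U dU] : exists U, forall x, rder U x (sqn (f x)).
  by apply: (primitive_compact (continuous_sqn cr ci)) => x /f0 ->; rewrite sqn0.
have [F dF] : exists F, forall x, rder F x (sqn (fz z f (dC 2 f) x)).
  by apply: (primitive_compact (h := fun x => sqn (fz z f (dC 2 f) x)) (continuous_sqn gr gi)) => x /g0 ->; rewrite sqn0.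
have wg : {ae leb, forall x, (v - z *: u : L2R) x = fz z f (dC 2 f) x}.
  near=> x; have -> : (v - z *: u : L2R) x = v x + (- (z *: u) : L2R) x by near: x; exact: L2_add.
  have -> : (- (z *: u) : L2R) x = - (z *: u : L2R) x by near: x; exact: L2_opp.
  have -> : (z *: u : L2R) x = z * u x by near: x; exact: L2_scale.
  have -> : u x = f x by near: x.
  have -> : v x = cubic_oscillator_expr f x by near: x.
  rewrite /cubic_oscillator_expr /fz /VV line0 cCX -/(dC 2 f x); ring.
rewrite -opprB nrmN (nrm_compact X0 cr ci f0 dU uf) (nrm_compact X0 gr gi g0 dF wg).
exact: zM X0 td dU dF.
Unshelve. all: by end_near. Qed.

End square_integrable.

(** * Resolvents *)

Section resolvent_bounds.
Variable R : realType.
Variable V : normedModType R[i].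
Implicit Types (A : set (V * V)) (z c : R[i]) (f g u v : V).

Definition nm u : R := Re `|u|.

Lemma ge0C c : 0 <= c -> c = (Re c)%:C.
Proof. by move=> c0; apply: eqC => //; rewrite ImC; move: c0; rewrite lecE => /andP[/eqP]. Qed.
Lemma nmE u : `|u| = (nm u)%:C. Proof. exact: ge0C. Qed.
Lemma nm_ge0 u : 0 <= nm u. Proof. by rewrite -lecR -nmE; exact: normr_ge0. Qed.
Lemma nmD u v : nm (u + v) <= nm u + nm v.
Proof. by rewrite -lecR cCD -!nmE; exact: ler_normD. Qed.
Lemma nmZ c u : nm (c *: u) = normc c * nm u.
Proof. by have := normrZ c u; rewrite !nmE -[`|c|]/((normc c)%:C) -cCM => -[]. Qed.
Lemma nmN u : nm (- u) = nm u. Proof. by rewrite /nm normrN. Qed.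
Lemma nmB u v : nm (u - v) <= nm u + nm v. Proof. by rewrite -(nmN v); exact: nmD. Qed.

Lemma op_norm_le (T : {linear V -> V}) (M : R) : 0 <= M -> (forall f, nm (T f) <= M * nm f) -> op_norm T <= M.
Proof.
move=> M0 H; apply: ge_sup; first by exists (nm (T 0)), 0 => //=; rewrite normr0 ler01.
move=> _ [f /= f1 <-]; apply: le_trans (H f) _; rewrite -[X in _ <= X]mulr1; apply: ler_wpM2l => //.
by rewrite -lecR -nmE.
Qed.

Lemma bounded_resolvent A z T : is_resolvent A z T -> exists2 N : R, 0 < N & forall f, nm (T f) <= N * nm f.
Proof.
move=> [/linear_bounded_continuous/linear_boundedP bT _].
have pn : \forall r \near (+oo : set_system R[i]), 0 < r by apply: nbhs_pinfty_gt; exact: real0.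
have [r [r0 H]] := @filter_ex _ _ _ _ (filterI pn bT).
exists (Re r); first by rewrite -ltcR -ge0C // ltW.
by move=> f; have := H f; rewrite /= !nmE (ge0C (ltW r0)) -cCM lecR.
Qed.

(** From u = T0 (f - (z - z0) u), where the term in u is absorbed because its coefficient is at most
    1/2. *)
Lemma resolvent_near A z0 z T0 T (N : R) : is_resolvent A z0 T0 -> is_resolvent A z T ->
  0 < N -> (forall f, nm (T0 f) <= N * nm f) -> normc (z - z0) * N <= 1 / 2 -> forall f, nm (T f) <= 2 * N * nm f.
Proof.
move=> [_ R0] [_ R1] N0 HN zz f; set u := T f.
have Au : A (u, z *: u - f) by apply/R1.
have : u = T0 (f - (z - z0) *: u).
  by apply/R0; rewrite opprB addrA -scalerDl [z0 + _]addrC subrK.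
move=> uE; have := HN (f - (z - z0) *: u); rewrite -uE => H1.
have H2 := ler_wpM2l (ltW N0) (nmB f ((z - z0) *: u)); rewrite nmZ in H2.
have H3 := ler_wpM2r (nm_ge0 u) zz; lra.
Qed.

Lemma closure_approx A u v : closure A (u, v) -> forall e : R, 0 < e ->
  exists u' v', [/\ A (u', v'), nm (u - u') < e & nm (v - v') < e].
Proof.
move=> cA e e0; have e0' : 0 < e%:C :> R[i] by rewrite ltcR.
have [[u' v'] [Auv [/= b1 b2]]] := cA _ (nbhsx_ballx (u, v) _ e0').
exists u', v'; split => //; rewrite -ltcR -nmE.
  by move: b1; rewrite -ball_normE.
by move: b2; rewrite -ball_normE.
Qed.

Lemma lin3 u v f g : f + (u - v) + (v - f - g) = u - g.
Proof. by rewrite [LHS]addrA -[f + (u - v) + (v - f)]addrA subrKA [f + (u - f)]addrC subrK. Qed.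

(** [T f] lies in the domain of the closure, with z T f - f as image; approximation by elements of
    the graph [A] carries the bound over. *)
Lemma resolvent_a_priori A z T (s : R) : 0 <= s -> is_resolvent (closure A) z T ->
  (forall u v, A (u, v) -> nm u <= s * nm (z *: u - v)) -> forall f, nm (T f) <= s * nm f.
Proof.
move=> s0 [_ RT] H f; set u := T f; have cu : closure A (u, z *: u - f) by apply/RT.
have k0 : 0 < 1 + s * (normc z + 1) by rewrite ltr_wpDr // mulr_ge0 // addr_ge0 ?normc_ge0.
apply/ler_addgt0Pr => d d0; pose e := d / (1 + s * (normc z + 1)).
have e0 : 0 < e by rewrite divr_gt0.
have [u' [v' [Auv h1 h2]]] := closure_approx cu e0.
have E : z *: u' - v' = f - z *: (u - u') + (z *: u - f - v').
  by rewrite scalerBr opprB lin3.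
have b1 : nm (z *: u' - v') <= nm f + normc z * e + e.
  rewrite E; apply: le_trans (nmD _ _) _; apply: lerD (ltW h2); apply: le_trans (nmB _ _) _.
  by rewrite lerD2l nmZ; apply: ler_wpM2l; [exact: normc_ge0|exact: ltW].
have b2 : nm u <= nm u' + e.
  have -> : u = u' + (u - u') by rewrite addrC subrK.
  by apply: le_trans (nmD _ _) _; rewrite lerD2l ltW.
have b3 := le_trans (H _ _ Auv) (ler_wpM2l s0 b1).
have : e * (1 + s * (normc z + 1)) = d by rewrite /e divfK // gt_eqF.
lra.
Qed.

End resolvent_bounds.

(** * Resolvent bounds away from the spectrum *)

Section cubic_resolvent.
Local Open Scope quotient_scope.
Variable R : realType.
Local Notation leb := (@lebesgue_measure R).
Local Notation L2R := (L2C leb).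
Implicit Types (z : R[i]).

Lemma nm_nrm (u : L2R) : nm u = nrm u. Proof. by []. Qed.

Lemma resolvent_apr z (M : R) T : 0 <= M -> apr z M -> is_resolvent (cubic_oscillator R) z T ->
  op_norm T <= Num.sqrt M.
Proof.
move=> M0 zM rT; apply: op_norm_le; first exact: sqrtr_ge0.
apply: (resolvent_a_priori (sqrtr_ge0 M) rT) => u v Auv; rewrite !nm_nrm.
have := test_pair_apr zM Auv; rewrite -[M in X in X -> _](sqr_sqrtr M0) -exprMn.
by rewrite ler_sqr ?nnegrE ?nrm_ge0 // mulr_ge0 ?sqrtr_ge0 ?nrm_ge0.
Qed.

Definition spec_dist (d : R) z := forall l, spectrum (cubic_oscillator R) l -> d <= normc (z - l).

Lemma spec_dist_resolvent (d : R) z : 0 < d -> spec_dist d z -> exists T, is_resolvent (cubic_oscillator R) z T.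
Proof.
move=> d0 H; apply: contrapT => nT; have := H z nT; rewrite subrr normc0; lra.
Qed.

(* Compactness, the resolvent norm being locally bounded on the resolvent set. *)
Lemma rectangle_bound (d a b : R) : 0 < d -> exists2 M : R, 0 < M & forall z T, a <= Re z <= b -> a <= Im z <= b ->
  spec_dist d z -> is_resolvent (cubic_oscillator R) z T -> op_norm T <= M.
Proof.
move=> d0; have cK : compact (`[a, b] `*` `[a, b])%classic by apply: compact_setX; exact: segment_compact.
pose Q (M : R) (p : R * R) := forall T, spec_dist d (p.1 +i* p.2) ->
  is_resolvent (cubic_oscillator R) (p.1 +i* p.2) T -> op_norm T <= M.
have sub (p q : R * R) e : `|p.1 - q.1| < e / 2 -> `|p.2 - q.2| < e / 2 -> normc ((q.1 +i* q.2) - (p.1 +i* p.2)) < e.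
  move=> h1 h2; apply: le_lt_trans (normc_ReIm _) _; rewrite ReB ImB /=.
  rewrite -[complex.Re _]/(q.1) -[complex.Im _]/(q.2) distrC [X in _ + X]distrC.
  by rewrite -[complex.Re _]/(p.1) -[complex.Im _]/(p.2); lra.
have loc p : exists2 e : R, 0 < e & exists M0 : R, forall (q : R * R) M, `|p.1 - q.1| < e / 2 -> `|p.2 - q.2| < e / 2 -> M0 <= M -> Q M q.
  (* If [p] is within d / 2 of the spectrum, no [q] closer than d / 2 to [p] satisfies
     [spec_dist d]. Otherwise [p] is off the spectrum, and its resolvent bounds those nearby. *)
  have [[l sl pl]|far] := pselect (exists2 l, spectrum (cubic_oscillator R) l & normc ((p.1 +i* p.2) - l) < d / 2).
    exists (d / 2); first by rewrite divr_gt0.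
    exists 0 => q M h1 h2 _ T /(_ l sl) dl _.
    have := sub p q _ h1 h2; move: dl pl; move: (q.1 +i* q.2) (p.1 +i* p.2) => q' p' dl pl pq.
    have := le_normcD (q' - p') (p' - l); rewrite subrKA; lra.
  have [T0 rT0] : exists T, is_resolvent (cubic_oscillator R) (p.1 +i* p.2) T.
    apply: contrapT => nT; apply: far; exists (p.1 +i* p.2) => //.
    by rewrite subrr normc0 divr_gt0.
  have [N N0 HN] := bounded_resolvent rT0.
  exists (1 / (2 * N)); first by rewrite divr_gt0 // mulr_gt0.
  exists (2 * N) => q M h1 h2 NM T _ rT; apply: le_trans NM.
  apply: op_norm_le; first by rewrite mulr_ge0 // ltW.
  apply: (resolvent_near rT0 rT N0 HN).
  apply: (@le_trans _ _ (1 / (2 * N) * N)); last by rewrite invfM mul1r -mulrA mulVf ?gt_eqF // mulr1 mul1r.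
  by apply: ler_wpM2r; [exact: ltW|exact: ltW (sub p q _ h1 h2)].
have /compact_near_coveringP cov := cK.
have [|M [M0 HM]] := @filter_ex _ _ _ _ (filterI (nbhs_pinfty_gt (real0 R)) (cov R (+oo : set_system R) Q _ _)).
  move=> p _; have [e e0 [M0 HM]] := loc p.
  exists ([set q | ball p (e / 2) q], [set M | M0 <= M]) => /=.
    by split; [apply: nbhsx_ballx; rewrite divr_gt0|apply: nbhs_pinfty_ge; exact: num_real].
  by move=> [q M] /= [[b1 b2] ?]; exact: HM.
exists M => // z T zr zi; have := HM (Re z, Im z); rewrite /Q /=.
have -> : Re z +i* Im z = z by case: (z).
by apply; split; rewrite /= in_itv.
Qed.

End cubic_resolvent.

(** * Zeros of the Wronskian belong to the spectrum *)

Section eigenvalues.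
Local Open Scope quotient_scope.
Variable R : realType.
Local Notation leb := (@lebesgue_measure R).
Local Notation L2R := (L2C leb).
Implicit Types (z : R[i]) (K F P : R -> R).

(** For the pairing without conjugation the operator is symmetric, so (z - H) f pairs to 0 with a
    solution psi. The integral of h |psi|^2 is thus due to the error (z - H) f - h conj psi, and
    Cauchy-Schwarz applies. *)
Lemma pairing z (X : R) (f f' f'' psi psi1 : R -> R[i]) (h K F P : R -> R) : 0 <= X -> tdata f f' f'' X ->
  (forall x, cder psi x (psi1 x)) -> (forall x, cder psi1 x (VV z 0 x * psi x)) ->
  (forall x, rder K x (h x * sqn (psi x))) ->
  (forall x, rder F x (sqn (- fz z f f'' x - (h x)%:C * cj (psi x)))) ->
  (forall x, - X <= x <= X -> rder P x (sqn (psi x))) ->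
  (K X - K (- X)) ^+ 2 <= (F X - F (- X)) * (P X - P (- X)).
Proof.
move=> X0 [df df' supp] dp dp1 dK dF dP; have XX : - X <= X by lra.
pose w x := f' x * psi x - f x * psi1 x - (K x)%:C.
have dw x : cder w x ((- fz z f f'' x - (h x)%:C * cj (psi x)) * psi x).
  apply: cder_eq (cderD (cderD (cderM (df' x) (dp x)) (cderN (cderM (df x) (dp1 x)))) (cderN (cderC (dK x)))) _.
  rewrite cCM sqnE /fz; ring.
have := cauchy_schwarz XX (fun x xX => And3 (dw x) (dF x) (dP x xX)).
have [fX f'X _] := supp X (ler_norm X).
have [fX' f'X' _] := supp (- X) (ltac:(by rewrite normrN ler_norm)).
have -> : w X - w (- X) = - (K X - K (- X))%:C by rewrite /w fX f'X fX' f'X' !mul0r cCD cCN; ring.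
by rewrite sqnN sqnC.
Qed.

Lemma same_increment (P0 P1 p : R -> R) (a b : R) : a <= b -> (forall x, a <= x <= b -> rder P0 x (p x)) ->
  (forall x, a <= x <= b -> rder P1 x (p x)) -> P0 b - P0 a = P1 b - P1 a.
Proof. by move=> ab d0 d1; apply/le_anti/andP; split; apply: (nondecr_le ab _ _ (fun x _ => lexx (p x))). Qed.

Lemma pp_primitive z : Wz z 0 = 0 -> exists x0 B : R, [/\ 0 <= x0, 0 <= B & forall X, x0 <= X ->
  exists P, (forall x, - X <= x <= X -> rder P x (sqn (pp z (line 0 x)))) /\ P X - P (- X) <= B].
Proof.
move=> W0; have [x0 [B [x00 HB]]] := pp_L2 W0.
have du x : cder (fun x => pp z (line 0 x)) x (pp1 z (line 0 x)) by have [] := asol_line 0 x (asol_pp z).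
have [cr ci] := cder_continuous du; have cs := continuous_sqn cr ci.
have [P0 dP0] := primitive (- x0 - 1) cs.
exists x0, `|2 * B + (P0 x0 - P0 (- x0))|; split => // X xX.
have [P dP'] := primitive (- X - 1) cs.
have dP x : - X <= x <= X -> rder P x (sqn (pp z (line 0 x))).
  by move=> /andP[Xx _]; apply: dP'; apply: lt_le_trans Xx; rewrite gtrBl ltr01.
exists P; split => //; have [h1 h2] := HB X P xX dP.
have xx : - x0 <= x0 by lra.
have E : P0 x0 - P0 (- x0) = P x0 - P (- x0).
  apply: (same_increment xx) => x /andP[a b]; first by apply: dP0; apply: lt_le_trans a; rewrite gtrBl ltr01.
  by apply: dP; rewrite (le_trans b xX) andbT; apply: le_trans a; rewrite lerN2.
apply: le_trans (ler_norm _); rewrite E; lra.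
Qed.

(** Twice the positive part of 1 - x^2. *)
Definition tent (x : R) : R := 1 - x ^+ 2 + `|1 - x ^+ 2|.

Lemma tent_continuous : continuous tent.
Proof.
move=> x; have d : {for x, continuous (fun x : R => 1 - x ^+ 2)}.
  exact: rder_cont (rderD (rder_cst 1 x) (rderN (rderX 2 (rder_id x)))).
by apply: cvgD; [exact: d|apply: cvg_norm; exact: d].
Qed.

Lemma tent_ge0 x : 0 <= tent x.
Proof. by rewrite /tent -lerBlDl sub0r -normrN ler_norm. Qed.
Lemma tent_out x : 1 <= `|x| -> tent x = 0.
Proof.
move=> x1; rewrite /tent ler0_norm ?subrr //.
by rewrite subr_le0 -real_normK ?num_real //; exact: exprn_ege1.
Qed.
Lemma tent_in x : `|x| < 1 -> 0 < tent x.
Proof.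
move=> x1; rewrite /tent ltr_wpDr ?normr_ge0 //.
by rewrite subr_gt0 -real_normK ?num_real // exprn_ilt1.
Qed.

Lemma small_square (k b c : R) : 0 < k -> 0 <= b -> 0 < c -> (forall e, 0 < e -> k ^+ 2 <= (c * e) ^+ 2 * b) -> False.
Proof.
move=> k0 b0 c0 H; have b1 : 0 < b + 1 by lra.
have := H (k / (c * (b + 1))) (divr_gt0 k0 (mulr_gt0 c0 b1)).
have -> : c * (k / (c * (b + 1))) = k / (b + 1) by field; rewrite !gt_eqF.
rewrite expr_div_n mulrAC ler_pdivlMr ?exprn_gt0 // ler_pM2l ?exprn_gt0 //.
by move=> h; have := sqr_ge0 b; rewrite sqrrD in h; lra.
Qed.

(** The solution psi is square integrable at both ends, and the range of z - H pairs to 0 with it.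
    The function tent * conj psi has a positive pairing with psi, so it is not in the range and no
    resolvent exists. *)
Lemma zero_determinant_spectrum z : Wz z 0 = 0 -> spectrum (cubic_oscillator R) z.
Proof.
move=> W0 [T [_ RT]]; have [x0 [B [x00 B0 HB]]] := pp_primitive W0.
pose psi x := pp z (line 0 x); pose psi1 x := pp1 z (line 0 x).
have dp x : cder psi x (psi1 x) by have [] := asol_line 0 x (asol_pp z).
have dp1 x : cder psi1 x (VV z 0 x * psi x) by have [] := asol_line 0 x (asol_pp z).
have [cr ci] := cder_continuous dp; have cs := continuous_sqn cr ci.
pose chi x := (tent x)%:C * cj (psi x).
have chr : continuous (@complex.Re R \o chi).
  rewrite (_ : _ \o _ = fun x => tent x * (@complex.Re R \o psi) x).
    by move=> x; exact: cvgM (@tent_continuous x) (cr x).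
  by apply/funext => x; rewrite /chi /= ReM ReC ImC ReJ mul0r subr0.
have chj : continuous (@complex.Im R \o chi).
  rewrite (_ : _ \o _ = fun x => tent x * - (@complex.Im R \o psi) x).
    by move=> x; exact: cvgM (@tent_continuous x) (cvgN (ci x)).
  by apply/funext => x; rewrite /chi /= ImM ReC ImC ImJ mul0r addr0.
have ch0 x : 1 <= `|x| -> chi x = 0 by move=> /tent_out x1; rewrite /chi x1 cC0 mul0r.
have [G dG] : exists G, forall x, rder G x (sqn (chi x)).
  by apply: (primitive_compact (continuous_sqn chr chj)) => x /ch0 ->; rewrite sqn0.
have chL : chi \in cL2 leb.
  apply/mem_set; split; first exact: continuous_cmeasurable.
  by rewrite (cL2norm_integral (integral_sqn ler01 chr chj ch0 dG)) ltry.
pose f : L2R := \pi_(L2C leb) (CL2fun chL).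
have fchi : {ae leb, forall x, f x = chi x} by exact: (reprL2 (CL2fun chL)).
have [K dK] : exists K, forall x, rder K x (tent x * sqn (psi x)).
  apply: (@primitive_compact R (fun x => tent x * sqn (psi x)) 1) => [x|x /tent_out ->]; last by rewrite mul0r.
  exact: cvgM (@tent_continuous x) (cs x).
have K0 x : 0 <= tent x * sqn (psi x) by rewrite mulr_ge0 ?sqn_ge0 ?tent_ge0.
have kp : 0 < K 1 - K (- 1).
  rewrite subr_gt0 ltNge; apply/negP => K1.
  have p0 x : - 1 < x < 1 -> psi x = 0.
    move=> x1; have /eqP := flat (fun x _ => dK x) (fun x _ => K0 x) K1 x1.
    by rewrite mulf_eq0 gt_eqF ?tent_in ?ltr_norml //= => /eqP /sqn_eq0.
  have nz : \forall t \near (0 : R), psi t = 0.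
    by apply: filterS (near_between _) => [t|]; [exact: p0|rewrite ltrN10 ltr01].
  have [d1 d2] := dp 0.
  have r0 : Re (psi1 0) = 0 by apply: rder_near0 d1; apply: filterS nz => t ->; rewrite Re0.
  have i0 : Im (psi1 0) = 0 by apply: rder_near0 d2; apply: filterS nz => t ->; rewrite Im0.
  have := pp_neq0 z (line 0 0); rewrite -/(psi 0) -/(psi1 0) p0 ?ltrN10 ?ltr01 // /sqn r0 i0 Re0 Im0.
  by rewrite !expr0n /= addr0 mulr0 addr0 eqxx.
have c0 : 0 < normc z + 1 by rewrite ltr_wpDl ?normc_ge0.
(* [pairing] speaks of test functions, so the preimage [u] is approximated by one in the graph norm,
   with an arbitrarily small error [e]. *)
apply: (small_square kp B0 c0) => e e0; set u := T f.
have cu : cubic_oscillator R (u, z *: u - f) by apply/RT.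
have [u' [v' [[phi tf [/= uf vf]] h1 h2]]] := closure_approx cu e0; rewrite !nm_nrm in h1 h2.
have [X1 X10 td1] := ctest_tdata tf.
pose X := Num.max X1 (Num.max x0 1).
have [X1X x0X oneX] : [/\ X1 <= X, x0 <= X & 1 <= X] by rewrite /X !le_max !lexx !orbT.
have X0 : 0 <= X by exact: le_trans x00 x0X.
have td : tdata phi (dC 1 phi) (dC 2 phi) X by case: td1 => a b c; split => // x xX; apply: c; exact: le_trans xX.
have [df df' supp] := td; have [P [dP PB]] := HB X x0X.
have dV x : cder (VV z 0) x (3 * 'i%C * line 0 x ^+ 2).
  apply: cder_eq (cderD (cderM (cder_cst _ _) (cderX 3 (cder_line 0 x))) (cder_cst _ _)) _ => /=; ring.
have [gr gi] := cder_continuous (fun x => cderD (cderM (dV x) (df x)) (cderN (dC_cder 2 x tf))).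
pose g x := - fz z phi (dC 2 phi) x - chi x.
have gr' : continuous (@complex.Re R \o g).
  rewrite (_ : _ \o _ = fun x => - (@complex.Re R \o fz z phi (dC 2 phi)) x - (@complex.Re R \o chi) x).
    by move=> x; exact: cvgB (cvgN (gr x)) (chr x).
  by apply/funext => x; rewrite /g /= ReB ReN.
have gi' : continuous (@complex.Im R \o g).
  rewrite (_ : _ \o _ = fun x => - (@complex.Im R \o fz z phi (dC 2 phi)) x - (@complex.Im R \o chi) x).
    by move=> x; exact: cvgB (cvgN (gi x)) (chj x).
  by apply/funext => x; rewrite /g /= ImB ImN.
have g0 x : X <= `|x| -> g x = 0.
  move=> xX; have [a _ b] := supp x xX; rewrite /g /fz a b ch0 ?(le_trans oneX) //.
  by rewrite mulr0 !subr0 oppr0.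
have [F dF] : exists F, forall x, rder F x (sqn (g x)).
  by apply: (primitive_compact (continuous_sqn gr' gi')) => x /g0 ->; rewrite sqn0.
pose w : L2R := z *: u' - v' - f.
have wg : {ae leb, forall x, w x = g x}.
  near=> x; have -> : w x = (z *: u' - v' : L2R) x + (- f : L2R) x by near: x; exact: L2_add.
  have -> : (z *: u' - v' : L2R) x = (z *: u' : L2R) x + (- v' : L2R) x by near: x; exact: L2_add.
  have -> : (z *: u' : L2R) x = z * (u' : L2R) x by near: x; exact: L2_scale.
  have -> : (- v' : L2R) x = - (v' : L2R) x by near: x; exact: L2_opp.
  have -> : (- f : L2R) x = - f x by near: x; exact: L2_opp.
  have -> : (u' : L2R) x = phi x by near: x.
  have -> : (v' : L2R) x = cubic_oscillator_expr phi x by near: x.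
  have -> : f x = chi x by near: x.
  rewrite /g /cubic_oscillator_expr /fz /VV line0 cCX -/(dC 2 phi x); ring.
have nw : nrm w <= (normc z + 1) * e.
  have -> : w = - (z *: (u - u')) + (z *: u - f - v').
    by rewrite /w scalerBr opprB [LHS]addrAC; apply/esym; rewrite addrA; congr (_ - _);
       rewrite addrA subrK.
  apply: le_trans (nrmD _ _) _; rewrite nrmN nrmZ mulrDl mul1r; apply: lerD (ltW h2).
  by apply: ler_wpM2l; [exact: normc_ge0|exact: ltW].
have kX : K 1 - K (- 1) <= K X - K (- X).
  by apply: lerB; apply: (rder_ge0_mono dK) => //; rewrite lerN2.
have := pairing X0 td dp dp1 dK dF dP; rewrite -(nrm_compact X0 gr' gi' g0 dF wg) => H.
apply: (@le_trans _ _ ((K X - K (- X)) ^+ 2)).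
  by apply: lerXn2r; rewrite ?nnegrE ?(ltW kp) // (le_trans (ltW kp)).
apply: le_trans H _; apply: ler_pM; [exact: sqr_ge0| |by apply: lerXn2r; rewrite ?nnegrE ?nrm_ge0 ?mulr_ge0 ?(ltW c0) ?(ltW e0)|exact: PB].
have XX : - X <= X by lra.
by rewrite subr_ge0; apply: (nondecr XX dP) => x _; exact: sqn_ge0.
Unshelve. all: by end_near. Qed.

Lemma real_zero_spectrum (y : R) : 0 <= y -> Psi y%:C = 0 -> spectrum (cubic_oscillator R) y%:C.
Proof. by move=> y0 P0; apply: zero_determinant_spectrum; exact: Wz_real_zero. Qed.

End eigenvalues.

(** * Covering of the plane and the two inclusions *)

Section conclusion.
Variable R : realType.
Implicit Types (z : R[i]) (rho d : R).

Lemma strip_II_sym rho z : 1 <= rho -> `|Re z| <= rho ^+ 6 -> 4 ^+ 9 * rho ^+ 6 <= `|Im z| -> apr z (eb 4100 rho).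
Proof.
move=> r1 zr; have [z0|z0] := leP 0 (Im z).
  by rewrite ger0_norm // => zi; exact: strip_II.
rewrite ltr0_norm // => zi; rewrite -(cjK z); apply: apr_reflect; apply: strip_II => //.
  by rewrite ReJ.
by rewrite ImJ.
Qed.

Lemma strip_bound : exists2 K : R, 0 <= K & forall rho z, 1 <= rho -> 1 <= Re z -> Re z <= rho ^+ 6 ->
  apr z (eb K rho) \/ exists y : R, [/\ 1 / 2 <= y, Psi y%:C = 0 & normc (z - y%:C) <= expR (- rho ^+ 5)].
Proof.
have k0 : 0 <= 4 ^+ 9 :> R by exact: exprn_ge0.
(* [strip_III] is used with the threshold 4^9 of [strip_II], so that the two cover the strip. *)
have [K K0 HK] := strip_III k0.
pose C : R := 4100; exists (Num.max K C); first by rewrite le_max K0.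
move=> rho z r1 z1 zr.
have m1 : eb C rho <= eb (Num.max K C) rho by apply: (eb_le r1); rewrite le_max lexx orbT.
have m2 : eb K rho <= eb (Num.max K C) rho by apply: (eb_le r1); rewrite le_max lexx.
have [zi|/ltW zi] := leP (4 ^+ 9 * rho ^+ 6) `|Im z|.
  left; apply: apr_mono m1 _; apply: strip_II_sym => //.
  by rewrite ger0_norm //; exact: le_trans z1.
have [z0|/ltW z0] := leP 0 (Im z).
  have zi' : Im z <= 4 ^+ 9 * rho ^+ 6 by apply: le_trans zi; exact: ler_norm.
  by have [H|H] := HK rho z r1 z1 zr z0 zi'; [left; exact: apr_mono m2 H|right].
have zi' : Im (cj z) <= 4 ^+ 9 * rho ^+ 6 by rewrite ImJ; apply: le_trans zi; rewrite -normrN; exact: ler_norm.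
have z0' : 0 <= Im (cj z) by rewrite ImJ oppr_ge0.
have zr' : Re (cj z) <= rho ^+ 6 by rewrite ReJ.
have z1' : 1 <= Re (cj z) by rewrite ReJ.
have [H|[y [y1 y2 y3]]] := HK rho (cj z) r1 z1' zr' z0' zi'.
  by left; rewrite -(cjK z); apply: apr_reflect; exact: apr_mono m2 H.
by right; exists y; split => //; rewrite -normcJ' cjB cjC.
Qed.

(** The bound depends on [d] through the compact rectangle only. *)
Lemma half_plane_bound d r : 0 < d -> exists2 M : R, 0 < M & forall z T, Re z <= r -> spec_dist d z ->
  is_resolvent (cubic_oscillator R) z T -> op_norm T <= M.
Proof.
move=> d0; pose rho := 1 + `|r|; have r1 : 1 <= rho by rewrite /rho lerDl.
have r6 : rho <= rho ^+ 6 by rewrite -[X in X <= _]expr1; apply: ler_weXn2l.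
have r61 : 1 <= rho ^+ 6 by exact: le_trans r6.
have rr : r <= rho ^+ 6 by apply: le_trans r6; apply: le_trans (ler_norm r) _; rewrite /rho lerDr.
pose b := 4 ^+ 9 * rho ^+ 6.
have b1 : rho ^+ 6 <= b by rewrite /b ler_peMl ?exprn_ege1 ?ler1n // (le_trans _ r61).
have [M M0 HM] := rectangle_bound (- b) b d0.
exists (M + 1 + Num.sqrt (eb 4100 rho)) => [|z T zr dz rT].
  by rewrite ltr_pwDl ?sqrtr_ge0 // addr_gt0.
have [zl|zl] := leP (Re z) (- 1).
  apply: le_trans (resolvent_apr ler01 (apr_left zl) rT) _.
  by rewrite sqrtr1 -addrA addrCA lerDl addr_ge0 ?sqrtr_ge0 ?(ltW M0).
have zR : `|Re z| <= rho ^+ 6.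
  rewrite ler_norml (le_trans zr rr) andbT; apply: le_trans (ltW zl); by rewrite lerN2.
have [zi|/ltW zi] := leP b `|Im z|.
  apply: le_trans (resolvent_apr (eb_ge0 _ _) (strip_II_sym r1 zR zi) rT) _.
  by rewrite lerDr addr_ge0 ?(ltW M0).
apply: (@le_trans _ _ M); last by rewrite -addrA lerDl addr_ge0 ?sqrtr_ge0.
apply: HM dz rT; rewrite -ler_norml //; exact: le_trans b1.
Qed.

Lemma spec_distP d z : ~ spec_dist d z -> (\bigcup_(l in spectrum (cubic_oscillator R)) [set z | `|z - l| < d%:C]) z.
Proof.
move=> nd; apply: contrapT => nU; apply: nd => l sl; rewrite leNgt; apply/negP => zl; apply: nU.
by exists l => //=; rewrite -[`|_|]/((normc (z - l))%:C) ltcR.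
Qed.

Lemma spec_dist_pseudo d e (M : R) z : 0 < d -> 0 < M -> 1 / e = M -> spec_dist d z ->
  (forall T, is_resolvent (cubic_oscillator R) z T -> op_norm T <= M) -> ~ pseudospectrum (cubic_oscillator R) e z.
Proof.
move=> d0 M0 eM dz H [sz|[T rT]].
  by have [T rT] := spec_dist_resolvent d0 dz; apply: sz; exists T.
by rewrite eM ltNge H.
Qed.

Lemma sqrt_eb (K K' rho : R) : 1 <= rho -> 0 <= K -> K <= K' -> Num.sqrt (eb K rho) <= eb K' rho.
Proof.
move=> r1 K0 KK; apply: le_trans (eb_le r1 KK).
rewrite -[X in _ <= X]sqr_sqrtr ?eb_ge0 // expr2 ler_peMl ?sqrtr_ge0 //.
by rewrite -[X in X <= _]sqrtr1; apply: ler_wsqrtr; exact: eb_ge1.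
Qed.

(** This fixes the constant of the second claim: with eps = exp (- K rho^5) and C = K^(-6/5) the
    boundary line is Re z = rho^6. *)
Lemma rate_power (K rho : R) : 0 < K -> 0 < rho ->
  K `^ (- (6 / 5)) * ln (1 / (eb (- K) rho)) `^ (6 / 5) = rho ^+ 6.
Proof.
move=> K0 r0; rewrite ebN div1r invrK /eb expRK.
rewrite powRM ?exprn_ge0 ?(ltW K0) ?(ltW r0) // mulrA -powRD; last by apply/implyP => _; rewrite gt_eqF.
rewrite addNr powRr0 mul1r -powR_mulrn ?(ltW r0) // -powRrM.
rewrite (_ : 5%:R * (6 / 5) = 6%:R); first by rewrite powR_mulrn ?(ltW r0).
by field.
Qed.

Lemma decay_small d rho : 0 < d -> 1 <= rho -> 1 / d < rho -> expR (- rho ^+ 5) < d.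
Proof.
move=> d0 r1 dr; rewrite expRN invf_plt ?posrE ?expR_gt0 // -div1r; apply: lt_le_trans dr _.
have r5 : rho <= rho ^+ 5 by rewrite -[X in X <= _]expr1; apply: ler_weXn2l.
by apply: le_trans r5 _; have := expR_ge1Dx (rho ^+ 5); lra.
Qed.

Lemma rho_le_eb (K rho : R) : 1 <= K -> 1 <= rho -> rho <= eb K rho.
Proof.
move=> K1 r1; apply: le_trans (eb_le r1 K1).
have r5 : rho <= rho ^+ 5 by rewrite -[X in X <= _]expr1; apply: ler_weXn2l.
by apply: le_trans r5 _; rewrite /eb mul1r; have := expR_ge1Dx (rho ^+ 5); lra.
Qed.

End conclusion.

Theorem theorem4p1 (R : realType) :
  (forall delta r : R, 0 < delta -> 0 < r ->
     exists eps : R, 0 < eps /\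
       pseudospectrum (cubic_oscillator R) eps `<=`
         [set z | r <= complex.Re z] `|`
         \bigcup_(lambda in spectrum (cubic_oscillator R))
           [set z | `|z - lambda| < delta%:C]) /\
  (exists C : R, 0 < C /\ forall delta : R, 0 < delta ->
     exists eps : R, 0 < eps < 1 /\
       pseudospectrum (cubic_oscillator R) eps `<=`
         [set z | C * ln (1 / eps) `^ (6 / 5) <= complex.Re z] `|`
         \bigcup_(lambda in spectrum (cubic_oscillator R))
           [set z | `|z - lambda| < delta%:C] /\
       pseudospectrum (cubic_oscillator R) eps `\`
         \bigcup_(lambda in spectrum (cubic_oscillator R))
           [set z | `|z - lambda| < delta%:C] `<=`
         [set z | C * ln (1 / eps) `^ (6 / 5) <= complex.Re z]).
Proof.
split=> [d r d0 _|].
  have [M M0 HM] := half_plane_bound r d0.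
  exists (1 / M); split; first by rewrite divr_gt0.
  move=> z pz; have [dz|/spec_distP dz] := pselect (spec_dist d z); last by right.
  left => /=; rewrite leNgt; apply/negP => zr.
  apply: (spec_dist_pseudo d0 M0 _ dz _ pz); first by rewrite !div1r invrK.
  by move=> T; apply: HM => //; exact: ltW.
(* [K] is chosen before delta, so C does not depend on it; K + 1 is at least 1, as [rho_le_eb]
   requires. *)
have [K K0 HK] := strip_bound R; have K1 : 0 < K + 1 by rewrite ltr_wpDl.
exists ((K + 1) `^ (- (6 / 5))); split; first exact: powR_gt0.
move=> d d0; have [M M0 HM] := half_plane_bound 1 d0.
(* The summand [M] brings the bound on Re z <= 1 below 1 / eps. The summand 1 / d makes exp (-
   rho^5) < d, so that a real zero of [Psi] this close to z contradicts the distance from z to the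
   spectrum. *)
pose rho := 1 + M + 1 / d.
have d1 : 0 < 1 / d by rewrite divr_gt0.
have r1 : 1 <= rho by rewrite /rho -addrA lerDl addr_ge0 // ltW.
have rM : M <= rho by rewrite /rho addrAC lerDr addr_ge0 // ltW.
have rd : 1 / d < rho by rewrite /rho ltrDr addr_gt0.
have r0 : 0 < rho by exact: lt_le_trans r1.
pose eps := eb (- (K + 1)) rho.
have main : pseudospectrum (cubic_oscillator R) eps `<=`
    [set z | (K + 1) `^ (- (6 / 5)) * ln (1 / eps) `^ (6 / 5) <= complex.Re z] `|`
    \bigcup_(lambda in spectrum (cubic_oscillator R)) [set z | `|z - lambda| < d%:C].
  move=> z pz; have [dz|/spec_distP dz] := pselect (spec_dist d z); last by right.
  left; rewrite /= /eps rate_power // leNgt; apply/negP => /ltW zr.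
  apply: (spec_dist_pseudo d0 (eb_gt0 (K + 1) rho) _ dz _ pz); first by rewrite /eps div1r ebN invrK.
  move=> T rT; have [z1|/ltW z1] := leP (Re z) 1.
    apply: le_trans (HM z T z1 dz rT) _; apply: le_trans rM _; apply: rho_le_eb => //.
    by rewrite lerDr.
  have [zK|[y [y1 y0 zy]]] := HK rho z r1 z1 zr.
    apply: le_trans (resolvent_apr (eb_ge0 _ _) zK rT) _; apply: sqrt_eb => //.
    by rewrite lerDl.
  have y00 : 0 <= y by apply: le_trans y1; rewrite divr_ge0.
  have := le_lt_trans (le_trans (dz _ (real_zero_spectrum y00 y0)) zy) (decay_small d0 r1 rd).
  by rewrite ltxx.
exists eps; split; first by rewrite eb_gt0 /= /eps ebN invf_lt1 ?eb_gt0 // /eb expR_gt1 mulr_gt0 ?exprn_gt0.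
split; first exact: main.
by move=> z [pz nz]; case: (main z pz).
Qed.
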